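(* Let $(b(u),\,0\le u\leq 1)$ be a standard Brownian bridge, let $(\lambda_u^x,\ 0\le u\leq 1,\ x\in\mathbb{R})$ be its family of local times, and let $U$ be a uniform random variable on $[0,1]$ independent of $b$. Let $B$ be a standard Brownian motion, $L_1$ its local time at point $0$ at time $1$, and $\Lambda$ a uniform random variable on $[0,1]$ independent of $(B_1,L_1)$. Then for any non-negative measurable functions $f:\mathbb{R}\times[0,\infty)\to[0,\infty)$ and $g:[0,1]\to[0,\infty)$, $$\mathbb{E}\Big[f\big(b(U),\lambda_1^0\big)\,g\Big(\frac{\lambda_U^0}{\lambda_1^0}\Big)\Big]=\sqrt{\frac{\pi}{2}}\;\mathbb{E}\Big[f\big(\tfrac{1}{2}B_1,L_1\big)L_1\Big]\,\mathbb{E}[g(\Lambda)].$$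
   Context: The Brownian bridge is the standard one from $0$ to $0$ on $[0,1]$. Local times are normalized as occupation densities with respect to Lebesgue measure (jointly continuous versions): $\int_0^u \phi(b(s))\,ds=\int_{\mathbb{R}}\phi(x)\lambda_u^x\,dx$ for non-negative measurable $\phi$, and similarly for $B$ (started at $0$). With this normalization $(B_1,L_1)$ has density $\frac{1}{\sqrt{2\pi}}(|x|+l)\exp\big(-\frac{(l+|x|)^2}{2}\big)$ at $(x,l)\in\mathbb{R}\times[0,\infty)$. *)

(* Defs.v *)
From HB Require Import structures.
From mathcomp Require Import all_boot all_order all_algebra.
From mathcomp Require Import all_classical all_reals all_analysis.

Set Implicit Arguments.
Unset Strict Implicit.
Unset Printing Implicit Defensive.

Import Order.TTheory GRing.Theory Num.Theory.
Import numFieldNormedType.Exports.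

Local Open Scope classical_set_scope.
Local Open Scope ring_scope.
Local Open Scope ereal_scope.

(* A process indexed by a set I of times is a family X : R -> {RV P >-> R}
   of which only the members X t with t in I matter. *)

Section Independence.
Context {d} {T : measurableType d} {R : realType} (P : probability T R).

Definition process_sigma_algebra (I : set R) (X : R -> {RV P >-> R}) :
  set (set T) := <<s \bigcup_(t in I) g_sigma_algebra_preimage (X t) >>.

Definition indep_process (U : T -> R) (I : set R) (X : R -> {RV P >-> R}) :=
  forall (A : set R) (C : set T),
    measurable A -> process_sigma_algebra I X C ->
    P (U @^-1` A `&` C) = P (U @^-1` A) * P C.

Definition indep_var d1 (T1 : measurableType d1) d2 (T2 : measurableType d2)
    (Y : T -> T1) (Z : T -> T2) :=
  forall (A : set T1) (C : set T2), measurable A -> measurable C ->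
    P (Y @^-1` A `&` Z @^-1` C) = P (Y @^-1` A) * P (Z @^-1` C).

(* Mutual independence: the product rule for a subfamily is the case where
   A i = setT for the other indices. *)
Definition mutual_indep n (Y : 'I_n -> T -> R) :=
  forall A : 'I_n -> set R, (forall i, measurable (A i)) ->
    P (\bigcap_i (Y i @^-1` A i)) = \prod_i P (Y i @^-1` A i).

End Independence.

Section Processes.
Context {d} {T : measurableType d} {R : realType} (P : probability T R).

Definition is_uniform01 (U : {RV P >-> R}) :=
  (forall w, U w \in `[0%R, 1%R]) /\
  forall A : set R, measurable A ->
    distribution P U A = uniform_prob (@ltr01 R) A.

(* Point masses count as Gaussian; they are treated apart because
   normal_prob m 0 is not a point mass in the library. *)
Definition is_gaussian (Y : T -> R) :=
  exists m s : R, (0 <= s)%R /\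
    forall A : set R, measurable A ->
      P (Y @^-1` A) = if s == 0%R then \d_m A else normal_prob m s A.

Definition is_gaussian_process (I : set R) (X : R -> {RV P >-> R}) :=
  forall n (t a : 'I_n -> R), (forall i, I (t i)) ->
    is_gaussian (fun w => (\sum_(i < n) a i * X (t i) w)%R).

Definition continuous_paths (I : set R) (X : R -> {RV P >-> R}) :=
  forall w, {within I, continuous (fun t : R => X t w)}.

Record is_brownian_bridge (b : R -> {RV P >-> R}) : Prop := {
  bridge_gaussian : is_gaussian_process `[0%R, 1%R] b ;
  bridge_mean : forall t, (0 <= t <= 1)%R -> 'E_P[b t] = 0 ;
  bridge_cov : forall s t, (0 <= s <= 1)%R -> (0 <= t <= 1)%R ->
    covariance P (b s) (b t) = (Num.min s t - s * t)%:E ;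
  bridge_continuous : continuous_paths `[0%R, 1%R] b
}.

Record is_brownian_motion (B : R -> {RV P >-> R}) : Prop := {
  bm_start : {ae P, forall w, B 0%R w = 0%R} ;
  bm_indep_increments : forall n (t : nat -> R), (0 <= t 0)%R ->
    (forall i, t i <= t i.+1)%R ->
    mutual_indep P (fun (i : 'I_n) w => (B (t i.+1) w - B (t i) w)%R) ;
  bm_gaussian_increments : forall s t, (0 <= s)%R -> (s < t)%R ->
    forall A : set R, measurable A ->
      P ((fun w => B t w - B s w)%R @^-1` A)
      = normal_prob 0%R (Num.sqrt (t - s)) A ;
  bm_continuous : continuous_paths `[0%R, +oo[ B
}.

(* ell u x is the local time at the point x and at time u. *)
Record is_local_time (I : set R) (X : R -> {RV P >-> R})
    (ell : R -> R -> {RV P >-> R}) : Prop := {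
  local_time_continuous : forall w,
    {within I `*` [set: R],
       continuous (fun ux : R * R => ell ux.1 ux.2 w)} ;
  local_time_occupation : {ae P, forall w, forall (u : R) (phi : R -> R),
    I u -> measurable_fun [set: R] phi -> (forall x, (0 <= phi x)%R) ->
    \int[lebesgue_measure]_(s in `[0%R, u]) (phi (X s w))%:E
    = \int[lebesgue_measure]_x (phi x * ell u x w)%:E}
}.

End Processes.

(* Main.v *)
(** Replace the point mass at 0 in the definition of the local times by a bump of
    width eps.  By the Markov property of the bridge (an h-transform of Brownian motion),
    the mixed moments of the local times at 0 before and after the time U, tested
    against a function of b(U), are iterated integrals of heat kernels, and as eps -> 0
    they become convolutions in time of the functions p_t(0) and p_t(x), where
    p_t(x) = exp(-x^2/2t) / sqrt(2 pi t).  Convolution is commutative, and the identity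
    p(x) * p(x) = p(0) * p(2x) moves the visit to x behind all visits to 0 while doubling
    x.  So the order of the visits plays no role, and what remains is a moment of
    L_1 tested against a function of B_1/2; the factorials of the ordered integrals
    combine to m! n! / (m+n+1)! = E[Lambda^m (1 - Lambda)^n].  Hence
      (b(U), lambda_U, lambda_1 - lambda_U) and (B_1/2, Lambda L_1, (1 - Lambda) L_1),
    the second one under the measure with density sqrt(pi/2) L_1, have the same mixed
    moments.  Trigonometric test functions determine the law of the first coordinate,
    and the moments determine that of the others because E[exp(a L_1)] is finite. *)

Require Import Defs.
From HB Require Import structures.
From mathcomp Require Import all_boot all_order all_algebra.
From mathcomp Require Import all_classical all_reals all_analysis.
From mathcomp Require Import measurable_realfun ring lra.

Set Implicit Arguments.
Unset Strict Implicit.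
Unset Printing Implicit Defensive.

Import Order.TTheory GRing.Theory Num.Theory.
Import numFieldNormedType.Exports.

Local Open Scope classical_set_scope.
Local Open Scope ring_scope.
Local Open Scope ereal_scope.

(** * Measures and integrals *)

(** Most quantities are arranged to be integrals of nonnegative functions, so that Tonelli applies
    without integrability conditions; hence the test functions [1 + cos (a x + e)], where the phase
    [e] covers real and imaginary parts at once. Both processes are treated as h-transforms of
    Brownian motion and share one kernel, [chain]: the bridge closes it at [0] at time [1] and
    divides by [p_1(0)], Brownian motion leaves the end point free. The extra power of [L_1] comes
    from counting: in the bridge, [m + n] visits to [0] and one visit to [x] make [m + n + 2]
    kernels, two of which touch [x]; the exchange leaves [m + n + 1] kernels [p(0)] and one [p(2x)],
    which is Brownian motion with [m + n + 1] visits to [0]. The constant is [sqrt (2 pi) / 2]: the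
    inverse of [p_1(0)] times the Jacobian of the doubling. The obstacle is the singularity of
    [p_t(0)] at [t = 0]: the kernels are unbounded in time, so the passage to [eps = 0] rests on
    majorants [C (1 + p_t(0))], a form that convolution preserves up to time [1], and on uniform
    bounds for second moments. *)

Section measure_tools.
Context d (T : measurableType d) (R : realType).

Lemma ge0_dominated_cvg (m : {measure set T -> \bar R})
    (f_ : (T -> \bar R)^nat) (f g : T -> \bar R) :
  (forall n, measurable_fun setT (f_ n)) ->
  measurable_fun setT g ->
  (forall n x, 0 <= f_ n x) -> (forall n x, f_ n x <= g x) ->
  {ae m, forall x, f_ ^~ x @ \oo --> f x} ->
  measurable_fun setT f ->
  \int[m]_x g x < +oo ->
  \int[m]_x f_ n x @[n --> \oo] --> \int[m]_x f x.
Proof.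
move=> mf_ mg f0 fg ff mf goo.
have g0 x : 0 <= g x by exact: le_trans (f0 0%N x) (fg 0%N x).
have [] := @dominated_convergence _ _ _ m setT measurableT f_ f g mf_ mf => //.
- by apply: filterS ff => x + _.
- apply/integrableP; split => //.
  by under eq_integral do rewrite gee0_abs//.
- by apply: aeW => x n _; rewrite gee0_abs.
Qed.

Lemma dominated_cvg_EFin (m : {measure set T -> \bar R})
    (f_ : (T -> R)^nat) (f g : T -> R) :
  (forall n, measurable_fun setT (f_ n)) -> measurable_fun setT f ->
  (forall x, f_ ^~ x @ \oo --> f x) ->
  m.-integrable setT (EFin \o g) -> (forall n x, `|f_ n x| <= g x)%R ->
  [/\ m.-integrable setT (EFin \o f),
      \int[m]_x (f_ n x)%:E @[n --> \oo] --> \int[m]_x (f x)%:E &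
      (\int[m]_x f_ n x)%R @[n --> \oo] --> (\int[m]_x f x)%R].
Proof.
move=> mf_ mf ff ig fg.
have [|||||intf _ cv] := @dominated_convergence _ _ _ m setT measurableT
  (fun n x => (f_ n x)%:E) (EFin \o f) (EFin \o g).
- by move=> n; exact/measurable_EFinP.
- exact/measurable_EFinP.
- by apply: aeW => x _; exact/cvg_EFin/ff/nearW.
- exact: ig.
- by apply: aeW => x n _; rewrite /= lee_fin.
split => //; apply: fine_cvg; rewrite fineK; first exact: cv.
exact: integrable_fin_num.
Qed.

Section weighted_measure.
Variables (m : {measure set T -> \bar R}) (g : T -> R).
Hypotheses (mg : measurable_fun setT g) (g0 : forall x, (0 <= g x)%R).

(** The two proofs are arguments so that the measure structure declared below can be found from the
    term [wmeasure mg g0]. *)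
Definition wmeasure of measurable_fun setT g & (forall x, (0 <= g x)%R) :=
  fun A : set T => \int[m]_(x in A) (g x)%:E.

Let wmeasure0 : wmeasure mg g0 set0 = 0.
Proof. by rewrite /wmeasure integral_set0. Qed.

Let wmeasure_ge0 A : 0 <= wmeasure mg g0 A.
Proof. by apply: integral_ge0 => x _; rewrite lee_fin. Qed.

Let wmeasure_sigma_additive : semi_sigma_additive (wmeasure mg g0).
Proof.
move=> /= F mF tF mUF; rewrite /wmeasure; apply: cvg_toP.
  apply: ereal_nondecreasing_is_cvgn => p q pq.
  apply: lee_sum_nneg_natr => // k _ _.
  by apply: integral_ge0 => x _; rewrite lee_fin.
rewrite ge0_integral_bigcup//=.
- by apply: measurable_funTS; exact/measurable_EFinP.
- by move=> x _; rewrite lee_fin.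
Qed.

HB.instance Definition _ := isMeasure.Build _ _ _ (wmeasure mg g0)
  wmeasure0 wmeasure_ge0 wmeasure_sigma_additive.

End weighted_measure.

Import HBNNSimple.

(** By hypothesis the formula holds on the level sets of a simple function, hence for simple
    functions by linearity, hence for [f] by monotone convergence on both sides. Any measure [nu]
    with the given density is allowed, so that [wmeasure] and [normal_prob] are both covered. *)
Lemma ge0_integral_density (m nu : {measure set T -> \bar R}) (g : T -> R) :
  measurable_fun setT g -> (forall x, (0 <= g x)%R) ->
  (forall A, measurable A -> nu A = \int[m]_(x in A) (g x)%:E) ->
  forall f : T -> \bar R, measurable_fun setT f -> (forall x, 0 <= f x) ->
  \int[nu]_x f x = \int[m]_x (f x * (g x)%:E).
Proof.
move=> mg g0 nuE f mf f0.
pose f_ := nnsfun_approx measurableT mf.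
have fcvg x : EFin \o f_ ^~ x @ \oo --> f x by exact: cvg_nnsfun_approx.
have sfE n : \int[nu]_x (f_ n x)%:E = \int[m]_x ((f_ n x)%:E * (g x)%:E).
  under [LHS]eq_integral do rewrite fimfunE -fsumEFin//.
  rewrite ge0_integral_fsum//; last 2 first.
    - by move=> r; exact/measurable_EFinP/measurableT_comp.
    - by move=> r x _; rewrite EFinM nnfun_muleindic_ge0.
  under [RHS]eq_integral.
    move=> x _; rewrite fimfunE -fsumEFin// ge0_mule_fsuml; last first.
      by move=> r; rewrite EFinM nnfun_muleindic_ge0.
    over.
  rewrite [RHS]ge0_integral_fsum//; last 2 first.
    - move=> r; apply: emeasurable_funM; last exact/measurable_EFinP.
      by apply/measurable_EFinP/measurableT_comp.
    - by move=> r x _; apply: mule_ge0; [rewrite EFinM nnfun_muleindic_ge0|rewrite lee_fin].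
  apply: eq_fsbigr => r _.
  have mA : measurable (f_ n @^-1` [set r]) by [].
  rewrite integralZl_indic_nnsfun// integral_indic// setIT.
  (* A negative [r] is not a value of the nonnegative [f_ n], so its level set is empty. *)
  have [r0|r0] := leP 0%R r; last first.
    rewrite (preimage_nnfun0 _ r0) measure0 mule0.
    by rewrite integral0_eq// => x _; rewrite indic0 mulr0 mul0e.
  under [RHS]eq_integral do rewrite EFinM -muleA.
  rewrite ge0_integralZl//; last 2 first.
    by apply: emeasurable_funM => //; exact/measurable_EFinP.
    by move=> x _; rewrite mule_ge0// lee_fin.
  rewrite nuE//; congr (_ * _).
  rewrite [LHS]integral_mkcond; apply: eq_integral => x _.
  by rewrite patchE indicE; case: ifPn => _; rewrite ?mul1e ?mul0e.
transitivity (limn (fun n => \int[nu]_x (f_ n x)%:E)).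
  rewrite -monotone_convergence//.
  - by apply: eq_integral => x _; apply/esym/cvg_lim => //; exact: fcvg.
  - by move=> n; exact/measurable_EFinP.
  - by move=> n x _; rewrite lee_fin.
  - by move=> x _ a b ab; rewrite lee_fin; exact/lefP/nd_nnsfun_approx.
under eq_fun do rewrite sfE.
rewrite -monotone_convergence//.
- apply: eq_integral => x _; apply/cvg_lim => //.
  by apply: cvgeZr => //; exact: fcvg.
- by move=> n; apply: emeasurable_funM; exact/measurable_EFinP.
- by move=> n x _; rewrite mule_ge0// lee_fin.
- move=> x _ a b ab; rewrite lee_wpmul2r// lee_fin//.
  exact/lefP/nd_nnsfun_approx.
Qed.

(** Rectangles are stable under intersection and generate the product sigma-algebra; finite total
    mass allows the constant sequence [setT] as exhaustion. *)
Lemma eq_measure_rectangles d' (T' : measurableType d')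
    (m1 m2 : {measure set (T * T') -> \bar R}) :
  m1 setT < +oo ->
  (forall A B, measurable A -> measurable B -> m1 (A `*` B) = m2 (A `*` B)) ->
  forall C, measurable C -> m1 C = m2 C.
Proof.
move=> m1oo m12; apply: (measure_unique
  [set A `*` B | A in measurable & B in measurable] (fun=> setT)).
- exact: measurable_prod_measurableType.
- move=> _ _ [A1 mA1 [B1 mB1 <-]] [A2 mA2 [B2 mB2 <-]].
  exists (A1 `&` A2); first exact: measurableI.
  by exists (B1 `&` B2); [exact: measurableI|rewrite setXI].
- by move=> _; exists setT => //; exists setT => //; rewrite setXTT.
- by rewrite bigcup_const.
- by move=> _ [A mA [B mB <-]]; exact: m12.
- by move=> _.
Qed.

Section tonelli.
Context d' (T' : measurableType d').
Variables (m1 : {sigma_finite_measure set T -> \bar R})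
  (m2 : {sigma_finite_measure set T' -> \bar R}) (G : T -> T' -> \bar R).
Hypotheses (mG : measurable_fun setT (fun p : T * T' => G p.1 p.2))
  (G0 : forall x y, 0 <= G x y).

Lemma ge0_measurable_integral2 : measurable_fun setT (fun x => \int[m2]_y G x y).
Proof.
exact: (@measurable_fun_fubini_tonelli_F _ _ _ _ _ m2 (fun p => G p.1 p.2) mG (fun p => G0 p.1 p.2)).
Qed.

Lemma ge0_tonelli : \int[m1]_x \int[m2]_y G x y = \int[m2]_y \int[m1]_x G x y.
Proof.
exact: (@fubini_tonelli _ _ _ _ _ m1 m2 (fun p => G p.1 p.2) mG (fun p => G0 p.1 p.2)).
Qed.

Lemma measurable_fun_section2 x : measurable_fun setT (G x).
Proof. exact: (measurableT_comp mG (pair1_measurable x)). Qed.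

Lemma measurable_fun_section1 y : measurable_fun setT (G ^~ y).
Proof. exact: (measurableT_comp mG (pair2_measurable y)). Qed.

End tonelli.

End measure_tools.

Section affine_change_of_variables.
Context (R : realType).
Notation mu := (@lebesgue_measure R).
Implicit Types (f : R -> \bar R) (c e : R).

Lemma ge0_integralN f : measurable_fun setT f -> (forall x, 0 <= f x) ->
  \int[mu]_x f x = \int[mu]_x f (- x)%R.
Proof.
move=> mf f0.
have mN : measurable_fun [set: R] (-%R : R -> measurableTypeR R) by [].
transitivity (\int[pushforward mu (-%R : R -> measurableTypeR R)]_x f x).
  by apply: eq_measure_integral => //= A mA _; exact/esym/lebesgue_measureN.
by rewrite ge0_integral_pushforward// preimage_setT.
Qed.

(** On half-open intervals the rescaled image of Lebesgue measure has the right length, and these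
    intervals determine Lebesgue measure; the rest is the integral formula for image measures. *)
Lemma ge0_integral_affine_pos f c e : (0 < c)%R ->
  measurable_fun setT f -> (forall x, 0 <= f x) ->
  \int[mu]_x f x = c%:E * \int[mu]_x f (c * x + e)%R.
Proof.
move=> c0 mf f0.
pose phi := (fun x => c * x + e)%R : R -> measurableTypeR R.
have mphi : measurable_fun [set: R] phi.
  by apply: measurable_funD => //; apply: measurable_funM.
have c0' := ltW c0.
pose m : {measure set (measurableTypeR R) -> \bar R} :=
  mscale (NngNum c0') (pushforward mu phi).
transitivity (\int[m mphi]_x f x).
  apply: eq_measure_integral => //= A mA _.
  apply: lebesgue_measure_unique => //= _ [[a b]] _ <-.
  rewrite /m /mscale/= /pushforward.
  have -> : phi @^-1` `]a, b] = `]((a - e) / c)%R, ((b - e) / c)%R]%classic.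
    apply/seteqP; split => x /=; rewrite !in_itv/= /phi;
      by rewrite ltr_pdivrMr// ler_pdivlMr// [(x * c)%R]mulrC ltrBlDr lerBrDr.
  rewrite !lebesgue_measure_itv/= !lte_fin ltr_pM2r ?invr_gt0// ltrD2r.
  case: ifPn => _; last by rewrite mule0.
  by rewrite -!EFinB -EFinM; congr EFin; field; rewrite gt_eqF.
rewrite ge0_integral_mscale//; congr (_ * _).
by rewrite ge0_integral_pushforward// preimage_setT.
Qed.

Lemma ge0_integral_affine f c e : c != 0%R ->
  measurable_fun setT f -> (forall x, 0 <= f x) ->
  \int[mu]_x f x = `|c|%:E * \int[mu]_x f (c * x + e)%R.
Proof.
move=> c0 mf f0; have [c0'|c0'|/eqP] := ltgtP c 0%R; last by rewrite (negbTE c0).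
- rewrite ltr0_norm// (@ge0_integral_affine_pos _ (- c)%R e)// ?oppr_gt0//.
  congr (_ * _); rewrite ge0_integralN//.
    by apply: eq_integral => x _; congr f; ring.
  apply: measurableT_comp => //.
  by apply: measurable_funD => //; apply: measurable_funM.
- by rewrite gtr0_norm// (@ge0_integral_affine_pos _ c e).
Qed.

Lemma ge0_integral_reflect f e : measurable_fun setT f -> (forall x, 0 <= f x) ->
  \int[mu]_x f (e - x)%R = \int[mu]_x f x.
Proof.
move=> mf f0; rewrite (@ge0_integral_affine f (-1) e)//.
rewrite normrN1 mul1e; apply: eq_integral => x _; congr f; ring.
Qed.

Lemma ge0_integral_translate f e : measurable_fun setT f -> (forall x, 0 <= f x) ->
  \int[mu]_x f (x + e)%R = \int[mu]_x f x.
Proof.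
move=> mf f0; rewrite (@ge0_integral_affine f 1 e) ?oner_eq0//.
by rewrite normr1 mul1e; apply: eq_integral => x _; rewrite mul1r.
Qed.

End affine_change_of_variables.


(** * Gaussian laws and uniqueness of Fourier transforms *)

Section gaussian_fourier.
Local Open Scope ring_scope.
Context (R : realType).
Notation mu := (@lebesgue_measure R).
Notation N01 := (normal_pdf (0:R) 1).

Lemma normal_pdf01E : N01 = (fun x => (Num.sqrt (pi *+ 2))^-1 * expR (- x ^+ 2 / 2)).
Proof.
apply/funext => x.
rewrite normal_pdfE ?oner_eq0// /normal_peak /normal_fun.
by rewrite expr1n mul1r subr0.
Qed.

Lemma is_derive_normal_pdf01 (x : R) : is_derive x 1 N01 (- x * N01 x).
Proof.
rewrite normal_pdf01E.
have h : is_derive x 1 (fun y : R => - y ^+ 2 / 2) (- x).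
  have -> : (fun y : R => - y ^+ 2 / 2) = (- 2^-1 : R) \*: ((@id R) ^+ 2).
    by apply/funext => y /=; rewrite /GRing.scale/= exprfctE; lra.
  by apply: is_derive_eq; rewrite /GRing.scale/=; lra.
have h2 := @is_derive1_comp R expR (fun y : R => - y ^+ 2 / 2) x _ _ (is_derive_expR _) h.
have h3 := is_deriveZ (Num.sqrt (pi *+ 2))^-1 h2.
by apply: (is_derive_eq h3); rewrite /GRing.scale/=; ring.
Qed.

Lemma continuous_normal_pdf01 : continuous N01.
Proof. by apply: continuous_normal_pdf; rewrite oner_eq0. Qed.

(** From [expR (x ^+ 2 / 4) >= 1 + x ^+ 2 / 4] follows [x ^+ 2 <= 4 * expR (x ^+ 2 / 4)]. So half of
    the Gaussian exponent absorbs the square, and the integrand is at most [C] times the centred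
    normal density of variance [2]. *)
Lemma integrable_sqr_normal_pdf01 : mu.-integrable setT (fun x => (x ^+ 2 * N01 x)%:E).
Proof.
have s0 : Num.sqrt 2 != 0 :> R by rewrite gt_eqF// sqrtr_gt0.
pose C := 4 * (Num.sqrt (pi *+ 2))^-1 / normal_peak (Num.sqrt 2 : R).
have mx : measurable_fun setT (fun x : R => x ^+ 2 * N01 x).
  by apply: measurable_funM => //; exact: measurable_normal_pdf.
have h : mu.-integrable setT (fun x => C%:E * (normal_pdf 0 (Num.sqrt 2) x)%:E)%E.
  by apply: integrableZl => //; exact: integrable_normal_pdf.
apply: le_integrable h => //; first exact/measurable_EFinP.
move=> x _; rewrite -EFinM !abse_EFin lee_fin !ger0_norm; last 2 first.
- rewrite mulr_ge0 ?normal_pdf_ge0// /C mulr_ge0 ?invr_ge0 ?normal_peak_ge0//.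
- by rewrite mulr_ge0 ?normal_pdf_ge0// sqr_ge0.
rewrite normal_pdf01E normal_pdfE// /normal_fun subr0 sqr_sqrtr// /C.
rewrite !mulrA mulfVK ?gt_eqF ?normal_peak_gt0//.
rewrite mulrAC [leRHS]mulrAC ler_wpM2r// ?invr_ge0//.
have -> : - x ^+ 2 / 2 = - x ^+ 2 / (2 *+ 2) + - (x ^+ 2 / 4).
  by rewrite -mulr_natr; field.
rewrite expRD mulrCA [leRHS]mulrC ler_wpM2l ?expR_ge0//.
rewrite expRN ler_pdivrMr ?expR_gt0//.
by have := expR_ge1Dx (x ^+ 2 / 4); nra.
Qed.

Lemma integrable_normr_normal_pdf01 : mu.-integrable setT (fun x => (`|x| * N01 x)%:E).
Proof.
have h : mu.-integrable setT (fun x => (N01 x)%:E + (x ^+ 2 * N01 x)%:E)%E.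
  apply: integrableD => //; first exact: integrable_normal_pdf.
  exact: integrable_sqr_normal_pdf01.
apply: le_integrable h => //.
  apply/measurable_EFinP; apply: measurable_funM; last exact: measurable_normal_pdf.
  exact: normr_measurable.
move=> x _; rewrite -EFinD !abse_EFin lee_fin.
rewrite [leLHS]ger0_norm ?mulr_ge0 ?normal_pdf_ge0//.
rewrite [leRHS]ger0_norm; last first.
  by rewrite addr_ge0 ?normal_pdf_ge0// mulr_ge0 ?sqr_ge0 ?normal_pdf_ge0.
rewrite -[X in _ <= X + _]mul1r -mulrDl ler_wpM2r ?normal_pdf_ge0//.
by have := sqr_ge0 (`|x| - 1); rewrite sqrrB real_normK ?num_real//; have := normr_ge0 x; nra.
Qed.

Lemma cvg_linear_normal_pdf01 (F : R -> R) (u : nat -> R) :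
  (forall x, `|F x| <= (1 + `|x|) * N01 x) -> (forall n, `|u n| = n.+1%:R) ->
  F (u n) @[n --> \oo] --> (0 : R).
Proof.
move=> Fb un; apply: norm_cvg0.
pose C : R := 4 * (Num.sqrt (pi *+ 2))^-1.
apply: (@squeeze_cvgr _ _ _ _ (cst 0) (fun n => C * n.+1%:R^-1)).
- apply: nearW => n; rewrite normr_ge0/= (le_trans (Fb _))// un normal_pdf01E.
  rewrite -real_normK ?num_real// un /C mulrCA -mulrA [leRHS]mulrCA.
  rewrite ler_wpM2l ?invr_ge0//.
  have n1 : 1 <= n.+1%:R :> R by rewrite ler1n.
  rewrite mulNr expRN ler_pdivrMr ?expR_gt0// mulrAC ler_pdivlMr; last lra.
  by have := expR_ge1Dx ((n.+1%:R : R) ^+ 2 / 2); nra.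
- exact: cvg_cst.
- rewrite -[X in _ --> X](mulr0 C); apply: cvgMr; exact: cvg_harmonic.
Qed.

(** The fundamental theorem on [[- n.+1, n.+1]] leaves two boundary terms, which tend to [0] by the
    bound on [F]; [g] dominates the integrals. This is the form of integration by parts used below,
    with [F] the Gaussian density times a factor of at most linear growth. *)
Lemma integral_derivative_eq0 (F f g : R -> R) :
  (forall x : R, is_derive x 1 F (f x)) -> continuous f ->
  mu.-integrable setT (EFin \o g) -> (forall x, `|f x| <= g x) ->
  (forall x, `|F x| <= (1 + `|x|) * N01 x) ->
  \int[mu]_x f x = 0.
Proof.
move=> dF cf ig fg Fb.
have mf : measurable_fun setT f by exact: continuous_measurable_fun.
have [|||||_ cv _] := @dominated_cvg_EFin _ _ _ mu
  (fun n => f \_ `[- n.+1%:R, n.+1%:R]) f g => //.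
- by move=> n; apply/(measurable_restrictT _ _).1 => //; exact: measurable_funTS.
- move=> x; apply: cvg_near_cst; near=> n; rewrite patchE ifT// inE/= in_itv/=.
  rewrite -ler_norml (le_trans (ltW (truncnS_gt _)))// ler_nat ltnS.
  near: n; exact: nbhs_infty_ge.
- move=> n x; rewrite patchE; case: ifPn => _ //.
  by rewrite normr0 (le_trans _ (fg x)).
have E : (fun n => \int[mu]_x ((f \_ `[- n.+1%:R, n.+1%:R]) x)%:E)%E =
    (fun n => (F n.+1%:R)%:E - (F (- n.+1%:R))%:E)%E.
  apply/funext => n /=; rewrite -(@continuous_FTC2 _ f).
  - by rewrite [RHS]integral_mkcond restrict_EFin.
  - by apply: (@lt_trans _ _ 0); rewrite ?oppr_lt0 ltr0n.
  - exact: continuous_subspaceT.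
  - split.
    + by move=> x _; have [] := dF x.
    + apply: cvg_at_right_filter; apply: differentiable_continuous.
      by apply/derivable1_diffP; have [] := dF (- n.+1%:R).
    + apply: cvg_at_left_filter; apply: differentiable_continuous.
      by apply/derivable1_diffP; have [] := dF n.+1%:R.
  - by move=> x _; rewrite derive1E; have [_ ->] := dF x.
have FE : ((F n.+1%:R)%:E - (F (- n.+1%:R))%:E)%E @[n --> \oo] --> 0%E.
  rewrite -[X in _ --> X]sube0; apply: cvgeB => //.
    by apply: cvg_EFin; [exact: nearW|apply: cvg_linear_normal_pdf01 => // n; rewrite normr_nat].
  apply: cvg_EFin; [exact: nearW|].
  by apply: (@cvg_linear_normal_pdf01 F (fun n => - n.+1%:R)) => // n; rewrite normrN normr_nat.
move: cv; rewrite E => cv; rewrite /Rintegral -[RHS]/(fine 0%E); congr fine.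
exact: cvg_unique cv FE.
Unshelve. all: by end_near. Qed.

Lemma continuous_cos_affine (a e : R) : continuous (fun x => cos (a * x + e)).
Proof.
move=> x; apply: (continuous_comp (f := fun x => a * x + e)); last exact: continuous_cos.
by apply: cvgD; [exact: mulrl_continuous|exact: cvg_cst].
Qed.

Lemma continuous_sin_affine (a e : R) : continuous (fun x => sin (a * x + e)).
Proof.
move=> x; apply: (continuous_comp (f := fun x => a * x + e)); last exact: continuous_sin.
by apply: cvgD; [exact: mulrl_continuous|exact: cvg_cst].
Qed.

Lemma is_derive_affine (a e x : R) : is_derive x 1 (fun x : R => a * x + e) a.
Proof.
have -> : (fun x : R => a * x + e) = (a \*: @id R) + cst e by apply/funext => y.
by apply: is_derive_eq; rewrite /GRing.scale/= mulr1 addr0.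
Qed.

Lemma integrable_bounded_mul (h k : R -> R) (C : R) :
  measurable_fun setT h -> measurable_fun setT k -> (forall x, `|h x| <= C) ->
  mu.-integrable setT (fun x => (`|k x|)%:E) -> mu.-integrable setT (fun x => (h x * k x)%:E).
Proof.
move=> mh mk hC ik.
have C0 : 0 <= C by exact: le_trans (hC 0).
apply: le_integrable (integrableZl measurableT C ik) => //.
  by apply/measurable_EFinP/measurable_funM.
move=> x _; rewrite -EFinM !abse_EFin lee_fin !normrM normr_id.
by rewrite (ger0_norm C0) ler_wpM2r.
Qed.

(** Gaussian integration by parts: the difference of both sides is the integral of the derivative of
    [sin (a * x + e) * N01 x], because the density has derivative [- x * N01 x]. *)
Lemma stein_sin (a e : R) :
  \int[mu]_x (x * sin (a * x + e) * N01 x) = a * \int[mu]_x (cos (a * x + e) * N01 x).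
Proof.
have mN : measurable_fun setT N01 by exact: measurable_normal_pdf.
have mc := continuous_measurable_fun (@continuous_cos_affine a e).
have ms := continuous_measurable_fun (@continuous_sin_affine a e).
have i1 : mu.-integrable setT (fun x => (cos (a * x + e) * N01 x)%:E).
  apply: (@integrable_bounded_mul _ _ 1) => //; first by move=> x; exact: cos_max.
  by under eq_fun do rewrite ger0_norm ?normal_pdf_ge0//; exact: integrable_normal_pdf.
have i2 : mu.-integrable setT (fun x => (x * sin (a * x + e) * N01 x)%:E).
  under eq_fun do rewrite mulrAC mulrC.
  apply: (@integrable_bounded_mul _ _ 1) => //; first exact: measurable_funM.
    by move=> x; exact: sin_max.
  under eq_fun do rewrite normrM [X in _ * X]ger0_norm ?normal_pdf_ge0//.
  exact: integrable_normr_normal_pdf01.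
apply/eqP; rewrite eq_sym -subr_eq0 -RintegralZl// -RintegralB//; last first.
  exact: (integrableZl measurableT a i1).
apply/eqP; apply: (@integral_derivative_eq0 (fun x => sin (a * x + e) * N01 x) _
   (fun x => (`|a| + `|x|) * N01 x)).
- move=> x.
  have h1 := @is_derive1_comp R sin (fun x : R => a * x + e) x _ _ (is_derive_sin _) (is_derive_affine a e x).
  have h := is_deriveM h1 (is_derive_normal_pdf01 x).
  by apply: (is_derive_eq h); rewrite /GRing.scale/=; ring.
- move=> x; apply: cvgB; apply: cvgM.
  + exact: cvg_cst.
  + by apply: cvgM; [exact: continuous_cos_affine|exact: continuous_normal_pdf01].
  + by apply: cvgM; [exact: cvg_id|exact: continuous_sin_affine].
  + exact: continuous_normal_pdf01.
- have -> : EFin \o (fun x => (`|a| + `|x|) * N01 x) =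
      (fun x => `|a|%:E * (N01 x)%:E + (`|x| * N01 x)%:E)%E.
    by apply/funext => x; rewrite /= -EFinM -EFinD mulrDl.
  apply: integrableD => //; last exact: integrable_normr_normal_pdf01.
  by apply: integrableZl => //; exact: integrable_normal_pdf.
- move=> x; rewrite (le_trans (ler_normB _ _))// mulrDl !normrM.
  rewrite (ger0_norm (normal_pdf_ge0 _ _ _)) lerD//.
    by rewrite ler_wpM2l// ler_piMl ?normal_pdf_ge0 ?cos_max.
  by rewrite -mulrA ler_wpM2l// ler_piMl ?normal_pdf_ge0 ?sin_max.
- move=> x; rewrite normrM (ger0_norm (normal_pdf_ge0 _ _ _)) ler_wpM2r ?normal_pdf_ge0//.
  by rewrite (le_trans (sin_max _))// lerDl.
Qed.

Lemma second_moment_normal_pdf01 : \int[mu]_x (x ^+ 2 * N01 x) = 1.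
Proof.
have iN := @integrable_normal_pdf R 0 1.
have i2 := integrable_sqr_normal_pdf01.
have I1 : \int[mu]_x N01 x = 1 :> R by rewrite /Rintegral integral_normal_pdf.
apply/eqP; rewrite eq_sym -subr_eq0 -[X in X - _]I1 -RintegralB//; apply/eqP.
apply: (@integral_derivative_eq0 (fun x => x * N01 x) _ (fun x => N01 x + x ^+ 2 * N01 x)).
- move=> x; have h := is_deriveM (is_derive_id x (1:R)) (is_derive_normal_pdf01 x).
  by apply: (is_derive_eq h); rewrite /GRing.scale/=; ring.
- move=> x; apply: cvgB; first exact: continuous_normal_pdf01.
  by apply: cvgM; [exact: exprn_continuous|exact: continuous_normal_pdf01].
- exact: (integrableD measurableT iN i2).
- move=> x; rewrite (le_trans (ler_normB _ _))// normrM.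
  by rewrite !ger0_norm ?normal_pdf_ge0 ?sqr_ge0.
- move=> x; rewrite normrM (ger0_norm (normal_pdf_ge0 _ _ _)) ler_wpM2r ?normal_pdf_ge0//.
  by rewrite lerDr.
Qed.

(** As a function of [a] the left side has derivative [- a] times itself: differentiation under the
    integral brings down [- x * sin], dominated by [|x| * N01 x], and [stein_sin] turns this back
    into a cosine. So [phi a * expR (a ^+ 2 / 2)] is constant, with value [cos e] at [a = 0]. *)
Lemma fourier_normal_pdf01 (a e : R) :
  \int[mu]_x (cos (a * x + e) * N01 x) = cos e * expR (- a ^+ 2 / 2).
Proof.
pose phi a := \int[mu]_x (cos (a * x + e) * N01 x).
have dphi (b : R) : is_derive b 1 phi (- b * phi b).
  pose f (b x : R) := cos (b * x + e) * N01 x.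
  have mN : measurable_fun setT N01 by exact: measurable_normal_pdf.
  have df (c x : R) : is_derive c 1 (f ^~ x) (- x * sin (c * x + e) * N01 x).
    have h0 := is_derive_affine x e c.
    have h1 := @is_derive1_comp R cos (fun c : R => x * c + e) c _ _ (is_derive_cos _) h0.
    have -> : f ^~ x = N01 x \*: (cos \o (fun c => x * c + e)).
      by apply/funext => y; rewrite /f -[RHS]/(N01 x * cos (x * y + e)) (mulrC y x); exact: mulrC.
    have h := is_deriveZ (N01 x) h1.
    by apply: (is_derive_eq h); rewrite /GRing.scale/= [x * c]mulrC; ring.
  have fI x : mu.-integrable setT (EFin \o f x).
    apply: (@integrable_bounded_mul _ _ 1) => //.
    - exact: continuous_measurable_fun (@continuous_cos_affine _ _).
    - by move=> y; exact: cos_max.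
    - by under eq_fun do rewrite ger0_norm ?normal_pdf_ge0//; exact: integrable_normal_pdf.
  have bI : (`](b - 1), (b + 1)[%classic : set R) b by rewrite /= in_itv/=; lra.
  have P1E c x : partial1of2 f c x = - x * sin (c * x + e) * N01 x.
    by rewrite partial1of2E; have [_ ->] := df c x.
  have df1 : forall x y : R, (`](b - 1), (b + 1)[%classic : set R) x -> [set: R] y -> derivable (f ^~ y) x 1.
    by move=> x y _ _; have [] := df x y.
  have Gub : forall x y : R, (`](b - 1), (b + 1)[%classic : set R) x -> [set: R] y ->
      `|partial1of2 f x y| <= `|y| * N01 y.
    move=> x y _ _; rewrite P1E !normrM normrN (ger0_norm (normal_pdf_ge0 _ _ _)).
    by rewrite ler_wpM2r ?normal_pdf_ge0// ler_piMr// sin_max.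
  have G0 : forall y : R, 0 <= `|y| * N01 y by move=> y; rewrite mulr_ge0 ?normal_pdf_ge0.
  have dv := @derivable_under_integral R _ _ mu f setT measurableT b (b - 1) (b + 1) bI
    (fun x _ => fI x) df1 (fun y => `|y| * N01 y) G0 integrable_normr_normal_pdf01 Gub.
  have dE := @differentiation_under_integral R _ _ mu f setT measurableT b (b - 1) (b + 1) bI
    (fun x _ => fI x) df1 (fun y => `|y| * N01 y) G0 integrable_normr_normal_pdf01 Gub.
  apply: DeriveDef => //.
  rewrite -derive1E dE.
  under eq_Rintegral do rewrite P1E.
  rewrite mulNr -stein_sin.
  rewrite -mulN1r -RintegralZl//.
    by apply: eq_Rintegral => x _; ring.
  under eq_fun do rewrite mulrAC mulrC.
  apply: (@integrable_bounded_mul _ _ 1) => //.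
  - exact: continuous_measurable_fun (@continuous_sin_affine _ _).
  - exact: measurable_funM.
  - by move=> x; exact: sin_max.
  under eq_fun do rewrite normrM [X in _ * X]ger0_norm ?normal_pdf_ge0//.
  exact: integrable_normr_normal_pdf01.
pose psi b := phi b * expR (b ^+ 2 / 2).
have dpsi (b : R) : is_derive b 1 psi 0.
  have h : is_derive b 1 (fun y : R => y ^+ 2 / 2) b.
    have -> : (fun y : R => y ^+ 2 / 2) = (2^-1 : R) \*: ((@id R) ^+ 2).
      by apply/funext => y /=; rewrite /GRing.scale/= exprfctE; lra.
    by apply: is_derive_eq; rewrite /GRing.scale/=; lra.
  have h2 := @is_derive1_comp R expR (fun y : R => y ^+ 2 / 2) b _ _ (is_derive_expR _) h.
  have h3 := is_deriveM (dphi b) h2.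
  by apply: (is_derive_eq h3); rewrite /GRing.scale/=; ring.
have := is_derive_0_is_cst a 0 dpsi.
rewrite /psi expr0n/= mul0r expR0 mulr1 => E.
have E0 : phi 0 = cos e.
  rewrite /phi; under eq_Rintegral do rewrite mul0r add0r.
  by rewrite RintegralZl//; [rewrite /Rintegral integral_normal_pdf mulr1|exact: integrable_normal_pdf].
by rewrite -/(phi a) -E0 -E mulNr expRN mulfK// gt_eqF// expR_gt0.
Qed.

End gaussian_fourier.

Section gaussian_variables.
Local Open Scope ring_scope.
Context (R : realType).
Notation mu := (@lebesgue_measure R).
Notation N01 := (normal_pdf (0:R) 1).

Lemma measurable_normal_pdf01 : measurable_fun setT N01.
Proof. exact: measurable_normal_pdf. Qed.

Lemma normal_pdf_affine (m s x : R) : 0 < s -> s * normal_pdf m s (s * x + m) = N01 x.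
Proof.
move=> s0; rewrite normal_pdf01E normal_pdfE ?gt_eqF// /normal_peak /normal_fun.
rewrite -[s ^+ 2 * pi *+ 2]mulrnAr.
rewrite sqrtrM ?sqr_ge0// sqrtr_sqr gtr0_norm// addrK.
have p0 : Num.sqrt (pi *+ 2) != 0 :> R by rewrite gt_eqF// sqrtr_gt0 mulrn_wgt0// pi_gt0.
rewrite invfM !mulrA divff ?gt_eqF// mul1r; congr (_ * expR _).
by rewrite -mulr_natr; field; rewrite gt_eqF.
Qed.

Lemma ge0_integral_normal_prob (m s : R) (h : R -> \bar R) : 0 < s ->
  measurable_fun setT h -> (forall x, 0 <= h x)%E ->
  (\int[normal_prob m s]_x h x = \int[mu]_x (h (s * x + m)%R * (N01 x)%:E))%E.
Proof.
move=> s0 mh h0.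
have mN := @measurable_normal_pdf R m s.
have nE : forall A, measurable A ->
    normal_prob m s A = (\int[mu]_(x in A) (normal_pdf m s x)%:E)%E by [].
rewrite (@ge0_integral_density _ _ _ mu (normal_prob m s) _ mN (@normal_pdf_ge0 R m s) nE h mh h0).
rewrite (@ge0_integral_affine_pos _ (fun x => h x * (normal_pdf m s x)%:E)%E s m)//; last 2 first.
- by apply: emeasurable_funM => //; apply/measurable_EFinP; exact: measurable_normal_pdf.
- by move=> x; rewrite mule_ge0// lee_fin normal_pdf_ge0.
rewrite -ge0_integralZl//; last 3 first.
- apply: emeasurable_funM.
    by apply: measurableT_comp => //; apply: measurable_funD => //; exact: measurable_funM.
  apply/measurable_EFinP; apply: measurableT_comp; first exact: measurable_normal_pdf.
  by apply: measurable_funD => //; exact: measurable_funM.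
- by move=> x _; rewrite mule_ge0// lee_fin normal_pdf_ge0.
- by rewrite lee_fin ltW.
by apply: eq_integral => x _; rewrite muleCA -EFinM normal_pdf_affine.
Qed.

Section is_gaussian.
Context d (T : measurableType d) (P : probability T R) (Y : T -> R).
Hypothesis mY : measurable_fun setT Y.

(** With the law written as that of [s * x + m] for a standard normal [x], the value [s = 0] stands
    for the point mass, so later proofs do not distinguish the two cases of [is_gaussian]. *)
Lemma is_gaussian_ge0_integral : is_gaussian P Y ->
  exists m s : R, forall h : R -> \bar R, measurable_fun setT h -> (forall x, 0 <= h x)%E ->
  (\int[P]_w h (Y w) = \int[mu]_x (h (s * x + m)%R * (N01 x)%:E))%E.
Proof.
move=> [m [s [s0 PY]]]; exists m, s => h mh h0.
have mY' : measurable_fun setT (Y : T -> measurableTypeR R) by [].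
transitivity (\int[pushforward P (Y : T -> measurableTypeR R)]_x h x)%E.
  by rewrite ge0_integral_pushforward// preimage_setT.
have [s00|s00] := eqVneq s 0.
  rewrite s00; under [RHS]eq_integral do rewrite mul0r add0r.
  rewrite ge0_integralZl//; last 2 first.
  - by apply/measurable_EFinP; exact: measurable_normal_pdf01.
  - by move=> x _; rewrite lee_fin normal_pdf_ge0.
  rewrite integral_normal_pdf mule1.
  rewrite [LHS](eq_measure_integral \d_(m : measurableTypeR R)); last first.
    by move=> A mA _; rewrite /= /pushforward PY// s00 eqxx.
  by rewrite integral_dirac// diracT mul1e.
have s1 : 0 < s by rewrite lt_neqAle eq_sym s00.
rewrite [LHS](eq_measure_integral (normal_prob m s)); last first.
  by move=> A mA _; rewrite /= /pushforward PY// (negbTE s00).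
exact: ge0_integral_normal_prob.
Qed.

Lemma probability_integral_cst (c : \bar R) : (\int[P]_w (cst c w) = c)%E.
Proof.
apply: etrans (integral_cst P measurableT c) _.
by rewrite [X in (_ * X)%E](probability_setT P) mule1.
Qed.

Lemma integrable_bounded (h : T -> R) (C : R) : measurable_fun setT h ->
  (forall x, `|h x| <= C) -> P.-integrable setT (EFin \o h).
Proof.
move=> mh hC; apply/integrableP; split; first exact/measurable_EFinP.
apply: (@le_lt_trans _ _ (\int[P]_w (cst C%:E) w)%E).
  apply: ge0_le_integral => //=.
  - by apply/measurable_EFinP; apply: measurableT_comp.
  - by move=> x _; rewrite lee_fin (le_trans _ (hC x)).
by rewrite probability_integral_cst ltry.
Qed.

(** The law is known through nonnegative test functions and two unnamed parameters [m] and [s].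
    Integrability, [m = 0] and the value [s ^+ 2] of the second moment are extracted first; then the
    Fourier transform of the normal law applies. *)
Lemma gaussian_cos : is_gaussian P Y -> 'E_P[Y] = 0%E ->
  P.-integrable setT (fun w => ((Y w) ^+ 2)%:E) /\
  forall e, \int[P]_w cos (Y w + e) = cos e * expR (- (\int[P]_w (Y w) ^+ 2) / 2).
Proof.
move=> /is_gaussian_ge0_integral[m [s PY]] EY0.
(* A shift by [c] keeps the test function a square, hence nonnegative; [c = 0] yields integrability,
   and comparison with [c = 1] yields the mean. *)
have sq (c : R) : (\int[P]_w ((Y w + c) ^+ 2)%:E = ((m + c) ^+ 2 + s ^+ 2)%:E)%E.
  rewrite (PY (fun x => ((x + c) ^+ 2)%:E)); last 2 first.
  - by apply/measurable_EFinP; apply: measurable_funX; exact: measurable_funD.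
  - by move=> x; rewrite lee_fin sqr_ge0.
  have i1 := integrable_sqr_normal_pdf01 R.
  have i0 := integrable_normal_pdf (0:R) 1.
  have ix : mu.-integrable setT (fun x : R => (x * N01 x)%:E).
    apply: le_integrable (integrable_normr_normal_pdf01 R) => //.
      by apply/measurable_EFinP; apply: measurable_funM => //; exact: measurable_normal_pdf01.
    by move=> x _; rewrite /= !normrM normr_id.
  have Ex : (\int[mu]_x (x * N01 x)%:E = 0)%E.
    have := @stein_sin R 0 (pi / 2); rewrite mul0r.
    under eq_Rintegral do rewrite mul0r add0r sin_pihalf mulr1.
    move=> E0; have : (\int[mu]_x (x * N01 x)%:E)%E \is a fin_num by exact: integrable_fin_num.
    by move=> /fineK <-; congr EFin.
  have Ex2 : (\int[mu]_x (x ^+ 2 * N01 x)%:E = 1)%E.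
    have : (\int[mu]_x (x ^+ 2 * N01 x)%:E)%E \is a fin_num by exact: integrable_fin_num.
    by move=> /fineK <-; congr EFin; exact: second_moment_normal_pdf01.
  under eq_integral.
    move=> x _.
    have -> : (((s * x + m + c) ^+ 2)%:E * (N01 x)%:E =
      (s ^+ 2)%:E * (x ^+ 2 * N01 x)%:E + ((2 * s * (m + c))%:E * (x * N01 x)%:E +
       ((m + c) ^+ 2)%:E * (N01 x)%:E))%E.
      by rewrite -!EFinM -!EFinD; congr EFin; ring.
    over.
  rewrite integralD//; last 2 first.
  - exact: integrableZl.
  - by apply: integrableD => //; exact: integrableZl.
  rewrite integralD//; [|exact: integrableZl|exact: integrableZl].
  rewrite !integralZl// Ex Ex2 integral_normal_pdf mule0 add0e !mule1 -EFinD.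
  by rewrite addrC.
have sq0 : (\int[P]_w ((Y w) ^+ 2)%:E = (m ^+ 2 + s ^+ 2)%:E)%E.
  by have := sq 0; rewrite addr0 => <-; apply: eq_integral => w _; rewrite addr0.
have iY2 : P.-integrable setT (fun w => ((Y w) ^+ 2)%:E).
  apply/integrableP; split; first by apply/measurable_EFinP; exact: measurable_funX.
  under eq_integral do rewrite gee0_abs ?lee_fin ?sqr_ge0//.
  by rewrite sq0 ltry.
have iY : P.-integrable setT (EFin \o Y).
  have i1 : P.-integrable setT (fun w => 1%:E + ((Y w) ^+ 2)%:E)%E.
    apply: integrableD => //; apply: (@integrable_bounded (cst 1) 1) => //.
    by move=> x; rewrite normr1.
  apply: le_integrable i1 => //; first exact/measurable_EFinP.
  move=> w _; rewrite -EFinD !abse_EFin lee_fin [leRHS]ger0_norm ?addr_ge0 ?sqr_ge0//.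
  by have := sqr_ge0 (`|Y w| - 1); rewrite -[(Y w) ^+ 2]real_normK ?num_real//; nra.
have m0 : m = 0.
  have := sq 1.
  under eq_integral.
    move=> x _.
    have -> : ((Y x + 1) ^+ 2)%:E = (((Y x) ^+ 2)%:E + (2%:E * (Y x)%:E + 1%:E))%E.
      by rewrite -EFinM -!EFinD; congr EFin; ring.
    over.
  have i11 : P.-integrable setT (cst 1%:E : T -> \bar R).
    by apply: (@integrable_bounded (cst 1) 1) => // x; rewrite normr1.
  have i2 : P.-integrable setT (fun w => 2%:E * (Y w)%:E)%E by exact: integrableZl.
  rewrite integralD//; last by exact: integrableD.
  rewrite integralD// integralZl//; move: EY0; rewrite unlock => ->.
  rewrite sq0 probability_integral_cst mule0 add0e -EFinD => -[]; nra.
split => // e.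
have -> : \int[P]_w (Y w) ^+ 2 = s ^+ 2.
  by rewrite /Rintegral sq0 m0 expr0n add0r.
have mc : measurable_fun setT (fun x : R => cos (x + e)).
  apply: continuous_measurable_fun.
  by under eq_fun do rewrite -[X in X + e]mul1r; exact: continuous_cos_affine.
have ic : P.-integrable setT (fun w => (cos (Y w + e))%:E).
  apply: (@integrable_bounded (fun w => cos (Y w + e)) 1).
    exact: (measurableT_comp mc).
  by move=> x; exact: cos_max.
have i11 : P.-integrable setT (cst 1%:E : T -> \bar R).
  by apply: (@integrable_bounded (cst 1) 1) => // x; rewrite normr1.
have icN : mu.-integrable setT (fun x => (cos (s * x + e) * N01 x)%:E).
  apply: (@integrable_bounded_mul _ _ _ 1) => //.
  - exact: continuous_measurable_fun (@continuous_cos_affine _ _ _).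
  - exact: measurable_normal_pdf01.
  - by move=> y; exact: cos_max.
  - by under eq_fun do rewrite ger0_norm ?normal_pdf_ge0//; exact: integrable_normal_pdf.
have iN := @integrable_normal_pdf R 0 1.
(* The summand [1] makes the test function nonnegative; it adds the total mass [1] to both sides and
   is cancelled at the end. *)
have E : \int[P]_w (1 + cos (Y w + e)) = \int[mu]_x (N01 x + cos (s * x + e) * N01 x).
  rewrite /Rintegral (PY (fun x => (1 + cos (x + e))%:E)).
  - by congr fine; apply: eq_integral => x _; rewrite -EFinM mulrDl mul1r m0 addr0.
  - by apply/measurable_EFinP; exact: measurable_funD.
  - by move=> x; rewrite lee_fin -lerBlDl sub0r cos_geN1.
move: E; rewrite RintegralD// RintegralD// fourier_normal_pdf01.
rewrite /Rintegral integral_normal_pdf probability_integral_cst.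
by move/addrI.
Qed.

End is_gaussian.
End gaussian_variables.

(** * Uniqueness of Fourier transforms of finite measures on the line *)

Section fourier_uniqueness.
Local Open Scope ring_scope.
Context (R : realType).
Notation mu := (@lebesgue_measure R).
Notation N01 := (normal_pdf (0:R) 1).

Lemma eq_finite_measure_itv (m1 m2 : {measure set (measurableTypeR R) -> \bar R}) :
  (m1 setT < +oo)%E -> (forall a b, a <= b -> m1 `]a, b]%classic = m2 `]a, b]%classic) ->
  forall A, measurable A -> m1 A = m2 A.
Proof.
move=> m1oo m12 A mA.
apply: (@measure_unique _ R (measurableTypeR R) (@ocitv R) (fun k => `](- k%:R), k%:R]%classic)) => //.
- exact: ocitvI.
- by move=> i; exact: is_ocitv.
- by rewrite -subTset => x _; exists (Num.truncn `|x|).+1 => //=; rewrite in_itv/=;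
  have := truncnS_gt `|x|; rewrite ltr_norml => /andP[-> /ltW].
- move=> _ [[a b] _ <-]/=; have [ab|ba] := leP a b; first exact: m12.
  by rewrite set_itv_ge ?measure0// -leNgt bnd_simp ltW.
- move=> k; apply: le_lt_trans m1oo; apply: le_measure; rewrite ?inE//.
Qed.

(** A continuous approximation from above of the indicator of []-oo, c]], descending with slope
    [- n] to the right of [c]. *)
Definition ramp (c : R) (n : nat) (x : R) := Num.max 0 (Num.min 1 (1 + n%:R * (c - x))).

Lemma continuous_ramp c n : continuous (ramp c n).
Proof.
have ca : continuous (fun x : R => 1 + n%:R * (c - x)).
  move=> x; apply: cvgD; first exact: cvg_cst.
  apply: cvgM; first exact: cvg_cst.
  by apply: cvgB; [exact: cvg_cst|exact: cvg_id].
move=> x; apply: (@continuous_max R _ (cst 0) (fun y => Num.min 1 (1 + n%:R * (c - y)))).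
  exact: cst_continuous.
apply: (@continuous_min R _ (cst 1) (fun y => 1 + n%:R * (c - y))).
  exact: cst_continuous.
exact: ca.
Qed.

Lemma ramp_ge0 c n x : 0 <= ramp c n x. Proof. by rewrite le_max lexx. Qed.

Lemma ramp_le1 c n x : ramp c n x <= 1. Proof. by rewrite ge_max ler01 ge_min lexx. Qed.

Lemma le_ramp a b n x : a <= b -> ramp a n x <= ramp b n x.
Proof.
move=> ab; rewrite /ramp ge_max !le_max lexx/=; apply/orP; right.
rewrite le_min !ge_min lexx/=; apply/orP; right.
by rewrite lerD2l ler_wpM2l// lerB.
Qed.

Lemma cvg_ramp (c x : R) : ramp c n x @[n --> \oo] --> ((x <= c)%R%:R : R).
Proof.
have [xc|cx] := leP x c.
  apply: cvg_near_cst; apply: nearW => n.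
  by rewrite /ramp min_l ?max_r// lerDl mulr_ge0// subr_ge0.
apply: cvg_near_cst; near=> n.
have h : 1 + n%:R * (c - x) <= 0.
  rewrite -opprB mulrN subr_le0 -ler_pdivrMr ?subr_gt0// mul1r.
  near: n; exact: nbhs_infty_ger.
by rewrite /ramp min_r ?max_l// (le_trans h).
Unshelve. all: by end_near. Qed.

Lemma adde_fin_inj (a x y : \bar R) : a \is a fin_num -> (a + x = a + y)%E -> x = y.
Proof.
by move=> af /(congr1 (fun z => z - a)%E); rewrite ![(a + _)%E]addeC !addeK.
Qed.

Lemma add1cos_ge0 (x : R) : 0 <= 1 + cos x.
Proof. by rewrite -lerBlDl sub0r cos_geN1. Qed.

Lemma integral_cos_normal_pdf01 (v : R) :
  (\int[mu]_x ((1 + cos (v * x)) * N01 x)%:E = (1 + expR (- v ^+ 2 / 2))%:E)%E.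
Proof.
have iN := @integrable_normal_pdf R 0 1.
have ic : mu.-integrable setT (fun x => (cos (v * x + 0) * N01 x)%:E).
  apply: (@integrable_bounded_mul _ _ _ 1) => //.
  - exact: continuous_measurable_fun (@continuous_cos_affine _ _ _).
  - exact: measurable_normal_pdf01.
  - by move=> y; exact: cos_max.
  - by under eq_fun do rewrite ger0_norm ?normal_pdf_ge0//; exact: iN.
under eq_integral do rewrite mulrDl mul1r EFinD -[v * _]addr0.
rewrite integralD// integral_normal_pdf EFinD; congr (_ + _)%E.
rewrite -[LHS]fineK; last exact: integrable_fin_num.
by rewrite -/(Rintegral _ _ _) fourier_normal_pdf01 cos0 mul1r.
Qed.

Section one_side.
Context d (T : measurableType d) (P : probability T R) (Z X : T -> R).
Hypotheses (mZ : measurable_fun setT Z) (mX : measurable_fun setT X).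
Hypotheses (Z0 : forall w, 0 <= Z w).

(** The Gaussian is its own Fourier transform: [expR (- v ^+ 2 / 2)] is the mean of [cos (v * x)]
    over a standard normal [x]. By Tonelli the integral of a Gaussian kernel in [X] is therefore
    determined by integrals of cosines of [X]. The summand [1] keeps the integrands nonnegative. *)
Lemma gaussian_kernel_cos (c y : R) :
  (\int[P]_w (Z w * (1 + expR (- ((y - X w) * c) ^+ 2 / 2)))%:E =
   \int[mu]_x (\int[P]_w (Z w * (1 + cos (- (x * c) * X w + x * c * y)))%:E * (N01 x)%:E))%E.
Proof.
pose F (p : T * R) := ((Z p.1 * (1 + cos ((y - X p.1) * c * p.2))) * N01 p.2)%:E.
have mF : measurable_fun setT F.
  apply/measurable_EFinP; apply: measurable_funM; last first.
    by apply: measurableT_comp; [exact: measurable_normal_pdf01|exact: measurable_snd].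
  apply: measurable_funM; first exact: (measurableT_comp mZ measurable_fst).
  apply: measurable_funD => //; apply: measurableT_comp.
    exact: continuous_measurable_fun (@continuous_cos R).
  apply: measurable_funM; last exact: measurable_snd.
  apply: measurable_funM => //; apply: measurable_funB => //.
  exact: (measurableT_comp mX measurable_fst).
have F0 p : (0 <= F p)%E.
  by rewrite lee_fin mulr_ge0 ?normal_pdf_ge0// mulr_ge0// add1cos_ge0.
transitivity (\int[P]_w \int[mu]_x F (w, x))%E.
  apply: eq_integral => w _; rewrite /F/=.
  under eq_integral do rewrite -mulrA EFinM.
  rewrite ge0_integralZl//; last 3 first.
  - apply/measurable_EFinP/measurable_funM; last exact: measurable_normal_pdf01.
    apply: measurable_funD => //; apply: measurableT_comp.
      exact: continuous_measurable_fun (@continuous_cos R).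
    exact: measurable_funM.
  - by move=> x _; rewrite lee_fin mulr_ge0 ?normal_pdf_ge0// add1cos_ge0.
  - by rewrite lee_fin.
  by rewrite integral_cos_normal_pdf01 EFinM.
rewrite fubini_tonelli//; apply: eq_integral => x _.
under eq_integral do rewrite /F/= EFinM.
rewrite ge0_integralZr//; last 3 first.
- apply/measurable_EFinP; apply: measurable_funM => //.
  apply: measurable_funD => //; apply: measurableT_comp.
    exact: continuous_measurable_fun (@continuous_cos R).
  by apply: measurable_funM => //; apply: measurable_funM => //; exact: measurable_funB.
- by move=> w _; rewrite lee_fin mulr_ge0// add1cos_ge0.
- by rewrite lee_fin normal_pdf_ge0.
by congr (_ * _)%E; apply: eq_integral => w _ /=; congr (_ * (1 + cos _))%:E; ring.
Qed.

(** After the substitution [y = s * x + X w] the sample [w] enters through [Z w] and the kernel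
    [N01 ((y - X w) / s)] only, and [gaussian_kernel_cos] controls the integral of these. *)
Lemma gaussian_smoothing (h : R -> R) (s : R) : 0 < s ->
  measurable_fun setT h -> (forall x, 0 <= h x) ->
  (\int[P]_w \int[mu]_x (Z w * (h (s * x + X w) * N01 x))%:E =
   \int[mu]_y ((s^-1 * h y)%:E * \int[P]_w (Z w * N01 ((y - X w) / s))%:E))%E.
Proof.
move=> s0 mh h0.
pose F (p : T * R) := ((s^-1 * h p.2) * (Z p.1 * N01 ((p.2 - X p.1) / s)))%:E.
have mF : measurable_fun setT F.
  apply/measurable_EFinP; apply: measurable_funM.
    by apply: measurable_funM => //; exact: (measurableT_comp mh measurable_snd).
  apply: measurable_funM; first exact: (measurableT_comp mZ measurable_fst).
  apply: measurableT_comp; first exact: measurable_normal_pdf01.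
  apply: measurable_funM => //; apply: measurable_funB; first exact: measurable_snd.
  exact: (measurableT_comp mX measurable_fst).
have s'0 : 0 <= s^-1 by rewrite invr_ge0 ltW.
have F0 p : (0 <= F p)%E.
  by rewrite lee_fin mulr_ge0 ?mulr_ge0 ?normal_pdf_ge0.
transitivity (\int[P]_w \int[mu]_x F (w, x))%E.
  apply: eq_integral => w _.
  rewrite [RHS](@ge0_integral_affine_pos _ _ s (X w))//; last first.
    exact: (measurableT_comp mF (pair1_measurable w)).
  rewrite -ge0_integralZl//; last 2 first.
  - apply: (@measurableT_comp _ _ _ _ _ _ (fun x => F (w, x))).
      exact: (measurableT_comp mF (pair1_measurable w)).
    by apply: measurable_funD => //; exact: measurable_funM.
  - by rewrite lee_fin ltW.
  apply: eq_integral => x _; rewrite /F/= -EFinM; congr EFin.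
  rewrite addrK [s * x]mulrC mulfK ?gt_eqF//; field; exact: lt0r_neq0.
rewrite fubini_tonelli//; apply: eq_integral => y _.
rewrite -ge0_integralZl//.
- apply/measurable_EFinP; apply: measurable_funM => //.
  apply: measurableT_comp; first exact: measurable_normal_pdf01.
  by apply: measurable_funM => //; exact: measurable_funB.
- by move=> w _; rewrite lee_fin mulr_ge0 ?normal_pdf_ge0.
- by rewrite lee_fin mulr_ge0.
Qed.

Hypothesis Zoo : (\int[P]_w (Z w)%:E < +oo)%E.

Lemma cvg_gaussian_smoothing (h : R -> R) :
  continuous h -> (forall x, 0 <= h x <= 1) ->
  (\int[P]_w \int[mu]_x (Z w * (h (n.+1%:R^-1 * x + X w) * N01 x))%:E)%E
   @[n --> \oo] --> (\int[P]_w (Z w * h (X w))%:E)%E.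
Proof.
move=> ch h01.
have mh : measurable_fun setT h by exact: continuous_measurable_fun.
have mN := @measurable_normal_pdf01 R.
pose G n (p : T * R) := (Z p.1 * (h (n.+1%:R^-1 * p.2 + X p.1) * N01 p.2))%:E.
have G0 n p : (0 <= G n p)%E.
  rewrite lee_fin mulr_ge0// mulr_ge0 ?normal_pdf_ge0//.
  by have /andP[] := h01 (n.+1%:R^-1 * p.2 + X p.1).
have mG n : measurable_fun setT (G n).
  apply/measurable_EFinP; apply: measurable_funM; first exact: (measurableT_comp mZ measurable_fst).
  apply: measurable_funM; last exact: (measurableT_comp mN measurable_snd).
  apply: (measurableT_comp mh); apply: measurable_funD.
    by apply: measurable_funM => //; exact: measurable_snd.
  exact: (measurableT_comp mX measurable_fst).
have mGw n w : measurable_fun setT (fun x => G n (w, x)).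
  exact: (measurableT_comp (mG n) (pair1_measurable w)).
apply: (@ge0_dominated_cvg _ _ _ P _ _ (EFin \o Z)).
- by move=> n; exact: (@ge0_measurable_integral2 _ _ _ _ _ mu (fun x y => G n (x, y)) (mG n) (fun x y => G0 n (x, y))).
- exact/measurable_EFinP.
- move=> n w; apply: integral_ge0 => x _; rewrite lee_fin mulr_ge0// mulr_ge0 ?normal_pdf_ge0//.
  by have /andP[] := h01 (n.+1%:R^-1 * x + X w).
- move=> n w; apply: (@le_trans _ _ (\int[mu]_x ((Z w)%:E * (N01 x)%:E))%E).
    apply: ge0_le_integral => //.
    + move=> x _; rewrite lee_fin mulr_ge0// mulr_ge0 ?normal_pdf_ge0//.
      by have /andP[] := h01 (n.+1%:R^-1 * x + X w).
    + exact: (mGw n w).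
    + by apply: emeasurable_funM => //; exact/measurable_EFinP.
    + move=> x _; rewrite -EFinM lee_fin ler_wpM2l// ler_piMl ?normal_pdf_ge0//.
      by have /andP[] := h01 (n.+1%:R^-1 * x + X w).
  rewrite ge0_integralZl//; [by rewrite integral_normal_pdf mule1|exact/measurable_EFinP|..].
  + by move=> x _; rewrite lee_fin normal_pdf_ge0.
  + by rewrite lee_fin.
- apply: aeW => w.
  have -> : (Z w * h (X w))%:E = (\int[mu]_x (Z w * (h (X w) * N01 x))%:E)%E.
    under eq_integral do rewrite mulrA EFinM.
    rewrite ge0_integralZl//; [by rewrite integral_normal_pdf mule1|exact/measurable_EFinP|..].
    + by move=> x _; rewrite lee_fin normal_pdf_ge0.
    + by rewrite lee_fin mulr_ge0//; have /andP[] := h01 (X w).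
  have [|||||_ + _] := @dominated_cvg_EFin _ _ _ mu
     (fun n x => Z w * (h (n.+1%:R^-1 * x + X w) * N01 x)) (fun x => Z w * (h (X w) * N01 x))
     (fun x => Z w * N01 x) => //.
  + by move=> n; apply/measurable_EFinP; exact: (mGw n w).
  + by apply: measurable_funM => //; exact: measurable_funM.
  + move=> x; apply: cvgM; first exact: cvg_cst.
    apply: cvgM; last exact: cvg_cst.
    apply: continuous_cvg; first exact: ch.
    rewrite -[X in _ --> X]add0r; apply: cvgD; last exact: cvg_cst.
    rewrite -[X in _ --> X](mul0r x); apply: cvgMl; exact: cvg_harmonic.
  + exact: (integrableZl measurableT (Z w) (@integrable_normal_pdf R 0 1)).
  + move=> n x; rewrite normrM (ger0_norm (Z0 w)) ler_wpM2l// normrM (ger0_norm (normal_pdf_ge0 _ _ _)).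
    rewrite ler_piMl ?normal_pdf_ge0// ger0_norm//;
      by have /andP[] := h01 (n.+1%:R^-1 * x + X w).
- by apply/measurable_EFinP; apply: measurable_funM => //; exact: measurableT_comp.
- by [].
Qed.

End one_side.

Section two_sides.
Context d1 (T1 : measurableType d1) (P1 : probability T1 R) (Z1 X1 : T1 -> R).
Hypotheses (mZ1 : measurable_fun setT Z1) (mX1 : measurable_fun setT X1).
Hypotheses (Z10 : forall w, 0 <= Z1 w) (Z1oo : (\int[P1]_w (Z1 w)%:E < +oo)%E).
Context d2 (T2 : measurableType d2) (P2 : probability T2 R) (Z2 X2 : T2 -> R).
Hypotheses (mZ2 : measurable_fun setT Z2) (mX2 : measurable_fun setT X2).
Hypotheses (Z20 : forall w, 0 <= Z2 w) (Z2oo : (\int[P2]_w (Z2 w)%:E < +oo)%E).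

Lemma split_kernel d (T : measurableType d) (P : probability T R) (Z k : T -> R) :
  measurable_fun setT Z -> measurable_fun setT k -> (forall w, 0 <= Z w) ->
  (forall w, 0 <= k w) ->
  (\int[P]_w (Z w * (1 + k w))%:E =
   \int[P]_w (Z w)%:E + \int[P]_w (Z w * k w)%:E)%E.
Proof.
move=> mZ mk Z0 k0; under eq_integral do rewrite mulrDr mulr1 EFinD.
rewrite ge0_integralD//.
- by move=> x _; rewrite lee_fin.
- exact/measurable_EFinP.
- by move=> x _; rewrite lee_fin mulr_ge0.
- by apply/measurable_EFinP; exact: measurable_funM.
Qed.

(** Equal cosine integrals give equal integrals of Gaussian kernels, hence of Gaussian smoothings of
    bounded continuous functions, hence of these functions as the width tends to [0]. Differences of
    ramps then give the intervals []a, b]], which determine the images under [X1] and [X2] of the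
    measures weighted by [Z1] and [Z2]. *)
Lemma fourier_unique_ge0 :
  (forall a e, \int[P1]_w (Z1 w * (1 + cos (a * X1 w + e)))%:E =
               \int[P2]_w (Z2 w * (1 + cos (a * X2 w + e)))%:E)%E ->
  forall h : R -> \bar R, measurable_fun setT h -> (forall x, 0 <= h x)%E ->
  (\int[P1]_w (h (X1 w) * (Z1 w)%:E) = \int[P2]_w (h (X2 w) * (Z2 w)%:E))%E.
Proof.
move=> H.
have mass : (\int[P1]_w (Z1 w)%:E = \int[P2]_w (Z2 w)%:E)%E.
  (* Frequency [0] with phase [pi / 2] makes the cosine vanish and leaves the total mass. *)
  have := H 0 (pi / 2).
  under eq_integral do rewrite mul0r add0r cos_pihalf addr0 mulr1.
  by under [in X in _ = X -> _]eq_integral do rewrite mul0r add0r cos_pihalf addr0 mulr1.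
have mE d (T : measurableType d) (X : T -> R) (c y : R) : measurable_fun setT X ->
    measurable_fun setT (fun w => expR (- ((y - X w) * c) ^+ 2 / 2)).
  move=> mX; apply: measurableT_comp => //; apply: measurable_funM => //.
  apply: measurableT_comp => //; apply: measurable_funX; apply: measurable_funM => //.
  exact: measurable_funB.
have kerE c y : (\int[P1]_w (Z1 w * expR (- ((y - X1 w) * c) ^+ 2 / 2))%:E =
                \int[P2]_w (Z2 w * expR (- ((y - X2 w) * c) ^+ 2 / 2))%:E)%E.
  have : (\int[P1]_w (Z1 w * (1 + expR (- ((y - X1 w) * c) ^+ 2 / 2)))%:E =
         \int[P2]_w (Z2 w * (1 + expR (- ((y - X2 w) * c) ^+ 2 / 2)))%:E)%E.
    rewrite !gaussian_kernel_cos//; apply: eq_integral => x _.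
    by rewrite H.
  rewrite !split_kernel//; [|exact: mE|exact: mE].
  rewrite mass; apply: adde_fin_inj; rewrite ge0_fin_numE// integral_ge0// => w _.
  by rewrite lee_fin.
have ker01 s y : (\int[P1]_w (Z1 w * N01 ((y - X1 w) / s))%:E =
                 \int[P2]_w (Z2 w * N01 ((y - X2 w) / s))%:E)%E.
  have C0 : 0 <= (Num.sqrt (pi *+ 2))^-1 :> R by rewrite invr_ge0.
  rewrite normal_pdf01E.
  under eq_integral do rewrite mulrCA EFinM.
  under [in RHS]eq_integral do rewrite mulrCA EFinM.
  rewrite !ge0_integralZl//; first by rewrite kerE.
  - by apply/measurable_EFinP; apply: measurable_funM => //; exact: mE.
  - by move=> w _; rewrite lee_fin mulr_ge0// expR_ge0.
  - by apply/measurable_EFinP; apply: measurable_funM => //; exact: mE.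
  - by move=> w _; rewrite lee_fin mulr_ge0// expR_ge0.
have cont (h : R -> R) : continuous h -> (forall x, 0 <= h x <= 1) ->
    (\int[P1]_w (Z1 w * h (X1 w))%:E = \int[P2]_w (Z2 w * h (X2 w))%:E)%E.
  move=> ch h01; have mh : measurable_fun setT h by exact: continuous_measurable_fun.
  have h0 x : 0 <= h x by case/andP: (h01 x).
  have c1 := @cvg_gaussian_smoothing _ _ P1 _ _ mZ1 mX1 Z10 Z1oo h ch h01.
  have c2 := @cvg_gaussian_smoothing _ _ P2 _ _ mZ2 mX2 Z20 Z2oo h ch h01.
  apply: (cvg_unique _ c1) => //.
  move: c2; apply: cvg_trans; apply: near_eq_cvg; apply: nearW => n.
  have n0 : 0 < n.+1%:R^-1 :> R by rewrite invr_gt0 ltr0n.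
  by rewrite !gaussian_smoothing//; apply: eq_integral => y _; rewrite ker01.
pose m1 := pushforward (wmeasure P1 mZ1 Z10) (X1 : T1 -> measurableTypeR R).
pose m2 := pushforward (wmeasure P2 mZ2 Z20) (X2 : T2 -> measurableTypeR R).
have mE1 (A : set R) : measurable A -> m1 A = (\int[P1]_w (Z1 w * \1_A (X1 w))%:E)%E.
  move=> mA; rewrite /m1 /pushforward /wmeasure integral_mkcond.
  apply: eq_integral => w _; rewrite patchE indicE.
  by have [/set_mem|/negP] := boolP (w \in _) => wA; [rewrite mem_set// mulr1|rewrite memNset ?mulr0// => /mem_set].
have mE2 (A : set R) : measurable A -> m2 A = (\int[P2]_w (Z2 w * \1_A (X2 w))%:E)%E.
  move=> mA; rewrite /m2 /pushforward /wmeasure integral_mkcond.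
  apply: eq_integral => w _; rewrite patchE indicE.
  by have [/set_mem|/negP] := boolP (w \in _) => wA; [rewrite mem_set// mulr1|rewrite memNset ?mulr0// => /mem_set].
have mX1' : measurable_fun setT (X1 : T1 -> measurableTypeR R) by [].
have mX2' : measurable_fun setT (X2 : T2 -> measurableTypeR R) by [].
have m12 (A : set (measurableTypeR R)) : measurable A -> m1 A = m2 A.
  apply: eq_finite_measure_itv => [|a b ab].
    suff: (m1 setT < +oo)%E by [].
    by rewrite mE1//; under eq_integral do rewrite indicT mulr1.
  suff: m1 `]a, b]%classic = m2 `]a, b]%classic by [].
  rewrite mE1 ?mE2//.
  have cvi d (T : measurableType d) (P : probability T R) (Z X : T -> R) :
      measurable_fun setT Z -> measurable_fun setT X -> (forall w, 0 <= Z w) ->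
      (\int[P]_w (Z w)%:E < +oo)%E ->
      (\int[P]_w (Z w * (ramp b n (X w) - ramp a n (X w)))%:E)%E @[n --> \oo] -->
      (\int[P]_w (Z w * \1_`]a, b]%classic (X w))%:E)%E.
    move=> mZ mX Z0 Zoo.
    apply: (@ge0_dominated_cvg _ _ _ P _ _ (EFin \o Z)) => //.
    - move=> n; apply/measurable_EFinP; apply: measurable_funM => //.
      by apply: measurable_funB; apply: measurableT_comp => //;
        apply: continuous_measurable_fun; exact: continuous_ramp.
    - exact/measurable_EFinP.
    - by move=> n w; rewrite lee_fin mulr_ge0// subr_ge0 le_ramp.
    - move=> n w; rewrite lee_fin ler_piMr// lerBlDr.
      by rewrite (le_trans (ramp_le1 _ _ _))// lerDl ramp_ge0.
    - apply: aeW => w; apply: cvg_EFin; first exact: nearW.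
      apply: cvgM; first exact: cvg_cst.
      have -> : \1_`]a, b]%classic (X w) = (X w <= b)%R%:R - (X w <= a)%R%:R :> R.
        rewrite indicE mem_setE in_itv/=.
        case: (leP (X w) b) => xb; case: (leP (X w) a) => xa //=; rewrite ?subr0 ?subrr//.
        by have := le_lt_trans (le_trans xa ab) xb; rewrite ltxx.
      by apply: cvgB; exact: cvg_ramp.
    - apply/measurable_EFinP; apply: measurable_funM => //.
      have mi : measurable_fun setT (\1_`]a, b]%classic : R -> R) by exact: measurable_indic.
      exact: (measurableT_comp mi mX).
  apply: (cvg_unique _ (cvi _ _ _ _ _ mZ1 mX1 Z10 Z1oo)) => //.
  have := cvi _ _ _ _ _ mZ2 mX2 Z20 Z2oo.
  apply: cvg_trans; apply: near_eq_cvg; apply: nearW => n.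
  apply/esym; apply: (cont (fun x => ramp b n x - ramp a n x)).
    by move=> x; apply: cvgB; exact: continuous_ramp.
  move=> x; rewrite subr_ge0 le_ramp//= lerBlDr.
  by rewrite (le_trans (ramp_le1 _ _ _))// lerDl ramp_ge0.
move=> h mh h0.
transitivity (\int[m1]_x h x)%E.
  rewrite ge0_integral_pushforward// preimage_setT.
  rewrite (@ge0_integral_density _ _ _ P1 (wmeasure P1 mZ1 Z10) Z1)//.
  - exact: (measurableT_comp mh mX1).
  - by move=> x; exact: h0.
transitivity (\int[m2]_x h x)%E.
  by apply: eq_measure_integral => A mA _; exact: m12.
rewrite ge0_integral_pushforward// preimage_setT.
rewrite (@ge0_integral_density _ _ _ P2 (wmeasure P2 mZ2 Z20) Z2)//.
- exact: (measurableT_comp mh mX2).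
- by move=> x; exact: h0.
Qed.

(** Frequency and phase [0] give equal masses; adding them to both sides turns the cosine into the
    nonnegative [1 + cos]. *)
Lemma fourier_unique :
  (forall a e, \int[P1]_w (Z1 w * cos (a * X1 w + e)) =
               \int[P2]_w (Z2 w * cos (a * X2 w + e))) ->
  forall h : R -> \bar R, measurable_fun setT h -> (forall x, 0 <= h x)%E ->
  (\int[P1]_w (h (X1 w) * (Z1 w)%:E) = \int[P2]_w (h (X2 w) * (Z2 w)%:E))%E.
Proof.
move=> H; apply: fourier_unique_ge0 => a e.
have iZ d (T : measurableType d) (P : probability T R) (Z X : T -> R) :
    measurable_fun setT Z -> measurable_fun setT X -> (forall w, 0 <= Z w) ->
    (\int[P]_w (Z w)%:E < +oo)%E ->
    (\int[P]_w (Z w * (1 + cos (a * X w + e)))%:E =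
      (\int[P]_w Z w + \int[P]_w (Z w * cos (a * X w + e)))%:E)%E.
  move=> mZ mX Z0 Zoo.
  have iZ : P.-integrable setT (EFin \o Z).
    apply/integrableP; split; first exact/measurable_EFinP.
    by under eq_integral do rewrite /= ger0_norm//.
  have iZc : P.-integrable setT (fun w => (Z w * cos (a * X w + e))%:E).
    apply: le_integrable iZ => //.
      apply/measurable_EFinP; apply: measurable_funM => //.
      exact: (measurableT_comp (continuous_measurable_fun (@continuous_cos_affine _ a e)) mX).
    move=> w _; rewrite !abse_EFin lee_fin normrM (ger0_norm (Z0 w)).
    by rewrite ler_piMr// cos_max.
  under eq_integral do rewrite mulrDr mulr1 EFinD.
  by rewrite integralD// EFinD; congr (_ + _)%E; rewrite /Rintegral fineK//; exact: integrable_fin_num.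
rewrite !iZ// H; congr (_ + _)%:E.
by have := H 0 0; under eq_Rintegral do rewrite mul0r add0r cos0 mulr1;
  move=> ->; apply: eq_Rintegral => w _; rewrite mul0r add0r cos0 mulr1.
Qed.

End two_sides.
End fourier_uniqueness.

(** * Markov property of bridge and Brownian motion *)

Section markov_product.
Local Open Scope ring_scope.
Context (R : realType) d (T : measurableType d) (P : probability T R).
Notation mu := (@lebesgue_measure R).
Notation N01 := (normal_pdf (0:R) 1).

Definition bounded_measurable (f : T -> R) :=
  measurable_fun setT f /\ exists C, forall w, `|f w| <= C.

Lemma bounded_measurable_integrable f : bounded_measurable f ->
  P.-integrable setT (EFin \o f).
Proof. by move=> [mf [C fC]]; exact: integrable_bounded fC. Qed.

Lemma bounded_measurableD f g : bounded_measurable f -> bounded_measurable g ->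
  bounded_measurable (fun w => f w + g w).
Proof.
move=> [mf [C fC]] [mg [D gD]]; split; first exact: measurable_funD.
by exists (C + D) => w; rewrite (le_trans (ler_normD _ _))// lerD.
Qed.

Lemma bounded_measurableM f g : bounded_measurable f -> bounded_measurable g ->
  bounded_measurable (fun w => f w * g w).
Proof.
move=> [mf [C fC]] [mg [D gD]]; split; first exact: measurable_funM.
by exists (C * D) => w; rewrite normrM ler_pM.
Qed.

Lemma bounded_measurable_cst (c : R) : bounded_measurable (fun=> c).
Proof. by split => //; exists `|c|. Qed.

Lemma bounded_measurable_cos f : measurable_fun setT f ->
  bounded_measurable (fun w => cos (f w)).
Proof.
move=> mf; split; last by exists 1 => w; exact: cos_max.
by apply: (measurableT_comp (continuous_measurable_fun (@continuous_cos R)) mf).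
Qed.

Lemma expectationD f g : bounded_measurable f -> bounded_measurable g ->
  \int[P]_w (f w + g w) = \int[P]_w f w + \int[P]_w g w.
Proof. by move=> bf bg; rewrite RintegralD//; exact: bounded_measurable_integrable. Qed.

Lemma expectationZ (c : R) f : bounded_measurable f ->
  \int[P]_w (c * f w) = c * \int[P]_w f w.
Proof. by move=> bf; rewrite RintegralZl//; exact: bounded_measurable_integrable. Qed.

Context (X : R -> T -> R) (mX : forall t, measurable_fun setT (X t)).

Definition bounded_nonneg (h : R -> R) :=
  measurable_fun setT h /\ exists C, forall x, 0 <= h x <= C.

Definition cylinder (l : seq (R * (R -> R))) (w : T) := \prod_(p <- l) p.2 (X p.1 w).

Fixpoint cylinder_in (S : set R) (l : seq (R * (R -> R))) :=
  if l is p :: l' then [/\ S p.1, bounded_nonneg p.2 & cylinder_in S l'] else True.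

Lemma cylinder_cons p l w : cylinder (p :: l) w = p.2 (X p.1 w) * cylinder l w.
Proof. by rewrite /cylinder big_cons. Qed.

Lemma cylinder_nil w : cylinder [::] w = 1.
Proof. by rewrite /cylinder big_nil. Qed.

Lemma cylinder_bounded S l : cylinder_in S l ->
  bounded_measurable (cylinder l) /\ forall w, 0 <= cylinder l w.
Proof.
elim: l => [_|[t h] l IH /= [_ [mh [C hC]] /IH[bl l0]]].
  rewrite (_ : cylinder [::] = fun=> 1); last by apply/funext => w; rewrite cylinder_nil.
  by split => //; exact: bounded_measurable_cst.
rewrite (_ : cylinder _ = fun w => h (X t w) * cylinder l w); last first.
  by apply/funext => w; rewrite cylinder_cons.
split=> [|w]; last by rewrite mulr_ge0//; case/andP: (hC (X t w)).
apply: bounded_measurableM => //; split; first exact: measurableT_comp.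
by exists C => w; case/andP: (hC (X t w)) => h0 hc; rewrite ger0_norm.
Qed.

Definition lincomb (l : seq (R * R)) (w : T) := \sum_(p <- l) p.2 * X p.1 w.

Lemma lincomb_cons p l w : lincomb (p :: l) w = p.2 * X p.1 w + lincomb l w.
Proof. by rewrite /lincomb big_cons. Qed.

Lemma measurable_lincomb l : measurable_fun setT (lincomb l).
Proof. by apply: measurable_sum => p; exact: measurable_funM. Qed.

Context (S : set R) (D : T -> R) (mD : measurable_fun setT D) (v : R) (v0 : 0 <= v).
Hypothesis fourier_increment : forall l a e, {in l, forall p, S p.1} ->
  \int[P]_w cos (lincomb l w + a * D w + e) =
  expR (- a ^+ 2 * v / 2) * \int[P]_w cos (lincomb l w + e).

(** Induction on the test functions in [l1]. If the next test function of [X u] were a cosine, the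
    product formula would merge it into the cosine of the linear combination, changing only [l2] and
    [e]. So the induction hypothesis says that the weights [Z1] and [Z2] have the same Fourier
    transform along [X u], and [fourier_unique] replaces the cosine by [h]. *)
Lemma fourier_increment_cylinder l1 l2 a e : cylinder_in S l1 ->
  {in l2, forall p, S p.1} ->
  \int[P]_w (cylinder l1 w * cos (lincomb l2 w + a * D w + e)) =
  expR (- a ^+ 2 * v / 2) * \int[P]_w (cylinder l1 w * cos (lincomb l2 w + e)).
Proof.
set k := expR _.
have k01 : 0 <= k <= 1.
  by rewrite expR_ge0/= -[leRHS]expR0 ler_expR !mulNr oppr_le0 divr_ge0// mulr_ge0// sqr_ge0.
elim: l1 l2 e => [|[u h] l1 IH] l2 e /=.
  move=> _ l2S; under eq_Rintegral do rewrite cylinder_nil mul1r.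
  by rewrite fourier_increment//; under [in RHS]eq_Rintegral do rewrite cylinder_nil mul1r.
move=> [Su [mh [C hC]] l1S] l2S.
have [bl l0] := cylinder_bounded l1S.
have ml2 := measurable_lincomb l2.
have mlD b : measurable_fun setT (fun w => lincomb l2 w + b * D w + e).
  by apply: measurable_funD => //; apply: measurable_funD => //; exact: measurable_funM.
have mle : measurable_fun setT (fun w => lincomb l2 w + e) by exact: measurable_funD.
have bc1 := bounded_measurable_cos (mlD a).
have bc2 := bounded_measurable_cos mle.
have bX r e' : bounded_measurable (fun w => cos (r * X u w + e')).
  by apply: bounded_measurable_cos; apply: measurable_funD => //; exact: measurable_funM.
(* Both weights are nonnegative, the second one because [k] lies between [0] and [1]. *)
pose Z1 w := cylinder l1 w * (1 + cos (lincomb l2 w + a * D w + e)).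
pose Z2 w := cylinder l1 w * (1 + k * cos (lincomb l2 w + e)).
have bZ1 : bounded_measurable Z1.
  apply: bounded_measurableM => //; apply: bounded_measurableD => //.
  exact: bounded_measurable_cst.
have bZ2 : bounded_measurable Z2.
  apply: bounded_measurableM => //; apply: bounded_measurableD => //.
    exact: bounded_measurable_cst.
  by apply: bounded_measurableM => //; exact: bounded_measurable_cst.
have Z10 w : 0 <= Z1 w by rewrite mulr_ge0// add1cos_ge0.
have Z20 w : 0 <= Z2 w.
  rewrite mulr_ge0//; case/andP: k01 => k0 k1.
  by have := cos_geN1 (lincomb l2 w + e); have := cos_le1 (lincomb l2 w + e); nra.
have Zoo Z : bounded_measurable Z -> (forall w, 0 <= Z w) -> (\int[P]_w (Z w)%:E < +oo)%E.
  move=> /bounded_measurable_integrable /integrableP[_]; under eq_integral do rewrite /=.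
  by move=> + Z0; under eq_integral do rewrite ger0_norm//.
have FU := @fourier_unique R _ T P Z1 (X u) bZ1.1 (mX u) Z10 (Zoo _ bZ1 Z10)
   _ T P Z2 (X u) bZ2.1 (mX u) Z20 (Zoo _ bZ2 Z20).
have cosM (x y : R) : cos x * cos y = 2^-1 * cos (x + y) + 2^-1 * cos (x - y).
  by rewrite cosD cosB; field.
have {}FU : (\int[P]_w ((h (X u w))%:E * (Z1 w)%:E) = \int[P]_w ((h (X u w))%:E * (Z2 w)%:E))%E.
  apply: (FU _ (fun x => (h x)%:E)) => [r e'||x]; last 2 first.
  - exact/measurable_EFinP.
  - by rewrite lee_fin; case/andP: (hC x).
  have bl' (l : seq (R * R)) b e'' : bounded_measurable
      (fun w => cylinder l1 w * cos (lincomb l w + b * D w + e'')).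
    apply: bounded_measurableM => //; apply: bounded_measurable_cos.
    apply: measurable_funD => //; apply: measurable_funD; first exact: measurable_lincomb.
    exact: measurable_funM.
  have bl'' (l : seq (R * R)) e'' : bounded_measurable
      (fun w => cylinder l1 w * cos (lincomb l w + e'')).
    apply: bounded_measurableM => //; apply: bounded_measurable_cos.
    by apply: measurable_funD => //; exact: measurable_lincomb.
  have c2 := bounded_measurable_cst (2^-1).
  have ck := bounded_measurable_cst (k * 2^-1).
  have bcX : bounded_measurable (fun w => cylinder l1 w * cos (r * X u w + e')).
    exact: bounded_measurableM.
  transitivity (\int[P]_w (cylinder l1 w * cos (r * X u w + e') +
      (2^-1 * (cylinder l1 w * cos (lincomb ((u, r) :: l2) w + a * D w + (e + e'))) +
       2^-1 * (cylinder l1 w * cos (lincomb ((u, - r) :: l2) w + a * D w + (e - e')))))).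
    apply: eq_Rintegral => w _; rewrite /Z1 mulrDr mulr1 mulrDl -mulrA cosM !lincomb_cons/=.
    by rewrite mulrDr; congr (_ + (_ + _)); rewrite mulrCA; congr (_ * (_ * cos _)); ring.
  rewrite expectationD//; last by apply: bounded_measurableD; exact: bounded_measurableM.
  rewrite expectationD//; [|exact: bounded_measurableM|exact: bounded_measurableM].
  rewrite !expectationZ// !IH//; last 2 first.
  - by move=> p; rewrite inE => /predU1P[->//|]; exact: l2S.
  - by move=> p; rewrite inE => /predU1P[->//|]; exact: l2S.
  rewrite [RHS](_ : _ = \int[P]_w (cylinder l1 w * cos (r * X u w + e') +
      (k * 2^-1 * (cylinder l1 w * cos (lincomb ((u, r) :: l2) w + (e + e'))) +
       k * 2^-1 * (cylinder l1 w * cos (lincomb ((u, - r) :: l2) w + (e - e')))))); last first.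
    apply: eq_Rintegral => w _; rewrite /Z2 !lincomb_cons/=.
    have -> : r * X u w + lincomb l2 w + (e + e') =
      (lincomb l2 w + e) + (r * X u w + e') by ring.
    have -> : - r * X u w + lincomb l2 w + (e - e') =
      (lincomb l2 w + e) - (r * X u w + e') by ring.
    have H := cosM (lincomb l2 w + e) (r * X u w + e').
    transitivity (cylinder l1 w * cos (r * X u w + e') +
      k * cylinder l1 w * (cos (lincomb l2 w + e) * cos (r * X u w + e'))); first by ring.
    by rewrite H; ring.
  rewrite expectationD//; last by apply: bounded_measurableD; exact: bounded_measurableM.
  rewrite expectationD//; [|exact: bounded_measurableM|exact: bounded_measurableM].
  by rewrite !expectationZ//; ring.
have bh : bounded_measurable (fun w => h (X u w)).
  split; first exact: measurableT_comp.
  by exists C => w; case/andP: (hC (X u w)) => h0 hc; rewrite ger0_norm.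
have bhl : bounded_measurable (fun w => h (X u w) * cylinder l1 w) by exact: bounded_measurableM.
have {}FU : \int[P]_w (h (X u w) * cylinder l1 w + h (X u w) * cylinder l1 w * cos (lincomb l2 w + a * D w + e)) =
    \int[P]_w (h (X u w) * cylinder l1 w + k * (h (X u w) * cylinder l1 w * cos (lincomb l2 w + e))).
  move/(congr1 fine): FU; rewrite /Rintegral => FU; apply: etrans (etrans FU _).
    by congr fine; apply: eq_integral => w _; rewrite -EFinM /Z1; congr EFin; ring.
  by congr fine; apply: eq_integral => w _; rewrite -EFinM /Z2; congr EFin; ring.
under eq_Rintegral do rewrite cylinder_cons/=.
under [in RHS]eq_Rintegral do rewrite cylinder_cons/=.
move: FU; rewrite expectationD//; last exact: bounded_measurableM.
rewrite expectationD//; last first.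
  by apply: bounded_measurableM; [exact: bounded_measurable_cst|exact: bounded_measurableM].
rewrite expectationZ//; last exact: bounded_measurableM.
by move/addrI.
Qed.

(** Under the weight [cylinder l], the variable [D] has the Fourier transform of a centred normal
    variable of variance [v]; Fourier uniqueness compares it with [Num.sqrt v * x] under the
    standard normal law, carrying the constant weight [c]. *)
Lemma increment_law l (h : R -> \bar R) : cylinder_in S l ->
  measurable_fun setT h -> (forall x, 0 <= h x)%E ->
  (\int[P]_w (h (D w) * (cylinder l w)%:E) =
   \int[P]_w (cylinder l w)%:E * \int[mu]_x (h (Num.sqrt v * x)%R * (N01 x)%:E))%E.
Proof.
move=> lS mh h0; have [bl l0] := cylinder_bounded lS.
have loo : (\int[P]_w (cylinder l w)%:E < +oo)%E.
  have /integrableP[_] := bounded_measurable_integrable bl.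
  by under eq_integral do rewrite /= ger0_norm//.
pose c := \int[P]_w cylinder l w.
have cE : (\int[P]_w (cylinder l w)%:E = c%:E)%E.
  by rewrite /c /Rintegral fineK// ge0_fin_numE//; apply: integral_ge0 => w _; rewrite lee_fin.
have c0 : 0 <= c by apply: Rintegral_ge0.
have ms : measurable_fun setT (fun x : R => Num.sqrt v * x) by exact: measurable_funM.
have mN := @measurable_normal_pdf01 R.
have mc (a e : R) : measurable_fun setT (fun x : R => cos (a * (Num.sqrt v * x) + e)).
  apply: (measurableT_comp (continuous_measurable_fun (@continuous_cos R))).
  by apply: measurable_funD => //; exact: measurable_funM.
have c1oo : (\int[normal_prob (0:R) 1]_w c%:E < +oo)%E.
  by rewrite (probability_integral_cst _ c%:E) ltry.
rewrite (@fourier_unique_ge0 R _ T P (cylinder l) D bl.1 mD l0 loo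
  _ _ (normal_prob (0:R) 1) (fun=> c) (fun x => Num.sqrt v * x) _ ms (fun=> c0) c1oo)//.
  rewrite (ge0_integral_normal_prob _ ltr01 (h := fun x => (h (Num.sqrt v * x)%R * c%:E)%E)).
  - under eq_integral do rewrite mul1r addr0 -muleA (muleC c%:E) muleA.
    rewrite ge0_integralZr//; first by rewrite cE muleC.
    + by apply: emeasurable_funM; [exact: (measurableT_comp mh)|exact/measurable_EFinP].
    + by move=> x _; rewrite mule_ge0// lee_fin normal_pdf_ge0.
  - by apply: emeasurable_funM => //; exact: (measurableT_comp mh).
  - by move=> x; rewrite mule_ge0// lee_fin.
move=> a e.
rewrite (ge0_integral_normal_prob _ ltr01 (h := fun x => (c * (1 + cos (a * (Num.sqrt v * x) + e)))%:E)); last 2 first.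
- by apply/measurable_EFinP; apply: measurable_funM => //; exact: measurable_funD.
- by move=> x; rewrite lee_fin mulr_ge0// add1cos_ge0.
have bc : bounded_measurable (fun w => cos (a * D w + e)).
  by apply: bounded_measurable_cos; apply: measurable_funD => //; exact: measurable_funM.
have ET (f : T -> R) : bounded_measurable f -> (\int[P]_w (f w)%:E = (\int[P]_w f w)%:E)%E.
  by move=> bf; rewrite /Rintegral fineK//; apply: integrable_fin_num => //; exact: bounded_measurable_integrable.
rewrite ET; last first.
  by apply: bounded_measurableM => //; apply: bounded_measurableD => //; exact: bounded_measurable_cst.
have -> : \int[P]_w (cylinder l w * (1 + cos (a * D w + e))) = c + expR (- a ^+ 2 * v / 2) * (c * cos e).
  under eq_Rintegral do rewrite mulrDr mulr1.
  rewrite expectationD//; last exact: bounded_measurableM.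
  congr (_ + _).
  have := @fourier_increment_cylinder l [::] a e lS.
  under eq_Rintegral do rewrite /lincomb big_nil add0r.
  move=> -> //; congr (_ * _).
  under eq_Rintegral do rewrite /lincomb big_nil add0r mulrC.
  by rewrite expectationZ// mulrC.
have iN := @integrable_normal_pdf R 0 1.
have icN : mu.-integrable setT (fun x => (cos ((a * Num.sqrt v) * x + e) * N01 x)%:E).
  apply: (@integrable_bounded_mul _ _ _ 1) => //.
  - exact: continuous_measurable_fun (@continuous_cos_affine _ _ _).
  - by move=> y; exact: cos_max.
  - by under eq_fun do rewrite ger0_norm ?normal_pdf_ge0//; exact: iN.
under eq_integral.
  move=> x _; rewrite -EFinM mul1r addr0 -mulrA mulrDl mul1r mulrA.
  rewrite EFinM EFinD; over.
rewrite integralZl//; last exact: integrableD.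
rewrite integralD// integral_normal_pdf.
rewrite -[X in (_ + X)%E]fineK; last exact: integrable_fin_num.
rewrite -/(Rintegral _ _ _) fourier_normal_pdf01 -EFinD -EFinM; congr EFin.
by rewrite exprMn sqr_sqrtr// mulNr; ring.
Qed.

(** This is independence of [D] from the past in integrated form. When [Phi] is the indicator of a
    rectangle, the indicator at time [s] joins the cylinder and [increment_law] applies. Both sides
    are integrals against measures on the plane, and rectangles determine these. *)
Lemma markov_cylinder l s (Phi : R -> R -> \bar R) : cylinder_in S l -> S s ->
  measurable_fun setT (fun p : R * R => Phi p.1 p.2) -> (forall x y, 0 <= Phi x y)%E ->
  (\int[P]_w (Phi (X s w) (D w) * (cylinder l w)%:E) =
   \int[P]_w (\int[mu]_x (Phi (X s w) (Num.sqrt v * x)%R * (N01 x)%:E) * (cylinder l w)%:E))%E.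
Proof.
move=> lS Ss mPhi Phi0; have [bl l0] := cylinder_bounded lS.
have loo : (\int[P]_w (cylinder l w)%:E < +oo)%E.
  have /integrableP[_] := bounded_measurable_integrable bl.
  by under eq_integral do rewrite /= ger0_norm//.
have mN := @measurable_normal_pdf01 R.
pose N := (normal_prob (0:R) 1).
have ml1 : measurable_fun setT (fun p : T * measurableTypeR R => cylinder l p.1).
  exact: (measurableT_comp bl.1 measurable_fst).
have l10 (p : T * measurableTypeR R) : 0 <= cylinder l p.1 by [].
pose f1 w : (R * R)%type := (X s w, D w).
pose f2 (p : T * measurableTypeR R) : (R * R)%type :=
  (X s p.1, Num.sqrt v * p.2).
have mf1 : measurable_fun setT f1 by exact: measurable_fun_pair.
have mf2 : measurable_fun setT f2.
  apply: measurable_fun_pair; first exact: (measurableT_comp (mX s) measurable_fst).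
  by apply: measurable_funM => //; exact: measurable_snd.
pose m1 := pushforward (wmeasure P bl.1 l0) f1.
pose m2 := pushforward (wmeasure (P \x N)%E ml1 l10) f2.
have E1 (Psi : R -> R -> \bar R) : measurable_fun setT (fun p : R * R => Psi p.1 p.2) ->
    (forall x y, 0 <= Psi x y)%E ->
    (\int[m1]_p Psi p.1 p.2 = \int[P]_w (Psi (X s w) (D w) * (cylinder l w)%:E))%E.
  move=> mPsi Psi0; rewrite ge0_integral_pushforward// preimage_setT.
  rewrite (@ge0_integral_density _ _ _ P (wmeasure P bl.1 l0) (cylinder l))//.
  - exact: bl.1.
  - exact: (measurableT_comp mPsi mf1).
  - by move=> w; exact: Psi0.
have E2 (Psi : R -> R -> \bar R) : measurable_fun setT (fun p : R * R => Psi p.1 p.2) ->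
    (forall x y, 0 <= Psi x y)%E ->
    (\int[m2]_p Psi p.1 p.2 =
     \int[P]_w (\int[mu]_x (Psi (X s w) (Num.sqrt v * x)%R * (N01 x)%:E) * (cylinder l w)%:E))%E.
  move=> mPsi Psi0; rewrite ge0_integral_pushforward// preimage_setT.
  rewrite (@ge0_integral_density _ _ _ (P \x N)%E (wmeasure (P \x N)%E ml1 l10) (fun p => cylinder l p.1))//; last 2 first.
  - exact: (measurableT_comp mPsi mf2).
  - by move=> w; exact: Psi0.
  rewrite fubini_tonelli1//=; last 2 first.
  - apply: emeasurable_funM; last exact/measurable_EFinP.
    exact: (measurableT_comp mPsi mf2).
  - by move=> p; rewrite mule_ge0 ?lee_fin// Psi0.
  have mPw w : measurable_fun setT (fun y : R => Psi (X s w) (Num.sqrt v * y)).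
    apply: (@measurableT_comp _ _ _ _ _ _ (Psi (X s w))); last exact: measurable_funM.
    exact: (measurable_fun_section2 mPsi).
  apply: eq_integral => w _; rewrite /fubini_F.
  rewrite (ge0_integral_normal_prob _ ltr01 (h := fun y => (Psi (X s w) (Num.sqrt v * y)%R * (cylinder l w)%:E)%E)).
  - under eq_integral do rewrite mul1r addr0 -muleA (muleC (cylinder l w)%:E) muleA.
    rewrite ge0_integralZr//.
    + by apply: emeasurable_funM; [exact: mPw|exact/measurable_EFinP].
    + by move=> x _; rewrite mule_ge0 ?lee_fin ?normal_pdf_ge0// Psi0.
    + by rewrite lee_fin.
  - by apply: emeasurable_funM; [exact: mPw|exact/measurable_EFinP].
  - by move=> x; rewrite mule_ge0 ?lee_fin// Psi0.
have indX (A C : set R) (p : R * R) : \1_(A `*` C) p = \1_A p.1 * \1_C p.2 :> R.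
  by rewrite !indicE in_setX; case: (_ \in A); case: (_ \in C); rewrite /= ?mulr1 ?mulr0 ?mul0r.
have mind (A C : set R) : measurable A -> measurable C ->
    measurable_fun setT (fun p : R * R => (\1_A p.1 * \1_C p.2)%:E : \bar R).
  move=> mA mC.
  have mA1 : measurable_fun setT (\1_A : R -> R) by exact: measurable_indic.
  have mC1 : measurable_fun setT (\1_C : R -> R) by exact: measurable_indic.
  apply/measurable_EFinP; apply: measurable_funM.
    exact: (measurableT_comp mA1 measurable_fst).
  exact: (measurableT_comp mC1 measurable_snd).
have m12 C : measurable C -> m1 C = m2 C.
  apply: eq_measure_rectangles => [|A B mA mB].
    suff: (m1 setT < +oo)%E by [].
    rewrite -[X in (X < _)%E]mul1e -[X in (X < _)%E](integral_cst _ measurableT 1%E).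
    rewrite (E1 (fun _ _ => 1%E))//.
    by under eq_integral do rewrite mul1e.
  suff: m1 (A `*` B) = m2 (A `*` B) by [].
  have mAB : measurable (A `*` B) by exact: measurableX.
  transitivity (\int[m1]_p (\1_A p.1 * \1_B p.2)%:E)%E.
    by under eq_integral do rewrite -indX; rewrite integral_indic// setIT.
  transitivity (\int[m2]_p (\1_A p.1 * \1_B p.2)%:E)%E; last first.
    by under eq_integral do rewrite -indX; rewrite integral_indic// setIT.
  rewrite (E1 (fun x y => (\1_A x * \1_B y)%:E))//; last exact: mind.
  rewrite (E2 (fun x y => (\1_A x * \1_B y)%:E))//; last exact: mind.
  have lS' : cylinder_in S ((s, \1_A) :: l).
    split => //=; split; first exact: measurable_indic.
    by exists 1 => x; rewrite indicE; case: (_ \in _); rewrite /= ?lexx ?ler01.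
  have mB1 : measurable_fun setT (\1_B : R -> R) by exact: measurable_indic.
  have mA1 : measurable_fun setT (\1_A : R -> R) by exact: measurable_indic.
  have := @increment_law _ (EFin \o \1_B) lS'.
  move=> /(_ _ _)/wrap[]; first exact/measurable_EFinP.
    by move=> x; rewrite lee_fin.
  under eq_integral do rewrite cylinder_cons/=.
  move=> E; transitivity (\int[P]_x ((\1_B (D x))%:E * (\1_A (X s x) * cylinder l x)%:E))%E.
    by apply: eq_integral => w _; rewrite -!EFinM; congr EFin; ring.
  rewrite E; under eq_integral do rewrite cylinder_cons/=.
  rewrite -ge0_integralZr//; last 3 first.
  - by apply/measurable_EFinP; apply: measurable_funM; [exact: measurableT_comp|exact: bl.1].
  - by move=> w _; rewrite lee_fin mulr_ge0.
  - by apply: integral_ge0 => x _; rewrite mule_ge0 ?lee_fin ?normal_pdf_ge0.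
  apply: eq_integral => w _.
  under [in RHS]eq_integral do rewrite EFinM -muleA.
  rewrite [in RHS]ge0_integralZl//.
  - by rewrite EFinM muleAC.
  - by apply: emeasurable_funM; apply/measurable_EFinP => //; apply: (measurableT_comp mB1); exact: measurable_funM.
  - by move=> x _; rewrite mule_ge0 ?lee_fin ?normal_pdf_ge0.
rewrite -E1// -E2//; apply: eq_measure_integral => A mA _; exact: m12.
Qed.

End markov_product.

(** * Increments of the rescaled bridge *)

Section bridge_increment.
Local Open Scope ring_scope.
Context (R : realType) d (T : measurableType d) (P : probability T R).

Lemma integrable_prod (f g : T -> R) : measurable_fun setT f -> measurable_fun setT g ->
  P.-integrable setT (fun w => ((f w) ^+ 2)%:E) ->
  P.-integrable setT (fun w => ((g w) ^+ 2)%:E) ->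
  P.-integrable setT (fun w => (f w * g w)%:E).
Proof.
move=> mf mg f2 g2; apply: le_integrable (integrableD measurableT f2 g2) => //.
  by apply/measurable_EFinP; exact: measurable_funM.
move=> w _; rewrite -EFinD !abse_EFin lee_fin [leRHS]ger0_norm ?addr_ge0 ?sqr_ge0//.
rewrite normrM -[(f w) ^+ 2]real_normK ?num_real// -[(g w) ^+ 2]real_normK ?num_real//.
by have := sqr_ge0 (`|f w| - `|g w|); have := normr_ge0 (f w); have := normr_ge0 (g w); nra.
Qed.

Context (b : R -> {RV P >-> R}) (hb : is_brownian_bridge b).
Notation X := (fun t : R => b t : T -> R).

Let mX t : measurable_fun setT (X t) := measurable_funPT (b t).

Lemma bridge_lincomb_gaussian (l : seq (R * R)) : {in l, forall p, 0 <= p.1 <= 1} ->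
  is_gaussian P (lincomb X l).
Proof.
move=> l01; pose t (i : 'I_(size l)) := (tnth (in_tuple l) i).1.
pose a (i : 'I_(size l)) := (tnth (in_tuple l) i).2.
have := @bridge_gaussian _ _ _ _ _ hb (size l) t a.
have -> : (fun w : T => \sum_(i < size l) a i * b (t i) w) = lincomb X l.
  by apply/funext => w; rewrite /lincomb [RHS]big_tnth.
by apply => i; rewrite /= in_itv/=; apply: l01; exact: mem_tnth.
Qed.

Let single t : lincomb X [:: (t, 1)] = b t.
Proof. by apply/funext => w; rewrite lincomb_cons /lincomb big_nil mul1r addr0. Qed.

Lemma bridge_sqr_integrable (t : R) : 0 <= t <= 1 ->
  P.-integrable setT (fun w => ((b t w) ^+ 2)%:E).
Proof.
move=> t01; have := @bridge_lincomb_gaussian [:: (t, 1)].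
rewrite single => /(_ _)/wrap[]; first by move=> p; rewrite inE => /eqP ->.
by move=> /gaussian_cos[]//; exact: bridge_mean.
Qed.

Lemma bridge_integrable (t : R) : 0 <= t <= 1 -> P.-integrable setT (EFin \o b t).
Proof.
move=> t01; have h2 := bridge_sqr_integrable t01.
have i1 := bounded_measurable_integrable P (bounded_measurable_cst _ 1).
apply: le_integrable (integrableD measurableT i1 h2) => //.
  exact/measurable_EFinP.
move=> w _; rewrite -EFinD !abse_EFin lee_fin [leRHS]ger0_norm ?addr_ge0 ?sqr_ge0//.
by have := sqr_ge0 (`|b t w| - 1); rewrite -[(b t w) ^+ 2]real_normK ?num_real//; nra.
Qed.

Lemma bridge_covE (s t : R) : 0 <= s <= 1 -> 0 <= t <= 1 ->
  \int[P]_w (b s w * b t w) = Num.min s t - s * t.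
Proof.
move=> s01 t01; have := bridge_cov hb s01 t01.
rewrite covariance.unlock (bridge_mean hb s01) (bridge_mean hb t01) expectation.unlock/= => E.
rewrite /Rintegral -[RHS]/(fine (Num.min s t - s * t)%:E) -E; congr fine.
by apply: eq_integral => w _; congr EFin; rewrite -[RHS]/((b s w - 0) * (b t w - 0)) !subr0.
Qed.

Lemma lincomb_mean (l : seq (R * R)) : {in l, forall p, 0 <= p.1 <= 1} ->
  P.-integrable setT (EFin \o lincomb X l) /\ 'E_P[lincomb X l] = 0%E.
Proof.
elim: l => [_|[t a] l IH l01].
  rewrite (_ : lincomb X [::] = cst 0); last by apply/funext => w; rewrite /lincomb big_nil.
  split; last by rewrite expectation.unlock integral0.
  exact: (bounded_measurable_integrable P (bounded_measurable_cst _ 0)).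
have [|il El] := IH; first by move=> p pl; apply: l01; rewrite inE pl orbT.
have t01 : 0 <= t <= 1 by apply: (l01 (t, a)); rewrite inE eqxx.
have it := bridge_integrable t01.
have E : EFin \o lincomb X ((t, a) :: l) =
    (fun w => a%:E * (b t w)%:E + (lincomb X l w)%:E)%E.
  by apply/funext => w; rewrite /= lincomb_cons.
split; first by rewrite E; apply: integrableD => //; exact: integrableZl.
move: El; rewrite expectation.unlock => El.
transitivity (\int[P]_w (a%:E * (b t w)%:E + (lincomb X l w)%:E))%E.
  by apply: eq_integral => w _; rewrite lincomb_cons.
rewrite integralD//; last exact: integrableZl.
rewrite integralZl//; have := bridge_mean hb t01; rewrite expectation.unlock => ->.
by rewrite mule0 add0e.
Qed.

Lemma bridge_lincomb_cos (l : seq (R * R)) : {in l, forall p, 0 <= p.1 <= 1} ->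
  P.-integrable setT (fun w => ((lincomb X l w) ^+ 2)%:E) /\
  forall e, \int[P]_w cos (lincomb X l w + e) =
    cos e * expR (- (\int[P]_w (lincomb X l w) ^+ 2) / 2).
Proof.
move=> l01; apply: gaussian_cos.
- exact: measurable_lincomb.
- exact: bridge_lincomb_gaussian.
- by case: (lincomb_mean l01).
Qed.

Section increment.
Variables (s t : R).
Hypotheses (s0 : 0 <= s) (st : s < t) (t1 : t < 1).

(** The process [b t / (1 - t)] is a Brownian motion run with the clock [t / (1 - t)], so its
    increments, unlike those of [b], are independent of the past. *)
Definition bridge_increment w := (1 - t)^-1 * b t w - (1 - s)^-1 * b s w.
Definition bridge_variance := t / (1 - t) - s / (1 - s).

Let t01 : 0 <= t <= 1. Proof. by rewrite (ltW t1) (le_trans s0 (ltW st)). Qed.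
Let s01 : 0 <= s <= 1. Proof. by rewrite s0 (ltW (lt_trans st t1)). Qed.

Let bridge_incrementE : bridge_increment = lincomb X [:: (t, (1 - t)^-1); (s, - (1 - s)^-1)].
Proof.
apply/funext => w; rewrite !lincomb_cons /lincomb big_nil addr0/=.
by rewrite /bridge_increment mulNr.
Qed.

Lemma measurable_bridge_increment : measurable_fun setT bridge_increment.
Proof. by rewrite bridge_incrementE; exact: measurable_lincomb. Qed.

Let in_ts (u v : R) : {in [:: (t, u); (s, v)], forall p, 0 <= p.1 <= 1}.
Proof. by move=> p; rewrite !inE => /orP[]/eqP ->. Qed.

Let incr_sqr : P.-integrable setT (fun w => ((bridge_increment w) ^+ 2)%:E).
Proof. by rewrite bridge_incrementE; have [] := bridge_lincomb_cos (@in_ts (1 - t)^-1 (- (1 - s)^-1)). Qed.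

Let ibb (u v : R) : 0 <= u <= 1 -> 0 <= v <= 1 -> P.-integrable setT (EFin \o (fun w => b u w * b v w)).
Proof. by move=> u01 v01; apply: integrable_prod => //; exact: bridge_sqr_integrable. Qed.

(** The covariance of [b r] with [b t / (1 - t)] is [r] for every [t >= r], so the two terms
    cancel. *)
Lemma bridge_increment_orthogonal (r : R) : 0 <= r <= s -> \int[P]_w (b r w * bridge_increment w) = 0.
Proof.
move=> /andP[r0 rs].
have r01 : 0 <= r <= 1 by rewrite r0 (le_trans rs)//; case/andP: s01.
have -> : (fun w => b r w * bridge_increment w) =
   (fun w => (1 - t)^-1 * (b r w * b t w) - (1 - s)^-1 * (b r w * b s w)).
  by apply/funext => w; rewrite /bridge_increment; ring.
rewrite RintegralB//; last 2 first.
- exact: (integrableZl measurableT _ (ibb r01 t01)).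
- exact: (integrableZl measurableT _ (ibb r01 s01)).
rewrite !RintegralZl//; [|exact: ibb|exact: ibb].
rewrite !bridge_covE// !min_l// ?(le_trans rs (ltW st))//.
by field; rewrite !subr_eq0 !gt_eqF//= (lt_trans st).
Qed.

Lemma bridge_increment_sqr : \int[P]_w (bridge_increment w) ^+ 2 = bridge_variance.
Proof.
have i1 : P.-integrable setT (EFin \o (fun w => b t w * bridge_increment w)).
  by apply: integrable_prod; [exact: mX|exact: measurable_bridge_increment|exact: bridge_sqr_integrable|exact: incr_sqr].
have i2 : P.-integrable setT (EFin \o (fun w => b s w * bridge_increment w)).
  by apply: integrable_prod; [exact: mX|exact: measurable_bridge_increment|exact: bridge_sqr_integrable|exact: incr_sqr].
have -> : (fun w => bridge_increment w ^+ 2) =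
   (fun w => (1 - t)^-1 * (b t w * bridge_increment w) - (1 - s)^-1 * (b s w * bridge_increment w)).
  by apply/funext => w; rewrite /bridge_increment; ring.
rewrite RintegralB//; last 2 first.
- exact: (integrableZl measurableT _ i1).
- exact: (integrableZl measurableT _ i2).
rewrite !RintegralZl// (@bridge_increment_orthogonal s) ?s0 ?lexx// mulr0 subr0.
have -> : (fun w => b t w * bridge_increment w) =
   (fun w => (1 - t)^-1 * (b t w * b t w) - (1 - s)^-1 * (b t w * b s w)).
  by apply/funext => w; rewrite /bridge_increment; ring.
rewrite RintegralB//; last 2 first.
- exact: (integrableZl measurableT _ (ibb t01 t01)).
- exact: (integrableZl measurableT _ (ibb t01 s01)).
rewrite !RintegralZl//; [|exact: ibb|exact: ibb].
rewrite !bridge_covE// minxx (min_r (ltW st)) /bridge_variance.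
by field; rewrite !subr_eq0 !gt_eqF//= (lt_trans st).
Qed.

(** The linear combination and the increment are jointly Gaussian and uncorrelated, so their
    variances add and the exponential factor splits off. *)
Lemma bridge_fourier_increment (l : seq (R * R)) a e : {in l, forall p, [set r | 0 <= r <= s] p.1} ->
  \int[P]_w cos (lincomb X l w + a * bridge_increment w + e) =
  expR (- a ^+ 2 * bridge_variance / 2) * \int[P]_w cos (lincomb X l w + e).
Proof.
move=> ls.
have l01 : {in l, forall p, 0 <= p.1 <= 1}.
  move=> p /ls/= /andP[-> ps]; rewrite (le_trans ps)//; by case/andP: s01.
pose l' := (t, a * (1 - t)^-1) :: (s, - (a * (1 - s)^-1)) :: l.
have l'01 : {in l', forall p, 0 <= p.1 <= 1}.
  by move=> p; rewrite !inE => /or3P[/eqP ->//|/eqP ->//|]; exact: l01.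
have [l'2 l'c] := bridge_lincomb_cos l'01.
have [l2 lc] := bridge_lincomb_cos l01.
have l'E w : lincomb X l' w = lincomb X l w + a * bridge_increment w.
  by rewrite !lincomb_cons/= /bridge_increment; ring.
have ml := measurable_lincomb mX.
under eq_Rintegral do rewrite -l'E.
rewrite l'c lc mulrCA; congr (_ * _); rewrite -expRD; congr expR.
suff -> : \int[P]_w lincomb X l' w ^+ 2 = \int[P]_w lincomb X l w ^+ 2 + a ^+ 2 * bridge_variance.
  by ring.
have orth : \int[P]_w (lincomb X l w * bridge_increment w) = 0.
  elim: {l' l'01 l'2 l'c l'E l2 lc} l ls l01 => [|[r c] l IH] ls l01.
    under eq_Rintegral do rewrite /lincomb big_nil mul0r.
    by rewrite /Rintegral integral0.
  under eq_Rintegral do rewrite lincomb_cons/= mulrDl -mulrA.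
  have l01' : {in l, forall p, 0 <= p.1 <= 1} by move=> p pl; apply: l01; rewrite inE pl orbT.
  have r0s : 0 <= r <= s by have := ls (r, c); apply; rewrite inE eqxx.
  have r01 : 0 <= r <= 1 by have := l01 (r, c); apply; rewrite inE eqxx.
  have ir : P.-integrable setT (EFin \o (fun w => b r w * bridge_increment w)).
    by apply: integrable_prod; [exact: mX|exact: measurable_bridge_increment|exact: bridge_sqr_integrable|exact: incr_sqr].
  have [l2 _] := bridge_lincomb_cos l01'.
  rewrite RintegralD//; last 2 first.
  - exact: (integrableZl measurableT _ ir).
  - by apply: integrable_prod => //; exact: measurable_bridge_increment.
  rewrite RintegralZl// bridge_increment_orthogonal// mulr0 add0r IH//.
  by move=> p pl; apply: ls; rewrite inE pl orbT.
have ilD : P.-integrable setT (EFin \o (fun w => lincomb X l w * bridge_increment w)).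
  by apply: integrable_prod => //; exact: measurable_bridge_increment.
have -> : (fun w => lincomb X l' w ^+ 2) = (fun w => lincomb X l w ^+ 2 +
    (2 * a * (lincomb X l w * bridge_increment w) + a ^+ 2 * bridge_increment w ^+ 2)).
  by apply/funext => w; rewrite l'E; ring.
have i2 := integrableZl measurableT (2 * a) ilD.
have i3 := integrableZl measurableT (a ^+ 2) incr_sqr.
rewrite RintegralD//; last exact: (integrableD measurableT i2 i3).
rewrite RintegralD// !RintegralZl// orth mulr0 add0r.
by rewrite bridge_increment_sqr.
Qed.

End increment.
End bridge_increment.

(** * Independence and the increments of Brownian motion *)

Section independence.
Context d (T : measurableType d) (R : realType) (P : probability T R).

Section pair.
Context d1 (T1 : measurableType d1) d2 (T2 : measurableType d2).
Variables (Y : T -> T1) (Z : T -> T2).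
Hypotheses (mY : measurable_fun setT Y) (mZ : measurable_fun setT Z).
Let mixY := isMeasurableFun.Build _ _ _ _ _ mY.
Let packY : {mfun T >-> T1} := HB.pack Y mixY.
Let mixZ := isMeasurableFun.Build _ _ _ _ _ mZ.
Let packZ : {mfun T >-> T2} := HB.pack Z mixZ.

Lemma indep_var_integral (Phi : T1 -> T2 -> \bar R) : indep_var P Y Z ->
  measurable_fun setT (fun p : T1 * T2 => Phi p.1 p.2) -> (forall x y, 0 <= Phi x y) ->
  \int[P]_w Phi (Y w) (Z w) = \int[P]_w \int[P]_w' Phi (Y w) (Z w').
Proof.
move=> ind mPhi Phi0.
pose f w := (Y w, Z w).
have mf : measurable_fun setT f by exact: measurable_fun_pair.
transitivity (\int[pushforward P f]_p Phi p.1 p.2).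
  by rewrite ge0_integral_pushforward// preimage_setT.
transitivity (\int[distribution P packY \x distribution P packZ]_p Phi p.1 p.2).
  apply: eq_measure_integral => A mA _; apply/esym.
  by apply: product_measure_unique.
rewrite fubini_tonelli1//.
rewrite ge0_integral_distribution//.
- apply: eq_integral => w _ /=; rewrite /fubini_F ge0_integral_distribution//.
  exact: (measurable_fun_section2 mPhi).
- apply: (@measurable_fun_fubini_tonelli_F _ _ _ _ _ (distribution P packZ) (fun p => Phi p.1 p.2)) => //.
- by move=> x; apply: integral_ge0 => y _; exact: Phi0.
Qed.

End pair.

Variables (n : nat) (D : 'I_n.+1 -> T -> R).
Hypothesis mD : forall i, measurable_fun setT (D i).
Hypothesis indD : mutual_indep P D.

Let mpre (i : 'I_n.+1) (A : set R) : measurable A -> measurable (D i @^-1` A).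
Proof. by move=> mA; rewrite -[X in measurable X]setTI; exact: mD. Qed.

(** The sum is measurable for the sigma-algebra generated by the first [n] variables. On the
    intersections of preimages that generate it, the restriction of [P] to an event of the last
    variable agrees with [P] times the probability of that event; uniqueness of finite measures
    extends this to the whole sigma-algebra. *)
Lemma mutual_indep_sum_last (c : 'I_n -> R) :
  indep_var P (fun w => \sum_(i < n) c i * D (widen_ord (leqnSn n) i) w)%R (D ord_max).
Proof.
pose S w := (\sum_(i < n) c i * D (widen_ord (leqnSn n) i) w)%R.
pose G := [set E : set T | exists A : 'I_n -> set R, (forall i, measurable (A i)) /\
   E = \bigcap_i (D (widen_ord (leqnSn n) i) @^-1` A i)].
have Gm : G `<=` measurable.
  move=> _ [A [mA ->]]; rewrite bigcap_mkcond/=.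
  apply: fin_bigcap_measurable => // i _.
  by case: ifPn => _ //; exact: mpre.
have mS (A : set R) : measurable A -> <<s G >> (S @^-1` A).
  move=> mA; pose TG := g_sigma_algebraType G.
  have : measurable_fun setT (S : TG -> R).
    apply: measurable_sum => i; apply: measurable_funM => // _ B mB.
    rewrite setTI; apply: sub_sigma_algebra.
    exists (fun j => if j == i then B else setT); split.
      by move=> j; case: ifPn.
    apply/seteqP; split => w /=; last by move=> /(_ i I); rewrite eqxx.
    by move=> Bw j _; case: eqP => [->|].
  by move=> /(_ measurableT A mA); rewrite setTI.
move=> A C mA mC.
have mDC : measurable (D ord_max @^-1` C) by exact: mpre.
have c0 : (0 <= fine (P (D ord_max @^-1` C)))%R by exact: fine_ge0.
pose m1 : {measure set T -> \bar R} := mrestr P mDC.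
pose m2 : {measure set T -> \bar R} := mscale (NngNum c0) P.
have GT : G setT.
  exists (fun=> setT); split => //; apply/esym; rewrite -subTset => w _ i _ //.
have m12 E : <<s G >> E -> m1 E = m2 E.
  apply: (g_sigma_algebra_measure_unique G Gm (fun=> setT)) => //.
  - by rewrite bigcup_const.
  - move=> _ _ [A1 [mA1 ->]] [A2 [mA2 ->]]; exists (fun i => A1 i `&` A2 i); split.
      by move=> i; exact: measurableI.
    by rewrite -bigcapI; apply: eq_bigcapr => i _; rewrite preimage_setI.
  - move=> _ [B [mB ->]].
    (* Mutual independence is applied twice, with [C] and with [setT] in the last slot. *)
    pose B1 (i : 'I_n.+1) := if unlift ord_max i is Some j then B j else C.
    pose B2 (i : 'I_n.+1) := if unlift ord_max i is Some j then B j else setT.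
    have wl j : widen_ord (leqnSn n) j = lift ord_max j.
      by apply: val_inj; rewrite /= /bump leqNgt ltn_ord.
    have mB1 i : measurable (B1 i) by rewrite /B1; case: unlift.
    have mB2 i : measurable (B2 i) by rewrite /B2; case: unlift.
    have E1 : \bigcap_i (D (widen_ord (leqnSn n) i) @^-1` B i) `&` (D ord_max @^-1` C) =
              \bigcap_i (D i @^-1` B1 i).
      apply/seteqP; split=> w /=.
        move=> [Bw Cw] i _; rewrite /B1; case: unliftP => [j ->|->//].
        by rewrite -wl; exact: Bw.
      move=> Bw; split; last by have := Bw ord_max I; rewrite /B1 /= unlift_none.
      by move=> i _; have := Bw (lift ord_max i) I; rewrite /B1 /= liftK wl.
    have E2 : \bigcap_i (D (widen_ord (leqnSn n) i) @^-1` B i) =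
              \bigcap_i (D i @^-1` B2 i).
      apply/seteqP; split=> w /=.
        move=> Bw i _; rewrite /B2; case: unliftP => [j ->|->//].
        by rewrite -wl; exact: Bw.
      by move=> Bw i _; have := Bw (lift ord_max i) I; rewrite /B2 /= liftK wl.
    rewrite /m1 /m2 /= /mrestr /mscale/= E1 indD// E2 indD//.
    rewrite !big_ord_recr/= /B1 /B2 unlift_none preimage_setT probability_setT mule1.
    rewrite fineK ?fin_num_measure// muleC; congr (_ * _).
    by apply: eq_bigr => i _; rewrite wl liftK.
  - by move=> k; rewrite /m1 /= /mrestr setTI (le_lt_trans (probability_le1 _ _)) ?ltry.
have := m12 _ (mS A mA); rewrite /m1 /m2 /= /mrestr /mscale/= fineK ?fin_num_measure//.
by rewrite muleC.
Qed.

End independence.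

Section brownian_increment.
Local Open Scope ring_scope.
Context (R : realType) d (T : measurableType d) (P : probability T R).
Notation mu := (@lebesgue_measure R).
Notation N01 := (normal_pdf (0:R) 1).

(** Integrating out the independent [D] first produces the Gaussian Fourier transform. As elsewhere,
    [1] is added to the cosine because [indep_var_integral] is stated for nonnegative functions. *)
Lemma cos_gaussian_increment (S D : T -> R) (v : R) : 0 < v ->
  measurable_fun setT S -> measurable_fun setT D -> indep_var P S D ->
  (forall A : set R, measurable A -> P (D @^-1` A) = normal_prob 0 (Num.sqrt v) A) ->
  forall a e, \int[P]_w cos (S w + a * D w + e) =
    expR (- a ^+ 2 * v / 2) * \int[P]_w cos (S w + e).
Proof.
move=> v0 mS mD ind PD a e.
have sv0 : 0 < Num.sqrt v by rewrite sqrtr_gt0.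
have mD' : measurable_fun setT (D : T -> measurableTypeR R) by [].
have icN s : mu.-integrable setT (fun x => (cos ((a * Num.sqrt v) * x + (s + e)) * N01 x)%:E).
  apply: (@integrable_bounded_mul _ _ _ 1) => //.
  - exact: continuous_measurable_fun (@continuous_cos_affine _ _ _).
  - exact: measurable_normal_pdf01.
  - by move=> y; exact: cos_max.
  - by under eq_fun do rewrite ger0_norm ?normal_pdf_ge0//; exact: integrable_normal_pdf.
pose Phi (x y : R) := (1 + cos (x + a * y + e))%:E.
have mPhi : measurable_fun setT (fun p : R * R => Phi p.1 p.2).
  apply/measurable_EFinP; apply: measurable_funD => //.
  apply: (measurableT_comp (continuous_measurable_fun (@continuous_cos R))).
  apply: measurable_funD => //; apply: measurable_funD; first exact: measurable_fst.
  by apply: measurable_funM => //; exact: measurable_snd.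
have Phi0 x y : (0 <= Phi x y)%E by rewrite lee_fin add1cos_ge0.
have inner s : (\int[P]_w Phi s (D w) = (1 + expR (- a ^+ 2 * v / 2) * cos (s + e))%:E)%E.
  transitivity (\int[pushforward P (D : T -> measurableTypeR R)]_x Phi s x)%E.
    rewrite ge0_integral_pushforward// ?preimage_setT//.
    exact: (measurable_fun_section2 mPhi).
  rewrite [LHS](eq_measure_integral (normal_prob 0 (Num.sqrt v))); last first.
    by move=> A mA _; rewrite /= /pushforward PD.
  rewrite ge0_integral_normal_prob//; last exact: (measurable_fun_section2 mPhi).
  under eq_integral.
    move=> x _; rewrite -EFinM addr0 mulrDl mul1r EFinD mulrA addrAC [s + _ + _]addrC; over.
  rewrite integralD//; [|exact: integrable_normal_pdf].
  rewrite integral_normal_pdf -[X in (_ + X)%E]fineK; last exact: (integrable_fin_num _ (icN s)).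
  rewrite -/(Rintegral _ _ _) fourier_normal_pdf01 -EFinD; congr (1 + _)%:E.
  by rewrite mulrC exprMn sqr_sqrtr ?ltW// !mulNr.
have := indep_var_integral mS mD ind mPhi Phi0.
under [in X in _ = X -> _]eq_integral do rewrite inner.
have b1 : bounded_measurable (fun w => cos (S w + a * D w + e)).
  apply: bounded_measurable_cos; apply: measurable_funD => //.
  by apply: measurable_funD => //; exact: measurable_funM.
have b2 : bounded_measurable (fun w => cos (S w + e)).
  by apply: bounded_measurable_cos; exact: measurable_funD.
have bc (c : R) := bounded_measurable_cst T c.
move=> /(congr1 fine) E.
have {}E : \int[P]_w (1 + cos (S w + a * D w + e)) =
   \int[P]_w (1 + expR (- a ^+ 2 * v / 2) * cos (S w + e)) := E.
move: E; rewrite (expectationD P (bc 1) b1) (expectationD P (bc 1) (bounded_measurableM (bc _) b2)).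
by rewrite expectationZ// => /addrI.
Qed.

Context (B : R -> {RV P >-> R}) (hB : is_brownian_motion B).
Notation X := (fun t : R => B t : T -> R).

Let mX t : measurable_fun setT (X t) := measurable_funPT (B t).

Section increment.
Variables (s t : R).
Hypotheses (s0 : 0 <= s) (st : s < t).

(** Abel summation writes a linear combination of values at sorted times as a combination of
    successive increments from time [0] on, and [B t - B s] is one further increment. The equality
    is almost sure because [B 0 = 0] is. *)
Lemma brownian_sorted_increment (l : seq (R * R)) : sorted <=%R (map fst l) ->
  {in l, forall p, 0 <= p.1 <= s} ->
  exists S : T -> R, [/\ measurable_fun setT S, {ae P, forall w, S w = lincomb X l w} &
    indep_var P S (fun w => B t w - B s w)].
Proof.
move=> sl ls; set m := size l.
pose us := 0 :: map fst l ++ [:: s; t].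
(* The default value [t] of [nth] prolongs the finite list to the infinite nondecreasing sequence of
   times that the definition of Brownian motion asks for. *)
pose u (i : nat) := nth t us i.
have sus : size us = m.+3 by rewrite /= size_cat size_map addn2.
have ls' r : r \in map fst l -> 0 <= r <= s by move=> /mapP[p pl ->]; exact: ls.
have sortus : sorted <=%R us.
  rewrite /= cat_path path_sortedE; last exact: le_trans.
  rewrite sl andbT /= (ltW st) andbT; apply/andP; split.
    by apply/allP => r /ls'/andP[].
  have : last 0 (map fst l) \in 0 :: map fst l by exact: mem_last.
  by rewrite andbT inE => /predU1P[->//|/ls'/andP[]].
have um1 : u m.+1 = s by rewrite /u /us /= nth_cat size_map ltnn subnn.
have um2 i : u (m.+2 + i)%N = t.
  case: i => [|i]; first by rewrite addn0 /u /us /= nth_cat size_map ltnNge leqnSn /= subSnn.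
  by rewrite /u nth_default// sus addnS ltnS leq_addr.
have u_mono i : u i <= u i.+1.
  have [im|im] := ltnP i.+1 m.+3; first by apply: (sortedP t sortus); rewrite sus.
  have -> : i.+1 = (m.+2 + (i.+1 - m.+2))%N by rewrite subnKC// ltnW.
  have -> : i = (m.+2 + (i - m.+2))%N by rewrite subnKC.
  by rewrite -addnS !um2.
have u00 : u 0%N = 0 by [].
have uS (i : 'I_m) : u i.+1 = (nth (0, 0) l i).1.
  by rewrite /u /us /= nth_cat size_map ltn_ord (nth_map (0, 0)).
pose D (i : 'I_m.+2) w := B (u i.+1) w - B (u i) w.
have indD : mutual_indep P D.
  by apply: (bm_indep_increments hB) => //; rewrite u00.
have mD i : measurable_fun setT (D i) by exact: measurable_funB.
(* Increment number [j] occurs in the values at all later times of the list, so its coefficient is a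
   tail sum. *)
pose c (j : 'I_m.+1) := \sum_(i < m | (j <= i)%N) (nth (0, 0) l i).2.
exists (fun w => \sum_(j < m.+1) c j * D (widen_ord (leqnSn _) j) w).
split.
- by apply: measurable_sum => i; exact: measurable_funM.
- apply: filterS (bm_start hB) => w B0.
  rewrite /lincomb (big_nth (0, 0)) big_mkord.
  under eq_bigr do rewrite /c mulr_suml.
  rewrite (exchange_big_dep xpredT)//=; apply: eq_bigr => i _.
  rewrite -mulr_sumr; congr (_ * _); rewrite -uS.
  transitivity (\sum_(j < m.+1 | (j < i.+1)%N) (B (u j.+1) w - B (u j) w)).
    by apply: eq_bigl => j; rewrite ltnS.
  rewrite -(big_ord_widen _ (fun j => B (u j.+1) w - B (u j) w)); last by rewrite ltnS ltnW.
  by rewrite -(big_mkord xpredT (fun j => B (u j.+1) w - B (u j) w)) telescope_sumr// u00 B0 subr0.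
- have := mutual_indep_sum_last mD indD c.
  congr (indep_var P _ _); apply/funext => w.
  by rewrite /D /= um1 -[m.+2]addn0 um2.
Qed.

Lemma Rintegral_ae_cos (f g : T -> R) : measurable_fun setT f -> measurable_fun setT g ->
  {ae P, forall w, f w = g w} -> \int[P]_w cos (f w) = \int[P]_w cos (g w).
Proof.
move=> mf mg fg; congr fine; apply: ae_eq_integral => //.
- by apply/measurable_EFinP; case: (bounded_measurable_cos mf).
- by apply/measurable_EFinP; case: (bounded_measurable_cos mg).
- by apply: filterS fg => w -> _.
Qed.

Lemma brownian_fourier_increment (l : seq (R * R)) a e :
  {in l, forall p, [set r | 0 <= r <= s] p.1} ->
  \int[P]_w cos (lincomb X l w + a * (B t w - B s w) + e) =
  expR (- a ^+ 2 * (t - s) / 2) * \int[P]_w cos (lincomb X l w + e).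
Proof.
move=> ls; pose l' := sort (relpre fst <=%R) l.
have ll' : lincomb X l = lincomb X l'.
  apply/funext => w; rewrite /lincomb; apply: perm_big.
  by rewrite perm_sym perm_sort.
have sl' : sorted <=%R (map fst l').
  by rewrite sorted_map; apply: sort_sorted => x y; exact: le_total.
have ls' : {in l', forall p, 0 <= p.1 <= s}.
  by move=> p; rewrite mem_sort => /ls.
have [S [mS Sl ind]] := brownian_sorted_increment sl' ls'.
have ml := measurable_lincomb mX l'.
have mBB : measurable_fun setT (fun w => B t w - B s w) by exact: measurable_funB.
have mBa : measurable_fun setT (fun w => a * (B t w - B s w)) by exact: measurable_funM.
have c := cos_gaussian_increment (v := t - s) _ mS mBB ind _ a e.
rewrite ll'.
transitivity (\int[P]_w cos (S w + a * (B t w - B s w) + e)).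
  apply: Rintegral_ae_cos => //.
  - by apply: measurable_funD => //; exact: measurable_funD.
  - by apply: measurable_funD => //; exact: measurable_funD.
  - by apply: filterS Sl => w ->.
rewrite c ?subr_gt0//; last exact: (bm_gaussian_increments hB).
congr (_ * _); apply: Rintegral_ae_cos => //; try exact: measurable_funD.
by apply: filterS Sl => w ->.
Qed.

End increment.
End brownian_increment.

(** * Heat kernels and iterated integrals *)

Section heat_kernel.
Local Open Scope ring_scope.
Context (R : realType).
Notation mu := (@lebesgue_measure R).
Notation N01 := (normal_pdf (0:R) 1).

Lemma measurable_invr : measurable_fun setT (@GRing.inv R).
Proof.
(* At [0] both sides vanish; elsewhere the real power is taken of a positive number. *)
have -> : @GRing.inv R = fun x => x * (x ^+ 2) `^ (-1).
  apply/funext => x; rewrite powR_inv1 ?sqr_ge0//.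
  have [->|x0] := eqVneq x 0; first by rewrite invr0 mul0r.
  by rewrite expr2 invfM mulrA divff// mul1r.
apply: measurable_funM => //.
have m2 : measurable_fun setT (fun x : R => x ^+ 2) by exact: measurable_funX.
have mp : measurable_fun setT (@powR R ^~ (-1)) by exact: measurable_powR.
exact: (measurableT_comp mp m2).
Qed.

(* As [Num.sqrt] is [0] on negative numbers and [0^-1 = 0], this is [0] for [t <= 0]. *)
Definition heat (t y : R) := (Num.sqrt (t * (pi *+ 2)))^-1 * expR (- y ^+ 2 / (2 * t)).

Lemma measurable_heat : measurable_fun setT (fun p : R * R => heat p.1 p.2).
Proof.
have msq : measurable_fun setT (@Num.sqrt R) by apply: continuous_measurable_fun; exact: (@sqrt_continuous R).
have m1 : measurable_fun setT (fun p : R * R => p.1) := measurable_fst.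
have m2 : measurable_fun setT (fun p : R * R => p.2) := measurable_snd.
apply: measurable_funM.
  apply: (measurableT_comp measurable_invr); apply: (measurableT_comp msq).
  exact: measurable_funM.
apply: measurableT_comp => //; apply: measurable_funM.
  by apply: measurableT_comp => //; exact: measurable_funX.
by apply: (measurableT_comp measurable_invr); exact: measurable_funM.
Qed.

Lemma heat_ge0 t y : 0 <= heat t y.
Proof. by rewrite mulr_ge0 ?expR_ge0// invr_ge0. Qed.

Lemma heat_le0 t y : t <= 0 -> heat t y = 0.
Proof.
move=> t0; rewrite /heat ler0_sqrtr ?invr0 ?mul0r//.
by rewrite mulr_le0_ge0// mulrn_wge0// pi_ge0.
Qed.

Lemma heat_gt0 t y : 0 < t -> 0 < heat t y.
Proof.
by move=> t0; rewrite mulr_gt0 ?expR_gt0// invr_gt0 sqrtr_gt0 mulr_gt0// mulrn_wgt0// pi_gt0.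
Qed.

Lemma heatN t y : heat t (- y) = heat t y.
Proof. by rewrite /heat sqrrN. Qed.

Lemma heat_le t y : heat t y <= heat t 0.
Proof.
have [t0|t0] := leP t 0; first by rewrite !heat_le0.
rewrite /heat ler_wpM2l ?invr_ge0// ler_expR expr0n oppr0 mul0r.
by rewrite mulNr oppr_le0 divr_ge0 ?sqr_ge0// mulr_ge0// ltW.
Qed.

Lemma heat_normal_pdf t y m : 0 < t -> heat t (y - m) = normal_pdf m (Num.sqrt t) y.
Proof.
move=> t0; rewrite normal_pdfE ?gt_eqF ?sqrtr_gt0// /normal_peak /normal_fun.
rewrite sqr_sqrtr ?ltW// /heat -mulrnAr; congr (_ * expR (_ / _)).
by rewrite mulr_natl.
Qed.

Lemma integral_heat t m : 0 < t -> (\int[mu]_y (heat t (y - m))%:E = 1)%E.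
Proof.
by move=> t0; under eq_integral do rewrite heat_normal_pdf//; exact: integral_normal_pdf.
Qed.

Lemma continuous_heat t : continuous (heat t).
Proof.
move=> y; apply: cvgM; first exact: cvg_cst.
apply: continuous_comp; last exact: continuous_expR.
apply: cvgM; last exact: cvg_cst.
by apply: cvgN; exact: exprn_continuous.
Qed.

(** The substitution [y = c * (x + Num.sqrt t * z)]; Brownian motion uses it with [c = 1], the
    bridge with [c = 1 - t]. *)
Lemma normal_heat_change (t : R) (c x : R) (H : R -> \bar R) : 0 < t -> 0 < c ->
  measurable_fun setT H -> (forall y, 0 <= H y)%E ->
  (\int[mu]_z (H (c * (x + Num.sqrt t * z))%R * (N01 z)%:E) =
   \int[mu]_y (H y * (heat (c ^+ 2 * t) (y - c * x))%:E))%E.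
Proof.
move=> t0 c0 mH H0.
have s0 : 0 < c * Num.sqrt t by rewrite mulr_gt0// sqrtr_gt0.
have mN : measurable_fun setT (fun y => normal_pdf (c * x) (c * Num.sqrt t) y) by exact: measurable_normal_pdf.
have E y : heat (c ^+ 2 * t) (y - c * x) = normal_pdf (c * x) (c * Num.sqrt t) y.
  rewrite heat_normal_pdf ?mulr_gt0 ?exprn_gt0//.
  by rewrite sqrtrM ?sqr_ge0// sqrtr_sqr gtr0_norm.
under [RHS]eq_integral do rewrite E.
rewrite [RHS](@ge0_integral_affine_pos _ _ (c * Num.sqrt t) (c * x))//; last 2 first.
- by apply: emeasurable_funM => //; exact/measurable_EFinP.
- by move=> y; rewrite mule_ge0// lee_fin normal_pdf_ge0.
rewrite -ge0_integralZl//; last 3 first.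
- have ma : measurable_fun setT (fun z : R => c * Num.sqrt t * z + c * x).
    by apply: measurable_funD => //; exact: measurable_funM.
  apply: emeasurable_funM; first exact: (measurableT_comp mH).
  by apply/measurable_EFinP; exact: (measurableT_comp mN).
- by move=> y _; rewrite mule_ge0// lee_fin normal_pdf_ge0.
- by rewrite lee_fin ltW.
apply: eq_integral => z _; rewrite muleCA -EFinM normal_pdf_affine//.
by congr (H _ * _)%E; ring.
Qed.

End heat_kernel.

(** * Joint measurability of continuous processes *)

Section continuous_process.
Local Open Scope ring_scope.
Context (R : realType) d (T : measurableType d).

(** Paths are given as continuous on the unit interval only; composing the time with [clamp01] makes
    them continuous and jointly measurable over the whole line and leaves them unchanged on
    [[0, 1]]. *)
Definition clamp01 (t : R) := Num.max 0 (Num.min 1 t).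

Lemma clamp01_itv t : 0 <= clamp01 t <= 1.
Proof. by rewrite le_max lexx/= ge_max ler01 ge_min lexx. Qed.

Lemma clamp01_id t : 0 <= t <= 1 -> clamp01 t = t.
Proof. by move=> /andP[t0 t1]; rewrite /clamp01 min_r// max_r. Qed.

Lemma measurable_clamp01 : measurable_fun setT clamp01.
Proof. by apply: measurable_maxr => //; exact: measurable_minr. Qed.

(** The process sampled at the left ends of a grid of mesh [1 / n.+1] is a finite sum of measurable
    terms, and it converges pointwise by continuity of the paths. *)
Lemma measurable_continuous_process (X : R -> T -> R) :
  (forall t, 0 <= t <= 1 -> measurable_fun setT (X t)) ->
  (forall w, {within `[0, 1], continuous (X ^~ w)}) ->
  measurable_fun setT (fun p : R * T => X (clamp01 p.1) p.2).
Proof.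
move=> mX cX.
pose q (n k : nat) : R := clamp01 (k%:R / n.+1%:R).
pose I (n k : nat) : set R := `[k%:R / n.+1%:R, k.+1%:R / n.+1%:R[%classic.
(* There are [n.+2] intervals because the time [1] falls into the one of index [n.+1]. *)
pose Y n (p : R * T) := \sum_(k < n.+2) \1_(I n k) (clamp01 p.1) * X (q n k) p.2.
apply: (@measurable_fun_cvg _ _ _ _ Y).
  move=> n; apply: measurable_sum => k; apply: measurable_funM.
    have mi : measurable_fun setT (\1_(I n k) : R -> R) by apply: measurable_indic; exact: measurable_itv.
    by apply: (measurableT_comp mi); exact: (measurableT_comp measurable_clamp01 measurable_fst).
  by apply: (measurableT_comp _ measurable_snd); apply: mX; exact: clamp01_itv.
move=> [t w] _ /=; set s := clamp01 t.
have s01 : 0 <= s <= 1 := clamp01_itv t.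
pose f (n : nat) := Num.truncn (s * n.+1%:R).
have sn0 n : 0 <= s * n.+1%:R by rewrite mulr_ge0//; case/andP: s01.
have fle n : (f n)%:R <= s * n.+1%:R < (f n).+1%:R by exact: Num.Theory.truncn_itv.
have fn n : (f n < n.+2)%N.
  rewrite ltnS -(ler_nat R); case/andP: (fle n) => /le_trans + _; apply.
  by rewrite ler_piMl//; case/andP: s01.
have YE n : Y n (t, w) = X (q n (f n)) w.
  rewrite /Y /= (bigD1 (Ordinal (fn n)))//= big1 ?addr0.
    rewrite indicE mem_set ?mul1r// /I /= in_itv/=.
    by rewrite ler_pdivrMr ?ltr0n// ltr_pdivlMr ?ltr0n.
  move=> k /eqP kf; rewrite indicE memNset ?mul0r//.
  rewrite /I /= in_itv/= ler_pdivrMr ?ltr0n// ltr_pdivlMr ?ltr0n// => /andP[k1 k2].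
  apply: kf; apply: val_inj => /=; apply/eqP; rewrite eqn_leq.
  case/andP: (fle n) => f1 f2.
  by rewrite -ltnS -(ltr_nat R) (le_lt_trans k1)//= -ltnS -(ltr_nat R) (le_lt_trans f1).
under eq_fun do rewrite YE.
have qcv : q n (f n) @[n --> \oo] --> s.
  apply/cvgrPdist_le => e e0; near=> n.
  case/andP: (fle n) => f1 f2.
  have n0 : 0 < n.+1%:R :> R by rewrite ltr0n.
  have fs : (f n)%:R / n.+1%:R <= s by rewrite ler_pdivrMr.
  have qE : q n (f n) = (f n)%:R / n.+1%:R.
    by rewrite /q clamp01_id// divr_ge0//= (le_trans fs)//; case/andP: s01.
  rewrite qE ger0_norm ?subr_ge0// lerBlDr.
  have : s <= (f n)%:R / n.+1%:R + n.+1%:R^-1.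
    by rewrite -[X in _ + X]mul1r -mulrDl ler_pdivlMr// natr1 ltW.
  move=> /le_trans; apply; rewrite addrC lerD2r.
  rewrite invf_ple ?posrE//.
  by rewrite (le_trans (ltW (truncnS_gt _)))// ler_nat ltnS; near: n; exact: nbhs_infty_ge.
have cs := cX w s.
have sI : (`[0, 1]%classic : set R) s by rewrite /= in_itv.
move/subspace_continuousP : (cX w) => /(_ s sI) cXs.
apply: (cvg_comp (fun n => q n (f n)) (X ^~ w) _ cXs).
move=> A /= [e e0 Ae]; have /cvgrPdist_lt/(_ e e0) := qcv.
apply: filterS => n; rewrite /ball_ => sn; apply: Ae => //=.
by rewrite in_itv/=; exact: clamp01_itv.
Unshelve. all: by end_near. Qed.

End continuous_process.

(** * The bump and the iterated kernels *)

Section bump.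
Local Open Scope ring_scope.
Context (R : realType).
Notation mu := (@lebesgue_measure R).

Definition tent (x : R) := Num.max 0 (1 - `|x|).

Lemma tent_ge0 x : 0 <= tent x.
Proof. by rewrite le_max lexx. Qed.

Lemma tent_le1 x : tent x <= 1.
Proof. by rewrite ge_max ler01/= lerBlDr lerDl normr_ge0. Qed.

Lemma tent_out x : 1 <= `|x| -> tent x = 0.
Proof. by move=> x1; rewrite /tent max_l// subr_le0. Qed.

Lemma continuous_tent : continuous tent.
Proof.
move=> x; apply: (@continuous_max _ _ (cst 0) (fun x => 1 - `|x|)).
  exact: cvg_cst.
by apply: cvgB; [exact: cvg_cst|exact: norm_continuous].
Qed.

Lemma measurable_tent : measurable_fun setT tent.
Proof. by apply: continuous_measurable_fun; exact: continuous_tent. Qed.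

Definition tent_mass := \int[mu]_x tent x.

(** The tent lies below the indicator of [[-1, 1]] and is at least [1 / 2] on [[-1/2, 1/2]]; this
    makes its mass finite and positive, which is what the normalisation requires. *)
Lemma integral_tent : (\int[mu]_x (tent x)%:E)%E = tent_mass%:E /\ 0 < tent_mass.
Proof.
have i2 : (\int[mu]_x (tent x)%:E <= 2%:E)%E.
  have <- : (\int[mu]_x (\1_(`[-1, 1]%classic : set R) x)%:E = 2%:E)%E.
    rewrite integral_indic ?setIT; [|exact: measurableT|exact: measurable_itv].
    transitivity (lebesgue_measure (`[-1, 1]%classic : set R)) => //; rewrite lebesgue_measure_itv/= lte_fin ifT; last by lra.
    by rewrite -EFinB; congr EFin; lra.
  apply: ge0_le_integral => //.
  - by move=> x _; rewrite lee_fin tent_ge0.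
  - by apply/measurable_EFinP; exact: measurable_tent.
  - by apply/measurable_EFinP; apply: measurable_indic; exact: measurable_itv.
  move=> x _; rewrite lee_fin indicE; case: (leP 1 `|x|) => [x1|x1].
    by rewrite tent_out// ler0n.
  by rewrite mem_set ?tent_le1//= in_itv/= -ler_norml ltW.
have i1 : ((2^-1)%:E <= \int[mu]_x (tent x)%:E)%E.
  have mi : measurable (`[- 2^-1, 2^-1]%classic : set R) by exact: measurable_itv.
  have <- : (\int[mu]_x ((2^-1)%:E * (\1_(`[- 2^-1, 2^-1]%classic : set R) x)%:E) = (2^-1 : R)%:E)%E.
    rewrite ge0_integralZl//; last first.
      by apply/measurable_EFinP; exact: measurable_indic.
    rewrite integral_indic ?setIT//.
    rewrite -[X in (_ * X)%E]/(lebesgue_measure (`[- 2^-1, 2^-1]%classic : set R)) lebesgue_measure_itv/= lte_fin ifT; last by lra.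
    by rewrite -EFinB -EFinM; congr EFin; lra.
  apply: ge0_le_integral => //.
  - by apply/measurable_EFinP; apply: measurable_funM => //; exact: measurable_indic.
  - by apply/measurable_EFinP; exact: measurable_tent.
  move=> x _; rewrite -EFinM lee_fin indicE.
  have [xx|xx] := leP `|x| 2^-1; last first.
    rewrite memNset ?mulr0 ?tent_ge0//= in_itv/= -ler_norml => xx'.
    by move: xx; rewrite ltNge xx'.
  rewrite mem_set/= ?in_itv/= -?ler_norml// mulr1 /tent le_max; apply/orP; right.
  lra.
have fi : (\int[mu]_x (tent x)%:E)%E \is a fin_num.
  rewrite ge0_fin_numE ?(le_lt_trans i2) ?ltry//.
  by apply: integral_ge0 => x _; rewrite lee_fin tent_ge0.
have E : (\int[mu]_x (tent x)%:E)%E = tent_mass%:E by rewrite -[LHS]fineK.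
split => //; rewrite -lte_fin -E (lt_le_trans _ i1)// lte_fin.
by rewrite invr_gt0.
Qed.

Definition bump (x : R) := tent x / tent_mass.

Lemma bump_ge0 x : 0 <= bump x.
Proof. by rewrite divr_ge0 ?tent_ge0// ltW//; case: integral_tent. Qed.

Lemma bump_le x : bump x <= tent_mass^-1.
Proof.
by rewrite ler_piMl ?tent_le1// invr_ge0 ltW//; case: integral_tent.
Qed.

Lemma bump_out x : 1 <= `|x| -> bump x = 0.
Proof. by move=> x1; rewrite /bump tent_out// mul0r. Qed.

Lemma continuous_bump : continuous bump.
Proof. by move=> x; apply: cvgM; [exact: continuous_tent|exact: cvg_cst]. Qed.

Lemma measurable_bump : measurable_fun setT bump.
Proof. by apply: continuous_measurable_fun; exact: continuous_bump. Qed.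

Lemma integral_bump : (\int[mu]_x (bump x)%:E = 1)%E.
Proof.
have [tE t0] := integral_tent.
under eq_integral do rewrite /bump EFinM muleC.
rewrite ge0_integralZl//; last 3 first.
- by apply/measurable_EFinP; exact: measurable_tent.
- by move=> x _; rewrite lee_fin tent_ge0.
- by rewrite lee_fin invr_ge0 ltW.
by rewrite tE -EFinM mulVf// gt_eqF.
Qed.

End bump.

Section chain_symbols.
Local Open Scope ring_scope.
Context (R : realType).
Notation mu := (@lebesgue_measure R).

(* [None] stands for a point mass at [0], smoothed into [bump] at scale [eps];
   [Some p] stands for the function [x |-> 1 + cos (p.1 * x + p.2)]. *)
Definition symbol := option (R * R).

Definition symbol_density (o : symbol) (x : R) :=
  if o is Some p then 1 + cos (p.1 * x + p.2) else bump x.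

Definition symbol_scale (eps : R) (o : symbol) : R := if o is Some _ then 1 else eps.

Definition symbol_fun eps o (x : R) :=
  (symbol_scale eps o)^-1 * symbol_density o ((symbol_scale eps o)^-1 * x).

Lemma symbol_density_ge0 o x : 0 <= symbol_density o x.
Proof.
by case: o => [p|] /=; [exact: add1cos_ge0|exact: bump_ge0].
Qed.

Lemma continuous_symbol_density o : continuous (symbol_density o).
Proof.
case: o => [p|] x /=; last exact: continuous_bump.
by apply: cvgD; [exact: cvg_cst|exact: continuous_cos_affine].
Qed.

Lemma measurable_symbol_density o : measurable_fun setT (symbol_density o).
Proof. by apply: continuous_measurable_fun; exact: continuous_symbol_density. Qed.

Lemma symbol_density_le o : exists2 C, 0 <= C & forall x, symbol_density o x <= C.
Proof.
case: o => [p|] /=; last first.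
  exists (tent_mass R)^-1; last exact: bump_le.
  by rewrite invr_ge0 ltW//; case: (integral_tent R).
by exists 2 => // x; have := cos_le1 (p.1 * x + p.2); lra.
Qed.

Lemma symbol_scale_ge0 eps o : 0 <= eps -> 0 <= symbol_scale eps o.
Proof. by case: o. Qed.

Lemma symbol_scale_gt0 eps o : 0 < eps -> 0 < symbol_scale eps o.
Proof. by case: o. Qed.

Lemma symbol_fun_ge0 eps o x : 0 <= eps -> 0 <= symbol_fun eps o x.
Proof.
by move=> e0; rewrite mulr_ge0 ?symbol_density_ge0// invr_ge0 symbol_scale_ge0.
Qed.

Lemma continuous_symbol_fun eps o : continuous (symbol_fun eps o).
Proof.
move=> x; apply: cvgM; first exact: cvg_cst.
apply: (@continuous_comp _ _ _ (fun x => (symbol_scale eps o)^-1 * x)).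
  by apply: cvgM; [exact: cvg_cst|exact: cvg_id].
exact: continuous_symbol_density.
Qed.

Lemma measurable_symbol_fun eps o : measurable_fun setT (symbol_fun eps o).
Proof. by apply: continuous_measurable_fun; exact: continuous_symbol_fun. Qed.

Lemma bounded_nonneg_symbol_fun eps o : 0 <= eps -> bounded_nonneg (symbol_fun eps o).
Proof.
move=> e0; split; first exact: measurable_symbol_fun.
have [C C0 hC] := symbol_density_le o.
exists ((symbol_scale eps o)^-1 * C) => x.
by rewrite symbol_fun_ge0//= ler_wpM2l ?invr_ge0 ?symbol_scale_ge0.
Qed.

End chain_symbols.

Section chain.
Local Open Scope ring_scope.
Context (R : realType).
Notation mu := (@lebesgue_measure R).
Implicit Types (l : seq (symbol R)) (o : symbol R).

(* The head of the list is the factor with the latest time. *)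
Fixpoint chain (eps : R) l (t y : R) : \bar R :=
  if l is o :: l' then
    (\int[mu]_s \int[mu]_z (chain eps l' s (symbol_scale eps o * z) *
       (symbol_density o z * heat (t - s) (y - symbol_scale eps o * z))%:E))%E
  else (heat t y)%:E.

Lemma chain_ge0 eps l t y : (0 <= chain eps l t y)%E.
Proof.
elim: l t y => [|o l IH] t y /=; first by rewrite lee_fin heat_ge0.
apply: integral_ge0 => s _; apply: integral_ge0 => z _; rewrite mule_ge0//.
by rewrite lee_fin mulr_ge0 ?symbol_density_ge0 ?heat_ge0.
Qed.

Lemma chain_le0 eps l t y : t <= 0 -> chain eps l t y = 0%E.
Proof.
elim: l t y => [|o l IH] t y t0 /=; first by rewrite heat_le0.
rewrite integral0_eq// => s _; rewrite integral0_eq// => z _.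
have [s0|s0] := leP s 0; first by rewrite IH// mul0e.
by rewrite heat_le0 ?mulr0 ?mule0// subr_le0 (le_trans t0)// ltW.
Qed.

Lemma measurable_chain eps l :
  measurable_fun setT (fun p : R * R => chain eps l p.1 p.2).
Proof.
elim: l => [|o l IH] /=; first by apply/measurable_EFinP; exact: measurable_heat.
pose G (p : R * R * R) (z : R) := (chain eps l p.2 (symbol_scale eps o * z) *
  (symbol_density o z * heat (p.1.1 - p.2) (p.1.2 - symbol_scale eps o * z))%:E)%E.
have G0 p z : (0 <= G p z)%E.
  by rewrite mule_ge0 ?chain_ge0// lee_fin mulr_ge0 ?symbol_density_ge0 ?heat_ge0.
have m1 : measurable_fun setT (fun q : R * R * R * R => q.1.1.1).
  by do 3 apply: (measurableT_comp measurable_fst) => //.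
have m2 : measurable_fun setT (fun q : R * R * R * R => q.1.1.2).
  apply: (measurableT_comp measurable_snd); apply: (measurableT_comp measurable_fst).
  exact: measurable_fst.
have m3 : measurable_fun setT (fun q : R * R * R * R => q.1.2).
  by apply: (measurableT_comp measurable_snd); exact: measurable_fst.
have m4 : measurable_fun setT (fun q : R * R * R * R => symbol_scale eps o * q.2).
  by apply: measurable_funM => //; exact: measurable_snd.
have mG : measurable_fun setT (fun q : R * R * R * R => G q.1 q.2).
  apply: emeasurable_funM.
    exact: (measurableT_comp IH (measurable_fun_pair m3 m4)).
  apply/measurable_EFinP; apply: measurable_funM.
    exact: (measurableT_comp (measurable_symbol_density o) measurable_snd).
  apply: (measurableT_comp (@measurable_heat R) (measurable_fun_pair _ _)).
    exact: measurable_funB.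
  exact: measurable_funB.
have mI := ge0_measurable_integral2 mu mG G0.
apply: (@ge0_measurable_integral2 _ _ _ _ _ mu
  (fun (p : R * R) (s : R) => (\int[mu]_z G (p, s) z)%E)) => //.
by move=> p s; apply: integral_ge0 => z _; exact: G0.
Qed.

(** The definition of [chain] integrates over the rescaled position [z], so that it makes sense at
    [eps = 0], where [None] puts the path at [0] with mass [1]. For [eps > 0] the substitution
    [x = symbol_scale eps o * z] gives back an integral over positions. *)
Lemma chain_consE eps o l t y : 0 < eps ->
  chain eps (o :: l) t y =
  (\int[mu]_s \int[mu]_x (chain eps l s x *
     (symbol_fun eps o x * heat (t - s) (y - x))%:E))%E.
Proof.
move=> e0 /=; apply: eq_integral => s _.
have c0 := symbol_scale_gt0 o e0; set c := symbol_scale eps o in c0 *.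
have mW := measurable_fun_section2 (measurable_chain eps l) s.
have mh : measurable_fun setT (fun x : R => heat (t - s) (y - x)).
  have mb : measurable_fun setT (fun x : R => y - x) by exact: measurable_funB.
  have mk : measurable_fun setT (heat (t - s) : R -> R).
    by apply: continuous_measurable_fun; exact: continuous_heat.
  exact: (measurableT_comp mk mb).
have msf := measurable_symbol_fun eps o.
rewrite [RHS](@ge0_integral_affine_pos _ _ c 0)//; last 2 first.
- apply: emeasurable_funM => //; apply/measurable_EFinP.
  exact: measurable_funM.
- by move=> x; rewrite mule_ge0 ?chain_ge0// lee_fin mulr_ge0 ?symbol_fun_ge0 ?heat_ge0// ltW.
have mc : measurable_fun setT (fun x : R => c * x + 0).
  by apply: measurable_funD => //; exact: measurable_funM.
rewrite -ge0_integralZl//; last 3 first.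
- apply: emeasurable_funM; first exact: (measurableT_comp mW).
  apply/measurable_EFinP.
  by apply: measurable_funM; [exact: (measurableT_comp msf)|exact: (measurableT_comp mh)].
- by move=> x _; rewrite mule_ge0 ?chain_ge0// lee_fin mulr_ge0 ?symbol_fun_ge0 ?heat_ge0// ltW.
- by rewrite lee_fin ltW.
apply: eq_integral => z _; rewrite addr0 muleCA -EFinM; congr (_ * _%:E)%E.
have -> : symbol_fun eps o (c * z) = c^-1 * symbol_density o z.
  by rewrite /symbol_fun -/c mulKf ?gt_eqF.
by rewrite -mulrA mulVKf ?gt_eqF.
Qed.

End chain.

Section path_integral.
Local Open Scope ring_scope.
Context (R : realType) d (T : measurableType d).
Notation mu := (@lebesgue_measure R).
Implicit Types (l : seq (symbol R)) (o : symbol R).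
Variable X : R -> T -> R.
Hypothesis mX : measurable_fun setT (fun p : R * T => X p.1 p.2).

(** The pathwise counterpart of [chain]. The indicator of [0 < s < t] has no analogue there because
    [heat] vanishes at nonpositive times. *)
Fixpoint path_integral (eps : R) l (t : R) (w : T) : \bar R :=
  if l is o :: l' then
    (\int[mu]_s (((0 < s < t)%R%:R * symbol_fun eps o (X s w))%:E *
      path_integral eps l' s w))%E
  else 1%E.

Lemma path_integral_ge0 eps l t w : 0 <= eps -> (0 <= path_integral eps l t w)%E.
Proof.
move=> e0; elim: l t => [|o l IH] t /=; first exact: lee01.
by apply: integral_ge0 => s _; rewrite mule_ge0// lee_fin mulr_ge0// symbol_fun_ge0.
Qed.

Lemma measurable_before d' (T' : measurableType d') (s t : T' -> R) :
  measurable_fun setT s -> measurable_fun setT t ->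
  measurable_fun setT (fun x => (0 < s x < t x)%R%:R : R).
Proof.
move=> ms mt.
have mb : measurable_fun setT (fun x => (0 < s x < t x)%R).
  by apply: measurable_and; exact: measurable_fun_ltr.
have mn : measurable_fun setT (fun c : bool => c%:R : R) by [].
exact: (measurableT_comp mn mb).
Qed.

Lemma measurable_path_integral eps l : 0 <= eps ->
  measurable_fun setT (fun p : R * T => path_integral eps l p.1 p.2).
Proof.
move=> e0; elim: l => [|o l IH] /=; first exact: measurable_cst.
pose G (p : R * T) (s : R) := (((0 < s < p.1)%R%:R * symbol_fun eps o (X s p.2))%:E *
      path_integral eps l s p.2)%E.
have m1 : measurable_fun setT (fun q : R * T * R => q.1.1).
  by apply: (measurableT_comp measurable_fst); exact: measurable_fst.
have m2 : measurable_fun setT (fun q : R * T * R => q.1.2).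
  by apply: (measurableT_comp measurable_snd); exact: measurable_fst.
have m3 : measurable_fun setT (fun q : R * T * R => q.2) by exact: measurable_snd.
apply: (@ge0_measurable_integral2 _ _ _ _ _ mu G).
  apply: emeasurable_funM.
    apply/measurable_EFinP; apply: measurable_funM; first exact: measurable_before.
    apply: (measurableT_comp (measurable_symbol_fun eps o)).
    exact: (measurableT_comp mX (measurable_fun_pair m3 m2)).
  exact: (measurableT_comp IH (measurable_fun_pair m3 m2)).
move=> p s; rewrite mule_ge0 ?path_integral_ge0// lee_fin mulr_ge0// symbol_fun_ge0//.
Qed.

Lemma measurable_process t : measurable_fun setT (X t).
Proof. exact: (measurableT_comp mX (pair1_measurable t)). Qed.

End path_integral.

Section path_integral_law.
Local Open Scope ring_scope.
Context (R : realType) d (T : measurableType d) (P : probability T R).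
Notation mu := (@lebesgue_measure R).
Implicit Types (l : seq (symbol R)) (o : symbol R).
Variable X : R -> T -> R.
Hypothesis mX : measurable_fun setT (fun p : R * T => X p.1 p.2).

Lemma cylinder_in_sub (S S' : set R) (c : seq (R * (R -> R))) : S `<=` S' ->
  cylinder_in S c -> cylinder_in S' c.
Proof.
by move=> SS; elim: c => //= p c IH [Sp bp /IH Sc]; split => //; exact: SS.
Qed.

Lemma path_integral_fubini eps o l (t : R) (G : T -> \bar R) : 0 <= eps ->
  measurable_fun setT G -> (forall w, 0 <= G w)%E ->
  (\int[P]_w (G w * \int[mu]_s (((0 < s < t)%R%:R * symbol_fun eps o (X s w))%:E *
      path_integral X eps l s w)) =
   \int[mu]_s ((0 < s < t)%R%:R%:E * \int[P]_w (G w * (symbol_fun eps o (X s w))%:E *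
      path_integral X eps l s w)))%E.
Proof.
move=> e0.
have mXs := measurable_process mX.
  move=> mG G0.
  have mso : measurable_fun setT (fun p : T * R => symbol_fun eps o (X p.2 p.1)).
    apply: (measurableT_comp (measurable_symbol_fun eps o)).
    exact: (measurableT_comp mX (measurable_fun_pair measurable_snd measurable_fst)).
  have mpi : measurable_fun setT (fun p : T * R => path_integral X eps l p.2 p.1).
    exact: (measurableT_comp (measurable_path_integral mX l e0)
      (measurable_fun_pair measurable_snd measurable_fst)).
  have mbe : measurable_fun setT (fun p : T * R => (0 < p.2 < t)%R%:R : R).
    by apply: measurable_before => //; exact: measurable_snd.
  pose q (w : T) (s : R) := (((0 < s < t)%R%:R * symbol_fun eps o (X s w))%:E *
    path_integral X eps l s w)%E.
  have q0 w s : (0 <= q w s)%E.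
    by rewrite mule_ge0 ?path_integral_ge0// lee_fin mulr_ge0// symbol_fun_ge0.
  have mq : measurable_fun setT (fun p : T * R => q p.1 p.2).
    by apply: emeasurable_funM => //; apply/measurable_EFinP; exact: measurable_funM.
  transitivity (\int[P]_w \int[mu]_s (G w * q w s))%E.
    apply: eq_integral => w _; rewrite ge0_integralZl//.
    exact: (measurable_fun_section2 mq).
  rewrite (@ge0_tonelli _ _ _ _ _ P mu (fun w s => G w * q w s)%E); last 2 first.
  - by apply: emeasurable_funM => //; exact: (measurableT_comp mG measurable_fst).
  - by move=> w s; rewrite mule_ge0.
  apply: eq_integral => s _; rewrite -ge0_integralZl//; last 2 first.
  - apply: emeasurable_funM; last exact: (measurable_fun_section2 (measurable_path_integral mX l e0)).
    apply: emeasurable_funM => //; apply/measurable_EFinP.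
    exact: (measurableT_comp (measurable_symbol_fun eps o)).
  - by move=> w _; rewrite !mule_ge0 ?path_integral_ge0// lee_fin symbol_fun_ge0.
  by apply: eq_integral => w _; rewrite /q EFinM !muleA [(G w * _)%E]muleC.
Qed.

(** Up to time [t] the path integral is an iterated integral of cylinder functions. Each step of the
    induction moves the symbol at the latest time [s] into the weights [G1] and [G2] and lowers the
    horizon to [s]. *)
Lemma path_integral_congr eps l (t : R) (G1 G2 : T -> \bar R) : 0 <= eps ->
  measurable_fun setT G1 -> measurable_fun setT G2 ->
  (forall w, 0 <= G1 w)%E -> (forall w, 0 <= G2 w)%E ->
  (forall c, cylinder_in [set r | 0 <= r <= t] c ->
     (\int[P]_w (G1 w * (cylinder X c w)%:E) = \int[P]_w (G2 w * (cylinder X c w)%:E))%E) ->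
  (\int[P]_w (G1 w * path_integral X eps l t w) =
   \int[P]_w (G2 w * path_integral X eps l t w))%E.
Proof.
move=> e0; elim: l t G1 G2 => [|o l IH] t G1 G2 mG1 mG2 G10 G20 h /=.
  have := h [::] I; under eq_integral do rewrite cylinder_nil.
  by under [X in _ = X -> _]eq_integral do rewrite cylinder_nil.
have mXs := measurable_process mX.
rewrite (path_integral_fubini o l t e0 mG1 G10) (path_integral_fubini o l t e0 mG2 G20).
apply: eq_integral => s _.
have [/andP[s0 st]|_] := boolP (0 < s < t)%R; last by rewrite !mul0e.
congr (_ * _)%E; apply: IH.
- by apply: emeasurable_funM => //; apply/measurable_EFinP; exact: (measurableT_comp (measurable_symbol_fun eps o)).
- by apply: emeasurable_funM => //; apply/measurable_EFinP; exact: (measurableT_comp (measurable_symbol_fun eps o)).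
- by move=> w; rewrite mule_ge0// lee_fin symbol_fun_ge0.
- by move=> w; rewrite mule_ge0// lee_fin symbol_fun_ge0.
move=> c cs; have := h ((s, symbol_fun eps o) :: c).
under eq_integral do rewrite cylinder_cons/= EFinM muleA.
under [X in (_ -> _ = X) -> _]eq_integral do rewrite cylinder_cons/= EFinM muleA.
apply; split => /=.
- by rewrite !ltW.
- exact: bounded_nonneg_symbol_fun.
- apply: cylinder_in_sub cs => r /= /andP[-> /=] /le_trans; apply.
  exact: ltW.
Qed.

(* [X] is the h-transform by [g] of a Brownian motion started at [0]. *)
Variables (V : R -> Prop) (g : R -> R -> R) (g0 : R).
Hypothesis V_le : forall s t, s < t -> V t -> V s.
Hypothesis g_gt0 : forall t y, V t -> 0 < g t y.
Hypothesis g0_gt0 : 0 < g0.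
Hypothesis mg : forall t, measurable_fun setT (g t).
Hypothesis marginal : forall t (H : R -> \bar R), 0 < t -> V t ->
  measurable_fun setT H -> (forall x, 0 <= H x)%E ->
  (\int[P]_w H (X t w) = \int[mu]_y (H y * (heat t y * g t y / g0)%:E))%E.
Hypothesis markov : forall s t (H : R -> \bar R) c, 0 < s -> s < t -> V t ->
  measurable_fun setT H -> (forall x, 0 <= H x)%E ->
  cylinder_in [set r | 0 <= r <= s] c ->
  (\int[P]_w (H (X t w) * (cylinder X c w)%:E) =
   \int[P]_w (\int[mu]_y (H y * (heat (t - s) (y - X s w) * g t y / g s (X s w))%:E) *
     (cylinder X c w)%:E))%E.

(** Induction from the latest time [s]: the Markov property replaces [H (X t)] by its conditional
    mean [K s (X s)], which becomes the terminal function at time [s], and the factors [g s x]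
    cancel between consecutive steps. What remains is a product of heat kernels, that is the chain,
    with [g t y / g0] at the end. *)
Lemma path_integral_law eps l t (H : R -> \bar R) : 0 < eps -> 0 < t -> V t ->
  measurable_fun setT H -> (forall x, 0 <= H x)%E ->
  (\int[P]_w (H (X t w) * path_integral X eps l t w) =
   \int[mu]_y (chain eps l t y * (H y * (g t y / g0)%:E)))%E.
Proof.
move=> e0; have e0' := ltW e0.
elim: l t H => [|o l IH] t H t0 Vt mH H0.
  under eq_integral do rewrite mule1.
  rewrite marginal//; apply: eq_integral => y _.
  by rewrite muleCA -EFinM mulrA.
have mXs := measurable_process mX.
have mso := measurable_symbol_fun eps o.
have so0 x : 0 <= symbol_fun eps o x by exact: symbol_fun_ge0.
pose p s x y := (heat (t - s) (y - x) * g t y / g s x).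
have mp s : measurable_fun setT (fun q : R * R => p s q.1 q.2).
  apply: measurable_funM; last first.
    by apply: (measurableT_comp (@measurable_invr R)); exact: (measurableT_comp (mg s) measurable_fst).
  apply: measurable_funM; last exact: (measurableT_comp (mg t) measurable_snd).
  have mk : measurable_fun setT (heat (t - s) : R -> R).
    by apply: continuous_measurable_fun; exact: continuous_heat.
  by apply: (measurableT_comp mk); exact: measurable_funB.
have p0 s x y : 0 < s -> s < t -> 0 <= p s x y.
  move=> s0 st; apply: divr_ge0; last by apply/ltW/g_gt0/(V_le st).
  by apply: mulr_ge0; [exact: heat_ge0|exact/ltW/g_gt0].
pose K s x := (\int[mu]_y (H y * (p s x y)%:E))%E.
have mK s : 0 < s -> s < t -> measurable_fun setT (K s).
  move=> s0 st; apply: (@ge0_measurable_integral2 _ _ _ _ _ mu (fun x y => (H y * (p s x y)%:E)%E)).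
    apply: emeasurable_funM; first exact: (measurableT_comp mH measurable_snd).
    by apply/measurable_EFinP; exact: mp.
  by move=> x y; rewrite mule_ge0// lee_fin p0.
have K0 s x : 0 < s -> s < t -> (0 <= K s x)%E.
  by move=> s0 st; apply: integral_ge0 => y _; rewrite mule_ge0// lee_fin p0.
pose k y := (H y * (g t y / g0)%:E)%E.
have mk : measurable_fun setT k.
  by apply: emeasurable_funM => //; apply/measurable_EFinP; exact: measurable_funM.
have k0 y : (0 <= k y)%E by rewrite mule_ge0// lee_fin divr_ge0 ?ltW ?g_gt0.
have mheat r : measurable_fun setT (fun q : R * R => heat r (q.2 - q.1)).
  have mk' : measurable_fun setT (heat r : R -> R).
    by apply: continuous_measurable_fun; exact: continuous_heat.
  by apply: (measurableT_comp mk'); exact: measurable_funB.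
pose f s x y := (chain eps l s x * (symbol_fun eps o x * heat (t - s) (y - x))%:E)%E.
have f0 s x y : (0 <= f s x y)%E.
  by rewrite mule_ge0 ?chain_ge0// lee_fin mulr_ge0 ?heat_ge0.
have mf s : measurable_fun setT (fun q : R * R => f s q.1 q.2).
  apply: emeasurable_funM.
    exact: (measurableT_comp (measurable_fun_section2 (measurable_chain eps l) s) measurable_fst).
  apply/measurable_EFinP; apply: measurable_funM => //.
  exact: (measurableT_comp mso measurable_fst).
pose F s y := (\int[mu]_x f s x y)%E.
have F0 s y : (0 <= F s y)%E by apply: integral_ge0.
have mF : measurable_fun setT (fun q : R * R => F q.1 q.2).
  apply: (@ge0_measurable_integral2 _ _ _ _ _ mu (fun (q : R * R) x => f q.1 x q.2)) => //.
  have m1 : measurable_fun setT (fun q : R * R * R => q.1.1).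
    by apply: (measurableT_comp measurable_fst); exact: measurable_fst.
  have m2 : measurable_fun setT (fun q : R * R * R => q.1.2).
    by apply: (measurableT_comp measurable_snd); exact: measurable_fst.
  have m3 : measurable_fun setT (fun q : R * R * R => q.2) by exact: measurable_snd.
  apply: emeasurable_funM.
    exact: (measurableT_comp (measurable_chain eps l) (measurable_fun_pair m1 m3)).
  apply/measurable_EFinP; apply: measurable_funM; first exact: (measurableT_comp mso).
  apply: (measurableT_comp (@measurable_heat R) (measurable_fun_pair _ _)).
    exact: measurable_funB.
  exact: measurable_funB.
have mFs s : measurable_fun setT (F s) by exact: (measurable_fun_section2 mF).
have step s : 0 < s -> s < t ->
  (\int[P]_w (H (X t w) * (symbol_fun eps o (X s w))%:E * path_integral X eps l s w) =
   \int[mu]_y (F s y * k y))%E.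
  move=> s0 st; have Vs : V s := V_le st Vt.
  rewrite (@path_integral_congr _ _ _ _ (fun w => K s (X s w) * (symbol_fun eps o (X s w))%:E)%E)//.
  - have mKs : measurable_fun setT (fun x => K s x * (symbol_fun eps o x)%:E)%E.
      by apply: emeasurable_funM; [exact: mK|exact/measurable_EFinP].
    rewrite (IH s (fun x => K s x * (symbol_fun eps o x)%:E)%E)//; last first.
      by move=> x; rewrite mule_ge0 ?K0// lee_fin.
    under [RHS]eq_integral => y _.
      rewrite -ge0_integralZr//; last exact: (measurable_fun_section1 (mf s)).
      over.
    rewrite (@ge0_tonelli _ _ _ _ _ mu mu (fun y x => f s x y * k y)%E); last 2 first.
    + apply: emeasurable_funM; last exact: (measurableT_comp mk measurable_fst).
      exact: (measurableT_comp (mf s) (measurable_fun_pair measurable_snd measurable_fst)).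
    + by move=> y x; rewrite mule_ge0.
    apply: eq_integral => x _.
    transitivity (chain eps l s x * (symbol_fun eps o x * (g s x / g0))%:E * K s x)%E.
      by rewrite -[RHS]muleA; congr (_ * _)%E; rewrite [RHS]muleC [in RHS]EFinM [RHS]muleA.
    rewrite -ge0_integralZl; last 4 first.
    + exact: measurableT.
    + apply: emeasurable_funM; first exact: mH.
      by apply/measurable_EFinP; exact: (measurableT_comp (mp s) (pair1_measurable x)).
    + by move=> y _; rewrite mule_ge0// lee_fin p0.
    + rewrite mule_ge0 ?chain_ge0// lee_fin mulr_ge0//.
      by apply: divr_ge0; [exact/ltW/g_gt0|exact: ltW].
    apply: eq_integral => y _; rewrite /f /k muleACA [RHS]muleACA -!EFinM.
    congr (_ * _%:E)%E; rewrite /p; field.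
    by rewrite !gt_eqF// g_gt0.
  - by apply: emeasurable_funM; [exact: (measurableT_comp mH)|apply/measurable_EFinP; exact: (measurableT_comp mso)].
  - apply: emeasurable_funM; first exact: (measurableT_comp (mK s s0 st)).
    by apply/measurable_EFinP; exact: (measurableT_comp mso).
  - by move=> w; rewrite mule_ge0// lee_fin.
  - by move=> w; rewrite mule_ge0 ?K0// lee_fin.
  move=> c cs; have := @markov s t H ((s, symbol_fun eps o) :: c) s0 st Vt mH H0.
  under eq_integral do rewrite cylinder_cons/= EFinM muleA.
  under [X in (_ -> _ = X) -> _]eq_integral do rewrite cylinder_cons/= EFinM muleA.
  apply; split => //=; first by rewrite lexx ltW.
  exact: bounded_nonneg_symbol_fun.
rewrite path_integral_fubini//; last exact: (measurableT_comp mH).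
(* Outside of [0 < s < t] the right integrand vanishes by itself, since a heat kernel has a
   nonpositive time. *)
transitivity (\int[mu]_s \int[mu]_y (F s y * k y))%E.
  apply: eq_integral => s _; have [/andP[s0 st]|st] := boolP (0 < s < t).
    by rewrite mul1e step.
  rewrite mul0e integral0_eq// => y _; rewrite /F integral0_eq ?mul0e// => x _.
  move: st; rewrite negb_and -!leNgt => /orP[s0|st]; rewrite /f.
    by rewrite chain_le0 ?mul0e.
  by rewrite heat_le0 ?subr_le0// mulr0 mule0.
rewrite (@ge0_tonelli _ _ _ _ _ mu mu (fun s y => F s y * k y)%E); last 2 first.
- by apply: emeasurable_funM => //; exact: (measurableT_comp mk measurable_snd).
- by move=> s y; rewrite mule_ge0.
apply: eq_integral => y _; rewrite chain_consE// ge0_integralZr//.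
exact: (measurable_fun_section1 mF).
Qed.

End path_integral_law.

Section clamped.
Local Open Scope ring_scope.
Context (R : realType) d (T : measurableType d).

Definition clamped (X : R -> T -> R) (t : R) := X (clamp01 t).

Lemma clamped_id X t : 0 <= t <= 1 -> clamped X t = X t.
Proof. by move=> t01; rewrite /clamped clamp01_id. Qed.

Lemma cylinder_clamped X (S : set R) c : (forall r, S r -> 0 <= r <= 1) ->
  cylinder_in S c -> cylinder (clamped X) c =1 cylinder X c.
Proof.
move=> S01; elim: c => [_ w|p c IH [/S01 Sp _ /IH h] w]; first by rewrite !cylinder_nil.
by rewrite !cylinder_cons h clamped_id.
Qed.

End clamped.

Section auxiliary.
Local Open Scope ring_scope.
Context (R : realType).

Lemma integral_ae_eq0_comp d (T : measurableType d) (P : probability T R)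
    (Y : T -> R) (k : R -> \bar R) : {ae P, forall w, Y w = 0} ->
  measurable_fun setT Y -> measurable_fun setT k -> (forall x, 0 <= k x)%E ->
  (\int[P]_w k (Y w) = k 0%R)%E.
Proof.
move=> Y0 mY mk k0; rewrite -[RHS](probability_integral_cst P).
apply: ge0_ae_eq_integral => //; first exact: (measurableT_comp mk).
  by move=> w _; exact: k0.
by apply: filterS Y0 => w + _ => ->.
Qed.

Lemma measurable_heat_at (t : R) : measurable_fun setT (heat t : R -> R).
Proof. by apply: continuous_measurable_fun; exact: continuous_heat. Qed.

Lemma measurable_chain_integrand eps (o : symbol R) l (t y : R) :
  measurable_fun setT (fun q : R * R => chain eps l q.1 q.2 *
    (symbol_fun eps o q.2 * heat (t - q.1) (y - q.2))%:E)%E.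
Proof.
apply: emeasurable_funM; first exact: measurable_chain.
apply/measurable_EFinP; apply: measurable_funM.
  exact: (measurableT_comp (measurable_symbol_fun eps o) measurable_snd).
apply: (measurableT_comp (@measurable_heat R) (measurable_fun_pair _ _)).
  exact: measurable_funB.
exact: measurable_funB.
Qed.

Lemma chain_integrand_ge0 eps (o : symbol R) l (t y s x : R) : 0 <= eps ->
  (0 <= chain eps l s x * (symbol_fun eps o x * heat (t - s) (y - x))%:E)%E.
Proof.
by move=> e0; rewrite mule_ge0 ?chain_ge0// lee_fin mulr_ge0 ?symbol_fun_ge0 ?heat_ge0.
Qed.

End auxiliary.

(** * The bridge and Brownian motion as h-transforms *)

Section bridge_path_integral.
Local Open Scope ring_scope.
Context (R : realType) d (T : measurableType d) (P : probability T R).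
Notation mu := (@lebesgue_measure R).
Variable b : R -> {RV P >-> R}.
Hypothesis hb : is_brownian_bridge b.
Notation X := (clamped (fun t => b t : T -> R)).

Lemma measurable_clamped_bridge : measurable_fun setT (fun p : R * T => X p.1 p.2).
Proof.
apply: (@measurable_continuous_process _ _ _ (fun t => b t : T -> R)) => //.
exact: bridge_continuous hb.
Qed.

(** The left side is the transition density of the bridge as it comes from the independent increment
    of [b t / (1 - t)]: a Gaussian of variance [(t - s) (1 - t) / (1 - s)]. Completing the square
    exhibits it as the h-transform of the heat kernel by [heat (1 - t) y]. *)
Lemma heat_bridge (s t x y : R) : 0 <= s -> s < t -> t < 1 ->
  heat ((1 - t) ^+ 2 * bridge_variance s t) (y - (1 - t) * ((1 - s)^-1 * x)) =
  heat (t - s) (y - x) * heat (1 - t) y / heat (1 - s) x.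
Proof.
move=> s0 st t1; have s1 : s < 1 := lt_trans st t1.
have a0 : 0 < t - s by rewrite subr_gt0.
have b0 : 0 < 1 - t by rewrite subr_gt0.
have c0 : 0 < 1 - s by rewrite subr_gt0.
have k0 : 0 < pi *+ 2 :> R by rewrite mulrn_wgt0// pi_gt0.
have vE : (1 - t) ^+ 2 * bridge_variance s t = (t - s) * (1 - t) / (1 - s).
  by rewrite /bridge_variance; field; rewrite !gt_eqF.
have v0 : 0 < (t - s) * (1 - t) / (1 - s) by rewrite divr_gt0 ?mulr_gt0.
have h0 : heat (1 - s) x != 0 by rewrite gt_eqF// heat_gt0.
apply: (mulIf h0); rewrite divfK// vE /heat mulrACA [RHS]mulrACA -!invfM.
rewrite -(sqrtrM _ (ltW (mulr_gt0 v0 k0))) -(sqrtrM _ (ltW (mulr_gt0 a0 k0))) -!expRD.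
congr ((Num.sqrt _)^-1 * expR _).
  by field; rewrite gt_eqF.
by field; rewrite !gt_eqF.
Qed.

Lemma bridge_markov (s t : R) (H : R -> \bar R) c : 0 <= s -> s < t -> t < 1 ->
  measurable_fun setT H -> (forall x, 0 <= H x)%E ->
  cylinder_in [set r | 0 <= r <= s] c ->
  (\int[P]_w (H (X t w) * (cylinder X c w)%:E) =
   \int[P]_w (\int[mu]_y (H y * (heat (t - s) (y - X s w) * heat (1 - t) y / heat (1 - s) (X s w))%:E) *
     (cylinder X c w)%:E))%E.
Proof.
move=> s0 st t1 mH H0 cs; have s1 : s < 1 := lt_trans st t1.
have t0 : 0 < t := le_lt_trans s0 st.
have s01 : 0 <= s <= 1 by rewrite s0 ltW.
have t01 : 0 <= t <= 1 by rewrite !ltW.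
have cE : cylinder X c =1 cylinder (fun t => b t : T -> R) c.
  apply: cylinder_clamped cs => r /= /andP[-> rs] /=.
  exact: le_trans rs (ltW s1).
(* The value [b t] is recovered from [b s] and the increment as
   [(1 - t) * ((1 - s)^-1 * b s + increment)]. *)
pose Phi x y := H ((1 - t) * ((1 - s)^-1 * x + y)).
have mPhi : measurable_fun setT (fun p : R * R => Phi p.1 p.2).
  apply: (measurableT_comp mH); apply: measurable_funM => //; apply: measurable_funD => //.
  by apply: measurable_funM => //.
have v0 : 0 < bridge_variance s t.
  rewrite /bridge_variance -subr_gt0 !subr0.
  have -> : t / (1 - t) - s / (1 - s) = (t - s) / ((1 - t) * (1 - s)).
    by field; rewrite !gt_eqF ?subr_gt0.
  by rewrite divr_gt0 ?mulr_gt0 ?subr_gt0.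
have := @markov_cylinder _ _ _ P (fun t => b t : T -> R) _ [set r | 0 <= r <= s]
  (bridge_increment b s t) _ (bridge_variance s t) (ltW v0)
  (@bridge_fourier_increment _ _ _ _ _ hb _ _ s0 st t1) c s Phi cs _ mPhi _.
move=> /(_ _ _ _ _)/wrap[] //.
- exact: measurable_bridge_increment.
- by rewrite /= s0 lexx.
- by move=> x y; exact: H0.
move=> E; transitivity (\int[P]_w (Phi (b s w) (bridge_increment b s t w) *
    (cylinder (fun t => b t : T -> R) c w)%:E))%E.
  apply: eq_integral => w _; rewrite cE clamped_id//; congr (H _ * _)%E.
  rewrite /bridge_increment [X in _ = (_ * X)%R]addrC subrK mulVKf//.
  by rewrite subr_eq0 gt_eqF.
rewrite E; apply: eq_integral => w _; rewrite cE; congr (_ * _)%E.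
have t1' : 0 < 1 - t by rewrite subr_gt0.
rewrite (normal_heat_change _ v0 t1' mH H0); apply: eq_integral => y _.
by rewrite heat_bridge// clamped_id.
Qed.

(** The definition of the bridge does not name its value at time [0]; it follows from the
    covariance, since the second moment of [b 0] is [min 0 0 - 0 * 0]. *)
Lemma bridge_start : {ae P, forall w, X 0 w = 0}.
Proof.
have h01 : 0 <= (0 : R) <= 1 by rewrite lexx ler01.
rewrite clamped_id//.
have iq := bridge_sqr_integrable hb h01.
have E : (\int[P]_w `|((b 0 w) ^+ 2)%:E| = 0)%E.
  under eq_integral do rewrite gee0_abs ?lee_fin ?sqr_ge0//.
  have := bridge_covE hb h01 h01; rewrite mul0r subr0 minxx.
  rewrite /Rintegral; under eq_integral do rewrite -expr2.
  by move=> h; rewrite -(fineK (integrable_fin_num measurableT iq)) [X in X%:E]h.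
move/(ae_eq_integral_abs P measurableT (measurable_int _ iq)) : E.
apply: filterS => w /(_ I)/= /eqP.
by rewrite eqe sqrf_eq0 => /eqP.
Qed.

Lemma bridge_marginal (t : R) (H : R -> \bar R) : 0 < t -> t < 1 ->
  measurable_fun setT H -> (forall x, 0 <= H x)%E ->
  (\int[P]_w H (X t w) = \int[mu]_y (H y * (heat t y * heat (1 - t) y / heat 1 0)%:E))%E.
Proof.
move=> t0 t1 mH H0; have := @bridge_markov 0 t H [::] (lexx 0) t0 t1 mH H0 I.
under eq_integral do rewrite cylinder_nil mule1.
under [X in _ = X -> _]eq_integral do rewrite cylinder_nil mule1.
move=> ->.
pose G (x y : R) := (H y * (heat (t - 0) (y - x) * heat (1 - t) y / heat (1 - 0) x)%:E)%E.
have G0 x y : (0 <= G x y)%E by rewrite mule_ge0// lee_fin divr_ge0 ?mulr_ge0 ?heat_ge0.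
have mh := @measurable_heat_at R.
have mG : measurable_fun setT (fun q : R * R => G q.1 q.2).
  apply: emeasurable_funM; first exact: (measurableT_comp mH measurable_snd).
  apply/measurable_EFinP; apply: measurable_funM.
    apply: measurable_funM; last exact: (measurableT_comp (mh _) measurable_snd).
    by apply: (measurableT_comp (mh _)); exact: measurable_funB.
  apply: (measurableT_comp (@measurable_invr R)).
  exact: (measurableT_comp (mh _) measurable_fst).
rewrite (@integral_ae_eq0_comp _ _ _ P (X 0) (fun x => \int[mu]_y G x y)%E bridge_start).
- by apply: eq_integral => y _; rewrite /G !subr0.
- exact: (measurable_process measurable_clamped_bridge 0).
- exact: (ge0_measurable_integral2 mu mG G0).
- by move=> x; apply: integral_ge0.
Qed.

(** The h-transform by [heat (1 - t)] degenerates at time [1], so [path_integral_law] is applied at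
    the time [s < 1] of the latest symbol. There the factor [heat (1 - s) x / heat 1 0] supplies the
    last kernel of the chain, which closes it at [0]. This is why the list is nonempty. *)
Lemma bridge_path_integral eps o l : 0 < eps ->
  (\int[P]_w path_integral X eps (o :: l) 1 w = chain eps (o :: l) 1 0 * ((heat 1 0)^-1)%:E)%E.
Proof.
move=> e0; have mX := measurable_clamped_bridge.
have e0' := ltW e0.
have h0 : 0 < heat 1 0 :> R by rewrite heat_gt0.
have mheat (r : R) : measurable_fun setT (heat r : R -> R).
  by apply: continuous_measurable_fun; exact: continuous_heat.
have mso := measurable_symbol_fun eps o.
have := @path_integral_fubini _ _ _ P _ mX eps o l 1 _ e0' (measurable_cst 1%E) (fun=> lee01).
under eq_integral do rewrite mul1e; move=> ->.
rewrite chain_consE// -ge0_integralZr//; last 3 first.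
- apply: (ge0_measurable_integral2 mu (measurable_chain_integrand eps o l 1 0)) => s x.
  exact: chain_integrand_ge0.
- by move=> s _; apply: integral_ge0 => x _; exact: chain_integrand_ge0.
- by rewrite lee_fin invr_ge0 ltW.
apply: eq_integral => s _; have [/andP[s0 s1]|st] := boolP (0 < s < 1); last first.
  rewrite mul0e integral0_eq ?mul0e// => x _.
  move: st; rewrite negb_and -!leNgt => /orP[s0|st].
    by rewrite chain_le0 ?mul0e.
  by rewrite heat_le0 ?subr_le0// mulr0 mule0.
rewrite mul1e; under eq_integral do rewrite mul1e.
rewrite (@path_integral_law _ _ _ P X mX (fun t => t < 1) (fun t y => heat (1 - t) y) (heat 1 0)
  (fun s t => @lt_trans _ _ t s 1) _ h0 _ bridge_marginal _ eps l s (fun x => (symbol_fun eps o x)%:E))//.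
- rewrite -ge0_integralZr//; last 3 first.
  + exact: (measurableT_comp (measurable_chain_integrand eps o l 1 0) (pair1_measurable s)).
  + by move=> x _; exact: chain_integrand_ge0.
  + by rewrite lee_fin invr_ge0 ltW.
  apply: eq_integral => x _; rewrite sub0r heatN -muleA -!EFinM; congr (_ * _%:E)%E.
  by rewrite mulrA.
- by move=> r y r1; rewrite heat_gt0// subr_gt0.
- move=> r u H c r0 ru u1; apply: bridge_markov => //; exact: ltW.
- exact/measurable_EFinP.
- by move=> x; rewrite lee_fin symbol_fun_ge0.
Qed.

End bridge_path_integral.

Section brownian_path_integral.
Local Open Scope ring_scope.
Context (R : realType) d (T : measurableType d) (P : probability T R).
Notation mu := (@lebesgue_measure R).
Variable B : R -> {RV P >-> R}.
Hypothesis hB : is_brownian_motion B.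
Notation X := (clamped (fun t => B t : T -> R)).

Lemma measurable_clamped_brownian : measurable_fun setT (fun p : R * T => X p.1 p.2).
Proof.
apply: (@measurable_continuous_process _ _ _ (fun t => B t : T -> R)) => // w.
have := @bm_continuous _ _ _ _ _ hB w; apply: continuous_subspaceW => x /=.
by rewrite !in_itv/= andbT => /andP[].
Qed.

(** The factors [1] are the trivial h-transform, in the shape that [path_integral_law] expects. In
    contrast to the bridge, the end time [1] is allowed. *)
Lemma brownian_markov (s t : R) (H : R -> \bar R) c : 0 <= s -> s < t -> t <= 1 ->
  measurable_fun setT H -> (forall x, 0 <= H x)%E ->
  cylinder_in [set r | 0 <= r <= s] c ->
  (\int[P]_w (H (X t w) * (cylinder X c w)%:E) =
   \int[P]_w (\int[mu]_y (H y * (heat (t - s) (y - X s w) * 1 / 1)%:E) *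
     (cylinder X c w)%:E))%E.
Proof.
move=> s0 st t1 mH H0 cs; have s1 : s < 1 := lt_le_trans st t1.
have t0 : 0 < t := le_lt_trans s0 st.
have s01 : 0 <= s <= 1 by rewrite s0 ltW.
have t01 : 0 <= t <= 1 by rewrite t1 ltW.
have cE : cylinder X c =1 cylinder (fun t => B t : T -> R) c.
  apply: cylinder_clamped cs => r /= /andP[-> rs] /=.
  exact: le_trans rs (ltW s1).
pose Phi x y := H (1 * (x + y)).
have mPhi : measurable_fun setT (fun p : R * R => Phi p.1 p.2).
  apply: (measurableT_comp mH); apply: measurable_funM => //; exact: measurable_funD.
have v0 : 0 < t - s by rewrite subr_gt0.
have := @markov_cylinder _ _ _ P (fun t => B t : T -> R) _ [set r | 0 <= r <= s]
  (fun w => B t w - B s w) _ (t - s) (ltW v0)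
  (@brownian_fourier_increment _ _ _ _ _ hB _ _ s0 st) c s Phi cs _ mPhi _.
move=> /(_ _ _ _ _)/wrap[] //.
- exact: measurable_funB.
- by rewrite /= s0 lexx.
- by move=> x y; exact: H0.
move=> E; transitivity (\int[P]_w (Phi (B s w) (B t w - B s w)%R *
    (cylinder (fun t => B t : T -> R) c w)%:E))%E.
  apply: eq_integral => w _; rewrite cE clamped_id//; congr (H _ * _)%E.
  by rewrite mul1r addrC subrK.
rewrite E; apply: eq_integral => w _; rewrite cE; congr (_ * _)%E.
rewrite normal_heat_change//; apply: eq_integral => y _.
by rewrite expr1n !mul1r clamped_id// mulr1 divr1.
Qed.

Lemma brownian_marginal (t : R) (H : R -> \bar R) : 0 < t -> t <= 1 ->
  measurable_fun setT H -> (forall x, 0 <= H x)%E ->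
  (\int[P]_w H (X t w) = \int[mu]_y (H y * (heat t y * 1 / 1)%:E))%E.
Proof.
move=> t0 t1 mH H0; have := @brownian_markov 0 t H [::] (lexx 0) t0 t1 mH H0 I.
under eq_integral do rewrite cylinder_nil mule1.
under [X in _ = X -> _]eq_integral do rewrite cylinder_nil mule1.
move=> ->.
pose G (x y : R) := (H y * (heat (t - 0) (y - x) * 1 / 1)%:E)%E.
have G0 x y : (0 <= G x y)%E by rewrite mule_ge0// lee_fin mulr1 divr1 heat_ge0.
have mh := @measurable_heat_at R.
have mG : measurable_fun setT (fun q : R * R => G q.1 q.2).
  apply: emeasurable_funM; first exact: (measurableT_comp mH measurable_snd).
  apply/measurable_EFinP; do 2 apply: measurable_funM => //.
  by apply: (measurableT_comp (mh _)); exact: measurable_funB.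
rewrite (@integral_ae_eq0_comp _ _ _ P (X 0) (fun x => \int[mu]_y G x y)%E).
- by apply: eq_integral => y _; rewrite /G !subr0.
- by rewrite clamped_id ?lexx ?ler01//; exact: bm_start hB.
- exact: (measurable_process measurable_clamped_brownian 0).
- exact: (ge0_measurable_integral2 mu mG G0).
- by move=> x; apply: integral_ge0.
Qed.

Lemma brownian_path_integral eps l (H : R -> \bar R) : 0 < eps ->
  measurable_fun setT H -> (forall x, 0 <= H x)%E ->
  (\int[P]_w (H (B 1 w) * path_integral X eps l 1 w) =
   \int[mu]_y (chain eps l 1 y * H y))%E.
Proof.
move=> e0 mH H0.
have := @path_integral_law _ _ _ P X measurable_clamped_brownian (fun t => t <= 1) (fun t y => 1) 1
  (fun s t st t1 => le_trans (ltW st) t1) (fun _ _ _ => ltr01) ltr01 (fun=> measurable_cst _) brownian_marginal _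
  eps l 1 H e0 ltr01 (lexx 1) mH H0.
move=> /(_ _)/wrap[].
  by move=> s t K c s0; apply: brownian_markov; exact: ltW.
rewrite clamped_id ?lexx ?ler01// => ->; apply: eq_integral => y _.
by rewrite divr1 mule1.
Qed.

End brownian_path_integral.

(** * Convolutions of heat kernels *)

Section square_substitution.
Local Open Scope ring_scope.
Context (R : realType).
Notation mu := (@lebesgue_measure R).

Definition unit_ind (s : R) : R := (0 < s <= 1)%R%:R.

Lemma measurable_itv_ind (a b : R) : measurable_fun setT (fun s : R => (a < s <= b)%R%:R : R).
Proof.
have mn : measurable_fun setT (fun c : bool => c%:R : R) by [].
apply: (measurableT_comp mn); apply: measurable_and; last exact: measurable_fun_ler.
exact: measurable_fun_ltr.
Qed.

Lemma clamp01_ltE (a s : R) : 0 < s <= 1 -> (clamp01 a < s) = (a < s).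
Proof.
by move=> /andP[s0 s1]; rewrite /clamp01 gt_max s0 gt_min [1 < s]ltNge s1.
Qed.

Lemma clamp01_geE (a s : R) : 0 < s <= 1 -> (s <= clamp01 a) = (s <= a).
Proof.
by move=> /andP[s0 s1]; rewrite /clamp01 le_max le_min s1 [s <= 0]leNgt s0.
Qed.

Lemma clamp01_le (a b : R) : a <= b -> clamp01 a <= clamp01 b.
Proof.
move=> ab; rewrite /clamp01 ge_max; apply/andP; split; first by rewrite le_max lexx.
by rewrite le_max; apply/orP; right; rewrite le_min !ge_min lexx ab orbT.
Qed.

Lemma integral_2v (p q : R) : 0 <= p -> p <= q ->
  (\int[mu]_(v in `]p, q]) (2 * v)%:E = (q ^+ 2 - p ^+ 2)%:E)%E.
Proof.
move=> p0; rewrite le_eqVlt => /predU1P[<-|pq].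
  by rewrite set_itvoc0 integral_set0 subrr.
have c2 : continuous (fun v : R => 2 * v).
  by move=> v; apply: cvgM; [exact: cvg_cst|exact: cvg_id].
rewrite integral_itv_obnd_cbnd; last first.
  by apply/measurable_EFinP; apply: measurable_funTS; exact: continuous_measurable_fun.
rewrite (@continuous_FTC2 _ (fun v => 2 * v) (fun v => v ^+ 2) p q pq)//.
- exact: continuous_subspaceT.
- have cx : continuous (fun v : R => v ^+ 2) by exact: exprn_continuous.
  split; first by move=> x _; exact: exprn_derivable.
    by apply: cvg_at_right_filter; exact: cx.
  by apply: cvg_at_left_filter; exact: cx.
- move=> x _; rewrite derive1E derive_val.
  by rewrite /= -[LHS]/(x * 1 + x * 1); ring.
Qed.

Lemma mem_itvoc (a b s : R) : (s \in (`]a, b]%classic : set R)) = (a < s <= b).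
Proof. by apply/idP/idP; rewrite inE /= in_itv. Qed.

Lemma integral_unit_ind (a b : R) : a <= b ->
  (\int[mu]_(s in `]a, b]) (unit_ind s)%:E = (clamp01 b - clamp01 a)%:E)%E.
Proof.
move=> ab; transitivity (\int[mu]_(s in `]clamp01 a, clamp01 b]) (cst 1%E) s)%E.
  rewrite integral_mkcond [RHS]integral_mkcond; apply: eq_integral => s _.
  rewrite !patchE !mem_itvoc /unit_ind; have [s01|s01] := boolP (0 < s <= 1).
    by rewrite clamp01_ltE// clamp01_geE.
  rewrite if_same; case: ifPn => // /andP[as_ sb]; case/negP: s01.
  have /andP[a0 _] := clamp01_itv a; have /andP[_ b1] := clamp01_itv b.
  by rewrite (le_lt_trans a0 as_) (le_trans sb b1).
rewrite integral_cst//= mul1e; have := clamp01_le ab.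
rewrite le_eqVlt lebesgue_measure_itv/= lte_fin => /predU1P[->|->//].
by rewrite ltxx subrr.
Qed.

Lemma integral_square_unit_ind (a b : R) : a <= b ->
  (\int[mu]_(v in (fun v : R => (v ^+ 2)%R) @^-1` `]a, b]%classic) (unit_ind v * (2 * v))%:E =
   (clamp01 b - clamp01 a)%:E)%E.
Proof.
move=> ab; have /andP[a0 a1] := clamp01_itv a; have /andP[b0 b1] := clamp01_itv b.
transitivity (\int[mu]_(v in `]Num.sqrt (clamp01 a), Num.sqrt (clamp01 b)]) (2 * v)%:E)%E; last first.
  by rewrite integral_2v ?sqrtr_ge0// ?ler_wsqrtr ?clamp01_le// !sqr_sqrtr.
rewrite integral_mkcond [RHS]integral_mkcond; apply: eq_integral => v _.
have -> : forall F, (F \_ ((fun v : R => (v ^+ 2)%R) @^-1` `]a, b]%classic)) v =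
    if a < v ^+ 2 <= b then F v else 0%E :> \bar R.
  move=> F; rewrite patchE; congr (if _ then _ else _).
  by apply/idP/idP; rewrite inE /= in_itv.
rewrite patchE mem_itvoc /unit_ind; have [v01|v01] := boolP (0 < v <= 1).
  have /andP[v0 v1] := v01.
  have w01 : 0 < v ^+ 2 <= 1 by rewrite exprn_gt0// exprn_ile1// ltW.
  rewrite mul1r -(clamp01_ltE a w01) -(clamp01_geE b w01).
  have vE : Num.sqrt (v ^+ 2) = v by rewrite sqrtr_sqr gtr0_norm.
  by rewrite -{4}vE -{5}vE ltr_sqrt ?exprn_gt0// ler_sqrt.
rewrite mul0r if_same; case: ifPn => // /andP[av vb]; case/negP: v01.
rewrite (le_lt_trans (sqrtr_ge0 _) av) (le_trans vb)//.
by rewrite -[leRHS]sqrtr1 ler_wsqrtr.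
Qed.

(** The substitution [s = v ^+ 2] on []0, 1]], which removes a singularity of order [s^(-1/2)]. It
    is proved for measures: [ds] and the image of [2 v dv] give the same mass to each []a, b]],
    whose bounds are first clamped to the unit interval. *)
Lemma ge0_integral_square (G : R -> \bar R) : measurable_fun setT G -> (forall x, 0 <= G x)%E ->
  (\int[mu]_s (G s * (unit_ind s)%:E) =
   \int[mu]_v (G (v ^+ 2)%R * (unit_ind v * (2 * v))%:E))%E.
Proof.
move=> mG G0.
have mu1 : measurable_fun setT unit_ind := measurable_itv_ind 0 1.
have m2 : measurable_fun setT (fun v : R => unit_ind v * (2 * v)).
  by apply: measurable_funM => //; exact: measurable_funM.
have u0 s : 0 <= unit_ind s by [].
have g0 v : 0 <= unit_ind v * (2 * v).
  by rewrite /unit_ind; case: ltP => //= v0; rewrite ?mul0r// mulr_ge0// mulr_ge0// ltW.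
pose sq := fun v : R => v ^+ 2 : measurableTypeR R.
have msq : measurable_fun [set: R] sq by exact: measurable_funX.
pose m : {measure set (measurableTypeR R) -> \bar R} := wmeasure mu mu1 u0.
pose n : {measure set (measurableTypeR R) -> \bar R} := wmeasure mu m2 g0.
have mn A : measurable A -> m A = pushforward n sq A.
  apply: (@eq_finite_measure_itv _ m (pushforward n sq)) => [|a b ab].
    rewrite /m/= /wmeasure.
    apply: (@le_lt_trans _ _ (\int[mu]_s (unit_ind s)%:E)%E); first by [].
    have := integral_unit_ind ler01; rewrite integral_mkcond.
    under eq_integral => s _.
      rewrite patchE mem_itvoc (_ : (if _ then _ else _) = (unit_ind s)%:E); last first.
        by case: ifPn => // /negbTE s01; rewrite /unit_ind s01.
      over.
    by move=> ->; rewrite ltry.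
  rewrite /m /= /pushforward /n /= /wmeasure integral_unit_ind//.
  by rewrite integral_square_unit_ind.
transitivity (\int[m]_s G s)%E.
  by rewrite (@ge0_integral_density _ _ _ mu m unit_ind mu1 u0).
transitivity (\int[pushforward n sq]_s G s)%E.
  by apply: eq_measure_integral => //= A mA _; exact: mn.
rewrite ge0_integral_pushforward// preimage_setT.
rewrite (@ge0_integral_density _ _ _ mu n _ m2 g0)// => [|v]; last exact: G0.
exact: (measurableT_comp mG msq).
Qed.

End square_substitution.

Section convolution.
Local Open Scope ring_scope.
Context (R : realType).
Notation mu := (@lebesgue_measure R).
Implicit Types f g h : R -> \bar R.

(** The integral runs over the whole line, so that commutativity and associativity follow from
    invariance under reflection and translation. For functions vanishing at nonpositive times it is
    the usual convolution on [[0, t]]. *)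
Definition conv f g (t : R) : \bar R := (\int[mu]_s (f s * g (t - s)%R))%E.

Lemma conv_ge0 f g t : (forall s, 0 <= f s)%E -> (forall s, 0 <= g s)%E -> (0 <= conv f g t)%E.
Proof. by move=> f0 g0; apply: integral_ge0 => s _; rewrite mule_ge0. Qed.

Lemma measurable_conv_integrand f g : measurable_fun setT f -> measurable_fun setT g ->
  measurable_fun setT (fun q : R * R => f q.2 * g (q.1 - q.2)%R)%E.
Proof.
move=> mf mg; apply: emeasurable_funM; first exact: (measurableT_comp mf measurable_snd).
apply: (measurableT_comp mg); exact: measurable_funB.
Qed.

Lemma measurable_conv f g : measurable_fun setT f -> measurable_fun setT g ->
  (forall s, 0 <= f s)%E -> (forall s, 0 <= g s)%E -> measurable_fun setT (conv f g).
Proof.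
move=> mf mg f0 g0.
apply: (ge0_measurable_integral2 mu (measurable_conv_integrand mf mg)) => t s.
by rewrite mule_ge0.
Qed.

Lemma convC f g t : measurable_fun setT f -> measurable_fun setT g ->
  (forall s, 0 <= f s)%E -> (forall s, 0 <= g s)%E -> conv f g t = conv g f t.
Proof.
move=> mf mg f0 g0; rewrite /conv -(@ge0_integral_reflect _ _ t).
- by apply: eq_integral => s _; rewrite subKr muleC.
- exact: (measurableT_comp (measurable_conv_integrand mf mg) (pair1_measurable t)).
- by move=> s; rewrite mule_ge0.
Qed.

Lemma convA f g h t : measurable_fun setT f -> measurable_fun setT g -> measurable_fun setT h ->
  (forall s, 0 <= f s)%E -> (forall s, 0 <= g s)%E -> (forall s, 0 <= h s)%E ->
  conv (conv f g) h t = conv f (conv g h) t.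
Proof.
move=> mf mg mh f0 g0 h0.
have mfg := measurable_conv_integrand mf mg.
have mgs (r : R) : measurable_fun setT (fun s : R => g (s - r)%R).
  by apply: (measurableT_comp mg); exact: measurable_funB.
have mht : measurable_fun setT (fun s : R => h (t - s)%R).
  by apply: (measurableT_comp mh); exact: measurable_funB.
transitivity (\int[mu]_s \int[mu]_r (f r * (g (s - r)%R * h (t - s)%R)))%E.
  apply: eq_integral => s _; rewrite /conv -ge0_integralZr//.
  - by apply: eq_integral => r _; rewrite muleA.
  - exact: (measurableT_comp mfg (pair1_measurable s)).
  - by move=> r _; rewrite mule_ge0.
rewrite (@ge0_tonelli _ _ _ _ _ mu mu (fun s r => f r * (g (s - r)%R * h (t - s)%R))%E); last 2 first.
- apply: emeasurable_funM; first exact: (measurableT_comp mf measurable_snd).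
  apply: emeasurable_funM; first by apply: (measurableT_comp mg); exact: measurable_funB.
  exact: (measurableT_comp mht measurable_fst).
- by move=> s r; rewrite !mule_ge0.
apply: eq_integral => r _; rewrite ge0_integralZl//; last 2 first.
- exact: emeasurable_funM (mgs r) mht.
- by move=> s _; rewrite mule_ge0.
congr (_ * _)%E; rewrite -(@ge0_integral_translate _ _ r); last 2 first.
- exact: emeasurable_funM (mgs r) mht.
- by move=> s; rewrite mule_ge0.
by apply: eq_integral => s _; rewrite addrK; congr (_ * h _)%E; ring.
Qed.

Lemma le_conv f f' g g' (t : R) : 
  measurable_fun setT f -> measurable_fun setT g ->
  measurable_fun setT f' -> measurable_fun setT g' ->
  (forall s, 0 <= f s)%E -> (forall s, 0 <= g s)%E ->
  (forall s, f s * g (t - s)%R <= f' s * g' (t - s)%R)%E -> (conv f g t <= conv f' g' t)%E.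
Proof.
move=> mf mg mf' mg' f0 g0 h; apply: ge0_le_integral => //.
- by move=> s _; rewrite mule_ge0.
- exact: (measurableT_comp (measurable_conv_integrand mf mg) (pair1_measurable t)).
- exact: (measurableT_comp (measurable_conv_integrand mf' mg') (pair1_measurable t)).
Qed.

Lemma conv_le0 f g t : (forall s, s <= 0 -> f s = 0%E) -> (forall s, s <= 0 -> g s = 0%E) ->
  t <= 0 -> conv f g t = 0%E.
Proof.
move=> f0 g0 t0; rewrite /conv integral0_eq// => s _.
have [s0|s0] := leP s 0; first by rewrite f0// mul0e.
by rewrite g0 ?mule0// subr_le0 (le_trans t0)// ltW.
Qed.

End convolution.

Section heat_convolution.
Local Open Scope ring_scope.
Context (R : realType).
Notation mu := (@lebesgue_measure R).

Definition heat0 (t : R) : \bar R := (heat t 0)%:E.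

Lemma unit_ind_ge0 (v : R) : (0 <= (unit_ind v)%:E)%E.
Proof. by rewrite lee_fin. Qed.

Definition step (t : R) : \bar R := ((0 < t)%R%:R)%:E.

Lemma heat0_ge0 t : (0 <= heat0 t)%E.
Proof. by rewrite lee_fin heat_ge0. Qed.

Lemma step_ge0 t : (0 <= step t)%E.
Proof. by rewrite lee_fin. Qed.

Lemma measurable_heat0 : measurable_fun setT heat0.
Proof.
apply/measurable_EFinP.
have m0 : measurable_fun setT (fun t : R => (t, 0) : R * R) by exact: measurable_fun_pair.
exact: (measurableT_comp (@measurable_heat R) m0).
Qed.

Lemma measurable_step : measurable_fun setT step.
Proof.
have mn : measurable_fun setT (fun c : bool => c%:R : R) by [].
by apply/measurable_EFinP; apply: (measurableT_comp mn); exact: measurable_fun_ltr.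
Qed.

Lemma heat0_le0 t : t <= 0 -> heat0 t = 0%E.
Proof. by move=> t0; rewrite /heat0 heat_le0. Qed.

Lemma step_le0 t : t <= 0 -> step t = 0%E.
Proof. by move=> t0; rewrite /step ltNge t0. Qed.

Lemma heat_at0 (t : R) : heat t 0 = (Num.sqrt (t * (pi *+ 2)))^-1.
Proof. by rewrite /heat expr0n oppr0 mul0r expR0 mulr1. Qed.

(** The common value, for all [v > 0], of [heat (t * v ^+ 2) 0 * (2 * v)]: the Jacobian of
    [s = t v^2] cancels the singularity of the kernel. *)
Definition heat0_scale (t : R) := 2 * heat t 0.

Lemma heat_square (t v : R) : 0 < t -> 0 < v -> heat (t * v ^+ 2) 0 * (2 * v) = heat0_scale t.
Proof.
move=> t0 v0; rewrite /heat0_scale !heat_at0 mulrAC sqrtrM; last first.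
  by apply: mulr_ge0; [exact: ltW|rewrite mulrn_wge0// pi_ge0].
rewrite sqrtr_sqr gtr0_norm// invfM; field.
by rewrite (gt_eqF v0) andbT gt_eqF// sqrtr_gt0 mulr_gt0// mulrn_wgt0// pi_gt0.
Qed.

(** Scaling by [t] followed by [u = v ^+ 2] trades the singular kernel for the constant
    [heat0_scale t]; as [k] vanishes at nonpositive times, the integral is confined to [v <= 1]. *)
Lemma conv_heat0 (k : R -> \bar R) t : 0 < t -> measurable_fun setT k ->
  (forall s, 0 <= k s)%E -> (forall s, s <= 0 -> k s = 0%E) ->
  conv heat0 k t = ((t * heat0_scale t)%:E *
    \int[mu]_v (k (t * (1 - v ^+ 2))%R * (unit_ind v)%:E))%E.
Proof.
move=> t0 mk k0 kn.
have mF : measurable_fun setT (fun s => heat0 s * k (t - s)%R)%E.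
  exact: (measurableT_comp (measurable_conv_integrand measurable_heat0 mk) (pair1_measurable t)).
have mk2 : measurable_fun setT (fun v : R => k (t * (1 - v ^+ 2))%R * (unit_ind v)%:E)%E.
  apply: emeasurable_funM; last by apply/measurable_EFinP; exact: measurable_itv_ind.
  apply: (measurableT_comp mk); apply: measurable_funM => //; exact: measurable_funB.
rewrite /conv (@ge0_integral_affine_pos _ _ t 0)//; last first.
  by move=> s; rewrite mule_ge0 ?heat0_ge0.
rewrite EFinM -muleA; congr (_ * _)%E.
transitivity (\int[mu]_u ((heat0 (t * u) * k (t - t * u)%R) * (unit_ind u)%:E))%E.
  apply: eq_integral => u _; rewrite addr0 /unit_ind.
  have [/= u0|u0] := ltP 0 u; last first.
    by rewrite heat0_le0 ?mul0e// mulr_ge0_le0// ltW.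
  have [u1|u1] := leP u 1; first by rewrite mule1.
  by rewrite kn ?mule0 ?mul0e// subr_le0 -{1}(mulr1 t) ler_pM2l// ltW.
rewrite (@ge0_integral_square _ (fun u => heat0 (t * u) * k (t - t * u)%R)%E); last 2 first.
- have mtu : measurable_fun setT (fun u : R => t * u) by exact: measurable_funM.
  exact: (measurableT_comp mF mtu).
- by move=> u; rewrite mule_ge0 ?heat0_ge0.
rewrite -ge0_integralZl//; last 2 first.
- by move=> v _; rewrite mule_ge0 ?unit_ind_ge0.
- by rewrite lee_fin mulr_ge0 ?heat_ge0.
apply: eq_integral => v _; rewrite /unit_ind.
have [/= v0|v0] := ltP 0 v; last by rewrite mul0r !mule0.
rewrite mulrBr mulr1 [in LHS]EFinM [(_%:E * (2 * v)%:E)%E]muleC muleACA /heat0 -EFinM.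
by rewrite heat_square.
Qed.

Lemma heat0_scaleE (t : R) : 0 < t -> t * heat0_scale t ^+ 2 = 2 / pi.
Proof.
move=> t0; rewrite /heat0_scale heat_at0 exprMn exprVn sqr_sqrtr; last first.
  by apply: mulr_ge0; [exact: ltW|rewrite mulrn_wge0// pi_ge0].
have p0 : pi != 0 :> R by rewrite gt_eqF// pi_gt0.
by move: pi p0 => p p0; rewrite -mulr_natr; field; rewrite p0 gt_eqF.
Qed.

Lemma heat0_scale_ge0 (t : R) : 0 <= heat0_scale t.
Proof. by rewrite mulr_ge0 ?heat_ge0. Qed.

Lemma mul_heat0_scale_le1 (t : R) : 0 < t -> t <= 1 -> t * heat0_scale t <= 1.
Proof.
move=> t0 t1; have x0 : 0 <= t * heat0_scale t by rewrite mulr_ge0 ?heat0_scale_ge0// ltW.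
rewrite -(ler_pXn2r (ltn0Sn 1)) ?nnegrE ?ler01// expr1n.
rewrite exprMn expr2 -mulrA heat0_scaleE// mulrA ler_pdivrMr ?pi_gt0// mul1r.
have := pi_ge2 R; lra.
Qed.

Lemma measurable_unit_ind : measurable_fun setT (fun v : R => (unit_ind v)%:E).
Proof. by apply/measurable_EFinP; exact: measurable_itv_ind. Qed.

Lemma integral_unit_ind1 : (\int[mu]_v (unit_ind v)%:E = 1)%E.
Proof.
have := integral_unit_ind (@ler01 R); rewrite integral_mkcond.
rewrite /clamp01 min_l// max_r// min_r// maxxx subr0 => <-.
apply: eq_integral => v _; rewrite patchE mem_itvoc.
by case: ifPn => // /negbTE v01; rewrite /unit_ind v01.
Qed.

Lemma conv_heat0_step_le (t : R) : t <= 1 -> (conv heat0 step t <= step t)%E.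
Proof.
move=> t1; have [t0|t0] := leP t 0.
  by rewrite conv_le0 ?step_ge0//; [exact: heat0_le0|exact: step_le0].
rewrite {2}/step t0 conv_heat0//; [|exact: measurable_step|exact: step_ge0|exact: step_le0].
rewrite -[leRHS]mule1; apply: lee_pmul.
- by rewrite lee_fin mulr_ge0 ?heat0_scale_ge0// ltW.
- by apply: integral_ge0 => v _; rewrite mule_ge0 ?step_ge0 ?unit_ind_ge0.
- by rewrite lee_fin mul_heat0_scale_le1.
rewrite -integral_unit_ind1; apply: ge0_le_integral => //.
- by move=> v _; rewrite mule_ge0 ?step_ge0 ?unit_ind_ge0.
- apply: emeasurable_funM; last exact: measurable_unit_ind.
  apply: (measurableT_comp measurable_step); apply: measurable_funM => //; exact: measurable_funB.
- exact: measurable_unit_ind.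
- by move=> v _; rewrite /step; case: ltP => _; rewrite ?mul1e ?mul0e ?unit_ind_ge0.
Qed.

Lemma heat0_le (s t : R) : 0 < s -> s <= t -> heat t 0 <= heat s 0.
Proof.
move=> s0 st; have k0 : 0 < pi *+ 2 :> R by rewrite mulrn_wgt0// pi_gt0.
have t0 := lt_le_trans s0 st.
rewrite !heat_at0 lef_pV2 ?posrE ?sqrtr_gt0 ?mulr_gt0//.
by rewrite ler_wsqrtr// ler_pM2r.
Qed.

(** The exact value for [t > 0] is [1 / 2]; the cruder bound [2 / pi] is derived here. The kernel
    decreases in time and [1 - v ^+ 2 >= 1 - v], so after a reflection the second singularity falls
    to the same substitution as the first. *)
Lemma conv_heat0_heat0_le (t : R) : (conv heat0 heat0 t <= step t)%E.
Proof.
have [t0|t0] := leP t 0.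
  by rewrite conv_le0 ?step_ge0//; exact: heat0_le0.
have c0 := heat0_scale_ge0 t.
rewrite /step t0 conv_heat0//; [|exact: measurable_heat0|exact: heat0_ge0|exact: heat0_le0].
have mt (k : R -> R) : measurable_fun setT k ->
    measurable_fun setT (fun v => heat0 (t * k v)%R * (unit_ind v)%:E)%E.
  move=> mk; apply: emeasurable_funM; last exact: measurable_unit_ind.
  by apply: (measurableT_comp measurable_heat0); exact: measurable_funM.
have B : (\int[mu]_v (heat0 (t * (1 - v ^+ 2))%R * (unit_ind v)%:E) <= (heat0_scale t)%:E)%E.
  apply: (@le_trans _ _ (\int[mu]_v (heat0 (t * v)%R * (unit_ind v)%:E))%E).
    rewrite -[leRHS](@ge0_integral_reflect _ _ 1); last 2 first.
    - by apply: (mt id).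
    - by move=> v; rewrite mule_ge0 ?heat0_ge0 ?unit_ind_ge0.
    apply: ge0_le_integral => //.
    - by move=> v _; rewrite mule_ge0 ?heat0_ge0 ?unit_ind_ge0.
    - apply: (mt (fun v => 1 - v ^+ 2)); apply: measurable_funB => //; exact: measurable_funX.
    - have m1 : measurable_fun setT (fun v : R => 1 - v) by exact: measurable_funB.
      exact: (measurableT_comp (mt id (@measurable_id _ _ _)) m1).
    - move=> v _; rewrite /unit_ind; have [/= v0|v0] := ltP 0 v; last first.
        by rewrite mule0 mule_ge0// heat0_ge0.
      have [v1|v1] := leP v 1; last by rewrite mule0 mule_ge0// heat0_ge0.
      rewrite mule1; have [->|v1'] := eqVneq v 1.
        by rewrite expr1n subrr mulr0 heat0_le0// mul0e.
      have {v1 v1'} v1 : v < 1 by rewrite lt_neqAle v1'.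
      have -> : (1 - v <= 1) = true by rewrite lerBlDr lerDl ltW.
      rewrite subr_gt0 v1 mule1 lee_fin heat0_le//.
        by rewrite mulr_gt0// subr_gt0.
      by rewrite ler_pM2l// lerB// expr2 ler_piMl// ltW.
  have mid : measurable_fun setT (fun v : R => heat0 (t * v)).
    by apply: (measurableT_comp measurable_heat0); exact: measurable_funM.
  rewrite (@ge0_integral_square _ (fun v => heat0 (t * v)))//; last by move=> v; exact: heat0_ge0.
  under eq_integral => v _.
    rewrite (_ : _ * _ = (heat0_scale t)%:E * (unit_ind v)%:E)%E; last first.
      rewrite /unit_ind; have [/= v0|v0] := ltP 0 v; last by rewrite mul0r !mule0.
      rewrite /heat0 -EFinM mulrCA -EFinM heat_square// mulrC.
      by [].
    over.
  rewrite ge0_integralZl//; first by rewrite integral_unit_ind1 mule1.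
  - exact: measurable_unit_ind.
  - by move=> v _; rewrite lee_fin.
apply: (le_trans (lee_wpmul2l _ B)); first by rewrite lee_fin mulr_ge0// ltW.
rewrite -EFinM -mulrA -expr2 heat0_scaleE// lee_fin ler_pdivrMr ?pi_gt0// mul1r.
exact: pi_ge2.
Qed.

Lemma conv_step_step_le (t : R) : t <= 1 -> (conv step step t <= step t)%E.
Proof.
move=> t1; have [t0|t0] := leP t 0.
  by rewrite conv_le0 ?step_ge0//; exact: step_le0.
rewrite [leRHS]/step t0 -integral_unit_ind1; apply: ge0_le_integral => //.
- by move=> v _; rewrite mule_ge0 ?step_ge0.
- exact: (measurableT_comp (measurable_conv_integrand measurable_step measurable_step) (pair1_measurable t)).
- exact: measurable_unit_ind.
move=> s _; rewrite /step /unit_ind -EFinM lee_fin subr_gt0.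
have [/= s0|s0] := ltP 0 s; last by rewrite mul0r.
have [st|st] := ltP s t; last by rewrite mulr0.
by rewrite (le_trans (ltW st) t1) mulr1.
Qed.

Lemma ge0_integral_even (phi : R -> \bar R) : measurable_fun setT phi -> (forall v, 0 <= phi v)%E ->
  (forall v, phi (- v)%R = phi v) -> (forall v, 1 < v -> phi v = 0%E) ->
  (\int[mu]_v phi v = 2%:E * \int[mu]_v (phi v * (unit_ind v)%:E))%E.
Proof.
move=> mphi phi0 phiN phi1.
have m1 : measurable_fun setT (fun v => phi v * (unit_ind v)%:E)%E.
  by apply: emeasurable_funM => //; exact: measurable_unit_ind.
have mN : measurable_fun setT (fun v : R => - v) by exact: oppr_measurable.
have m2 : measurable_fun setT (fun v : R => phi (- v)%R * (unit_ind (- v))%:E)%E.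
  exact: (measurableT_comp m1 mN).
have p1 v : (0 <= phi v * (unit_ind v)%:E)%E by rewrite mule_ge0 ?unit_ind_ge0.
transitivity (\int[mu]_v (phi v * (unit_ind v)%:E + phi (- v)%R * (unit_ind (- v))%:E))%E.
  apply: ge0_ae_eq_integral => //; first exact: emeasurable_funD.
    by move=> v _; rewrite adde_ge0.
  (* The two indicators together cover [[-1, 1]] up to the point [0], a null set. *)
  exists [set 0]; split; [exact: measurable_set1|exact: lebesgue_measure_set1|].
  move=> v /= /not_implyP[_]; apply: contra_notP => v0.
  rewrite phiN -ge0_muleDr ?unit_ind_ge0// -EFinD /unit_ind oppr_gt0 lerNl.
  have {v0} /eqP v0 : v <> 0 by [].
  have [v1|v1] := ltP 1 `|v|.
    have -> : phi v = 0%E.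
      move: v1; case: (ler0P v) => _ v1; last exact: phi1.
      by rewrite -phiN phi1.
    by rewrite mul0e.
  move: v1; rewrite ler_norml => /andP[-> ->]; move: v0; case: (ltgtP 0 v) => //= _ _.
    by rewrite addr0 mule1.
  by rewrite add0r mule1.
rewrite ge0_integralD//.
rewrite -(@ge0_integralN _ (fun v => phi v * (unit_ind v)%:E)%E)//.
by rewrite -mule2n -mule_natl.
Qed.

(* Both sides are [t * (2 pi t)^(-1/2)] times an integral over the unit interval:
   put [s = t v^2] on the left and [s = t (1 + v) / 2] on the right. *)
Lemma conv_heat_heat (x t : R) :
  conv (fun s => (heat s x)%:E) (fun s => (heat s x)%:E) t =
  conv heat0 (fun s => (heat s (2 * x))%:E) t.
Proof.
have mh (y : R) : measurable_fun setT (fun s : R => (heat s y)%:E).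
  have m0 : measurable_fun setT (fun t : R => (t, y) : R * R) by exact: measurable_fun_pair.
  by apply/measurable_EFinP; exact: (measurableT_comp (@measurable_heat R) m0).
have h0 (y s : R) : (0 <= (heat s y)%:E)%E by rewrite lee_fin heat_ge0.
have hn (y s : R) : s <= 0 -> (heat s y)%:E = 0%E by move=> s0; rewrite heat_le0.
have [t0|t0] := leP t 0.
  by rewrite !conv_le0//; [exact: heat0_le0|exact: hn|exact: hn|exact: hn].
rewrite conv_heat0//; last exact: hn.
have t2 : 0 < t / 2 by rewrite divr_gt0.
have mF := measurableT_comp (measurable_conv_integrand (mh x) (mh x)) (pair1_measurable t).
rewrite /conv (@ge0_integral_affine_pos _ _ (t / 2) (t / 2))//; last first.
  by move=> s; rewrite mule_ge0.
pose phi (v : R) := ((heat (t / 2 * v + t / 2) x)%:E * (heat (t - (t / 2 * v + t / 2)) x)%:E)%E.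
have mphi : measurable_fun setT phi.
  have ma : measurable_fun setT (fun v : R => t / 2 * v + t / 2).
    by apply: measurable_funD => //; exact: measurable_funM.
  exact: (measurableT_comp mF ma).
rewrite (@ge0_integral_even phi mphi); last 3 first.
- by move=> v; rewrite mule_ge0.
- by move=> v; rewrite /phi muleC; congr ((heat _ x)%:E * (heat _ x)%:E)%E; field.
- move=> v v1; rewrite /phi [X in (_ * X)%E]hn ?mule0//.
  have -> : t - (t / 2 * v + t / 2) = t / 2 * (1 - v) by field.
  by rewrite mulr_ge0_le0 ?subr_le0// ltW.
rewrite muleA -EFinM divfK// EFinM -muleA; congr (_ * _)%E.
rewrite -ge0_integralZl//; last 3 first.
- apply: emeasurable_funM; last exact: measurable_unit_ind.
  apply: (measurableT_comp (mh _)); apply: measurable_funM => //; exact: measurable_funB.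
- by move=> v _; rewrite mule_ge0 ?unit_ind_ge0.
- by rewrite lee_fin heat0_scale_ge0.
apply: eq_integral => v _; rewrite muleA.
have [v01|v01] := boolP (0 < v <= 1); last by rewrite /unit_ind (negbTE v01) !mule0.
congr (_ * _)%E; rewrite /phi -!EFinM; congr EFin.
(* At [v = 1] one time on each side is [0], and both sides vanish by the convention on [heat]. *)
have /andP[v0 v1] := v01; have [->|v1'] := eqVneq v 1.
  by rewrite expr1n subrr mulr0 mulr1 -splitr subrr !(@heat_le0 _ 0)// !mulr0.
have {v1 v1'}v1 : v < 1 by rewrite lt_neqAle v1'.
set A := t / 2 * v + t / 2; set B := t - A; set C := t * (1 - v ^+ 2).
have A0 : 0 < A by rewrite addr_gt0// mulr_gt0.
have BE : B = t / 2 * (1 - v) by rewrite /B /A; field.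
have B0 : 0 < B by rewrite BE mulr_gt0// subr_gt0.
have C0 : 0 < C by rewrite mulr_gt0// subr_gt0 exprn_ilt1// ltW.
have k0 : 0 < pi *+ 2 :> R by rewrite mulrn_wgt0// pi_gt0.
(* Together with [A + B = t] this gives [1 / A + 1 / B = 4 / C], which matches the exponents, the
   [4] being the square of the doubling; it also matches the square roots in the prefactors. *)
have ABC : C * t = 4 * (A * B) by rewrite BE /A /C; field.
rewrite /heat0_scale heat_at0 /heat mulrACA [RHS]mulrA; congr (_ * _); last first.
  rewrite -expRD; congr expR.
  have -> : C = 4 * (A * B) / t by rewrite -ABC mulfK// gt_eqF.
  have -> : t = A + B by rewrite /B addrC subrK.
  field; rewrite !gt_eqF//; exact: addr_gt0.
rewrite -mulrA -!invfM -!sqrtrM ?mulr_ge0 ?(ltW A0) ?(ltW t0) ?(ltW k0)//.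
have -> : t * (pi *+ 2) * (C * (pi *+ 2)) = 2 ^+ 2 * (A * (pi *+ 2) * (B * (pi *+ 2))).
  transitivity (C * t * (pi *+ 2) ^+ 2); first by ring.
  by rewrite ABC; ring.
rewrite [X in _ = 2 * X^-1]sqrtrM ?sqr_ge0// sqrtr_sqr ger0_norm// invfM.
by rewrite mulVKf.
Qed.

End heat_convolution.

(** * Domination of the chains and their limit as the bump shrinks *)

Section chain_limit.
Local Open Scope ring_scope.
Context (R : realType).
Notation mu := (@lebesgue_measure R).
Implicit Types (l : seq (symbol R)) (o : symbol R).

Lemma integral_heat1 (t : R) : 0 < t -> (\int[mu]_y (heat t y)%:E = 1)%E.
Proof.
move=> t0; rewrite -(@integral_heat R t 0 t0).
by apply: eq_integral => y _; rewrite subr0.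
Qed.

(** A bound, uniform in [eps] and in the end point, for the space integral of one factor of the
    chain. For a cosine, the symbol is at most [2] and the heat kernel has mass at most [1]; for a
    bump, the symbol has mass [1] and the heat kernel is at most its value at [0]. *)
Definition symbol_kernel o : R -> \bar R :=
  if o is Some _ then (fun t => 2%:E * step t)%E else @heat0 R.

Lemma measurable_symbol_kernel o : measurable_fun setT (symbol_kernel o).
Proof.
case: o => [p|] /=; last exact: measurable_heat0.
apply: emeasurable_funM => //; exact: measurable_step.
Qed.

Lemma symbol_kernel_ge0 o t : (0 <= symbol_kernel o t)%E.
Proof. by case: o => [p|] /=; rewrite ?heat0_ge0// mule_ge0 ?step_ge0. Qed.

Lemma symbol_kernel_le0 o t : t <= 0 -> symbol_kernel o t = 0%E.
Proof. by move=> t0; case: o => [p|] /=; rewrite ?heat0_le0// step_le0// mule0. Qed.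

Fixpoint majorant l : R -> \bar R :=
  if l is o :: l' then conv (majorant l') (symbol_kernel o) else @heat0 R.

Lemma majorant_ge0 l t : (0 <= majorant l t)%E.
Proof.
elim: l t => [|o l IH] t /=; first exact: heat0_ge0.
by apply: conv_ge0 => // s; exact: symbol_kernel_ge0.
Qed.

Lemma measurable_majorant l : measurable_fun setT (majorant l).
Proof.
elim: l => [|o l IH] /=; first exact: measurable_heat0.
apply: measurable_conv => //; first exact: measurable_symbol_kernel.
  exact: majorant_ge0.
exact: symbol_kernel_ge0.
Qed.

(** Up to time [1] every convolution of two of the functions [step] and [heat0] is at most [step],
    so a bound by [step + heat0] survives each further symbol. The kernel of a symbol is at most
    twice one of these functions and the bound has two summands, whence the factor [4]. *)
Lemma majorant_bounded l :
  exists2 C, 0 <= C & forall t, t <= 1 -> (majorant l t <= C%:E * (step t + heat0 t))%E.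
Proof.
elim: l => [|o l [C C0 IH]] /=.
  by exists 1 => // t _; rewrite mul1e leeDr ?step_ge0.
exists (C * 4); first by rewrite mulr_ge0.
move=> t t1.
have mk := measurable_symbol_kernel o.
have k0 := symbol_kernel_ge0 o.
pose g s := (C%:E * (step s + heat0 s))%E.
have sh0 s : (0 <= @step R s + heat0 s)%E by rewrite adde_ge0 ?step_ge0 ?heat0_ge0.
have mg : measurable_fun setT (fun s => @step R s + heat0 s)%E.
  by apply: emeasurable_funD; [exact: measurable_step|exact: measurable_heat0].
apply: (@le_trans _ _ (conv g (symbol_kernel o) t)).
  apply: le_conv => //; first exact: measurable_majorant.
  - exact: emeasurable_funM.
  - exact: majorant_ge0.
  - move=> s; have [s1|s1] := leP s 1; first by rewrite lee_wpmul2r ?IH.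
    by rewrite (symbol_kernel_le0 o (_ : t - s <= 0)) ?mule0// subr_le0 (le_trans t1)// ltW.
have -> : conv g (symbol_kernel o) t =
    (C%:E * (conv (@step R) (symbol_kernel o) t + conv (@heat0 R) (symbol_kernel o) t))%E.
  have mi := measurable_conv_integrand.
  have m1 := measurableT_comp (mi _ _ _ (@measurable_step R) mk) (pair1_measurable t).
  have m2 := measurableT_comp (mi _ _ _ (@measurable_heat0 R) mk) (pair1_measurable t).
  rewrite /conv -ge0_integralD//; last 2 first.
  - by move=> s _; rewrite mule_ge0 ?step_ge0.
  - by move=> s _; rewrite mule_ge0 ?heat0_ge0.
  rewrite -ge0_integralZl//.
  - apply: eq_integral => s _; rewrite /g -ge0_muleDl ?step_ge0 ?heat0_ge0// muleA//.
  - exact: emeasurable_funD.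
  - by move=> s _; rewrite adde_ge0// mule_ge0 ?step_ge0 ?heat0_ge0.
rewrite [in leRHS]EFinM -muleA lee_wpmul2l//.
have convZ (f : R -> \bar R) : measurable_fun setT f -> (forall s, 0 <= f s)%E ->
    conv f (fun s => 2%:E * step s)%E t = (2%:E * conv f (@step R) t)%E.
  move=> mf f0; rewrite /conv -ge0_integralZl//.
  - by apply: eq_integral => s _; rewrite muleCA.
  - exact: (measurableT_comp (measurable_conv_integrand mf (@measurable_step R)) (pair1_measurable t)).
  - by move=> s _; rewrite mule_ge0 ?step_ge0.
apply: (@le_trans _ _ (4%:E * step t)%E); last by rewrite lee_wpmul2l// leeDl ?heat0_ge0.
have -> : 4%:E = 2%:E + 2%:E :> \bar R by rewrite -EFinD; congr EFin; ring.
rewrite ge0_muleDl//; apply: leeD.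
  case: o mk k0 => [p|] mk k0 /=.
    rewrite convZ//; [|exact: measurable_step|exact: step_ge0].
    by rewrite lee_wpmul2l// conv_step_step_le.
  rewrite convC//; [|exact: measurable_step|exact: step_ge0].
  rewrite (le_trans (conv_heat0_step_le t1))// -{1}[step t]mul1e lee_wpmul2r ?step_ge0//.
  by rewrite lee_fin ler1n.
case: o mk k0 => [p|] mk k0 /=.
  rewrite convZ//; [|exact: measurable_heat0|exact: heat0_ge0].
  by rewrite lee_wpmul2l// conv_heat0_step_le.
rewrite (le_trans (conv_heat0_heat0_le t))// -{1}[step t]mul1e lee_wpmul2r ?step_ge0//.
by rewrite lee_fin ler1n.
Qed.

Lemma majorant_lty l t : t <= 1 -> (majorant l t < +oo)%E.
Proof.
move=> t1; have [C C0 h] := majorant_bounded l.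
by rewrite (le_lt_trans (h _ t1))// -EFinD -EFinM ltry.
Qed.

Definition chain_step (eps : R) l o (t y s : R) : \bar R :=
  (\int[mu]_z (chain eps l s (symbol_scale eps o * z) *
    (symbol_density o z * heat (t - s) (y - symbol_scale eps o * z))%:E))%E.

Lemma symbol_kernel_bound (eps : R) o (r y : R) :
  (\int[mu]_z (symbol_density o z * heat r (y - symbol_scale eps o * z))%:E <= symbol_kernel o r)%E.
Proof.
have mh (c : R) : measurable_fun setT (fun z : R => heat r (y - c * z)).
  apply: (measurableT_comp (@measurable_heat_at R r)).
  by apply: measurable_funB => //; exact: measurable_funM.
case: o => [p|] /=.
  apply: (@le_trans _ _ (\int[mu]_z (2%:E * (heat r (y - 1 * z))%:E))%E).
    apply: ge0_le_integral => //.
    - by move=> z _; rewrite lee_fin mulr_ge0 ?heat_ge0// add1cos_ge0.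
    - apply/measurable_EFinP; apply: measurable_funM; last exact: mh.
      exact: (measurable_symbol_density (Some p)).
    - by apply: emeasurable_funM => //; apply/measurable_EFinP; exact: mh.
    - move=> z _; rewrite -EFinM lee_fin ler_wpM2r ?heat_ge0//.
      by have := cos_le1 (p.1 * z + p.2); lra.
  rewrite ge0_integralZl//; last 2 first.
  - by apply/measurable_EFinP; exact: mh.
  - by move=> z _; rewrite lee_fin heat_ge0.
  rewrite lee_wpmul2l//; have [r0|r0] := leP r 0.
    by rewrite integral0_eq ?step_ge0// => z _; rewrite heat_le0.
  rewrite /step r0; under eq_integral do rewrite mul1r.
  rewrite (@ge0_integral_reflect _ (fun z => (heat r z)%:E))//; last 2 first.
  - by apply/measurable_EFinP; exact: measurable_heat_at.
  - by move=> z; rewrite lee_fin heat_ge0.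
  by rewrite integral_heat1.
rewrite /heat0 -[leRHS]mule1 -(integral_bump R) -ge0_integralZl//; last 3 first.
- by apply/measurable_EFinP; exact: measurable_bump.
- by move=> z _; rewrite lee_fin bump_ge0.
- by rewrite lee_fin heat_ge0.
apply: ge0_le_integral => //.
- by move=> z _; rewrite lee_fin mulr_ge0 ?heat_ge0// bump_ge0.
- by apply/measurable_EFinP; apply: measurable_funM; [exact: measurable_bump|exact: mh].
- by apply: emeasurable_funM => //; apply/measurable_EFinP; exact: measurable_bump.
- by move=> z _; rewrite -EFinM mulrC lee_fin ler_wpM2r ?bump_ge0// heat_le.
Qed.

Lemma measurable_chain_step_integrand (eps : R) l o (t y : R) :
  measurable_fun setT (fun q : R * R => chain eps l q.1 (symbol_scale eps o * q.2) *
    (symbol_density o q.2 * heat (t - q.1) (y - symbol_scale eps o * q.2))%:E)%E.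
Proof.
have mc : measurable_fun setT (fun q : R * R => symbol_scale eps o * q.2) by exact: measurable_funM.
apply: emeasurable_funM.
  exact: (measurableT_comp (measurable_chain eps l) (measurable_fun_pair measurable_fst mc)).
apply/measurable_EFinP; apply: measurable_funM.
  exact: (measurableT_comp (measurable_symbol_density o) measurable_snd).
apply: (measurableT_comp (@measurable_heat R) (measurable_fun_pair _ _)).
  exact: measurable_funB.
exact: measurable_funB.
Qed.

Lemma chain_step_integrand_ge0 (eps : R) l o (t y s z : R) :
  (0 <= chain eps l s (symbol_scale eps o * z) *
    (symbol_density o z * heat (t - s) (y - symbol_scale eps o * z))%:E)%E.
Proof. by rewrite mule_ge0 ?chain_ge0// lee_fin mulr_ge0 ?symbol_density_ge0 ?heat_ge0. Qed.

Lemma measurable_chain_step (eps : R) l o (t y : R) :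
  measurable_fun setT (chain_step eps l o t y).
Proof.
apply: (ge0_measurable_integral2 mu (measurable_chain_step_integrand eps l o t y)) => s z.
exact: chain_step_integrand_ge0.
Qed.

Lemma chain_step_ge0 (eps : R) l o (t y s : R) : (0 <= chain_step eps l o t y s)%E.
Proof. by apply: integral_ge0 => z _; exact: chain_step_integrand_ge0. Qed.

Lemma chain_step_le (eps : R) l o (t y s : R) (M : \bar R) :
  (forall x, chain eps l s x <= M)%E ->
  (chain_step eps l o t y s <= M * symbol_kernel o (t - s))%E.
Proof.
move=> lM; have M0 : (0 <= M)%E := le_trans (chain_ge0 eps l s 0) (lM 0).
have mh : measurable_fun setT (fun z : R => (symbol_density o z * heat (t - s) (y - symbol_scale eps o * z))%:E).
  apply/measurable_EFinP; apply: measurable_funM; first exact: measurable_symbol_density.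
  apply: (measurableT_comp (@measurable_heat_at R _)).
  by apply: measurable_funB => //; exact: measurable_funM.
have h0 z : (0 <= (symbol_density o z * heat (t - s) (y - symbol_scale eps o * z))%:E)%E.
  by rewrite lee_fin mulr_ge0 ?symbol_density_ge0 ?heat_ge0.
apply: (@le_trans _ _ (M * \int[mu]_z (symbol_density o z * heat (t - s) (y - symbol_scale eps o * z))%:E)%E); last first.
  by rewrite lee_wpmul2l// symbol_kernel_bound.
rewrite -ge0_integralZl//; apply: ge0_le_integral => //.
- by move=> z _; exact: chain_step_integrand_ge0.
- exact: (measurableT_comp (measurable_chain_step_integrand eps l o t y) (pair1_measurable s)).
- exact: emeasurable_funM.
- by move=> z _; rewrite lee_wpmul2r.
Qed.

Lemma chain_le_majorant (eps : R) l t y : (chain eps l t y <= majorant l t)%E.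
Proof.
elim: l t y => [|o l IH] t y /=; first by rewrite lee_fin heat_le.
apply: ge0_le_integral => //.
- by move=> s _; exact: chain_step_ge0.
- exact: measurable_chain_step.
- have mi := measurable_conv_integrand (measurable_majorant l) (measurable_symbol_kernel o).
  exact: (measurableT_comp mi (pair1_measurable t)).
- by move=> s _; exact: chain_step_le.
Qed.

Lemma product_dominated_cvg (A_ : (R -> \bar R)^nat) (B_ : (R -> R)^nat)
    (A : R -> \bar R) (B D : R -> R) (M : \bar R) :
  (forall n, measurable_fun setT (A_ n)) -> (forall n, measurable_fun setT (B_ n)) ->
  measurable_fun setT A -> measurable_fun setT B -> measurable_fun setT D ->
  (forall n z, 0 <= A_ n z <= M)%E -> (forall n z, 0 <= B_ n z <= D z) ->
  (forall z, A z \is a fin_num) ->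
  (forall z, A_ n z @[n --> \oo] --> A z) -> (forall z, B_ n z @[n --> \oo] --> B z) ->
  (0 <= M < +oo)%E -> (\int[mu]_z (D z)%:E < +oo)%E ->
  (\int[mu]_z (A_ n z * (B_ n z)%:E))%E @[n --> \oo] --> (\int[mu]_z (A z * (B z)%:E))%E.
Proof.
move=> mA_ mB_ mA mB mD A_M B_D Af AA BB /andP[M0 Moo] Doo.
have D0 z : 0 <= D z by have /andP[/le_trans] := B_D 0%N z; apply.
apply: (@ge0_dominated_cvg _ _ _ mu _ _ (fun z => M * (D z)%:E)%E).
- by move=> n; apply: emeasurable_funM; [exact: mA_|apply/measurable_EFinP; exact: mB_].
- by apply: emeasurable_funM => //; exact/measurable_EFinP.
- move=> n z; have /andP[A0 _] := A_M n z; have /andP[B0 _] := B_D n z.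
  by rewrite mule_ge0// lee_fin.
- move=> n z; have /andP[A0 AM] := A_M n z; have /andP[B0 BD] := B_D n z.
  by rewrite lee_pmul// lee_fin.
- apply: aeW => z; apply: cvgeM => //.
    by rewrite mule_def_fin// Af.
  by apply: cvg_EFin; [exact: nearW|exact: BB].
- by apply: emeasurable_funM => //; exact/measurable_EFinP.
rewrite ge0_integralZl//; first by rewrite lte_mul_pinfty// ge0_fin_numE.
- exact/measurable_EFinP.
- by move=> z _; rewrite lee_fin.
Qed.

Lemma chain_fin_num (eps : R) l t y : t <= 1 -> chain eps l t y \is a fin_num.
Proof.
move=> t1; rewrite ge0_fin_numE ?chain_ge0//.
exact: le_lt_trans (chain_le_majorant _ _ _ _) (majorant_lty l t1).
Qed.

(** Dominated convergence in the space variable at a fixed time [s], the inner chain being bounded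
    by [majorant l s]. *)
Lemma chain_step_cvg (eps_ : R^nat) l o (t y s : R) (y_ : R^nat) :
  eps_ @ \oo --> 0 -> y_ @ \oo --> y -> t <= 1 ->
  (s <= 1 -> forall x (x_ : R^nat), x_ @ \oo --> x ->
    chain (eps_ n) l s (x_ n) @[n --> \oo] --> chain 0 l s x) ->
  chain_step (eps_ n) l o t (y_ n) s @[n --> \oo] --> chain_step 0 l o t y s.
Proof.
move=> e0 yy t1 lcv.
have [ts|st] := leP t s.
  have st0 u v : chain_step u l o t v s = 0%E.
    by rewrite /chain_step integral0_eq// => z _; rewrite heat_le0 ?subr_le0// mulr0 mule0.
  rewrite st0 (_ : (fun n => _) = cst 0%E); first exact: cvg_cst.
  by apply/funext => n; exact: st0.
have s1 : s <= 1 := le_trans (ltW st) t1.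
have M0 : (0 <= majorant l s < +oo)%E by rewrite majorant_ge0 majorant_lty.
have mh := @measurable_heat_at R (t - s).
have ml (u : R) : measurable_fun setT (chain u l s).
  exact: (measurable_fun_section2 (measurable_chain u l) s).
have id1 : measurable_fun setT (fun z : R => z) by exact: measurable_id.
case: o => [p|]; last first.
  have ez z : eps_ n * z @[n --> \oo] --> 0 * z by apply: cvgM => //; exact: cvg_cst.
  have mc (c : R) : measurable_fun setT (fun z : R => c * z) by exact: measurable_funM.
  have mhc (c v : R) : measurable_fun setT (fun z : R => bump z * heat (t - s) (v - c * z)).
    apply: measurable_funM; first exact: measurable_bump.
    by apply: (measurableT_comp mh); exact: measurable_funB.
  apply: (@product_dominated_cvg (fun n z => chain (eps_ n) l s (eps_ n * z))
    (fun n z => bump z * heat (t - s) (y_ n - eps_ n * z)) (fun z => chain 0 l s (0 * z))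
    (fun z => bump z * heat (t - s) (y - 0 * z)) (fun z => bump z * heat (t - s) 0) (majorant l s)).
  - by move=> n; exact: (measurableT_comp (ml (eps_ n)) (mc (eps_ n))).
  - by move=> n; exact: mhc.
  - exact: (measurableT_comp (ml 0) (mc 0)).
  - exact: mhc.
  - by apply: measurable_funM => //; exact: measurable_bump.
  - by move=> n z; rewrite chain_ge0 chain_le_majorant.
  - by move=> n z; rewrite mulr_ge0 ?bump_ge0 ?heat_ge0//= ler_wpM2l ?bump_ge0// heat_le.
  - by move=> z; exact: chain_fin_num.
  - by move=> z; apply: lcv.
  - move=> z; apply: cvgM; first exact: cvg_cst.
    apply: (cvg_comp (fun n => y_ n - eps_ n * z) (heat (t - s)) _ (@continuous_heat R _ _)).
    exact: cvgB.
  - exact: M0.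
  - under eq_integral do rewrite EFinM muleC.
    rewrite ge0_integralZl//; first by rewrite integral_bump mule1 ltry.
    + by apply/measurable_EFinP; exact: measurable_bump.
    + by move=> z _; rewrite lee_fin bump_ge0.
    + by rewrite lee_fin heat_ge0.
pose h (z : R) := 1 + cos (p.1 * z + p.2).
have mhh : measurable_fun setT h := @measurable_symbol_density R (Some p).
have hc : continuous h := @continuous_symbol_density R (Some p).
have h0 z : 0 <= h z by exact: add1cos_ge0.
have h2 z : h z <= 2 by rewrite /h; have := cos_le1 (p.1 * z + p.2); lra.
have mB (v : R) : measurable_fun setT (fun z : R => v - z) by exact: measurable_funB.
(* The reflection of [z] at the end point moves the varying point out of the heat kernel, which then
   gives a dominating function independent of [n]. *)
have E u v : chain_step u l (Some p) t v s =
    (\int[mu]_z (chain u l s (v - z)%R * (h (v - z) * heat (t - s) z)%:E))%E.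
  rewrite /chain_step /= -(@ge0_integral_reflect _ _ v).
  - by apply: eq_integral => z _; rewrite mul1r subKr.
  - have m1 := measurableT_comp (measurable_chain_step_integrand u l (Some p) t v) (pair1_measurable s).
    exact: m1.
  - move=> z; exact: (chain_step_integrand_ge0 u l (Some p) t v s z).
rewrite E (_ : (fun n => _) = (fun n => \int[mu]_z (chain (eps_ n) l s (y_ n - z)%R *
    (h (y_ n - z) * heat (t - s) z)%:E))%E); last by apply/funext => n; exact: E.
have yz z : y_ n - z @[n --> \oo] --> y - z by apply: cvgB => //; exact: cvg_cst.
apply: (@product_dominated_cvg (fun n z => chain (eps_ n) l s (y_ n - z))
  (fun n z => h (y_ n - z) * heat (t - s) z) (fun z => chain 0 l s (y - z))
  (fun z => h (y - z) * heat (t - s) z) (fun z => 2 * heat (t - s) z) (majorant l s)).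
- by move=> n; exact: (measurableT_comp (ml (eps_ n)) (mB (y_ n))).
- by move=> n; apply: measurable_funM => //; exact: (measurableT_comp mhh (mB _)).
- exact: (measurableT_comp (ml 0) (mB y)).
- by apply: measurable_funM => //; exact: (measurableT_comp mhh (mB _)).
- exact: measurable_funM.
- by move=> n z; rewrite chain_ge0 chain_le_majorant.
- by move=> n z; rewrite mulr_ge0 ?h0 ?heat_ge0//= ler_wpM2r ?heat_ge0// h2.
- by move=> z; exact: chain_fin_num.
- by move=> z; apply: lcv.
- move=> z; apply: cvgM; last exact: cvg_cst.
  exact: (cvg_comp (fun n => y_ n - z) h (yz z) (hc _)).
- exact: M0.
- under eq_integral do rewrite EFinM.
  rewrite ge0_integralZl//.
  + have ts0 : 0 < t - s by rewrite subr_gt0.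
    by rewrite integral_heat1// mule1 ltry.
  + exact/measurable_EFinP.
  + by move=> z _; rewrite lee_fin heat_ge0.
Qed.

(** The inner chain is evaluated at the moving points [eps_ n * z], so the induction has to provide
    convergence along every convergent sequence of end points. *)
Lemma chain_cvg (eps_ : R^nat) l (t y : R) (y_ : R^nat) :
  eps_ @ \oo --> 0 -> y_ @ \oo --> y -> t <= 1 ->
  chain (eps_ n) l t (y_ n) @[n --> \oo] --> chain 0 l t y.
Proof.
move=> e0; elim: l t y y_ => [|o l IH] t y y_ yy t1.
  apply: cvg_EFin; first by apply: nearW.
  exact: (cvg_comp y_ (heat t) yy (@continuous_heat R t y)).
apply: (@ge0_dominated_cvg _ _ _ mu (fun n => chain_step (eps_ n) l o t (y_ n))
  (chain_step 0 l o t y) (fun s => majorant l s * symbol_kernel o (t - s))%E).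
- by move=> n; exact: measurable_chain_step.
- have mi := measurable_conv_integrand (measurable_majorant l) (measurable_symbol_kernel o).
  exact: (measurableT_comp mi (pair1_measurable t)).
- by move=> n s; exact: chain_step_ge0.
- by move=> n s; apply: chain_step_le => x; exact: chain_le_majorant.
- apply: aeW => s; apply: chain_step_cvg => // s1 x x_ xx; exact: IH.
- exact: measurable_chain_step.
- exact: (majorant_lty (o :: l) t1).
Qed.

End chain_limit.

Section terminal_weight.
Local Open Scope ring_scope.
Context (R : realType).
Notation mu := (@lebesgue_measure R).
Notation N01 := (normal_pdf (0:R) 1).
Implicit Types (l : seq (symbol R)) (o : symbol R).

(** The heat semigroup at time [r] applied to [1 + cos]; the cosine is an eigenfunction. The
    indicator reflects the convention that [heat] vanishes at nonpositive times. *)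
Definition heat_cos (p : R * R) (r x : R) : R :=
  (0 < r)%R%:R * (1 + cos (p.1 * x + p.2) * expR (- p.1 ^+ 2 * r / 2)).

Lemma integral_heat_cos p (r x : R) :
  (\int[mu]_y ((heat r (y - x))%:E * (symbol_density (Some p) y)%:E) = (heat_cos p r x)%:E)%E.
Proof.
rewrite /heat_cos; have [r0|r0] := leP r 0.
  by rewrite mul0r integral0_eq// => y _; rewrite heat_le0// mul0e.
rewrite mul1r.
have mh := @measurable_symbol_density R (Some p).
transitivity (\int[mu]_y ((symbol_density (Some p) y)%:E * (heat (1 ^+ 2 * r) (y - 1 * x))%:E))%E.
  by apply: eq_integral => y _; rewrite expr1n !mul1r muleC.
rewrite -(@normal_heat_change _ r 1 x (fun y => (symbol_density (Some p) y)%:E))//; last 2 first.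
- exact/measurable_EFinP.
- by move=> y; rewrite lee_fin symbol_density_ge0.
have E z : ((symbol_density (Some p) (1 * (x + Num.sqrt r * z)))%:E * (N01 z)%:E =
    (N01 z)%:E + (cos (p.1 * Num.sqrt r * z + (p.1 * x + p.2)) * N01 z)%:E)%E.
  rewrite -EFinM -EFinD; congr EFin; rewrite /= mulrDl mul1r; congr (_ + cos _ * _); ring.
under eq_integral do rewrite E.
have iN : mu.-integrable setT (fun z => (N01 z)%:E) by exact: integrable_normal_pdf.
have bc : forall a e : R, mu.-integrable setT (fun z => (cos (a * z + e) * N01 z)%:E).
  move=> a e; apply: (@integrable_bounded_mul _ _ _ 1).
  - by apply: continuous_measurable_fun; exact: continuous_cos_affine.
  - exact: measurable_normal_pdf.
  - by move=> z; exact: cos_max.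
  - by under eq_fun do rewrite ger0_norm ?normal_pdf_ge0//.
rewrite integralD//=.
rewrite integral_normal_pdf [RHS]EFinD; congr (_ + _)%E.
rewrite -[LHS]fineK; last exact: (integrable_fin_num _ (bc _ _)).
congr EFin; have := fourier_normal_pdf01 (p.1 * Num.sqrt r) (p.1 * x + p.2).
rewrite /Rintegral => ->; congr (_ * expR _).
by rewrite exprMn sqr_sqrtr ?(ltW r0)//; ring.
Qed.

Lemma heat_cos_ge0 p r x : 0 <= heat_cos p r x.
Proof.
rewrite -lee_fin -integral_heat_cos; apply: integral_ge0 => y _.
by rewrite mule_ge0// lee_fin ?heat_ge0// symbol_density_ge0.
Qed.

Lemma heat_cos_le p r x : heat_cos p r x <= 2 * (0 < r)%R%:R.
Proof.
rewrite /heat_cos; have [r0|r0] := leP r 0; first by rewrite mul0r mulr0.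
rewrite mul1r mulr1.
have e1 : expR (- p.1 ^+ 2 * r / 2) <= 1.
  by rewrite -expR0 ler_expR !mulNr oppr_le0 divr_ge0// mulr_ge0 ?sqr_ge0// ltW.
have : cos (p.1 * x + p.2) * expR (- p.1 ^+ 2 * r / 2) <= 1.
  apply: (le_trans (ler_norm _)); rewrite normrM -[leRHS]mulr1.
  by rewrite ler_pM ?normr_ge0 ?cos_max// ger0_norm ?expR_ge0.
lra.
Qed.

Lemma measurable_heat_cos p : measurable_fun setT (fun q : R * R => heat_cos p q.1 q.2).
Proof.
have mn : measurable_fun setT (fun c : bool => c%:R : R) by [].
apply: measurable_funM.
  by apply: (measurableT_comp mn); exact: measurable_fun_ltr.
apply: measurable_funD => //; apply: measurable_funM.
  apply: (measurableT_comp (continuous_measurable_fun (@continuous_cos R))); apply: measurable_funD => //.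
  exact: measurable_funM.
by apply: measurableT_comp => //; do 2 apply: measurable_funM => //.
Qed.

Lemma continuous_heat_cos p r : continuous (heat_cos p r).
Proof.
move=> x; apply: cvgM; first exact: cvg_cst.
apply: cvgD; first exact: cvg_cst.
by apply: cvgM; [exact: continuous_cos_affine|exact: cvg_cst].
Qed.

(** The contribution of a latest visit to [0] at time [s], the free end point having already been
    integrated against the test function. *)
Definition terminal_step (eps : R) l p (s : R) : \bar R :=
  (\int[mu]_z (chain eps l s (eps * z) * (bump z * heat_cos p (1 - s) (eps * z))%:E))%E.

Lemma measurable_terminal_integrand (eps : R) l p :
  measurable_fun setT (fun q : R * R => chain eps l q.1 (eps * q.2) *
    (bump q.2 * heat_cos p (1 - q.1) (eps * q.2))%:E)%E.
Proof.
have mc : measurable_fun setT (fun q : R * R => eps * q.2) by exact: measurable_funM.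
apply: emeasurable_funM.
  exact: (measurableT_comp (measurable_chain eps l) (measurable_fun_pair measurable_fst mc)).
apply/measurable_EFinP; apply: measurable_funM.
  exact: (measurableT_comp (@measurable_bump R) measurable_snd).
apply: (measurableT_comp (@measurable_heat_cos p) (measurable_fun_pair _ mc)).
exact: measurable_funB.
Qed.

Lemma terminal_integrand_ge0 (eps : R) l p (s z : R) :
  (0 <= chain eps l s (eps * z) * (bump z * heat_cos p (1 - s) (eps * z))%:E)%E.
Proof. by rewrite mule_ge0 ?chain_ge0// lee_fin mulr_ge0 ?bump_ge0 ?heat_cos_ge0. Qed.

Lemma measurable_terminal_step (eps : R) l p : measurable_fun setT (terminal_step eps l p).
Proof.
apply: (ge0_measurable_integral2 mu (measurable_terminal_integrand eps l p)) => s z.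
exact: terminal_integrand_ge0.
Qed.

Lemma integral_chain_cos (eps : R) l p :
  (\int[mu]_y (chain eps (None :: l) 1 y * (symbol_density (Some p) y)%:E) =
   \int[mu]_s terminal_step eps l p s)%E.
Proof.
have md := @measurable_symbol_density R (Some p).
have d0 y : (0 <= (symbol_density (Some p) y)%:E)%E by rewrite lee_fin symbol_density_ge0.
transitivity (\int[mu]_y \int[mu]_s (chain_step eps l None 1 y s * (symbol_density (Some p) y)%:E))%E.
  apply: eq_integral => y _; rewrite ge0_integralZr//; first exact: measurable_chain_step.
  by move=> s _; exact: chain_step_ge0.
pose f (y s z : R) := (chain eps l s (eps * z) * (bump z * heat (1 - s) (y - eps * z))%:E)%E.
have f0 y s z : (0 <= f y s z)%E := chain_step_integrand_ge0 eps l None 1 y s z.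
have mf : measurable_fun setT (fun q : R * R * R => f q.1.1 q.1.2 q.2).
  have m1 : measurable_fun setT (fun q : R * R * R => q.1.1).
    by apply: (measurableT_comp measurable_fst); exact: measurable_fst.
  have m2 : measurable_fun setT (fun q : R * R * R => q.1.2).
    by apply: (measurableT_comp measurable_snd); exact: measurable_fst.
  have m3 : measurable_fun setT (fun q : R * R * R => eps * q.2) by exact: measurable_funM.
  apply: emeasurable_funM.
    exact: (measurableT_comp (measurable_chain eps l) (measurable_fun_pair m2 m3)).
  apply/measurable_EFinP; apply: measurable_funM.
    exact: (measurableT_comp (@measurable_bump R) measurable_snd).
  apply: (measurableT_comp (@measurable_heat R) (measurable_fun_pair _ _)).
    exact: measurable_funB.
  exact: measurable_funB.
have mstep : measurable_fun setT (fun q : R * R => chain_step eps l None 1 q.1 q.2).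
  by apply: (ge0_measurable_integral2 mu mf) => q z; exact: f0.
rewrite (@ge0_tonelli _ _ _ _ _ mu mu
  (fun y s => chain_step eps l None 1 y s * (symbol_density (Some p) y)%:E)%E); last 2 first.
- apply: emeasurable_funM => //; apply/measurable_EFinP.
  exact: (measurableT_comp md measurable_fst).
- by move=> y s; rewrite mule_ge0 ?chain_step_ge0.
apply: eq_integral => s _.
have mfs : measurable_fun setT (fun q : R * R => f q.1 s q.2).
  have m0 : measurable_fun setT (fun q : R * R => ((q.1, s), q.2) : R * R * R).
    by apply: measurable_fun_pair => //; exact: measurable_fun_pair.
  exact: (measurableT_comp mf m0).
transitivity (\int[mu]_y \int[mu]_z (f y s z * (symbol_density (Some p) y)%:E))%E.
  apply: eq_integral => y _; rewrite ge0_integralZr//.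
  exact: (measurableT_comp mfs (pair1_measurable y)).
rewrite (@ge0_tonelli _ _ _ _ _ mu mu (fun y z => f y s z * (symbol_density (Some p) y)%:E)%E); last 2 first.
- apply: emeasurable_funM => //; apply/measurable_EFinP.
  exact: (measurableT_comp md measurable_fst).
- by move=> y z; rewrite mule_ge0.
apply: eq_integral => z _; rewrite EFinM -integral_heat_cos muleA -ge0_integralZl//.
- by apply: eq_integral => y _; rewrite /f EFinM !muleA.
- apply: emeasurable_funM; last exact/measurable_EFinP.
  apply/measurable_EFinP; apply: (measurableT_comp (@measurable_heat_at R _)).
  exact: measurable_funB.
- by move=> y _; rewrite mule_ge0// lee_fin heat_ge0.
- by rewrite mule_ge0 ?chain_ge0// lee_fin bump_ge0.
Qed.

Lemma terminal_step_le (eps : R) l p s :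
  (terminal_step eps l p s <= majorant l s * symbol_kernel (Some p) (1 - s)%R)%E.
Proof.
apply: (@le_trans _ _ (\int[mu]_z (majorant l s * symbol_kernel (Some p) (1 - s)%R * (bump z)%:E))%E).
  apply: ge0_le_integral => //.
  - by move=> z _; exact: terminal_integrand_ge0.
  - exact: (measurableT_comp (measurable_terminal_integrand eps l p) (pair1_measurable s)).
  - by apply: emeasurable_funM => //; apply/measurable_EFinP; exact: measurable_bump.
  - move=> z _; rewrite -muleA lee_pmul ?chain_ge0 ?chain_le_majorant//.
      by rewrite lee_fin mulr_ge0 ?bump_ge0 ?heat_cos_ge0.
    by rewrite /= /step -!EFinM lee_fin mulrC ler_wpM2r ?bump_ge0// heat_cos_le.
rewrite ge0_integralZl//.
- by rewrite integral_bump mule1.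
- by apply/measurable_EFinP; exact: measurable_bump.
- by move=> z _; rewrite lee_fin bump_ge0.
- by rewrite mule_ge0 ?majorant_ge0 ?symbol_kernel_ge0.
Qed.

Lemma integral_terminal_cvg (eps_ : R^nat) l p : eps_ @ \oo --> 0 ->
  (\int[mu]_s terminal_step (eps_ n) l p s)%E @[n --> \oo] -->
  (\int[mu]_s terminal_step 0%R l p s)%E.
Proof.
move=> e0.
have ez (z : R) : eps_ n * z @[n --> \oo] --> 0 * z by apply: cvgM => //; exact: cvg_cst.
have mc (c : R) : measurable_fun setT (fun z : R => c * z) by exact: measurable_funM.
have mi := measurable_conv_integrand (measurable_majorant l) (@measurable_symbol_kernel R (Some p)).
apply: (@ge0_dominated_cvg _ _ _ mu (fun n => terminal_step (eps_ n) l p) _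
  (fun s => majorant l s * symbol_kernel (Some p) (1 - s)%R)%E).
- by move=> n; exact: measurable_terminal_step.
- exact: (measurableT_comp mi (pair1_measurable (1:R))).
- by move=> n s; apply: integral_ge0 => z _; exact: terminal_integrand_ge0.
- by move=> n s; exact: terminal_step_le.
- apply: aeW => s; have [s1|s1] := leP 1 s.
    have st0 u : terminal_step u l p s = 0%E.
      rewrite /terminal_step integral0_eq// => z _.
      by rewrite /heat_cos subr_gt0 ltNge s1 mul0r mulr0 mule0.
    rewrite st0 (_ : (fun n => _) = cst 0%E); first exact: cvg_cst.
    by apply/funext => n; exact: st0.
  have mhc (c : R) : measurable_fun setT (fun z : R => bump z * heat_cos p (1 - s) (c * z)).
    apply: measurable_funM; first exact: measurable_bump.
    have m0 : measurable_fun setT (fun z : R => (1 - s, c * z) : R * R) by exact: measurable_fun_pair.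
    exact: (measurableT_comp (@measurable_heat_cos p) m0).
  have ml (u : R) : measurable_fun setT (chain u l s).
    exact: (measurable_fun_section2 (measurable_chain u l) s).
  apply: (@product_dominated_cvg _ (fun n z => chain (eps_ n) l s (eps_ n * z))
    (fun n z => bump z * heat_cos p (1 - s) (eps_ n * z)) (fun z => chain 0 l s (0 * z))
    (fun z => bump z * heat_cos p (1 - s) (0 * z)) (fun z => 2 * bump z) (majorant l s)).
  + by move=> n; exact: (measurableT_comp (ml (eps_ n)) (mc (eps_ n))).
  + by move=> n; exact: mhc.
  + exact: (measurableT_comp (ml 0) (mc 0)).
  + exact: mhc.
  + by apply: measurable_funM => //; exact: measurable_bump.
  + by move=> n z; rewrite chain_ge0 chain_le_majorant.
  + move=> n z; rewrite mulr_ge0 ?bump_ge0 ?heat_cos_ge0//= mulrC ler_wpM2r ?bump_ge0//.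
    by apply: (le_trans (heat_cos_le _ _ _)); rewrite ler_piMr// lern1; case: (_ < _).
  + by move=> z; apply: chain_fin_num; exact: ltW.
  + by move=> z; apply: chain_cvg => //; exact: ltW.
  + move=> z; apply: cvgM; first exact: cvg_cst.
    exact: (cvg_comp (fun n => eps_ n * z) (heat_cos p (1 - s)) (ez z) (@continuous_heat_cos p _ _)).
  + by rewrite majorant_ge0 majorant_lty// ltW.
  + under eq_integral do rewrite EFinM.
    rewrite ge0_integralZl//; first by rewrite integral_bump mule1 ltry.
    * by apply/measurable_EFinP; exact: measurable_bump.
    * by move=> z _; rewrite lee_fin bump_ge0.
- exact: measurable_terminal_step.
- exact: (majorant_lty (Some p :: l) (lexx 1)).
Qed.

End terminal_weight.

(** * Exchange of visits in the limit chains *)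

Section limit_chain.
Local Open Scope ring_scope.
Context (R : realType).
Notation mu := (@lebesgue_measure R).
Implicit Types (l : seq (symbol R)) (o : symbol R).

Definition heat_fun (y s : R) : \bar R := (heat s y)%:E.

Lemma heat_fun_ge0 y s : (0 <= heat_fun y s)%E.
Proof. by rewrite lee_fin heat_ge0. Qed.

Lemma measurable_heat_fun y : measurable_fun setT (heat_fun y).
Proof.
have m0 : measurable_fun setT (fun t : R => (t, y) : R * R) by exact: measurable_fun_pair.
by apply/measurable_EFinP; exact: (measurableT_comp (@measurable_heat R) m0).
Qed.

Definition chain_at l (y s : R) : \bar R := chain 0 l s y.

Lemma chain_at_ge0 l y s : (0 <= chain_at l y s)%E.
Proof. exact: chain_ge0. Qed.

Lemma measurable_chain_at l y : measurable_fun setT (chain_at l y).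
Proof.
have m0 : measurable_fun setT (fun t : R => (t, y) : R * R) by exact: measurable_fun_pair.
exact: (measurableT_comp (measurable_chain 0 l) m0).
Qed.

(** At [eps = 0] the position is [0] and the bump integrates to [1], so that a visit to [0] acts as
    a convolution in time. *)
Lemma chain_at_None l y t : chain_at (None :: l) y t = conv (chain_at l 0) (heat_fun y) t.
Proof.
apply: eq_integral => s _ /=.
under eq_integral do rewrite mul0r subr0 EFinM muleCA.
rewrite ge0_integralZr//; first by rewrite integral_bump mul1e.
- by apply/measurable_EFinP; exact: measurable_bump.
- by move=> z _; rewrite lee_fin bump_ge0.
- by rewrite mule_ge0 ?chain_ge0// lee_fin heat_ge0.
Qed.

Definition heat_cos0 (p : R * R) (r : R) : \bar R := (heat_cos p r 0)%:E.

Lemma heat_cos0_ge0 p r : (0 <= heat_cos0 p r)%E.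
Proof. by rewrite lee_fin heat_cos_ge0. Qed.

Lemma measurable_heat_cos0 p : measurable_fun setT (heat_cos0 p).
Proof.
have m0 : measurable_fun setT (fun t : R => (t, 0) : R * R) by exact: measurable_fun_pair.
by apply/measurable_EFinP; exact: (measurableT_comp (measurable_heat_cos p) m0).
Qed.

Lemma integral_terminal0 l p :
  (\int[mu]_s terminal_step 0%R l p s = conv (chain_at l 0) (heat_cos0 p) 1%R)%E.
Proof.
apply: eq_integral => s _; rewrite /terminal_step.
under eq_integral do rewrite mul0r EFinM muleCA.
rewrite ge0_integralZr//; first by rewrite integral_bump mul1e.
- by apply/measurable_EFinP; exact: measurable_bump.
- by move=> z _; rewrite lee_fin bump_ge0.
- by rewrite mule_ge0 ?chain_ge0// lee_fin heat_cos_ge0.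
Qed.

Lemma chain_at_Some l p t : chain_at (Some p :: l) 0 t =
  (\int[mu]_z ((symbol_density (Some p) z)%:E * conv (chain_at l z) (heat_fun z) t))%E.
Proof.
have mi := measurable_chain_step_integrand 0 l (Some p) t 0.
rewrite /chain_at /= (@ge0_tonelli _ _ _ _ _ mu mu (fun s z => chain 0 l s (1 * z) *
   ((1 + cos (p.1 * z + p.2)) * heat (t - s) (0 - 1 * z))%:E)%E); last 2 first.
- exact: mi.
- by move=> s z; exact: (chain_step_integrand_ge0 0 l (Some p) t 0 s z).
apply: eq_integral => z _; rewrite -ge0_integralZl//.
- by apply: eq_integral => s _; rewrite mul1r sub0r heatN EFinM muleCA.
- have mc := measurable_conv_integrand (measurable_chain_at l z) (measurable_heat_fun z).
  exact: (measurableT_comp mc (pair1_measurable t)).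
- by move=> s _; rewrite mule_ge0 ?chain_at_ge0 ?heat_fun_ge0.
Qed.

Notation zeros k := (nseq k None : seq (symbol R)).

(** The kernel that enters [z] and the one that leaves it are adjacent; [conv_heat_heat] replaces
    them by a return to [0] and a passage to [2 * z]. For [k > 0] associativity brings the two
    kernels together. *)
Lemma chain_at_zeros_heat k z t :
  conv (chain_at (zeros k) z) (heat_fun z) t = conv (chain_at (zeros k) 0) (heat_fun (2 * z)) t.
Proof.
case: k => [|k] /=; first exact: conv_heat_heat.
have mf := measurable_heat_fun; have mc := measurable_chain_at.
have f0 := heat_fun_ge0; have c0 := chain_at_ge0.
have m0 : measurable_fun setT (@heat0 R) := measurable_heat_fun 0.
have E1 y : chain_at (None :: zeros k) y = conv (chain_at (zeros k) 0) (heat_fun y).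
  by apply/funext => s; exact: chain_at_None.
transitivity (conv (conv (chain_at (zeros k) 0) (heat_fun z)) (heat_fun z) t).
  exact: (congr1 (fun f => conv f (heat_fun z) t) (E1 z)).
transitivity (conv (conv (chain_at (zeros k) 0) (heat_fun 0)) (heat_fun (2 * z)) t); last first.
  exact: (congr1 (fun f => conv f (heat_fun (2 * z)) t) (esym (E1 0))).
apply: (etrans (convA t (mc _ 0) (mf z) (mf z) (c0 _ 0) (f0 z) (f0 z))).
apply: (etrans _ (esym (convA t (mc _ 0) (mf 0) (mf (2 * z)) (c0 _ 0) (f0 0) (f0 (2 * z))))).
apply: (congr1 (fun f => conv (chain_at (zeros k) 0) f t)).
by apply/funext => s; exact: conv_heat_heat.
Qed.

(** A test function of the visited point [z], read as a function of the end point [2 * z], has half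
    the frequency. *)
Definition half_freq (p : R * R) : R * R := (p.1 / 2, p.2).

(** The factor [2^-1] is the Jacobian of [y = 2 * z]; it is what turns [sqrt (2 pi)] into
    [sqrt (pi / 2)] in the theorem. *)
Lemma integral_heat_double p (r : R) :
  (\int[mu]_z ((symbol_density (Some p) z)%:E * heat_fun (2 * z) r) =
   (2^-1)%:E * heat_cos0 (half_freq p) r)%E.
Proof.
rewrite /heat_cos0 -integral_heat_cos [in RHS](@ge0_integral_affine_pos _ _ 2 0)//; last 2 first.
- apply: emeasurable_funM; last by apply/measurable_EFinP; exact: measurable_symbol_density.
  by apply/measurable_EFinP; apply: (measurableT_comp (@measurable_heat_at R r)); exact: measurable_funB.
- by move=> y; rewrite mule_ge0// lee_fin ?heat_ge0 ?symbol_density_ge0.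
rewrite muleA -EFinM mulVf// mul1e; apply: eq_integral => z _.
rewrite addr0 subr0 muleC; congr (_ * _%:E)%E => /=.
by congr (1 + cos (_ + _)); field.
Qed.

Lemma chain_at_Some_zeros k p t : chain_at (Some p :: zeros k) 0 t =
  conv (chain_at (zeros k) 0) (fun r => (2^-1)%:E * heat_cos0 (half_freq p) r)%E t.
Proof.
have mf := measurable_heat_fun; have mc := measurable_chain_at.
have f0 := heat_fun_ge0; have c0 := chain_at_ge0.
have md := @measurable_symbol_density R (Some p).
rewrite chain_at_Some; under eq_integral do rewrite chain_at_zeros_heat.
have mz : measurable_fun setT (fun q : R * R => heat_fun (2 * q.1) (t - q.2)).
  apply/measurable_EFinP; apply: (measurableT_comp (@measurable_heat R) (measurable_fun_pair _ _)).
    exact: measurable_funB.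
  exact: measurable_funM.
have mG : measurable_fun setT (fun q : R * R => (symbol_density (Some p) q.1)%:E *
    (chain_at (zeros k) 0 q.2 * heat_fun (2 * q.1) (t - q.2)))%E.
  apply: emeasurable_funM; first by apply/measurable_EFinP; exact: (measurableT_comp md measurable_fst).
  apply: emeasurable_funM => //.
  exact: (measurableT_comp (measurable_chain_at (zeros k) 0) measurable_snd).
transitivity (\int[mu]_z \int[mu]_s ((symbol_density (Some p) z)%:E *
    (chain_at (zeros k) 0 s * heat_fun (2 * z) (t - s)%R)))%E.
  apply: eq_integral => z _; rewrite ge0_integralZl//.
  - have mi := measurable_conv_integrand (measurable_chain_at (zeros k) 0) (measurable_heat_fun (2 * z)).
    exact: (measurableT_comp mi (pair1_measurable t)).
  - by move=> s _; rewrite mule_ge0.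
  - by rewrite lee_fin symbol_density_ge0.
rewrite (@ge0_tonelli _ _ _ _ _ mu mu (fun z s => (symbol_density (Some p) z)%:E *
    (chain_at (zeros k) 0 s * heat_fun (2 * z) (t - s)))%E)//; last first.
  by move=> z s; rewrite !mule_ge0 ?chain_at_ge0 ?heat_fun_ge0// lee_fin symbol_density_ge0.
apply: eq_integral => s _; rewrite -integral_heat_double -ge0_integralZl//.
- by apply: eq_integral => z _; rewrite muleCA.
- apply: emeasurable_funM; first exact/measurable_EFinP.
  apply/measurable_EFinP; apply: (measurableT_comp (@measurable_heat_at R _)).
  exact: measurable_funM.
- by move=> z _; rewrite mule_ge0 ?heat_fun_ge0// lee_fin symbol_density_ge0.
Qed.

(** Each of the [n] later visits to [0] is a convolution with [heat_fun 0]; associativity and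
    commutativity move it before the factor that carries the test function. *)
Lemma chain_at_zeros_Some_zeros n k p : chain_at (zeros n ++ Some p :: zeros k) 0 =
  conv (chain_at (zeros (n + k)) 0) (fun r => (2^-1)%:E * heat_cos0 (half_freq p) r)%E.
Proof.
have mf := measurable_heat_fun; have mc := measurable_chain_at.
have f0 := heat_fun_ge0; have c0 := chain_at_ge0.
set c2 := fun r => _.
have c20 r : (0 <= c2 r)%E by rewrite mule_ge0 ?heat_cos0_ge0// lee_fin.
have mc2 : measurable_fun setT c2 by apply: emeasurable_funM => //; exact: measurable_heat_cos0.
elim: n => [|n IH]; first by apply/funext => t; rewrite cat0s chain_at_Some_zeros.
apply/funext => t; rewrite cat_cons chain_at_None IH addSn.
have -> : chain_at (zeros (n + k).+1) 0 = conv (chain_at (zeros (n + k)) 0) (heat_fun 0).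
  by apply/funext => s; exact: chain_at_None.
rewrite (convA t (mc _ 0) mc2 (mf 0) (c0 _ 0) c20 (f0 0)).
rewrite (convA t (mc _ 0) (mf 0) mc2 (c0 _ 0) (f0 0) c20).
by congr (conv _ _ t); apply/funext => s; exact: (convC s mc2 (mf 0) c20 (f0 0)).
Qed.

(* By [conv_heat_heat] a visit to [z] followed by visits to [0] has the density of
   visits to [0] followed by an end at [2 * z]. *)
Lemma terminal_chain_at n k p :
  (\int[mu]_s terminal_step 0%R (zeros (n + k)) (half_freq p) s =
   2%:E * chain_at (zeros n ++ Some p :: zeros k) 0%R 1%R)%E.
Proof.
rewrite integral_terminal0 chain_at_zeros_Some_zeros /conv -ge0_integralZl//.
- apply: eq_integral => s _; rewrite [RHS]muleCA; congr (_ * _)%E.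
  by rewrite /heat_cos0 -!EFinM mulrA mulfV ?pnatr_eq0// mul1r.
- have mc2 : measurable_fun setT (fun r => (2^-1)%:E * heat_cos0 (half_freq p) r)%E.
    by apply: emeasurable_funM => //; exact: measurable_heat_cos0.
  have mi := measurable_conv_integrand (measurable_chain_at (zeros (n + k)) 0) mc2.
  exact: (measurableT_comp mi (pair1_measurable (1 : R))).
- by move=> s _; rewrite !mule_ge0 ?chain_at_ge0 ?heat_cos0_ge0// lee_fin.
Qed.

End limit_chain.

(** * Local times as limits of occupation times *)

Section path_calculus.
Local Open Scope ring_scope.
Context (R : realType).
Notation mu := (@lebesgue_measure R).

Lemma continuous_clamp01 : continuous (@clamp01 R).
Proof.
have cmin : continuous (fun x : R => Num.min 1 x).
  by move=> x; apply: (@continuous_min _ _ (cst 1) id); [exact: cvg_cst|exact: cvg_id].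
move=> x; have := @continuous_max _ _ (cst 0 : R -> R^o) (fun x => Num.min 1 x) x.
by apply; [exact: cvg_cst|exact: cmin].
Qed.

Lemma within_continuous_comp (U V W : topologicalType) (A : set V) (f : V -> W) (g : U -> V) :
  {within A, continuous f} -> (forall x, A (g x)) -> continuous g -> continuous (f \o g).
Proof.
move=> /subspace_continuousP cf gA cg x N /(cf _ (gA x)) /= fN.
have := cg x _ fN; rewrite /= /nbhs /=; apply: filterS => y /= h; exact: h (gA y).
Qed.

Variable psi : R -> R.
Hypotheses (cpsi : continuous psi) (psi0 : forall s, 0 <= psi s).

(** The lower limit [-1] makes every time [t >= 0] an interior point, so that the primitive is
    differentiable at [0] as well; only its differences enter. *)
Definition primitive (t : R) := \int[mu]_(s in `[-1, t]) psi s.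

Lemma is_derive_primitive (t : R) : -1 < t -> is_derive t 1 primitive (psi t).
Proof.
move=> t1.
have ip : mu.-integrable `[-1, t + 1] (EFin \o psi).
  apply: continuous_compact_integrable; first exact: segment_compact.
  exact: continuous_subspaceT.
have tt : t < t + 1 by rewrite ltrDl.
have [d E] := @continuous_FTC1_closed _ psi (-1) t (t + 1) tt ip t1 (@cpsi t).
by apply: DeriveDef; [exact: d|rewrite -derive1E; exact: E].
Qed.

(** The integrand is the derivative of the next divided power of [primitive s - primitive u].
    Ordered integrals of equal factors thus become powers over factorials without any
    symmetrisation. *)
Lemma integral_primitive_pow n (u t : R) : 0 <= u -> u <= t ->
  (\int[mu]_(s in `[u, t]) (psi s * ((primitive s - primitive u) ^+ n / n`!%:R))%:E =
   ((primitive t - primitive u) ^+ n.+1 / n.+1`!%:R)%:E)%E.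
Proof.
move=> u0; rewrite le_eqVlt => /predU1P[<-|ut].
  by rewrite subrr expr0n mul0r set_itv1 integral_set1.
pose F (s : R) := (primitive s - primitive u) ^+ n.+1 / n.+1`!%:R.
pose f (s : R) := psi s * ((primitive s - primitive u) ^+ n / n`!%:R).
have dF (s : R) : -1 < s -> is_derive s 1 F (f s).
  move=> s1; have h := is_derive_primitive s1.
  have h1 : is_derive s 1 (fun s => primitive s - primitive u) (psi s).
    by apply: (is_derive_eq (is_deriveB h (is_derive_cst _ _ _))); rewrite subr0.
  have h2 := is_deriveX n.+1 h1.
  have h3 := is_deriveZ (n.+1`!%:R^-1 : R) h2.
  have FE : F = n.+1`!%:R^-1 \*: ((fun s => primitive s - primitive u) ^+ n.+1).
    by apply/funext => r; rewrite /F fctE /= mulrC.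
  rewrite FE; apply: (is_derive_eq h3); rewrite /f /GRing.scale/= factS natrM.
  have n0 : n.+1%:R != 0 :> R by rewrite pnatr_eq0.
  have f0 : n`!%:R != 0 :> R by rewrite pnatr_eq0 -lt0n fact_gt0.
  by move: (n.+1%:R) (n`!%:R) n0 f0 => a c a0 c0; field; rewrite a0 c0.
have cp (s : R) : -1 < s -> {for s, continuous primitive}.
  move=> s1; have h := is_derive_primitive s1.
  by apply: differentiable_continuous; exact/derivable1_diffP/ex_derive.
have cF (s : R) : -1 < s -> {for s, continuous F}.
  move=> s1; have h := dF _ s1.
  by apply: differentiable_continuous; exact/derivable1_diffP/ex_derive.
have u1 : -1 < u by rewrite (lt_le_trans _ u0)// ltrN10.
have t1 : -1 < t := lt_trans u1 ut.
have cf : {within `[u, t], continuous f}.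
  apply: continuous_in_subspaceT => s; rewrite inE/= in_itv/= => /andP[us _].
  apply: cvgM; first exact: cpsi.
  apply: cvgM; last exact: cvg_cst.
  apply: (@continuous_comp _ _ _ (fun s => primitive s - primitive u) (fun x => x ^+ n)).
    by apply: cvgB; [apply: cp; exact: lt_le_trans us|exact: cvg_cst].
  exact: exprn_continuous.
rewrite (@continuous_FTC2 _ f F u t ut cf).
- by rewrite /F subrr expr0n mul0r sube0.
- split.
  + move=> s; rewrite in_itv/= => /andP[us _].
    by have h := dF s (lt_trans u1 us); exact: ex_derive.
  + by apply: cvg_at_right_filter; exact: cF.
  + by apply: cvg_at_left_filter; exact: cF.
- move=> s; rewrite in_itv/= => /andP[us _].
  by have h := dF s (lt_trans u1 us); rewrite derive1E derive_val.
Qed.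

Lemma primitive_le (u t : R) : 0 <= u -> u <= t -> primitive u <= primitive t.
Proof.
move=> u0 ut; rewrite -subr_ge0 -[leRHS]expr1 -[leRHS]divr1 -lee_fin.
have := integral_primitive_pow 0 u0 ut; rewrite fact0 => <-.
by apply: integral_ge0 => s _; rewrite lee_fin expr0 divr1 mulr1.
Qed.

End path_calculus.

Section pathwise.
Local Open Scope ring_scope.
Context (R : realType).
Notation mu := (@lebesgue_measure R).

Lemma integral_itv_ind (a b : R) (g : R -> \bar R) : measurable_fun setT g ->
  (\int[mu]_s (((a < s < b)%R%:R)%:E * g s) = \int[mu]_(s in `[a, b]) g s)%E.
Proof.
move=> mg; rewrite -integral_itv_obnd_cbnd; last exact: measurable_funTS.
rewrite -integral_itv_bndo_bndc; last exact: measurable_funTS.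
rewrite [RHS]integral_mkcond; apply: eq_integral => s _; rewrite patchE.
have -> : (s \in (`]a, b[%classic : set R)) = (a < s < b).
  by apply/idP/idP; rewrite inE /= in_itv.
by case: ifPn => _; rewrite ?mul1e ?mul0e.
Qed.

Lemma measurable_primitive (psi : R -> R) : measurable_fun setT psi -> (forall s, 0 <= psi s) ->
  measurable_fun setT (primitive psi).
Proof.
move=> mpsi psi0.
pose G (t s : R) := ((s <= t)%R%:R * ((-1 <= s)%R%:R * psi s))%:E.
have mn : measurable_fun setT (fun c : bool => c%:R : R) by [].
have mG : measurable_fun setT (fun q : R * R => G q.1 q.2).
  apply/measurable_EFinP; apply: measurable_funM.
    by apply: (measurableT_comp mn); exact: measurable_fun_ler.
  have m1 : measurable_fun setT (fun s : R => (-1 <= s)%R%:R * psi s).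
    by apply: measurable_funM => //; apply: (measurableT_comp mn); exact: measurable_fun_ler.
  exact: (measurableT_comp m1 measurable_snd).
have -> : primitive psi = fun t => fine (\int[mu]_s G t s)%E.
  apply/funext => t; rewrite /primitive /Rintegral; congr fine.
  rewrite integral_mkcond; apply: eq_integral => s _; rewrite patchE /G.
  have -> : (s \in (`[-1, t]%classic : set R)) = (-1 <= s <= t).
    by apply/idP/idP; rewrite inE /= in_itv.
  by case: (-1 <= s); case: (s <= t); rewrite /= ?(mul1r, mul0r).
apply: (measurableT_comp (fine_measurable measurableT)).
apply: (ge0_measurable_integral2 mu mG) => t s.
by rewrite lee_fin !mulr_ge0.
Qed.

Context d (T : measurableType d).
Variables (X : R -> T -> R) (w : T) (eps : R).
Hypothesis eps0 : 0 <= eps.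
Hypothesis cX : continuous (X ^~ w).

Definition occupation (t : R) :=
  primitive (fun s => symbol_fun eps None (X s w)) t -
  primitive (fun s => symbol_fun eps None (X s w)) 0.

Let psi (s : R) := symbol_fun eps None (X s w).

Let cpsi : continuous psi.
Proof.
move=> s; apply: (@continuous_comp _ _ _ (X ^~ w) (symbol_fun eps None)); first exact: cX.
exact: continuous_symbol_fun.
Qed.

Let psi0 s : 0 <= psi s. Proof. exact: symbol_fun_ge0. Qed.

Let mpsi : measurable_fun setT psi.
Proof. exact: continuous_measurable_fun. Qed.

Lemma occupationB (u t : R) : occupation t - occupation u = primitive psi t - primitive psi u.
Proof. by rewrite /occupation opprB addrA subrK. Qed.

Lemma occupation_le (u t : R) : 0 <= u -> u <= t -> occupation u <= occupation t.
Proof. by move=> u0 ut; rewrite lerD2r; exact: primitive_le. Qed.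

Lemma occupation_ge0 (t : R) : 0 <= t -> 0 <= occupation t.
Proof. by move=> t0; rewrite subr_ge0; exact: primitive_le. Qed.

Lemma measurable_occupation : measurable_fun setT occupation.
Proof. by apply: measurable_funB => //; exact: measurable_primitive. Qed.

Lemma occupation_integral (t : R) : 0 <= t ->
  (\int[mu]_(s in `[0%R, t]) (symbol_fun eps None (X s w))%:E = (occupation t)%:E)%E.
Proof.
move=> t0; have := integral_primitive_pow cpsi 0 (lexx 0) t0.
rewrite expr1 fact0 !divr1 => <-; apply: eq_integral => s _.
by rewrite expr0 divr1 mulr1.
Qed.

Lemma integral_occupation_pow n (u t : R) : 0 <= u -> u <= t ->
  (\int[mu]_s ((u < s < t)%R%:R * (psi s * ((occupation s - occupation u) ^+ n / n`!%:R)))%:E =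
   ((occupation t - occupation u) ^+ n.+1 / n.+1`!%:R)%:E)%E.
Proof.
move=> u0 ut; rewrite [in RHS]occupationB -(integral_primitive_pow cpsi n u0 ut) -integral_itv_ind.
  by apply: eq_integral => s _; rewrite occupationB EFinM.
apply/measurable_EFinP; apply: measurable_funM => //; apply: measurable_funM => //.
apply: measurable_funX; apply: measurable_funB => //.
exact: measurable_primitive.
Qed.

Notation zeros k := (nseq k None : seq (symbol R)).

Lemma path_integral_zeros k (t : R) : 0 <= t ->
  path_integral X eps (zeros k) t w = (occupation t ^+ k / k`!%:R)%:E.
Proof.
elim: k t => [|k IH] t t0; first by rewrite /= expr0 fact0 divr1.
have o0 : occupation 0 = 0 by rewrite /occupation subrr.
rewrite -[occupation t]subr0 -[X in (_ - X) ^+ _]o0 -integral_occupation_pow//=.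
apply: eq_integral => s _; have [/andP[s0 st]|_] := boolP (0 < s < t); last by rewrite !mul0r mul0e.
by rewrite IH ?ltW// -EFinM o0 subr0 mulrA.
Qed.

(** The time [u] of the symbol separates [m] earlier visits from [n] later ones. In the induction on
    [n] the latest time [s] is exchanged with [u], and integration over [s] raises the power of
    [occupation s - occupation u]. *)
Lemma path_integral_zeros_Some_zeros n m p (t : R) : 0 <= t ->
  path_integral X eps (zeros n ++ Some p :: zeros m) t w =
  (\int[mu]_u ((0 < u < t)%R%:R * (symbol_density (Some p) (X u w) *
     (occupation u ^+ m / m`!%:R) * ((occupation t - occupation u) ^+ n / n`!%:R)))%:E)%E.
Proof.
elim: n t => [|n IH] t t0.
  apply: eq_integral => u _; rewrite -/(path_integral _ _ _).
  have [/andP[u0 ut]|_] := boolP (0 < u < t); last by rewrite !mul0r mul0e.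
  rewrite path_integral_zeros ?ltW// -EFinM expr0 fact0 divr1 mulr1 !mul1r.
  by rewrite /symbol_fun /symbol_scale invr1 !mul1r.
pose k u := symbol_density (Some p) (X u w) * (occupation u ^+ m / m`!%:R).
have k0 u : 0 <= u -> 0 <= k u.
  move=> u0; rewrite mulr_ge0 ?symbol_density_ge0// divr_ge0//.
  by rewrite exprn_ge0// occupation_ge0.
have mo := measurable_occupation.
have mk : measurable_fun setT k.
  apply: measurable_funM.
    exact: (measurableT_comp (measurable_symbol_density (Some p)) (continuous_measurable_fun cX)).
  by apply: measurable_funM => //; exact: measurable_funX.
pose G (s u : R) := ((0 < s < t)%R%:R * psi s * ((0 < u < s)%R%:R *
  (k u * ((occupation s - occupation u) ^+ n / n`!%:R))))%:E.
have G0 s u : (0 <= G s u)%E.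
  rewrite lee_fin mulr_ge0//; first by rewrite mulr_ge0.
  have [/andP[u0 us]|_] := boolP (0 < u < s); last by rewrite mul0r.
  rewrite mul1r mulr_ge0 ?(k0 _ (ltW u0))// divr_ge0// exprn_ge0// subr_ge0.
  by rewrite occupation_le// ltW.
have mind (f g h : R * R -> R) : measurable_fun setT f -> measurable_fun setT g ->
    measurable_fun setT h -> measurable_fun setT (fun q => (f q < g q < h q)%R%:R : R).
  move=> mf mg mh.
  have mn : measurable_fun setT (fun c : bool => c%:R : R) by [].
  by apply: (measurableT_comp mn); apply: measurable_and; exact: measurable_fun_ltr.
have mG : measurable_fun setT (fun q : R * R => G q.1 q.2).
  apply/measurable_EFinP; apply: measurable_funM.
    apply: measurable_funM; first exact: mind.
    exact: (measurableT_comp mpsi measurable_fst).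
  apply: measurable_funM; first exact: mind.
  apply: measurable_funM; first exact: (measurableT_comp mk measurable_snd).
  apply: measurable_funM => //; apply: measurable_funX; apply: measurable_funB.
    exact: (measurableT_comp mo measurable_fst).
  exact: (measurableT_comp mo measurable_snd).
transitivity (\int[mu]_s \int[mu]_u G s u)%E.
  apply: eq_integral => s _; rewrite -/(path_integral _ _ _).
  have [/andP[s0 st]|st] := boolP (0 < s < t); last first.
    rewrite mul0r mul0e integral0_eq// => u _; rewrite /G (negbTE st) !mul0r//.
  rewrite IH ?ltW// -ge0_integralZl//.
  - by apply: eq_integral => u _; rewrite /G s0 st -EFinM.
  - apply/measurable_EFinP.
    have m1 : measurable_fun setT (fun u : R => (0 < u < s)%R%:R : R).
      by apply: measurable_before.
    apply: measurable_funM => //; apply: measurable_funM => //.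
    by apply: measurable_funM => //; apply: measurable_funX; exact: measurable_funB.
  - move=> u _; rewrite lee_fin; have [/andP[u0 us]|_] := boolP (0 < u < s); last by rewrite mul0r.
    rewrite mul1r mulr_ge0 ?(k0 _ (ltW u0))// divr_ge0// exprn_ge0// subr_ge0.
    by rewrite occupation_le// ltW.
  - by rewrite mul1r lee_fin symbol_fun_ge0.
rewrite (@ge0_tonelli _ _ _ _ _ mu mu G mG G0); apply: eq_integral => u _.
have [/andP[u0 ut]|ut] := boolP (0 < u < t); last first.
  rewrite mul0r integral0_eq// => s _; rewrite /G.
  have [/andP[s0 st]|_] := boolP (0 < s < t); last by rewrite !mul0r.
  have [/andP[u0 us]|_] := boolP (0 < u < s); last by rewrite mul0r mulr0.
  by rewrite u0 (lt_trans us st) in ut.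
rewrite mul1r EFinM -integral_occupation_pow ?ltW// -ge0_integralZl//.
- apply: eq_integral => s _; rewrite /G -EFinM; congr EFin.
  have [us|us] := boolP (u < s); last by rewrite andbF /= !mul0r !mulr0.
  rewrite u0 (lt_trans u0 us) /=; case: (s < t); rewrite ?mul0r ?mulr0// !mul1r.
  by rewrite /k mulrCA.
- apply/measurable_EFinP; apply: measurable_funM.
    have mn : measurable_fun setT (fun c : bool => c%:R : R) by [].
    by apply: (measurableT_comp mn); apply: measurable_and; exact: measurable_fun_ltr.
  apply: measurable_funM => //; apply: measurable_funM => //.
  by apply: measurable_funX; exact: measurable_funB.
- move=> s _; rewrite lee_fin; have [/andP[us st]|_] := boolP (u < s < t); last by rewrite mul0r.
  rewrite mul1r mulr_ge0// divr_ge0// exprn_ge0// subr_ge0.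
  by rewrite occupation_le// ltW.
- by rewrite lee_fin k0// ltW.
Qed.

End pathwise.

Section square_bounded_convergence.
Local Open Scope ring_scope.
Context (R : realType) d (T : measurableType d) (P : probability T R).

(* A bound on the second moments makes the sequence uniformly integrable:
   [x <= min x K + x ^ 2 / K]. *)
Lemma square_bounded_integral (f_ : (T -> R)^nat) (f : T -> R) (C : R) (l : \bar R) :
  (forall n, measurable_fun setT (f_ n)) -> measurable_fun setT f ->
  (forall n w, 0 <= f_ n w) -> (forall w, 0 <= f w) -> 0 <= C ->
  {ae P, forall w, f_ n w @[n --> \oo] --> f w} ->
  (forall n, (\int[P]_w (f_ n w ^+ 2)%:E <= C%:E)%E) ->
  (\int[P]_w (f_ n w)%:E)%E @[n --> \oo] --> l ->
  (\int[P]_w (f w)%:E = l)%E.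
Proof.
(* One inequality is Fatou's lemma, the other one uses truncation at a level [K]. *)
move=> mf_ mf f_0 f0 C0 ff fC fl; apply/eqP; rewrite eq_le; apply/andP; split.
  have -> : (\int[P]_w (f w)%:E = \int[P]_w limn_einf (fun n => (f_ n w)%:E))%E.
    apply: ae_eq_integral => //.
    - exact/measurable_EFinP.
    - apply: measurableT_comp => //.
      apply: (@measurable_fun_limn_esup _ _ _ setT (fun n w => - (f_ n w)%:E)%E) => n.
      by apply: measurableT_comp => //; exact/measurable_EFinP.
    - apply: filterS ff => w fw _.
      have /cvg_limn_einf_sup[-> _] // : (f_ n w)%:E @[n --> \oo] --> (f w)%:E.
      by apply: cvg_EFin => //; exact: nearW.
  apply: (le_trans (fatou _ _ _ _)) => //.
  - by move=> n; exact/measurable_EFinP.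
  - by move=> n w _; rewrite lee_fin.
  by have /cvg_limn_einf_sup[-> _] := fl.
apply/lee_addgt0Pr => e e0.
(* At this level the truncation error [C / K] is at most [e]; the summand [1] keeps [K] positive
   when [C = 0]. *)
pose K := (C + 1) / e.
have K0 : 0 < K by rewrite divr_gt0// ltr_wpDl.
pose g_ n w := Num.min (f_ n w) K.
pose g w := Num.min (f w) K.
have mg_ n : measurable_fun setT (g_ n) by exact: measurable_minr.
have mg : measurable_fun setT g by exact: measurable_minr.
have g_0 n w : 0 <= g_ n w by rewrite le_min f_0 ltW.
have gcv : (\int[P]_w (g_ n w)%:E)%E @[n --> \oo] --> (\int[P]_w (g w)%:E)%E.
  apply: (@ge0_dominated_cvg _ _ _ P _ _ (cst K%:E)).
  - by move=> n; exact/measurable_EFinP.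
  - exact: measurable_cst.
  - by move=> n w; rewrite lee_fin.
  - by move=> n w; rewrite lee_fin ge_min lexx orbT.
  - apply: filterS ff => w fw; apply: cvg_EFin; first exact: nearW.
    apply: (cvg_comp (f_ ^~ w) (fun x => Num.min x K) fw).
    exact: (@continuous_min _ _ (id : R -> R^o) (cst K) (f w) (@cvg_id _ _) (cvg_cst _)).
  - exact/measurable_EFinP.
  - by rewrite probability_integral_cst ltry.
have gf : (\int[P]_w (g w)%:E <= \int[P]_w (f w)%:E)%E.
  apply: ge0_le_integral => //.
  - by move=> w _; rewrite lee_fin le_min f0 ltW.
  - exact/measurable_EFinP.
  - exact/measurable_EFinP.
  - by move=> w _; rewrite lee_fin ge_min lexx.
apply: (@le_trans _ _ (\int[P]_w (g w)%:E + e%:E)%E); last by rewrite leeD2r.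
apply: (lee_cvg_to fl (_ : (\int[P]_w (g_ n w)%:E + e%:E)%E @[n --> \oo] --> _)).
  by apply: cvgeD => //; [exact: fin_num_adde_defl|exact: cvg_cst].
apply: nearW => n.
have -> : e%:E = (e / (C + 1) * (C + 1))%:E by rewrite divfK// gt_eqF// ltr_wpDl.
apply: (@le_trans _ _ (\int[P]_w ((g_ n w)%:E + (e / (C + 1) * (f_ n w) ^+ 2)%:E))%E).
  apply: ge0_le_integral => //.
  - by move=> w _; rewrite lee_fin.
  - exact/measurable_EFinP.
  - apply: emeasurable_funD; apply/measurable_EFinP => //.
    by apply: measurable_funM => //; exact: measurable_funX.
  - move=> w _; rewrite -EFinD lee_fin /g_; have [fK|fK] := leP (f_ n w) K.
      by rewrite lerDl mulr_ge0 ?sqr_ge0// divr_ge0 ?ltW// ltr_wpDl.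
    have h : f_ n w <= e / (C + 1) * f_ n w ^+ 2.
      have -> : e / (C + 1) = K^-1 by rewrite /K invf_div.
      by rewrite expr2 mulrA ler_peMl// mulrC ler_pdivlMr// mul1r ltW.
    by rewrite (le_trans h)// lerDr ltW.
rewrite ge0_integralD//; last 4 first.
- by move=> w _; rewrite lee_fin.
- exact/measurable_EFinP.
- by move=> w _; rewrite lee_fin mulr_ge0 ?sqr_ge0// divr_ge0 ?ltW// ltr_wpDl.
- by apply/measurable_EFinP; apply: measurable_funM => //; exact: measurable_funX.
rewrite leeD2l// EFinM; under eq_integral do rewrite EFinM.
rewrite ge0_integralZl//; last 3 first.
- by apply/measurable_EFinP; exact: measurable_funX.
- by move=> w _; rewrite lee_fin sqr_ge0.
- by rewrite lee_fin divr_ge0 ?ltW// ltr_wpDl.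
apply: lee_wpmul2l; first by rewrite lee_fin divr_ge0 ?ltW// ltr_wpDl.
by rewrite (le_trans (fC n))// lee_fin lerDl.
Qed.

End square_bounded_convergence.

Section occupation_limit.
Local Open Scope ring_scope.
Context (R : realType) d (T : measurableType d).
Notation mu := (@lebesgue_measure R).

Lemma integral_symbol_fun_None (eps : R) : 0 < eps ->
  (\int[mu]_x (symbol_fun eps None x)%:E = 1)%E.
Proof.
move=> e0; rewrite (@ge0_integral_affine_pos _ _ eps 0)//; last 2 first.
- by apply/measurable_EFinP; exact: measurable_symbol_fun.
- by move=> x; rewrite lee_fin symbol_fun_ge0// ltW.
rewrite -ge0_integralZl//; last 3 first.
- apply/measurable_EFinP; apply: (measurableT_comp (measurable_symbol_fun eps None)).
  by apply: measurable_funD => //; exact: measurable_funM.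
- by move=> x _; rewrite lee_fin symbol_fun_ge0// ltW.
- by rewrite lee_fin ltW.
rewrite -(integral_bump R); apply: eq_integral => x _; rewrite -EFinM addr0.
by rewrite /symbol_fun /= mulVKf ?gt_eqF// mulKf ?gt_eqF.
Qed.

Lemma symbol_fun_None_out (eps x : R) : 0 < eps -> eps <= `|x| -> symbol_fun eps None x = 0.
Proof.
move=> e0 ex; rewrite /symbol_fun /= bump_out ?mulr0// normrM gtr0_norm ?invr_gt0//.
by rewrite mulrC ler_pdivlMr// mul1r.
Qed.

Variables (X : R -> T -> R) (w : T) (l : R -> R) (u : R) (eps_ : R^nat).
Hypotheses (cX : continuous (X ^~ w)) (cl : continuous l) (u0 : 0 <= u).
Hypothesis occ : forall phi : R -> R, measurable_fun setT phi -> (forall x, 0 <= phi x) ->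
  (\int[mu]_(s in `[0%R, u]) (phi (X s w))%:E = \int[mu]_x (phi x * l x)%:E)%E.
Hypotheses (eps_0 : forall n, 0 < eps_ n) (eps_cvg : eps_ @ \oo --> 0).

(** By the occupation formula the occupation time is an average of [l] against a probability density
    carried by [[- eps, eps]], so it converges by continuity of [l] at [0]. *)
Lemma occupation_cvg : occupation X w (eps_ n) u @[n --> \oo] --> l 0.
Proof.
apply/cvgrPdist_le => dl dl0.
have /cvgrPdist_le/(_ dl dl0)[r /= r0 lr] := @cl 0.
near=> n.
have er : eps_ n < r.
  near: n; have /cvgrPdist_lt/(_ r r0) := eps_cvg.
  by apply: filterS => n; rewrite sub0r normrN => /(le_lt_trans (ler_norm _)).
have e0 := eps_0 n; set eps := eps_ n in e0 er *.
pose phi := symbol_fun eps None.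
have phi0 x : 0 <= phi x by rewrite symbol_fun_ge0// ltW.
have mphi : measurable_fun setT phi by exact: measurable_symbol_fun.
have iphi : mu.-integrable setT (EFin \o phi).
  apply/integrableP; split; first exact/measurable_EFinP.
  under eq_integral do rewrite /= ger0_norm//.
  by rewrite integral_symbol_fun_None// ltry.
have philb x : phi x * (l 0 - dl) <= phi x * l x <= phi x * (l 0 + dl).
  have [xe|xe] := leP eps `|x|; first by rewrite /phi symbol_fun_None_out// !mul0r lexx.
  have := lr x; rewrite /= sub0r normrN => /(_ (lt_trans xe er)).
  rewrite distrC ler_distl => /andP[h1 h2].
  by rewrite !ler_wpM2l.
have ml : measurable_fun setT l := continuous_measurable_fun cl.
have iphic c : mu.-integrable setT (fun x => (phi x * c)%:E).
  by under eq_fun do rewrite mulrC EFinM; exact: integrableZl.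
have iphil : mu.-integrable setT (fun x => (phi x * l x)%:E).
  apply: le_integrable (iphic (`|l 0| + dl)) => //.
    by apply/measurable_EFinP; exact: measurable_funM.
  have b0 : 0 <= `|l 0| + dl by rewrite addr_ge0// ltW.
  move=> x _; rewrite !abse_EFin lee_fin [leRHS](ger0_norm (mulr_ge0 (phi0 x) b0)).
  have /andP[h1 h2] := philb x; rewrite ler_norml; apply/andP; split.
    rewrite -mulrN (le_trans _ h1)// ler_wpM2l// opprD lerD2r lerNl.
    by rewrite -normrN ler_norm.
  by rewrite (le_trans h2)// ler_wpM2l// lerD2r ler_norm.
have intc c : (\int[mu]_x (phi x * c)%:E = c%:E)%E.
  under eq_integral do rewrite mulrC EFinM.
  by rewrite integralZl// integral_symbol_fun_None// mule1.
have oE : ((occupation X w eps u)%:E = \int[mu]_x (phi x * l x)%:E)%E.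
  by rewrite -occ// occupation_integral// ltW.
rewrite distrC ler_distl -!lee_fin oE -(intc (l 0 - dl)) -(intc (l 0 + dl)).
apply/andP; split; apply: le_integral => //.
- by move=> x _; rewrite lee_fin; case/andP: (philb x).
- by move=> x _; rewrite lee_fin; case/andP: (philb x).
Unshelve. all: by end_near. Qed.

End occupation_limit.

(** * The process at an independent uniform time *)

Section process_at_uniform_time.
Local Open Scope ring_scope.
Context (R : realType).
Notation mu := (@lebesgue_measure R).

Lemma uniform_integral d (T : measurableType d) (P : probability T R) (U : {RV P >-> R})
    (k : R -> \bar R) : is_uniform01 U -> measurable_fun setT k -> (forall x, 0 <= k x)%E ->
  (\int[P]_w k (U w) = \int[mu]_(u in `[0%R, 1%R]) k u)%E.
Proof.
move=> [_ hU] mk k0.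
have mU0 : measurable_fun setT (U : T -> R) by [].
have mU : measurable_fun setT (U : T -> measurableTypeR R) by exact: mU0.
transitivity (\int[pushforward P (U : T -> measurableTypeR R)]_u k u)%E.
  by rewrite ge0_integral_pushforward// preimage_setT.
transitivity (\int[uniform_prob (@ltr01 R)]_u k u)%E.
  by apply: eq_measure_integral => //= A mA _; exact: hU.
rewrite integral_uniform//.
by rewrite subr0 invr1 mul1e.
Qed.

(** Built from [path_integral] with clamped time, it is jointly measurable for every sigma-algebra
    for which the process is; below this is used with the sigma-algebra generated by the process. *)
Definition occ_at (eps : R) d (T : measurableType d) (X : R -> T -> R) (u : R) (w : T) : R :=
  fine (path_integral X eps [:: None] (clamp01 u) w).

Definition moment_fun (eps : R) n m (p : R * R) d (T : measurableType d) (X : R -> T -> R)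
    (u : R) (w : T) : R :=
  symbol_density (Some p) (X u w) * (occ_at eps X u w ^+ m / m`!%:R) *
  ((occ_at eps X 1 w - occ_at eps X u w) ^+ n / n`!%:R).

Lemma measurable_occ_at (eps : R) d (T : measurableType d) (X : R -> T -> R) : 0 <= eps ->
  measurable_fun setT (fun q : R * T => X q.1 q.2) ->
  measurable_fun setT (fun q : R * T => occ_at eps X q.1 q.2).
Proof.
move=> e0 mX; apply: (measurableT_comp (fine_measurable measurableT)).
have mp := measurable_path_integral mX [:: None] e0.
have mc : measurable_fun setT (fun q : R * T => (clamp01 q.1, q.2) : R * T).
  by apply: measurable_fun_pair => //; exact: (measurableT_comp (@measurable_clamp01 R) measurable_fst).
exact: (measurableT_comp mp mc).
Qed.

Lemma measurable_moment_fun (eps : R) n m p d (T : measurableType d) (X : R -> T -> R) : 0 <= eps ->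
  measurable_fun setT (fun q : R * T => X q.1 q.2) ->
  measurable_fun setT (fun q : R * T => moment_fun eps n m p X q.1 q.2).
Proof.
move=> e0 mX; have mo := measurable_occ_at e0 mX.
have m1 : measurable_fun setT (fun q : R * T => occ_at eps X 1 q.2).
  have mc : measurable_fun setT (fun q : R * T => (1, q.2) : R * T) by exact: measurable_fun_pair.
  exact: (measurableT_comp mo mc).
apply: measurable_funM; first apply: measurable_funM.
- exact: (measurableT_comp (measurable_symbol_density (Some p)) mX).
- by apply: measurable_funM => //; exact: measurable_funX.
- by apply: measurable_funM => //; apply: measurable_funX; exact: measurable_funB.
Qed.

Section paths.
Context d (T : measurableType d) (X : R -> T -> R) (w : T) (eps : R).
Hypotheses (eps0 : 0 <= eps) (cX : continuous (X ^~ w)).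

Lemma occ_atE (u : R) : 0 <= u <= 1 -> occ_at eps X u w = occupation X w eps u.
Proof.
move=> u01; rewrite /occ_at clamp01_id// (path_integral_zeros eps0 cX 1).
  by rewrite expr1 divr1.
by case/andP: u01.
Qed.

Lemma occ_at_le (u : R) : 0 <= u <= 1 -> 0 <= occ_at eps X u w <= occ_at eps X 1 w.
Proof.
move=> /[dup] u01 /andP[u0 u1]; rewrite !occ_atE ?lexx ?ler01//.
by rewrite occupation_ge0// occupation_le.
Qed.

Lemma moment_fun_ge0 n m p (u : R) : 0 <= u <= 1 -> 0 <= moment_fun eps n m p X u w.
Proof.
move=> u01; have /andP[a0 a1] := occ_at_le u01.
rewrite mulr_ge0//; last by rewrite divr_ge0// exprn_ge0// subr_ge0.
by rewrite mulr_ge0 ?symbol_density_ge0// divr_ge0// exprn_ge0.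
Qed.

Lemma moment_fun_le n m p (u : R) : 0 <= u <= 1 ->
  moment_fun eps n m p X u w <= 2 * occ_at eps X 1 w ^+ (m + n).
Proof.
move=> u01; have /andP[a0 a1] := occ_at_le u01.
have fle k (x y : R) : 0 <= x -> x <= y -> x ^+ k / k`!%:R <= y ^+ k.
  move=> x0 xy; rewrite ler_pdivrMr ?ltr0n ?fact_gt0//.
  apply: (@le_trans _ _ (y ^+ k)); first by rewrite lerXn2r ?nnegrE// (le_trans x0).
  by rewrite ler_peMr ?exprn_ge0 ?(le_trans x0)// ler1n fact_gt0.
rewrite exprD mulrA ler_pM//.
- by rewrite mulr_ge0 ?symbol_density_ge0// divr_ge0// exprn_ge0.
- by rewrite divr_ge0// exprn_ge0// subr_ge0.
- rewrite ler_pM// ?symbol_density_ge0//.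
  + by rewrite divr_ge0// exprn_ge0.
  + by have := cos_le1 (p.1 * X u w + p.2); rewrite /=; lra.
  + exact: fle.
- by apply: fle; rewrite ?subr_ge0// gerBl.
Qed.

Lemma integral_moment_fun n m p :
  (\int[mu]_(u in `[0%R, 1%R]) (moment_fun eps n m p X u w)%:E =
   path_integral X eps (nseq n None ++ Some p :: nseq m None) 1%R w)%E.
Proof.
pose K (u : R) := symbol_density (Some p) (X u w) * (occupation X w eps u ^+ m / m`!%:R) *
  ((occupation X w eps 1 - occupation X w eps u) ^+ n / n`!%:R).
transitivity (\int[mu]_(u in `[0%R, 1%R]) (K u)%:E)%E.
  apply: eq_integral => u; rewrite inE/= in_itv/= => u01.
  by rewrite /moment_fun !occ_atE ?lexx ?ler01.
rewrite (path_integral_zeros_Some_zeros eps0 cX)// -(@integral_itv_ind _ 0 1).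
  by apply: eq_integral => u _; rewrite -EFinM.
have mo := measurable_occupation eps0 cX.
apply/measurable_EFinP; apply: measurable_funM; first apply: measurable_funM.
- exact: (measurableT_comp (measurable_symbol_density (Some p)) (continuous_measurable_fun cX)).
- by apply: measurable_funM => //; exact: measurable_funX.
- by apply: measurable_funM => //; apply: measurable_funX; exact: measurable_funB.
Qed.

Lemma path_integral_None_pow k : path_integral X eps (nseq k None) 1 w = (occ_at eps X 1 w ^+ k / k`!%:R)%:E.
Proof.
by rewrite (path_integral_zeros eps0 cX)// occ_atE// lexx ler01.
Qed.

End paths.

(* The occupation times are functionals of the process, so that the independence
   of [U] and the process gives the law at time [U] by integration over the time. *)
Lemma expectation_moment_fun (eps : R) n m p d (T : measurableType d) (P : probability T R)
    (b : R -> {RV P >-> R}) (U : {RV P >-> R}) : 0 < eps ->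
  continuous_paths `[0%R, 1%R] b -> is_uniform01 U -> indep_process U `[0%R, 1%R] b ->
  (\int[P]_w (moment_fun eps n m p (clamped (fun t => b t : T -> R)) (U w) w)%:E =
   \int[P]_w path_integral (clamped (fun t => b t : T -> R)) eps
      (nseq n None ++ Some p :: nseq m None) 1%R w)%E.
Proof.
move=> e0 cb hU hUb; have e0' := ltW e0.
set X := clamped (fun t => b t : T -> R).
have cX w : continuous (X ^~ w).
  apply: (@within_continuous_comp R R R `[0, 1] (b ^~ w) (@clamp01 R)).
  - exact: cb.
  - by move=> t; rewrite /= in_itv/=; exact: clamp01_itv.
  - exact: continuous_clamp01.
pose G := \bigcup_(t in (`[0, 1]%classic : set R)) g_sigma_algebra_preimage (b t).
(* Independence is given for events of the process, so the sample space is equipped with the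
   sigma-algebra they generate and the identity is viewed as a random variable into it. *)
pose T' := g_sigma_algebraType G.
have mid : measurable_fun setT (id : T -> T').
  move=> _ A mA; rewrite setTI /=; move: A mA; apply: smallest_sub.
    exact: sigma_algebra_measurable.
  by move=> A [t _] [B mB <-]; rewrite setTI; apply: measurable_funPTI.
have mX' : measurable_fun setT (fun q : R * T' => X q.1 q.2).
  apply: (@measurable_continuous_process R _ T' (fun t => b t : T' -> R)).
    move=> t t01 _ B mB; rewrite setTI; apply: sub_sigma_algebra.
    by exists t; [rewrite /= in_itv|exists B => //; rewrite setTI].
  exact: cb.
have mX : measurable_fun setT (fun q : R * T => X q.1 q.2).
  by apply: (@measurable_continuous_process R _ T (fun t => b t : T -> R)).
(* The indicator makes [Phi] nonnegative at all real [u], as the integral formulas below require. *)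
pose Phi (u : R) (w : T') : \bar R := ((0 <= u <= 1)%R%:R * moment_fun eps n m p X u w)%:E.
have mn : measurable_fun setT (fun c : bool => c%:R : R) by [].
have mind : measurable_fun setT (fun u : R => (0 <= u <= 1)%R%:R : R).
  by apply: (measurableT_comp mn); apply: measurable_and; exact: measurable_fun_ler.
have mPhi : measurable_fun setT (fun q : R * T' => Phi q.1 q.2).
  apply/measurable_EFinP; apply: measurable_funM; first exact: (measurableT_comp mind measurable_fst).
  exact: measurable_moment_fun.
have mPhi2 : measurable_fun setT (fun q : R * T => Phi q.1 q.2).
  apply/measurable_EFinP; apply: measurable_funM; first exact: (measurableT_comp mind measurable_fst).
  exact: measurable_moment_fun.
have Phi0 u (w : T') : (0 <= Phi u w)%E.
  rewrite lee_fin; have [u01|_] := boolP (0 <= u <= 1); last by rewrite mul0r.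
  by rewrite mul1r (moment_fun_ge0 e0' (@cX w)).
have U01 w : 0 <= U w <= 1 by have := hU.1 w; rewrite in_itv.
have ind : indep_var P (U : T -> R) (id : T -> T').
  by move=> A C mA mC; exact: hUb.
transitivity (\int[P]_w Phi (U w) w)%E.
  by apply: eq_integral => w _; rewrite /Phi U01 mul1r.
have mU : measurable_fun setT (U : T -> R) by [].
rewrite (@indep_var_integral _ _ _ P _ _ _ _ (U : T -> R) (id : T -> T') mU mid Phi ind mPhi Phi0).
rewrite (@uniform_integral _ _ P U (fun u => \int[P]_w Phi u w)%E hU); last 2 first.
- by apply: (ge0_measurable_integral2 P mPhi2) => u w; exact: Phi0.
- by move=> u; apply: integral_ge0 => w _; exact: Phi0.
transitivity (\int[mu]_u \int[P]_w Phi u w)%E.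
  rewrite integral_mkcond; apply: eq_integral => u _; rewrite patchE.
  case: ifPn => //; rewrite notin_setE/= in_itv/= => /negP/negbTE u01.
  by rewrite integral0_eq// => w _; rewrite /Phi u01 mul0r.
rewrite (@ge0_tonelli _ _ _ _ _ mu P Phi mPhi2 Phi0); apply: eq_integral => w _.
rewrite -(integral_moment_fun e0' (@cX w)) [RHS]integral_mkcond; apply: eq_integral => u _.
rewrite patchE /Phi.
have -> : (u \in (`[0, 1]%classic : set R)) = (0 <= u <= 1).
  by apply/idP/idP; rewrite inE /= in_itv.
by case: ifPn => _; rewrite ?mul1r ?mul0r.
Qed.

End process_at_uniform_time.

Section local_time_limit.
Local Open Scope ring_scope.
Context (R : realType) d (T : measurableType d) (P : probability T R).
Notation mu := (@lebesgue_measure R).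
Variables (I : set R) (X0 : R -> {RV P >-> R}) (ell : R -> R -> {RV P >-> R}).
Hypotheses (I01 : `[0, 1]%classic `<=` I) (hell : is_local_time I X0 ell).
Hypothesis cX0 : continuous_paths `[0%R, 1%R] X0.
Notation X := (clamped (fun t => X0 t : T -> R)).

Lemma continuous_clamped w : continuous (X ^~ w).
Proof.
apply: (@within_continuous_comp R R R `[0, 1] (X0 ^~ w) (@clamp01 R)).
- exact: cX0.
- by move=> t; rewrite /= in_itv/=; exact: clamp01_itv.
- exact: continuous_clamp01.
Qed.

Lemma measurable_clamped : measurable_fun setT (fun q : R * T => X q.1 q.2).
Proof. by apply: (@measurable_continuous_process R _ T (fun t => X0 t : T -> R)). Qed.

Let cell w : {within I `*` [set: R], continuous (fun ux : R * R => ell ux.1 ux.2 w)}.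
Proof. by case: hell => + _; exact. Qed.

Lemma continuous_local_time_space (u : R) w : 0 <= u <= 1 -> continuous (fun x => ell u x w).
Proof.
move=> u01.
have h := @within_continuous_comp R (R * R)%type R (I `*` setT)
  (fun ux => ell ux.1 ux.2 w) (fun x => (u, x)) (@cell w).
apply: h => [x|x].
  by split => //=; apply: I01; rewrite /= in_itv.
exact: (@cvg_pair _ _ _ _ (nbhs u) (nbhs x) _ _ _ (fun=> u) id (cvg_cst u) cvg_id).
Qed.

Lemma continuous_local_time_clamped w : continuous (fun u => ell (clamp01 u) 0 w).
Proof.
have h := @within_continuous_comp R (R * R)%type R (I `*` setT)
  (fun ux => ell ux.1 ux.2 w) (fun u => (clamp01 u, 0)) (@cell w).
apply: h => [x|x].
  by split => //=; apply: I01; rewrite /= in_itv/= clamp01_itv.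
exact: (@cvg_pair _ _ _ _ (nbhs (clamp01 x)) (nbhs (0 : R)) _ _ _ (@clamp01 R) (fun=> 0) (@continuous_clamp01 R x) (cvg_cst 0)).
Qed.

Lemma measurable_local_time : measurable_fun setT (fun q : R * T => ell (clamp01 q.1) 0 q.2).
Proof.
apply: (@measurable_continuous_process R _ T (fun t w => ell t 0 w)) => //.
move=> w; apply/subspace_continuousP => s s01.
move=> N hN; have hN' : nbhs (ell (clamp01 s) 0 w) N by rewrite clamp01_id.
have h : \forall t \near s, N (ell (clamp01 t) 0 w) := @continuous_local_time_clamped w s N hN'.
change (\forall t \near s, (`[0, 1]%classic : set R) t -> N (ell t 0 w)).
by apply: filterS h => t + t01; rewrite clamp01_id.
Qed.

Definition eps_seq (n : nat) : R := n.+1%:R^-1.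

Lemma eps_seq_gt0 n : 0 < eps_seq n.
Proof. by rewrite invr_gt0 ltr0n. Qed.

Lemma eps_seq_cvg : eps_seq @ \oo --> 0.
Proof. exact: cvg_harmonic. Qed.

Lemma occ_at_cvg : {ae P, forall w, forall u, 0 <= u <= 1 ->
  occ_at (eps_seq n) X u w @[n --> \oo] --> ell u 0 w}.
Proof.
apply: filterS (local_time_occupation hell) => w occ u u01.
have cXw := @continuous_clamped w.
have E n : occ_at (eps_seq n) X u w = occupation X w (eps_seq n) u.
  by rewrite occ_atE// ltW// eps_seq_gt0.
rewrite (_ : (fun n => _) = (fun n => occupation X w (eps_seq n) u)); last exact/funext.
have /andP[u0 u1] := u01.
apply: (@occupation_cvg R d T X w (fun x => ell u x w) u eps_seq cXw) => //.
- exact: continuous_local_time_space.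
- move=> phi mphi phi0; rewrite -(occ u phi _ mphi phi0); last by apply: I01; rewrite /= in_itv.
  apply: eq_integral => s; rewrite inE/= in_itv/= => /andP[s0 su].
  by rewrite clamped_id// s0 (le_trans su).
- exact: eps_seq_gt0.
- exact: eps_seq_cvg.
Qed.

(** Sign and monotonicity are not part of the definition of local times; they are inherited, almost
    surely, from the occupation times that converge to them. *)
Lemma local_time_ge0_le : {ae P, forall w, forall u, 0 <= u <= 1 ->
  0 <= ell u 0 w <= ell 1 0 w}.
Proof.
apply: filterS occ_at_cvg => w h u u01.
have cXw := @continuous_clamped w.
have e0 n : 0 <= eps_seq n by rewrite ltW// eps_seq_gt0.
have le n := occ_at_le (e0 n) cXw u01.
apply/andP; split.
  by apply: (ler_cvg_to (cvg_cst 0) (h u u01)); apply: nearW => n; case/andP: (le n).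
apply: (ler_cvg_to (h u u01) (h 1 _)); first by rewrite lexx ler01.
by apply: nearW => n; case/andP: (le n).
Qed.

End local_time_limit.

(** * Moments of the local times *)

Section bridge_moments.
Local Open Scope ring_scope.
Context (R : realType) d (T : measurableType d) (P : probability T R).
Notation mu := (@lebesgue_measure R).
Notation zeros k := (nseq k None : seq (symbol R)).
Variables (b : R -> {RV P >-> R}) (lambda : R -> R -> {RV P >-> R}) (U : {RV P >-> R}).
Hypotheses (hb : is_brownian_bridge b) (hlambda : is_local_time `[0%R, 1%R] b lambda).
Hypotheses (hU : is_uniform01 U) (hUb : indep_process U `[0%R, 1%R] b).
Notation X := (clamped (fun t => b t : T -> R)).

(** The maximum with [0] alters the value on a null set only, and makes all powers nonnegative for
    every [w]. *)
Definition local_time_before w := Num.max 0 (lambda (U w) 0 w).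
Definition local_time_after w := Num.max 0 (lambda 1 0 w - lambda (U w) 0 w).

Let U01 w : 0 <= U w <= 1. Proof. by have := hU.1 w; rewrite in_itv. Qed.

Let cb := bridge_continuous hb.

Let mX : measurable_fun setT (fun q : R * T => X q.1 q.2).
Proof. exact: measurable_clamped. Qed.

Let mUid : measurable_fun setT (fun w : T => (U w : R, w) : R * T).
Proof. exact: measurable_fun_pair. Qed.

Lemma measurable_lambda_U : measurable_fun setT (fun w => lambda (U w) 0 w).
Proof.
have m := measurableT_comp (measurable_local_time (@subset_refl _ _) hlambda) mUid.
by move: m; apply: eq_measurable_fun => w _ /=; rewrite clamp01_id.
Qed.

Lemma measurable_bridge_U : measurable_fun setT (fun w => b (U w) w).
Proof.
by move: (measurableT_comp mX mUid); apply: eq_measurable_fun => w _ /=; rewrite clamped_id.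
Qed.

Lemma measurable_local_time_before : measurable_fun setT local_time_before.
Proof. by apply: measurable_maxr => //; exact: measurable_lambda_U. Qed.

Lemma measurable_local_time_after : measurable_fun setT local_time_after.
Proof.
by apply: measurable_maxr => //; apply: measurable_funB => //; exact: measurable_lambda_U.
Qed.

(** The summand [1] covers the empty list, which [bridge_path_integral] excludes. *)
Lemma bridge_path_integral_le (eps : R) l : 0 < eps ->
  (\int[P]_w path_integral X eps l 1 w <= 1 + majorant l 1 * ((heat 1 0)^-1)%:E)%E.
Proof.
move=> e0; have h0 : (0 <= ((heat 1 0)^-1)%:E :> \bar R)%E by rewrite lee_fin invr_ge0 heat_ge0.
case: l => [|o l].
  by rewrite probability_integral_cst leeDl// mule_ge0// majorant_ge0.
rewrite (bridge_path_integral hb)//.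
apply: (@le_trans _ _ (majorant (o :: l) 1 * ((heat 1 0)^-1)%:E)%E).
  by rewrite lee_wpmul2r// chain_le_majorant.
by rewrite leeDr.
Qed.

(** For positive [eps] the moment is a chain by [expectation_moment_fun] and [bridge_path_integral],
    and [chain_cvg] gives its limit; a uniform bound on second moments allows the limit under the
    expectation. The [n] visits after [U] stand first because the head of the list is the latest
    factor. *)
Lemma bridge_moments n m p :
  (\int[P]_w (symbol_density (Some p) (b (U w) w) * (local_time_before w ^+ m / m`!%:R) *
     (local_time_after w ^+ n / n`!%:R))%:E =
   chain_at (zeros n ++ Some p :: zeros m) 0%R 1%R * ((heat 1 0)^-1)%:E)%E.
Proof.
pose e := @eps_seq R.
have e0 k : 0 < e k := eps_seq_gt0 R k.
have e0' k : 0 <= e k := ltW (e0 k).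
pose K := (m + n)%N.
(* The moment function is at most [2 * a ^+ K], with [a] the total occupation, and the square of
   this is [4 * (2 * K)!] times the path integral of [2 * K] bumps, whose expectation the majorant
   bounds. *)
pose C := 4 * (2 * K)`!%:R * fine (1 + majorant (zeros (2 * K)) 1 * ((heat 1 0)^-1)%:E : \bar R)%E.
have finC : (1 + majorant (zeros (2 * K)) 1 * ((heat 1 0)^-1)%:E : \bar R)%E \is a fin_num.
  rewrite fin_numD fin_numM// ge0_fin_numE ?majorant_ge0// majorant_lty//.
have C0 : 0 <= C.
  rewrite mulr_ge0// fine_ge0// adde_ge0// mule_ge0 ?majorant_ge0//.
  by rewrite lee_fin invr_ge0 heat_ge0.
have mmf k : measurable_fun setT (fun w => moment_fun (e k) n m p X (U w) w).
  exact: (measurableT_comp (measurable_moment_fun n m p (e0' k) mX) mUid).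
apply: (@square_bounded_integral R d T P (fun k w => moment_fun (e k) n m p X (U w) w) _ C).
- exact: mmf.
- apply: measurable_funM; first apply: measurable_funM.
  + exact: (measurableT_comp (measurable_symbol_density (Some p)) measurable_bridge_U).
  + by apply: measurable_funM => //; apply: measurable_funX; exact: measurable_local_time_before.
  + by apply: measurable_funM => //; apply: measurable_funX; exact: measurable_local_time_after.
- by move=> k w; apply: moment_fun_ge0 => //; exact: continuous_clamped.
- move=> w; rewrite !mulr_ge0 ?symbol_density_ge0 ?invr_ge0 ?exprn_ge0//;
    by rewrite le_max lexx.
- exact: C0.
- have h1 := occ_at_cvg (@subset_refl _ _) hlambda cb.
  have h2 := local_time_ge0_le (@subset_refl _ _) hlambda cb.
  apply: filterS2 h1 h2 => w h1 h2.
  have /andP[l0 l1] := h2 _ (U01 w).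
  have o01 : 0 <= (1 : R) <= 1 by rewrite ler01 lexx.
  rewrite /local_time_before /local_time_after (max_r l0) max_r ?subr_ge0//.
  have c1 := h1 _ (U01 w); have c2 := h1 _ o01.
  have cpow k (f : nat -> R) (l : R) : f @ \oo --> l -> f j ^+ k / k`!%:R @[j --> \oo] --> l ^+ k / k`!%:R.
    move=> fl; apply: cvgM; last exact: cvg_cst.
    exact: (cvg_comp f (fun x => x ^+ k) fl (@exprn_continuous _ k _)).
  rewrite /moment_fun clamped_id//.
  apply: cvgM; last by apply: cpow; exact: cvgB.
  by apply: cvgM; [exact: cvg_cst|exact: cpow].
- move=> k; apply: (@le_trans _ _ (\int[P]_w ((4 * (2 * K)`!%:R)%:E * path_integral X (e k) (zeros (2 * K)) 1 w))%E).
    have cX w : continuous (X ^~ w) by exact: continuous_clamped.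
    apply: ge0_le_integral => //.
    + by move=> w _; rewrite lee_fin sqr_ge0.
    + by apply/measurable_EFinP; exact: measurable_funX.
    + apply: emeasurable_funM => //.
      exact: (measurable_fun_section2 (measurable_path_integral mX (zeros (2 * K)) (e0' k)) 1).
    + move=> w _; rewrite (path_integral_None_pow (e0' k) (@cX w)) -EFinM lee_fin.
      set a := occ_at (e k) X 1 w.
      have f1 : (2 * K)`!%:R != 0 :> R by rewrite pnatr_eq0 -lt0n fact_gt0.
      have -> : 4 * (2 * K)`!%:R * (a ^+ (2 * K) / (2 * K)`!%:R) = (2 * a ^+ K) ^+ 2.
        have -> : a ^+ (2 * K) = (a ^+ K) ^+ 2 by rewrite mulnC exprM.
        by move: (a ^+ K) ((2 * K)`!%:R) f1 => x c c0; field.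
      have a0 := moment_fun_ge0 (e0' k) (@cX w) n m p (U01 w).
      have a1 := moment_fun_le (e0' k) (@cX w) n m p (U01 w).
      by rewrite lerXn2r// nnegrE (le_trans a0 a1).
  rewrite ge0_integralZl//; last 2 first.
  + exact: (measurable_fun_section2 (measurable_path_integral mX (zeros (2 * K)) (e0' k)) 1).
  + by move=> w _; rewrite path_integral_ge0.
  have -> : C%:E = ((4 * (2 * K)`!%:R)%:E * (1 + majorant (zeros (2 * K)) 1 * ((heat 1 0)^-1)%:E))%E.
    by rewrite -(fineK finC) -EFinM.
  apply: lee_wpmul2l; first by rewrite lee_fin.
  exact: bridge_path_integral_le.
rewrite (_ : (fun k => _) = (fun k => chain (e k) (zeros n ++ Some p :: zeros m) 1 0 * ((heat 1 0)^-1)%:E)%E); last first.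
  apply/funext => k; rewrite (expectation_moment_fun n m p (e0 k) cb hU hUb).
  by case: (n) => [|n'] /=; rewrite (bridge_path_integral hb).
apply: cvgeM; last exact: cvg_cst.
  by apply: mule_def_fin => //; exact: chain_fin_num.
apply: chain_cvg => //; last exact: cvg_cst.
exact: eps_seq_cvg.
Qed.

End bridge_moments.

Section brownian_moments.
Local Open Scope ring_scope.
Context (R : realType) d (T : measurableType d) (P : probability T R).
Notation mu := (@lebesgue_measure R).
Notation zeros k := (nseq k None : seq (symbol R)).
Variables (B : R -> {RV P >-> R}) (L : R -> R -> {RV P >-> R}).
Hypotheses (hB : is_brownian_motion B) (hL : is_local_time `[0%R, +oo[ B L).
Notation X := (clamped (fun t => B t : T -> R)).

Let I01 : `[0, 1]%classic `<=` (`[0, +oo[%classic : set R).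
Proof. by move=> x /=; rewrite !in_itv/= andbT => /andP[]. Qed.

Let cB : continuous_paths `[0%R, 1%R] B.
Proof. by move=> w; have := @bm_continuous _ _ _ _ _ hB w; exact: continuous_subspaceW. Qed.

Let mX : measurable_fun setT (fun q : R * T => X q.1 q.2).
Proof. exact: measurable_clamped. Qed.

Definition local_time_one w := Num.max 0 (L 1 0 w).

Lemma measurable_local_time_one : measurable_fun setT local_time_one.
Proof. by apply: measurable_maxr. Qed.

Lemma brownian_path_integral_cos (eps : R) k p : 0 < eps ->
  (\int[P]_w ((symbol_density (Some p) (B 1 w))%:E * path_integral X eps (None :: zeros k) 1%R w) =
   \int[mu]_s terminal_step eps (zeros k) p s)%E.
Proof.
move=> e0; have md := @measurable_symbol_density R (Some p).
rewrite (brownian_path_integral hB (None :: zeros k) e0 (H := fun x => (symbol_density (Some p) x)%:E)).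
- exact: integral_chain_cos.
- exact/measurable_EFinP.
- by move=> x; rewrite lee_fin symbol_density_ge0.
Qed.

Lemma integral_terminal_le (eps : R) k p :
  (\int[mu]_s terminal_step eps (zeros k) p s <= majorant (Some p :: zeros k) 1)%E.
Proof.
apply: ge0_le_integral => //.
- by move=> s _; apply: integral_ge0 => z _; exact: terminal_integrand_ge0.
- exact: measurable_terminal_step.
- have mi := measurable_conv_integrand (measurable_majorant (zeros k)) (@measurable_symbol_kernel R (Some p)).
  exact: (measurableT_comp mi (pair1_measurable (1 : R))).
- by move=> s _; exact: terminal_step_le.
Qed.

(** The power is [k.+1] while the list has [k] bumps: the latest visit is the one inside
    [terminal_step]. As in [bridge_moments], a uniform bound on second moments justifies the
    limit. *)
Lemma brownian_moments k p :
  (\int[P]_w (symbol_density (Some p) (B 1 w) * (local_time_one w ^+ k.+1 / k.+1`!%:R))%:E =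
   \int[mu]_s terminal_step 0%R (zeros k) p s)%E.
Proof.
pose e := @eps_seq R.
have e0 j : 0 < e j := eps_seq_gt0 R j.
have e0' j : 0 <= e j := ltW (e0 j).
(* Chosen so that [K.+1 = 2 * k.+1], the degree of the squared moment function. *)
pose K := (2 * k).+1.
(* At frequency and phase [0] the symbol is the constant [2], which gives access to the plain
   moments of the occupation time. *)
pose z0 : R * R := (0, 0).
pose C := 4 * K.+1`!%:R * fine (majorant (Some z0 :: zeros K) 1 : \bar R)%E.
have finC : (majorant (Some z0 :: zeros K) 1 : \bar R)%E \is a fin_num.
  by rewrite ge0_fin_numE ?majorant_ge0// majorant_lty.
have C0 : 0 <= C by rewrite mulr_ge0// fine_ge0// majorant_ge0.
have cX w : continuous (X ^~ w) by exact: continuous_clamped.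
have o01 : 0 <= (1 : R) <= 1 by rewrite ler01 lexx.
have m1 : measurable_fun setT (fun w : T => (1, w) : R * T) by exact: measurable_fun_pair.
have mo j : measurable_fun setT (fun w => occ_at (e j) X 1 w).
  exact: (measurableT_comp (measurable_occ_at (e0' j) mX) m1).
have o0 j w : 0 <= occ_at (e j) X 1 w by case/andP: (occ_at_le (e0' j) (@cX w) o01).
have md : measurable_fun setT (fun w => symbol_density (Some p) (B 1 w)).
  by apply: (measurableT_comp (measurable_symbol_density (Some p))).
have d2 w : symbol_density (Some p) (B 1 w) <= 2.
  by have := cos_le1 (p.1 * B 1 w + p.2); rewrite /=; lra.
apply: (@square_bounded_integral R d T P
  (fun j w => symbol_density (Some p) (B 1 w) * (occ_at (e j) X 1 w ^+ k.+1 / k.+1`!%:R)) _ C).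
- by move=> j; apply: measurable_funM => //; apply: measurable_funM => //; exact: measurable_funX.
- apply: measurable_funM => //; apply: measurable_funM => //; apply: measurable_funX.
  exact: measurable_local_time_one.
- by move=> j w; rewrite mulr_ge0 ?symbol_density_ge0// divr_ge0// exprn_ge0.
- move=> w; rewrite !mulr_ge0 ?symbol_density_ge0 ?invr_ge0 ?exprn_ge0//.
  by rewrite le_max lexx.
- exact: C0.
- have h1 := occ_at_cvg I01 hL cB.
  have h2 := local_time_ge0_le I01 hL cB.
  apply: filterS2 h1 h2 => w h1 h2.
  have /andP[l0 _] := h2 _ o01.
  rewrite /local_time_one (max_r l0).
  apply: cvgM; first exact: cvg_cst.
  apply: cvgM; last exact: cvg_cst.
  exact: (cvg_comp (fun j => occ_at (e j) X 1 w) (fun x => x ^+ k.+1) (h1 _ o01) (@exprn_continuous _ _ _)).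
- move=> j; apply: (@le_trans _ _ (\int[P]_w ((4 * K.+1`!%:R)%:E *
      ((symbol_density (Some z0) (B 1 w))%:E * path_integral X (e j) (zeros K.+1) 1%R w)))%E).
    apply: ge0_le_integral => //.
    + by move=> w _; rewrite lee_fin sqr_ge0.
    + apply/measurable_EFinP; apply: measurable_funX; apply: measurable_funM => //.
      by apply: measurable_funM => //; exact: measurable_funX.
    + apply: emeasurable_funM => //; apply: emeasurable_funM.
        apply/measurable_EFinP.
        by apply: (measurableT_comp (measurable_symbol_density (Some z0))).
      exact: (measurable_fun_section2 (measurable_path_integral mX (zeros K.+1) (e0' j)) 1).
    + move=> w _; rewrite (path_integral_None_pow (e0' j) (@cX w)) -!EFinM lee_fin.
      have f1 : K.+1`!%:R != 0 :> R by rewrite pnatr_eq0 -lt0n fact_gt0.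
      set a := occ_at (e j) X 1 w.
      have -> : 4 * K.+1`!%:R * (symbol_density (Some z0) (B 1 w) * (a ^+ K.+1 / K.+1`!%:R)) =
          symbol_density (Some z0) (B 1 w) * (4 * a ^+ K.+1).
        by move: (K.+1`!%:R) f1 => c c0; field.
      have -> : symbol_density (Some z0) (B 1 w) = 2 :> R.
        by rewrite /= mul0r addr0 cos0; ring.
      have aK : a ^+ K.+1 = (a ^+ k.+1) ^+ 2.
        by rewrite -exprM; congr (_ ^+ _); rewrite /K muln2 -mul2n; ring.
      have q : a ^+ k.+1 / k.+1`!%:R <= a ^+ k.+1.
        rewrite ler_pdivrMr ?ltr0n ?fact_gt0//.
        by rewrite ler_peMr ?exprn_ge0 ?o0// ler1n fact_gt0.
      have q0 : 0 <= a ^+ k.+1 / k.+1`!%:R by rewrite divr_ge0// exprn_ge0// o0.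
      have d0 : 0 <= symbol_density (Some p) (B 1 w) by exact: symbol_density_ge0.
      have h : symbol_density (Some p) (B 1 w) * (a ^+ k.+1 / k.+1`!%:R) <= 2 * a ^+ k.+1 by rewrite ler_pM.
      have h2 : (symbol_density (Some p) (B 1 w) * (a ^+ k.+1 / k.+1`!%:R)) ^+ 2 <= (2 * a ^+ k.+1) ^+ 2.
        by rewrite lerXn2r// nnegrE mulr_ge0// exprn_ge0// o0.
      rewrite (le_trans h2)// aK exprMn; have := sqr_ge0 (a ^+ k.+1); lra.
  have mpi : measurable_fun setT (fun w => path_integral X (e j) (zeros K.+1) 1 w).
    exact: (measurable_fun_section2 (measurable_path_integral mX (zeros K.+1) (e0' j)) 1).
  rewrite ge0_integralZl//; last 2 first.
  + apply: emeasurable_funM => //; apply/measurable_EFinP.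
    by apply: (measurableT_comp (measurable_symbol_density (Some z0))).
  + by move=> w _; rewrite mule_ge0 ?path_integral_ge0// lee_fin symbol_density_ge0.
  have -> : C%:E = ((4 * K.+1`!%:R)%:E * majorant (Some z0 :: zeros K) 1)%E.
    by rewrite -(fineK finC) -EFinM.
  apply: lee_wpmul2l; first by rewrite lee_fin.
  rewrite (brownian_path_integral_cos K z0 (e0 j)).
  exact: integral_terminal_le.
rewrite (_ : (fun j => _) = (fun j => \int[mu]_s terminal_step (e j) (zeros k) p s)%E); last first.
  apply/funext => j; rewrite -(brownian_path_integral_cos k p (e0 j)).
  apply: eq_integral => w _; rewrite EFinM; congr (_ * _)%E.
  by rewrite -(path_integral_None_pow (e0' j) (@cX w)).
by apply: integral_terminal_cvg; exact: eps_seq_cvg.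
Qed.

End brownian_moments.

(** * Moment determinacy *)

Section exponential_moments.
Local Open Scope ring_scope.
Context (R : realType).

Lemma cvgn_eq_lim (S : topologicalType) (u v : nat -> S) (l m : S) : hausdorff_space S ->
  u @ \oo --> l -> v @ \oo --> m -> u =1 v -> l = m.
Proof. by move=> hS ul vm /funext uv; move: vm; rewrite -uv => /(cvg_unique hS ul). Qed.

Definition exp_sum (a : R) n x := \sum_(k < n) a ^+ k / k`!%:R * x ^+ k.

Lemma exp_sumE a n x : exp_sum a n x = series (exp_coeff (a * x)) n.
Proof.
rewrite /series/= big_mkord; apply: eq_bigr => k _.
by rewrite /exp_coeff/= exprMn mulrAC.
Qed.

Lemma exp_sum_cvg a x : exp_sum a n x @[n --> \oo] --> expR (a * x).
Proof.
under eq_cvg do rewrite exp_sumE.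
exact: is_cvg_series_exp_coeff.
Qed.

Lemma exp_sum_ge0 a n x : 0 <= a -> 0 <= x -> 0 <= exp_sum a n x.
Proof. by move=> a0 x0; apply: sumr_ge0 => k _; rewrite !mulr_ge0 ?exprn_ge0 ?invr_ge0. Qed.

Lemma exp_sum_nd a x m n : 0 <= a -> 0 <= x -> (m <= n)%N -> exp_sum a m x <= exp_sum a n x.
Proof.
move=> a0 x0 mn; rewrite !exp_sumE; apply: nondecreasing_series => // k _ _.
by rewrite exp_coeff_ge0// mulr_ge0.
Qed.

Lemma exp_sum_le a n x : 0 <= a -> 0 <= x -> exp_sum a n x <= expR (a * x).
Proof.
move=> a0 x0; rewrite (_ : expR _ = lim (exp_sum a n x @[n --> \oo])); last first.
  by apply/esym/cvg_lim => //; exact: exp_sum_cvg.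
apply: (@nondecreasing_cvgn_le _ (fun n => exp_sum a n x)).
  by move=> p q pq; exact: exp_sum_nd.
by apply: cvgP; exact: exp_sum_cvg.
Qed.

Lemma exprn_fact_le k (x : R) : 0 <= x -> x ^+ k <= k`!%:R * expR x.
Proof.
move=> x0; have f0 : 0 < k`!%:R :> R by rewrite ltr0n fact_gt0.
case: k f0 => [|k] f0; first by rewrite expr0 mul1r (le_trans _ (expR_ge1Dx x))// lerDl.
rewrite mulrC -ler_pdivrMr//; apply: le_trans (expR_ge1Dxn k x0).
by rewrite lerDr.
Qed.

(** The [k]-th derivative of the cosine at [e], so that [cos_sum] is a Taylor sum of
    [cos (a * x + e)]. *)
Definition cos_coef (e : R) k : R :=
  cos e * ((~~ odd k)%:R * (-1) ^+ k./2) - sin e * ((odd k)%:R * (-1) ^+ k.-1./2).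

Lemma cos_coef_le e k : `|cos_coef e k| <= 1.
Proof.
have c : `|cos e| <= 1 by rewrite ler_norml cos_geN1 cos_le1.
have s : `|sin e| <= 1 by rewrite ler_norml sin_geN1 sin_le1.
rewrite /cos_coef; case: odd => /=.
  by rewrite mul0r mulr0 sub0r normrN mul1r normrM normrX normrN1 expr1n mulr1.
by rewrite mul0r mulr0 subr0 mul1r normrM normrX normrN1 expr1n mulr1.
Qed.

Definition cos_sum (a e : R) n x := \sum_(k < n) cos_coef e k * (a ^+ k / k`!%:R * x ^+ k).

Lemma cos_sum_cvg a e x : cos_sum a e n x @[n --> \oo] --> cos (a * x + e).
Proof.
have E n : cos_sum a e n x =
    cos e * series (cos_coeff (a * x)) n - sin e * series (sin_coeff (a * x)) n.
  rewrite /series/= !big_mkord !mulr_sumr -sumrB; apply: eq_bigr => k _.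
  rewrite /cos_coef /cos_coeff /sin_coeff /= exprMn -?exprnP.
  move: (cos e) (sin e) (_ ^+ k./2) (_ ^+ k.-1./2) => c s y z.
  by move: (_^-1) (a ^+ k) (x ^+ k) => u v w; ring.
under eq_cvg do rewrite E.
rewrite cosD (mulrC (cos _)) (mulrC (sin _)); apply: cvgB.
  apply: cvgM; first exact: cvg_cst.
  by rewrite cos.unlock; exact: is_cvg_series_cos_coeff.
apply: cvgM; first exact: cvg_cst.
by rewrite sin.unlock; exact: is_cvg_series_sin_coeff.
Qed.

Lemma cos_sum_le a e n x : 0 <= x -> `|cos_sum a e n x| <= expR (`|a| * x).
Proof.
move=> x0; apply: le_trans (exp_sum_le n (normr_ge0 a) x0).
apply: (le_trans (ler_norm_sum _ _ _)); apply: ler_sum => k _.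
rewrite normrM !normrM normrV ?unitfE ?pnatr_eq0 -?lt0n ?fact_gt0// !normrX (ger0_norm x0).
rewrite (ger0_norm (ler0n _ _)) ler_piMl ?cos_coef_le//.
by rewrite !mulr_ge0 ?exprn_ge0 ?invr_ge0.
Qed.

Section one_measure.
Context d (T : measurableType d) (P : probability T R) (Z X : T -> R).
Hypotheses (mZ : measurable_fun setT Z) (mX : measurable_fun setT X).
Hypotheses (Z0 : forall w, 0 <= Z w) (X0 : forall w, 0 <= X w).

Lemma measurable_weighted_exp a : measurable_fun setT (fun w => Z w * expR (a * X w)).
Proof.
apply: measurable_funM => //; apply: (measurableT_comp (@measurable_expR R)).
exact: measurable_funM.
Qed.

Lemma measurable_weighted_power k : measurable_fun setT (fun w => Z w * X w ^+ k).
Proof. by apply: measurable_funM => //; exact: measurable_funX. Qed.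

Lemma weighted_exp_sum a n : 0 <= a ->
  (\int[P]_w (Z w * exp_sum a n (X w))%:E =
   \sum_(k < n) ((a ^+ k / k`!%:R)%:E * \int[P]_w (Z w * X w ^+ k)%:E))%E.
Proof.
move=> a0; transitivity (\int[P]_w (\sum_(k < n) ((a ^+ k / k`!%:R) * (Z w * X w ^+ k))%:E)%E)%E.
  apply: eq_integral => w _; rewrite sumEFin; congr (_%:E); rewrite mulr_sumr.
  by apply: eq_bigr => k _; rewrite mulrCA.
have mt k : measurable_fun setT (fun w => ((a ^+ k / k`!%:R) * (Z w * X w ^+ k))%:E).
  by apply/measurable_EFinP; apply: measurable_funM => //; exact: measurable_weighted_power.
have c0 (k : nat) : 0 <= a ^+ k / k`!%:R by rewrite mulr_ge0 ?exprn_ge0 ?invr_ge0.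
rewrite ge0_integral_sum//; last by move=> k w _; rewrite lee_fin !mulr_ge0// exprn_ge0.
apply: eq_bigr => k _; under eq_integral do rewrite EFinM.
rewrite ge0_integralZl//.
- by apply/measurable_EFinP; exact: measurable_weighted_power.
- by move=> w _; rewrite lee_fin mulr_ge0// exprn_ge0.
- by rewrite lee_fin.
Qed.

Lemma weighted_exp_cvg a : 0 <= a ->
  (\int[P]_w (Z w * exp_sum a n (X w))%:E @[n --> \oo] --> \int[P]_w (Z w * expR (a * X w))%:E)%E.
Proof.
move=> a0.
have h := @cvg_monotone_convergence _ _ _ P setT measurableT (fun n w => (Z w * exp_sum a n (X w))%:E).
rewrite (_ : (\int[P]_w (Z w * expR (a * X w))%:E =
  \int[P]_w limn (fun n => (Z w * exp_sum a n (X w))%:E))%E); last first.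
  apply: eq_integral => w _; apply/esym/cvg_lim => //; apply: cvg_EFin; first exact: nearW.
  by apply: cvgM; [exact: cvg_cst|exact: exp_sum_cvg].
apply: h.
- move=> n; apply/measurable_EFinP; apply: measurable_funM => //.
  by apply: measurable_sum => k; apply: measurable_funM => //; exact: measurable_funX.
- by move=> n w _; rewrite lee_fin mulr_ge0// exp_sum_ge0.
- by move=> w _ p q pq; rewrite lee_fin ler_wpM2l// exp_sum_nd.
Qed.

Hypothesis expX : forall a, 0 <= a -> (\int[P]_w (Z w * expR (a * X w))%:E < +oo)%E.

Lemma weighted_exp_integrable a : 0 <= a ->
  P.-integrable setT (EFin \o (fun w => Z w * expR (a * X w))).
Proof.
move=> a0; apply/integrableP; split; first exact/measurable_EFinP/measurable_weighted_exp.
rewrite (_ : (\int[P]_w _ = \int[P]_w (Z w * expR (a * X w))%:E)%E); first exact: expX.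
by apply: eq_integral => w _ /=; rewrite ger0_norm// mulr_ge0// expR_ge0.
Qed.

Lemma weighted_power_integrable k : P.-integrable setT (EFin \o (fun w => Z w * X w ^+ k)).
Proof.
apply: le_integrable (integrableZl measurableT (k`!%:R) (weighted_exp_integrable (@ler01 R))) => //.
  exact/measurable_EFinP/measurable_weighted_power.
move=> w _ /=; rewrite lee_fin mul1r !ger0_norm ?mulr_ge0 ?exprn_ge0 ?expR_ge0//.
by rewrite [leRHS]mulrCA ler_wpM2l// exprn_fact_le.
Qed.

Lemma weighted_poly_integral (c : nat -> R) n :
  P.-integrable setT (EFin \o (fun w => Z w * \sum_(k < n) c k * X w ^+ k)) /\
  \int[P]_w (Z w * \sum_(k < n) c k * X w ^+ k) = \sum_(k < n) c k * \int[P]_w (Z w * X w ^+ k).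
Proof.
elim: n => [|n [i1 e1]].
  have E w : Z w * (\sum_(k < 0) c k * X w ^+ k) = 0 by rewrite big_ord0 mulr0.
  rewrite big_ord0; split; last by under eq_Rintegral do rewrite E; rewrite Rintegral_cst// mul0r.
  by under [X in _.-integrable _ X]eq_fun do rewrite /= E; exact: integrable0.
have E w : Z w * (\sum_(k < n.+1) c k * X w ^+ k) =
    Z w * (\sum_(k < n) c k * X w ^+ k) + c n * (Z w * X w ^+ n).
  by rewrite big_ord_recr/= mulrDr mulrCA.
have i2 : P.-integrable setT (EFin \o (fun w => c n * (Z w * X w ^+ n))).
  exact: (integrableZl measurableT (c n) (weighted_power_integrable n)).
split.
  under [X in _.-integrable _ X]eq_fun do rewrite /= E EFinD.
  exact: integrableD.
under eq_Rintegral do rewrite E.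
rewrite RintegralD// e1 RintegralZl// ?big_ord_recr//.
exact: weighted_power_integrable.
Qed.

(** The Taylor sums of the cosine are bounded by [expR (|a| * X)], whose weighted integral is
    finite; dominated convergence then expresses the Fourier transform through the moments. *)
Lemma weighted_cos_cvg a e :
  \sum_(k < n) (cos_coef e k * (a ^+ k / k`!%:R)) * \int[P]_w (Z w * X w ^+ k) @[n --> \oo] -->
  \int[P]_w (Z w * cos (a * X w + e)).
Proof.
have mp n : measurable_fun setT (fun w => cos_sum a e n (X w)).
  apply: measurable_sum => k; apply: measurable_funM => //; apply: measurable_funM => //.
  exact: measurable_funX.
have m1 n : measurable_fun setT (fun w => Z w * cos_sum a e n (X w)) by exact: measurable_funM.
have m2 : measurable_fun setT (fun w => Z w * cos (a * X w + e)).
  apply: measurable_funM => //; apply: (measurableT_comp (continuous_measurable_fun (@continuous_cos R))).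
  by apply: measurable_funD => //; exact: measurable_funM.
have cv w : Z w * cos_sum a e n (X w) @[n --> \oo] --> Z w * cos (a * X w + e).
  by apply: cvgM; [exact: cvg_cst|exact: cos_sum_cvg].
have bd n w : `|Z w * cos_sum a e n (X w)| <= Z w * expR (`|a| * X w).
  by rewrite normrM (ger0_norm (Z0 w)) ler_wpM2l// cos_sum_le.
have [_ _] := dominated_cvg_EFin m1 m2 cv (weighted_exp_integrable (normr_ge0 a)) bd.
apply: cvg_trans; apply: near_eq_cvg; apply: nearW => n /=.
have [_ <-] := weighted_poly_integral (fun k => cos_coef e k * (a ^+ k / k`!%:R)) n.
by apply: eq_Rintegral => w _; congr (_ * _); apply: eq_bigr => k _; rewrite mulrA.
Qed.

End one_measure.

Section two_measures.
Context d1 (T1 : measurableType d1) (P1 : probability T1 R) (Z1 X1 : T1 -> R).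
Hypotheses (mZ1 : measurable_fun setT Z1) (mX1 : measurable_fun setT X1).
Hypotheses (Z10 : forall w, 0 <= Z1 w) (X10 : forall w, 0 <= X1 w).
Context d2 (T2 : measurableType d2) (P2 : probability T2 R) (Z2 X2 : T2 -> R).
Hypotheses (mZ2 : measurable_fun setT Z2) (mX2 : measurable_fun setT X2).
Hypotheses (Z20 : forall w, 0 <= Z2 w) (X20 : forall w, 0 <= X2 w).
Hypothesis expX2 : forall a, 0 <= a -> (\int[P2]_w (Z2 w * expR (a * X2 w))%:E < +oo)%E.
Hypothesis moments : forall k,
  (\int[P1]_w (Z1 w * X1 w ^+ k)%:E = \int[P2]_w (Z2 w * X2 w ^+ k)%:E)%E.

(** The exponential series has nonnegative terms, so monotone convergence computes both exponential
    moments from the power moments, and finiteness passes from the second law to the first. *)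
Let expX1 a : 0 <= a -> (\int[P1]_w (Z1 w * expR (a * X1 w))%:E < +oo)%E.
Proof.
move=> a0; suff -> : (\int[P1]_w (Z1 w * expR (a * X1 w))%:E = \int[P2]_w (Z2 w * expR (a * X2 w))%:E)%E.
  exact: expX2.
have c1 := @weighted_exp_cvg _ _ P1 _ _ mZ1 mX1 Z10 X10 a a0.
have c2 := @weighted_exp_cvg _ _ P2 _ _ mZ2 mX2 Z20 X20 a a0.
apply: (cvgn_eq_lim _ c1 c2) => // n.
by rewrite !weighted_exp_sum//; apply: eq_bigr => k _; rewrite moments.
Qed.

(* The second law is determined by its moments because its exponential
   moments are finite. *)
Lemma moments_unique (h : R -> \bar R) : measurable_fun setT h -> (forall x, 0 <= h x)%E ->
  (\int[P1]_w (h (X1 w) * (Z1 w)%:E) = \int[P2]_w (h (X2 w) * (Z2 w)%:E))%E.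
Proof.
have Zoo d (T : measurableType d) (P : probability T R) (Z X : T -> R) :
    (forall a, 0 <= a -> (\int[P]_w (Z w * expR (a * X w))%:E < +oo)%E) ->
    (\int[P]_w (Z w)%:E < +oo)%E.
  move=> /(_ 0 (lexx _)); congr (_ < _)%E; apply: eq_integral => w _.
  by rewrite mul0r expR0 mulr1.
apply: fourier_unique => //; first exact: Zoo expX1; first exact: Zoo expX2.
move=> a e.
have c1 := @weighted_cos_cvg _ _ P1 _ _ mZ1 mX1 Z10 X10 expX1 a e.
have c2 := @weighted_cos_cvg _ _ P2 _ _ mZ2 mX2 Z20 X20 expX2 a e.
apply: (cvgn_eq_lim _ c1 c2) => // n.
by apply: eq_bigr => k _; congr (_ * fine _); rewrite moments.
Qed.

End two_measures.
End exponential_moments.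

(** * Exponential moments of the Brownian local time *)

Section local_time_exponential.
Local Open Scope ring_scope.
Context (R : realType).
Notation mu := (@lebesgue_measure R).
Notation zeros k := (nseq k None : seq (symbol R)).

Definition heat0_exp (q s : R) : \bar R := (heat0 s * (expR (- q * s))%:E)%E.

Lemma heat0_exp_ge0 q s : (0 <= heat0_exp q s)%E.
Proof. by rewrite mule_ge0 ?heat0_ge0// lee_fin expR_ge0. Qed.

Lemma measurable_heat0_exp q : measurable_fun setT (heat0_exp q).
Proof.
apply: emeasurable_funM; first exact: measurable_heat0.
apply/measurable_EFinP; apply: (measurableT_comp (@measurable_expR R)).
exact: measurable_funM.
Qed.

(* The factor [expR (- q * s)] makes this small for large [q], whence the bound
   [growth q ^ k * expR q] on the [k]-th moment of the local time divided by [k`!]. *)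
Definition growth (q : R) : \bar R := conv (heat0_exp q) (@step R) 1.

Lemma growth_ge0 q : (0 <= growth q)%E.
Proof. by apply: conv_ge0; [exact: heat0_exp_ge0|exact: step_ge0]. Qed.

Let measurable_step1 (f : R -> \bar R) : measurable_fun setT f ->
  measurable_fun setT (fun s => f s * step (1 - s))%E.
Proof.
move=> mf; exact: (measurableT_comp (measurable_conv_integrand mf (@measurable_step R)) (pair1_measurable (1 : R))).
Qed.

Let heat0_exp_le (q s : R) : 0 <= q -> (heat0_exp q s * step (1 - s) <= heat0 s * step (1 - s))%E.
Proof.
move=> q0; rewrite /heat0_exp; have [s0|s0] := leP s 0; first by rewrite heat0_le0// !mul0e.
rewrite lee_wpmul2r ?step_ge0// -[leRHS]mule1 lee_wpmul2l ?heat0_ge0// lee_fin -expR0 ler_expR.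
by rewrite mulNr oppr_le0 mulr_ge0// ltW.
Qed.

Lemma growth_fin_num (q : R) : 0 <= q -> growth q \is a fin_num.
Proof.
move=> q0; rewrite ge0_fin_numE ?growth_ge0//.
apply: (@le_lt_trans _ _ (step 1)); last exact: ltry.
apply: le_trans (conv_heat0_step_le (lexx 1)); apply: ge0_le_integral => //.
- by move=> s _; rewrite mule_ge0 ?heat0_exp_ge0 ?step_ge0.
- exact: measurable_step1 (measurable_heat0_exp q).
- exact: measurable_step1 (@measurable_heat0 R).
- by move=> s _; exact: heat0_exp_le.
Qed.

Lemma growth_cvg0 : growth n%:R @[n --> \oo] --> 0%E.
Proof.
rewrite (_ : 0%E = \int[mu]_s (cst 0 s))%E; last by rewrite integral0.
apply: (@ge0_dominated_cvg _ _ _ mu (fun n s => heat0_exp n%:R s * step (1 - s))%E (cst 0%E)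
  (fun s => heat0 s * step (1 - s))%E).
- by move=> n; apply: measurable_step1; exact: measurable_heat0_exp.
- exact: measurable_step1 (@measurable_heat0 R).
- by move=> n s; rewrite mule_ge0 ?heat0_exp_ge0 ?step_ge0.
- by move=> n s; exact: heat0_exp_le.
- apply: aeW => s; rewrite /heat0_exp; have [s0|s0] := leP s 0.
    rewrite (_ : (fun n : nat => _) = cst 0%E); first exact: cvg_cst.
    by apply/funext => n; rewrite heat0_le0// !mul0e.
  rewrite /heat0 /step; under eq_cvg do rewrite -!EFinM.
  rewrite (_ : 0%E = (heat s 0 * 0 * (0 < 1 - s)%R%:R)%:E); last by rewrite mulr0 mul0r.
  apply: cvg_EFin; first exact: nearW.
  apply: cvgM; last exact: cvg_cst.
  apply: cvgM; first exact: cvg_cst.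
  rewrite (_ : (fun n : nat => expR (- n%:R * s)) = geometric 1 (expR (- s))); last first.
    by apply/funext => n /=; rewrite mul1r -expRM_natl mulrN mulNr.
  apply: cvg_geometric; rewrite ger0_norm ?expR_ge0// -expR0 ltr_expR oppr_lt0//.
- exact: measurable_cst.
- apply: (@le_lt_trans _ _ (step 1)); first exact: conv_heat0_step_le.
  by rewrite ltry.
Qed.

Lemma chain_at_zeros_le0 k (t : R) : t <= 0 -> chain_at (zeros k) 0 t = 0%E.
Proof.
elim: k t => [|k IH] t t0; first exact: heat0_le0.
by rewrite [zeros _]/= chain_at_None conv_le0// => s s0; rewrite /heat_fun heat_le0.
Qed.

(** Since [expR (q * (t - s)) = expR (q * t) * expR (- q * s)], one convolution with [heat0] turns a
    bound [M * expR (q * r)] into [M * growth q * expR (q * t)]; the function [step] starts the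
    induction with [M = 1]. *)
Lemma chain_at_zeros_growth (q : R) k (t : R) : 0 <= q -> t <= 1 ->
  (conv (chain_at (zeros k) 0) (@step R) t <= (growth q) ^+ k.+1 * (expR (q * t))%:E)%E.
Proof.
move=> q0; have g0 := growth_ge0 q; have ms := @measurable_step R; have s0 := @step_ge0 R.
have mh := @measurable_heat0 R; have h0 := @heat0_ge0 R.
have ge n t' : (0 <= growth q ^+ n * (expR (q * t'))%:E)%E.
  by rewrite mule_ge0 ?expe_ge0// lee_fin expR_ge0.
have key (F : R -> \bar R) n : measurable_fun setT F -> (forall r : R, 0 <= F r)%E ->
    (forall r, r <= 0 -> F r = 0%E) ->
    (forall r : R, (r <= 1)%R -> F r <= growth q ^+ n * (expR (q * r))%:E)%E ->
    forall t : R, t <= 1 -> (conv (@heat0 R) F t <= growth q ^+ n.+1 * (expR (q * t))%:E)%E.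
  move=> mF F0 Fn Fle t' t1.
  rewrite expeS {1}/growth /conv -muleA muleC -ge0_integralZl//; last 2 first.
  - exact: (measurableT_comp (measurable_conv_integrand (measurable_heat0_exp q) ms) (pair1_measurable (1 : R))).
  - by move=> s _; rewrite mule_ge0// heat0_exp_ge0.
  apply: ge0_le_integral => //.
  - by move=> s _; rewrite mule_ge0.
  - exact: (measurableT_comp (measurable_conv_integrand mh mF) (pair1_measurable (t' : R))).
  - apply: emeasurable_funM => //.
    exact: (measurableT_comp (measurable_conv_integrand (measurable_heat0_exp q) ms) (pair1_measurable (1 : R))).
  move=> s _; have [sn|sp] := leP s 0; first by rewrite heat0_le0// mul0e mule_ge0// mule_ge0// heat0_exp_ge0.
  have [s1|s1] := ltP s t'; last first.
    by rewrite [F _]Fn ?subr_le0// mule0 mule_ge0// mule_ge0// heat0_exp_ge0.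
  have -> : step (1 - s) = 1%E :> \bar R by rewrite /step subr_gt0 (lt_le_trans s1 t1).
  rewrite mule1 /heat0_exp [leRHS]muleCA; apply: lee_wpmul2l => //.
  apply: (le_trans (Fle _ _)); first by lra.
  by rewrite -muleA -EFinM -expRD; apply: lee_wpmul2l; rewrite ?expe_ge0// lee_fin ler_expR; lra.
elim: k t => [|k IH] t t1.
  have -> : chain_at (zeros 0) 0 = @heat0 R by [].
  apply: key t1 => //; first exact: step_le0.
  move=> r r1; rewrite expe0 mul1e; have [r0|r0] := leP r 0.
    by rewrite step_le0// lee_fin expR_ge0.
  by rewrite /step r0 lee_fin -expR0 ler_expR mulr_ge0// ltW.
have -> : chain_at (zeros k.+1) 0 = conv (@heat0 R) (chain_at (zeros k) 0).
  apply/funext => r; rewrite [zeros _]/= chain_at_None convC//.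
  - exact: measurable_chain_at.
  - exact: chain_at_ge0.
have mc := @measurable_chain_at R (zeros k) 0; have c0 := chain_at_ge0 (zeros k) (0 : R).
rewrite convA//; apply: key => //.
- exact: measurable_conv.
- by move=> r; apply: conv_ge0.
- by move=> r r0; apply: conv_le0 => //; [exact: chain_at_zeros_le0|exact: step_le0].
Qed.

Context d (T : measurableType d) (P : probability T R).
Variables (B : R -> {RV P >-> R}) (L : R -> R -> {RV P >-> R}).
Hypotheses (hB : is_brownian_motion B) (hL : is_local_time `[0%R, +oo[ B L).

Lemma local_time_one_ge0 w : 0 <= local_time_one L w.
Proof. by rewrite le_max lexx. Qed.

Lemma local_time_power_le (q : R) k : 0 <= q ->
  (\int[P]_w (local_time_one L w ^+ k / k`!%:R)%:E <= growth q ^+ k * (expR q)%:E)%E.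
Proof.
move=> q0; case: k => [|k].
  rewrite expe0 mul1e; under eq_integral do rewrite expr0 fact0 divr1.
  by rewrite probability_integral_cst lee_fin -expR0 ler_expR.
pose z : R * R := (0, 0).
have c2 (x : R) : symbol_density (Some z) x = 2 by rewrite /= mul0r addr0 cos0; ring.
have h := brownian_moments hB hL k z.
have mk : measurable_fun setT (fun w => (local_time_one L w ^+ k.+1 / k.+1`!%:R)%:E).
  apply/measurable_EFinP; apply: measurable_funM => //; apply: measurable_funX.
  exact: measurable_local_time_one.
have k0 w : (0 <= (local_time_one L w ^+ k.+1 / k.+1`!%:R)%:E)%E.
  by rewrite lee_fin divr_ge0// exprn_ge0// local_time_one_ge0.
have -> : (\int[P]_w (local_time_one L w ^+ k.+1 / k.+1`!%:R)%:E =
    conv (chain_at (zeros k) 0%R) (@step R) 1%R)%E.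
  (* Both sides are doubled because the symbol of frequency and phase [0] is the constant [2]. *)
  have half (x : \bar R) : x = (2^-1%:E * (2%:E * x))%E by rewrite muleA -EFinM mulVf// mul1e.
  rewrite [LHS]half [RHS]half; congr (_ * _)%E; transitivity (\int[mu]_s terminal_step 0%R (zeros k) z s)%E.
    rewrite -h -ge0_integralZl//; apply: eq_integral => w _.
    by rewrite c2 EFinM.
  rewrite integral_terminal0 /conv -ge0_integralZl//; last 2 first.
  - have mi := measurable_conv_integrand (@measurable_chain_at R (zeros k) 0) (@measurable_step R).
    exact: (measurableT_comp mi (pair1_measurable (1 : R))).
  - by move=> s _; rewrite mule_ge0 ?chain_at_ge0 ?step_ge0.
  apply: eq_integral => s _; rewrite [RHS]muleCA; congr (_ * _)%E.
  rewrite /heat_cos0 /heat_cos /step -EFinM; congr (_%:E).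
  by rewrite /z/= expr0n/= oppr0 !mul0r add0r cos0 expR0; ring.
have := @chain_at_zeros_growth q k 1 q0 (lexx 1); by rewrite mulr1.
Qed.

Lemma local_time_exp_lty a : 0 <= a ->
  (\int[P]_w (expR (a * local_time_one L w))%:E < +oo)%E.
Proof.
move=> a0; have mL := measurable_local_time_one L.
have L0 := local_time_one_ge0.
(* For this [n] one has [a * growth n <= 1 / 2], so the exponential series is dominated by a
   geometric series of ratio [1 / 2]. *)
have [n gn] : exists n : nat, fine (growth n%:R) <= (2 * (1 + a))^-1.
  have b0 : 0 < (2 * (1 + a))^-1 by rewrite invr_gt0 mulr_gt0// ltr_wpDr.
  have h : fine (growth n%:R) @[n --> \oo] --> 0 := fine_cvg growth_cvg0.
  have [n _ /(_ n (leqnn n))/= hn] := cvgr_lt 0 (h _) _ b0.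
  by exists n; exact: ltW.
have e0 : 0 <= n%:R :> R by [].
apply: (@le_lt_trans _ _ (2 * expR n%:R)%:E); last exact: ltry.
have cv := @weighted_exp_cvg R _ _ P (cst 1) _ (measurable_cst _) mL (fun _ => ler01) L0 a a0.
under eq_integral do rewrite -[expR _]mul1r.
rewrite -(cvg_lim _ cv)//; apply: lime_le; first exact: cvgP cv.
apply: nearW => m; rewrite weighted_exp_sum//.
apply: (@le_trans _ _ (\sum_(k < m) (2^-1 ^+ k * expR n%:R)%:E)%E).
  apply: lee_sum => k _; rewrite (_ : (_ * _ = (a ^+ k)%:E * \int[P]_w (local_time_one L w ^+ k / k`!%:R)%:E)%E); last first.
    rewrite EFinM -muleA -ge0_integralZl//.
    - congr (_ * _)%E; apply: eq_integral => w _; by rewrite mul1r -EFinM mulrC.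
    - by apply/measurable_EFinP; apply: measurable_weighted_power => //; exact: measurable_cst.
    - by move=> w _; rewrite lee_fin mul1r exprn_ge0.
  apply: (@le_trans _ _ ((a ^+ k)%:E * (growth n%:R ^+ k * (expR n%:R)%:E))%E).
    by rewrite lee_wpmul2l ?lee_fin ?exprn_ge0// local_time_power_le.
  rewrite muleA EFinM lee_wpmul2r ?lee_fin ?expR_ge0//.
  rewrite -(fineK (growth_fin_num e0)) -EFin_expe -EFinM lee_fin -exprMn.
  have g0 : 0 <= fine (growth n%:R) by rewrite fine_ge0 ?growth_ge0.
  apply: lerXn2r; rewrite ?nnegrE ?mulr_ge0//.
  apply: (le_trans (ler_wpM2l a0 gn)).
  by rewrite ler_pdivrMr ?mulr_gt0 ?ltr_wpDr//; lra.
rewrite sumEFin lee_fin -mulr_suml ler_wpM2r ?expR_ge0//.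
have -> : \sum_(k < m) 2^-1 ^+ k = 2 - 2 * 2^-1 ^+ m :> R.
  elim: m => [|m IH]; first by rewrite big_ord0 expr0; ring.
  by rewrite big_ord_recr/= IH exprS; field.
by rewrite lerBlDr lerDl mulr_ge0.
Qed.

End local_time_exponential.

Section weighted_laws.
Local Open Scope ring_scope.
Context (R : realType).
Context d1 (T1 : measurableType d1) (P1 : {measure set T1 -> \bar R}) (Z1 : T1 -> R).
Context d2 (T2 : measurableType d2) (P2 : {measure set T2 -> \bar R}) (Z2 : T2 -> R).
Context d3 (S : measurableType d3) d4 (S' : measurableType d4).
Variables (X1 : T1 -> S) (Y1 : T1 -> S') (X2 : T2 -> S) (Y2 : T2 -> S').
Hypotheses (mZ1 : measurable_fun setT Z1) (Z10 : forall w, 0 <= Z1 w).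
Hypotheses (mX1 : measurable_fun setT X1) (mY1 : measurable_fun setT Y1).
Hypotheses (mZ2 : measurable_fun setT Z2) (Z20 : forall w, 0 <= Z2 w).
Hypotheses (mX2 : measurable_fun setT X2) (mY2 : measurable_fun setT Y2).
Hypothesis Z1oo : (\int[P1]_w (Z1 w)%:E < +oo)%E.
Hypothesis rectangles : forall A C, measurable A -> measurable C ->
  (\int[P1]_w (\1_A (X1 w) * \1_C (Y1 w) * Z1 w)%:E =
   \int[P2]_w (\1_A (X2 w) * \1_C (Y2 w) * Z2 w)%:E)%E.

Lemma weighted_rectangles_unique (h : S * S' -> \bar R) :
  measurable_fun setT h -> (forall x, 0 <= h x)%E ->
  (\int[P1]_w (h (X1 w, Y1 w) * (Z1 w)%:E) = \int[P2]_w (h (X2 w, Y2 w) * (Z2 w)%:E))%E.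
Proof.
move=> mh h0.
pose f1 w := (X1 w, Y1 w); pose f2 w := (X2 w, Y2 w).
have mf1 : measurable_fun setT f1 by exact: measurable_fun_pair.
have mf2 : measurable_fun setT f2 by exact: measurable_fun_pair.
pose m1 := pushforward (wmeasure P1 mZ1 Z10) f1.
pose m2 := pushforward (wmeasure P2 mZ2 Z20) f2.
have rE d (T : measurableType d) (P : {measure set T -> \bar R}) (Z : T -> R) (X : T -> S) (Y : T -> S') A C :
    (\int[P]_(w in (fun w => (X w, Y w)) @^-1` (A `*` C)) (Z w)%:E =
     \int[P]_w (\1_A (X w) * \1_C (Y w) * Z w)%:E)%E.
  rewrite integral_mkcond; apply: eq_integral => w _; rewrite patchE !indicE.
  rewrite (_ : (w \in _) = (X w \in A) && (Y w \in C)); last first.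
    by apply/idP/andP => [/set_mem[] ? ?|[/set_mem ? /set_mem ?]]; [split; exact: mem_set|exact/mem_set].
  by case: (X w \in A); case: (Y w \in C); rewrite /= ?mul1r ?mul0r.
have m12 C : measurable C -> m1 C = m2 C.
  apply: (@eq_measure_rectangles _ _ _ _ _ (pushforward (wmeasure P1 mZ1 Z10) f1) (pushforward (wmeasure P2 mZ2 Z20) f2)).
    exact: Z1oo.
  by move=> A A' mA mA'; exact: etrans (rE _ _ P1 Z1 X1 Y1 A A') (etrans (rectangles mA mA') (esym (rE _ _ P2 Z2 X2 Y2 A A'))).
transitivity (\int[m1]_x h x)%E.
  rewrite [RHS]ge0_integral_pushforward// ?preimage_setT.
  rewrite (@ge0_integral_density _ _ _ P1 (wmeasure P1 mZ1 Z10) Z1)//.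
  - exact: (measurableT_comp mh mf1).
  - by move=> x; exact: h0.
transitivity (\int[m2]_x h x)%E.
  by apply: eq_measure_integral => A mA _; exact: m12.
rewrite ge0_integral_pushforward// preimage_setT.
rewrite (@ge0_integral_density _ _ _ P2 (wmeasure P2 mZ2 Z20) Z2)//.
- exact: (measurableT_comp mh mf2).
- by move=> x; exact: h0.
Qed.

End weighted_laws.

Section independence_product.
Local Open Scope ring_scope.
Context (R : realType) d (T : measurableType d) (P : probability T R).
Context d1 (T1 : measurableType d1) d2 (T2 : measurableType d2).
Variables (Y : T -> T1) (Z : T -> T2).

Lemma indep_var_integralM (h : T1 -> \bar R) (k : T2 -> \bar R) :
  measurable_fun setT Y -> measurable_fun setT Z -> indep_var P Y Z ->
  measurable_fun setT h -> measurable_fun setT k ->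
  (forall x, 0 <= h x)%E -> (forall x, 0 <= k x)%E ->
  (\int[P]_w (h (Y w) * k (Z w)) = \int[P]_w h (Y w) * \int[P]_w k (Z w))%E.
Proof.
move=> mY mZ ind mh mk h0 k0.
have mhk : measurable_fun setT (fun q : T1 * T2 => h q.1 * k q.2)%E.
  apply: emeasurable_funM; first exact: (measurableT_comp mh measurable_fst).
  exact: (measurableT_comp mk measurable_snd).
rewrite (indep_var_integral mY mZ (Phi := fun x y => h x * k y)%E ind mhk); last first.
  by move=> x y; rewrite mule_ge0.
rewrite -ge0_integralZr//.
- by apply: eq_integral => w _; rewrite ge0_integralZl//; exact: (measurableT_comp mk mZ).
- exact: (measurableT_comp mh mY).
- exact: integral_ge0.
Qed.

End independence_product.

Section uniform_beta.
Local Open Scope ring_scope.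
Context (R : realType) d (T : measurableType d) (P : probability T R).

Lemma uniform_beta (V : {RV P >-> R}) m n : is_uniform01 V ->
  (\int[P]_w (V w ^+ m * (1 - V w) ^+ n)%:E = ((m`! * n`!)%:R / (m + n).+1`!%:R : R)%:E)%E.
Proof.
move=> hV; have mk (c : R) : measurable_fun setT (fun v : R => `|c - v|).
  by apply: measurableT_comp => //; exact: measurable_funB.
(* The absolute values keep the integrand nonnegative outside of [[0, 1]], since [uniform_integral]
   takes functions that are nonnegative everywhere. *)
transitivity (\int[P]_w (`|0 - V w| ^+ m * `|1 - V w| ^+ n)%:E)%E.
  apply: eq_integral => w _; have := hV.1 w; rewrite in_itv/= => /andP[v0 v1].
  by rewrite sub0r normrN !ger0_norm// subr_ge0.
rewrite (uniform_integral (k := fun v => (`|0 - v| ^+ m * `|1 - v| ^+ n)%:E) hV); last 2 first.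
- by apply/measurable_EFinP; apply: measurable_funM; apply: measurable_funX; exact: mk.
- by move=> v; rewrite lee_fin mulr_ge0// exprn_ge0.
rewrite -beta_fun_fact EFin_beta_fun integral_mkcond; apply: eq_integral => v _.
rewrite !patchE; case: ifPn => // /set_mem/=; rewrite in_itv/= => /andP[v0 v1].
by rewrite sub0r normrN !ger0_norm ?subr_ge0.
Qed.

End uniform_beta.

(** * The joint law *)

Section joint_law.
Local Open Scope ring_scope.
Context (R : realType).
Notation mu := (@lebesgue_measure R).
Notation zeros k := (nseq k None : seq (symbol R)).
Context d (T : measurableType d) (P : probability T R).
Variables (b : R -> {RV P >-> R}) (lambda : R -> R -> {RV P >-> R}) (U : {RV P >-> R}).
Hypotheses (hb : is_brownian_bridge b) (hlambda : is_local_time `[0%R, 1%R] b lambda).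
Hypotheses (hU : is_uniform01 U) (hUb : indep_process U `[0%R, 1%R] b).
Context d' (T' : measurableType d') (Q : probability T' R).
Variables (B : R -> {RV Q >-> R}) (L : R -> R -> {RV Q >-> R}) (Lambda : {RV Q >-> R}).
Hypotheses (hB : is_brownian_motion B) (hL : is_local_time `[0%R, +oo[ B L).
Hypotheses (hLambda : is_uniform01 Lambda).
Hypothesis hLambdaBL : indep_var Q Lambda (fun w => (B 1%R w, L 1%R 0%R w)).

Notation before := (local_time_before lambda U).
Notation after := (local_time_after lambda U).
Notation bU := (fun w => b (U w) w).
Notation L1 := (local_time_one L).
Let half_B w := 2^-1 * B 1 w.
Let part1 w := Lambda w * L1 w.
Let part2 w := (1 - Lambda w) * L1 w.
Let c : R := Num.sqrt (pi / 2).

Let mbU : measurable_fun setT bU. Proof. exact: measurable_bridge_U. Qed.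
Let mbefore : measurable_fun setT before.
Proof. exact: (measurable_local_time_before hlambda hU). Qed.
Let mafter : measurable_fun setT after.
Proof. exact: (measurable_local_time_after hlambda hU). Qed.
Let mL1 : measurable_fun setT L1. Proof. exact: measurable_local_time_one. Qed.
Let mhalf : measurable_fun setT half_B. Proof. by apply: measurable_funM. Qed.
Let mpart1 : measurable_fun setT part1. Proof. by apply: measurable_funM. Qed.
Let mpart2 : measurable_fun setT part2.
Proof. by apply: measurable_funM => //; apply: measurable_funB. Qed.
Let before0 w : 0 <= before w. Proof. by rewrite le_max lexx. Qed.
Let after0 w : 0 <= after w. Proof. by rewrite le_max lexx. Qed.
Let L10 w : 0 <= L1 w. Proof. by rewrite le_max lexx. Qed.
Let Lambda01 w : 0 <= Lambda w <= 1. Proof. by have := hLambda.1 w; rewrite in_itv. Qed.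
Let part10 w : 0 <= part1 w. Proof. by rewrite mulr_ge0//; case/andP: (Lambda01 w). Qed.
Let part20 w : 0 <= part2 w.
Proof. by rewrite mulr_ge0// subr_ge0; case/andP: (Lambda01 w). Qed.
Let part1_le w : part1 w <= L1 w. Proof. by rewrite ler_piMl//; case/andP: (Lambda01 w). Qed.
Let part2_le w : part2 w <= L1 w.
Proof. by rewrite ler_piMl// lerBlDr lerDl; case/andP: (Lambda01 w). Qed.
Let c0 : 0 <= c. Proof. exact: sqrtr_ge0. Qed.

(** The normalisation [sqrt (2 pi)] of the bridge is twice the constant of the theorem; this [2]
    matches the one in [terminal_chain_at]. *)
Let inv_heat1 : (heat 1 0)^-1 = 2 * c.
Proof.
rewrite heat_at0 invrK mul1r /c (_ : pi *+ 2 = 2 ^+ 2 * (pi / 2)).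
  by rewrite sqrtrM ?sqr_ge0// sqrtr_sqr ger0_norm.
by rewrite -mulr_natr; field.
Qed.

(** Both sides are multiples of the same limit chain. On the left the factor is [m! n!] over
    [heat 1 0]. On the right the power [m + n + 1] of the local time gives [c (m + n + 1)!] times
    twice the chain, and the independent [Lambda] contributes the beta integral
    [m! n! / (m + n + 1)!]. *)
Lemma joint_moments n m p :
  (\int[P]_w (symbol_density (Some p) (bU w) * (before w ^+ m * after w ^+ n))%:E =
   \int[Q]_w (symbol_density (Some p) (half_B w) * (c * L1 w * (part1 w ^+ m * part2 w ^+ n)))%:E)%E.
Proof.
pose fm : R := m`!%:R; pose fn : R := n`!%:R; pose fk : R := (m + n).+1`!%:R.
have f0 k : k`!%:R != 0 :> R by rewrite pnatr_eq0 -lt0n fact_gt0.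
have mdens (q : R * R) := @measurable_symbol_density R (Some q).
have dens0 (q : R * R) (x : R) := @symbol_density_ge0 R (Some q) x.
transitivity ((fm * fn)%:E * (chain_at (zeros n ++ Some p :: zeros m) 0%R 1%R * ((heat 1 0)^-1)%:E))%E.
  rewrite -(bridge_moments hb hlambda hU hUb) -ge0_integralZl//.
  - apply: eq_integral => w _; rewrite -EFinM; congr (_%:E).
    have := f0 m; have := f0 n; rewrite /fm /fn.
    move: (m`!%:R) (n`!%:R) (symbol_density _ _) (_ ^+ m) (_ ^+ n) => x y D u v x0 y0.
    by field; rewrite x0 y0.
  - apply/measurable_EFinP; apply: measurable_funM; first apply: measurable_funM.
    + exact: (measurableT_comp (mdens p) mbU).
    + by apply: measurable_funM => //; exact: measurable_funX.
    + by apply: measurable_funM => //; exact: measurable_funX.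
  - by move=> w _; rewrite lee_fin !mulr_ge0 ?dens0 ?exprn_ge0 ?invr_ge0.
  - by rewrite lee_fin mulr_ge0.
rewrite inv_heat1.
(* The truncation of the local time is put inside [k], because independence is assumed for the pair
   of [B 1] and [L 1 0] itself. *)
pose k (x : R * R) := symbol_density (Some p) (2^-1 * x.1) * (c * Num.max 0 x.2 * Num.max 0 x.2 ^+ (m + n)).
have mmax : measurable_fun setT (fun x : R * R => Num.max 0 x.2) by exact: measurable_maxr.
have mk : measurable_fun setT k.
  apply: measurable_funM.
    apply: (measurableT_comp (mdens p)); exact: measurable_funM.
  by apply: measurable_funM; [exact: measurable_funM|exact: measurable_funX].
have mx0 (x : R) : 0 <= Num.max 0 x by rewrite le_max lexx.
have k0 x : 0 <= k x by rewrite !mulr_ge0 ?dens0 ?exprn_ge0.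
pose h (v : R) : R := `|v| ^+ m * `|1 - v| ^+ n.
have mn : measurable_fun setT (fun v : R => `|v|) by [].
have mn1 : measurable_fun setT (fun v : R => `|1 - v|).
  by apply: (measurableT_comp mn); exact: measurable_funB.
have mh : measurable_fun setT h by apply: measurable_funM; exact: measurable_funX.
have h0 v : 0 <= h v by rewrite mulr_ge0// exprn_ge0.
have mBL : measurable_fun setT (fun w => (B 1 w, L 1 0 w)) by exact: measurable_fun_pair.
transitivity (\int[Q]_w (h (Lambda w))%:E * \int[Q]_w (k (B 1 w, L 1 0 w))%:E)%E; last first.
  rewrite -(indep_var_integralM _ mBL hLambdaBL (h := fun v => (h v)%:E) (k := fun x => (k x)%:E))//.
  - apply: eq_integral => w _; rewrite -EFinM; congr (_%:E).
    have /andP[l0 l1] := Lambda01 w.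
    rewrite /h /k /= -/(L1 w) -/(half_B w) /part1 /part2 ger0_norm// ger0_norm ?subr_ge0//.
    by rewrite !exprMn exprD; move: (1 + cos _) => D; ring.
  - exact/measurable_EFinP.
  - exact/measurable_EFinP.
have -> : (\int[Q]_w (h (Lambda w))%:E = (fm * fn / fk)%:E)%E.
  rewrite -natrM -(uniform_beta m n hLambda); apply: eq_integral => w _.
  by have /andP[l0 l1] := Lambda01 w; rewrite /h !ger0_norm ?subr_ge0.
have -> : (\int[Q]_w (k (B 1 w, L 1 0 w))%:E =
   (c * fk)%:E * (2%:E * chain_at (zeros n ++ Some p :: zeros m) 0%R 1%R))%E.
  rewrite -terminal_chain_at addnC -(brownian_moments hB hL) -ge0_integralZl//.
  - apply: eq_integral => w _; rewrite -EFinM; congr (_%:E).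
    rewrite /k /= -/(L1 w) /half_freq/=.
    have -> : p.1 * (2^-1 * B 1 w) = p.1 / 2 * B 1 w by rewrite mulrA.
    rewrite exprS; have := f0 (m + n).+1; rewrite -/fk.
    move: fk (1 + _) (_ ^+ _) => x D u x0; by field.
  - apply/measurable_EFinP; apply: measurable_funM.
      by apply: (measurableT_comp (mdens _)).
    by apply: measurable_funM => //; exact: measurable_funX.
  - by move=> w _; rewrite lee_fin !mulr_ge0 ?dens0 ?exprn_ge0 ?invr_ge0.
  - by rewrite lee_fin mulr_ge0.
move: (chain_at _ _ _) => C.
rewrite [in LHS](muleC C) !muleA -!EFinM; congr (_%:E * _)%E.
have := f0 (m + n).+1; rewrite -/fk; move: fm fn fk => x y z z0; by field.
Qed.

Let indE (S : Type) (A : set S) x : 0 <= (\1_A x : R) <= 1.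
Proof. by rewrite indicE; case: (_ \in _) => /=; rewrite ?lexx ?ler01. Qed.

Let mind (A : set R) : measurable A -> measurable_fun setT (\1_A : R -> R).
Proof. by move=> mA; exact: measurable_indic. Qed.

(** As [L1 ^+ k <= k! * expR L1] and [X] is at most [L1], a single exponential moment of [L1]
    dominates the integrand. *)
Lemma local_time_weight_lty (Z X : T' -> R) (C a : R) k :
  measurable_fun setT Z -> measurable_fun setT X ->
  (forall w, 0 <= Z w <= C * L1 w ^+ k) -> (forall w, 0 <= X w <= L1 w) -> 0 <= C -> 0 <= a ->
  (\int[Q]_w (Z w * expR (a * X w))%:E < +oo)%E.
Proof.
move=> mZ mX hZ hX C0 a0.
have mE r (Y : T' -> R) : measurable_fun setT Y -> measurable_fun setT (fun w => expR (r * Y w)).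
  by move=> mY; apply: (measurableT_comp (@measurable_expR R)); exact: measurable_funM.
have ck : 0 <= C * k`!%:R by rewrite mulr_ge0.
apply: (@le_lt_trans _ _ (\int[Q]_w ((C * k`!%:R)%:E * (expR ((1 + a) * L1 w))%:E))%E).
  apply: ge0_le_integral => //.
  - by move=> w _; rewrite lee_fin mulr_ge0 ?expR_ge0//; case/andP: (hZ w).
  - by apply/measurable_EFinP; apply: measurable_funM => //; exact: mE.
  - by apply: emeasurable_funM => //; apply/measurable_EFinP; exact: mE.
  move=> w _; have /andP[Z0 Z1] := hZ w; have /andP[X0 X1] := hX w.
  rewrite -EFinM lee_fin mulrDl mul1r expRD mulrA; apply: ler_pM => //; rewrite ?expR_ge0//.
    by rewrite (le_trans Z1)// -mulrA ler_wpM2l// exprn_fact_le.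
  by rewrite ler_expR ler_wpM2l.
rewrite ge0_integralZl//; last by apply/measurable_EFinP; exact: mE.
have a1 : 0 <= 1 + a by rewrite addr_ge0.
rewrite lte_mul_pinfty ?lee_fin//; exact: (local_time_exp_lty hB hL a1).
Qed.

Let weightP m n w := before w ^+ m * after w ^+ n.
Let weightQ m n w := c * L1 w * (part1 w ^+ m * part2 w ^+ n).

Let mweightP m n : measurable_fun setT (weightP m n).
Proof. by apply: measurable_funM; exact: measurable_funX. Qed.
Let mweightQ m n : measurable_fun setT (weightQ m n).
Proof. by apply: measurable_funM; apply: measurable_funM => //; exact: measurable_funX. Qed.
Let weightP0 m n w : 0 <= weightP m n w. Proof. by rewrite mulr_ge0// exprn_ge0. Qed.
Let weightQ0 m n w : 0 <= weightQ m n w.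
Proof. by rewrite !mulr_ge0// ?exprn_ge0. Qed.
Let weightQ_le m n w : weightQ m n w <= c * L1 w ^+ (m + n).+1.
Proof.
rewrite /weightQ exprS -mulrA ler_wpM2l// ler_wpM2l// exprD ler_pM ?exprn_ge0//.
  by rewrite lerXn2r ?nnegrE ?(le_trans (part10 _)).
by rewrite lerXn2r ?nnegrE ?(le_trans (part20 _)).
Qed.

Let weightQ_lty m n : (\int[Q]_w (weightQ m n w)%:E < +oo)%E.
Proof.
have := @local_time_weight_lty (weightQ m n) (cst 0) c 0 (m + n).+1.
under eq_integral do rewrite mul0r expR0 mulr1.
by apply => // w; rewrite ?weightQ0 ?weightQ_le// lexx L10.
Qed.

Let weightPQ m n : (\int[P]_w (weightP m n w)%:E = \int[Q]_w (weightQ m n w)%:E)%E.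
Proof.
(* Frequency [0] and phase [pi / 2] reduce the symbol to the constant [1]. *)
have := joint_moments n m (0, pi / 2).
under eq_integral do rewrite /= mul0r add0r cos_pihalf addr0 mul1r.
by under [in X in _ = X -> _]eq_integral do rewrite /= mul0r add0r cos_pihalf addr0 mul1r.
Qed.

(** The three coordinates are identified one after the other, while powers of the others stay as
    weights. The first one is settled by Fourier uniqueness, for all powers of the two local
    times. *)
Lemma joint_law_terminal m n (h : R -> \bar R) : measurable_fun setT h -> (forall x, 0 <= h x)%E ->
  (\int[P]_w (h (bU w) * (weightP m n w)%:E) = \int[Q]_w (h (half_B w) * (weightQ m n w)%:E))%E.
Proof.
move=> mh h0; apply: (fourier_unique_ge0 (mweightP m n) mbU (weightP0 m n) _
  (mweightQ m n) mhalf (weightQ0 m n) _ _ mh h0).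
- by rewrite weightPQ.
- exact: weightQ_lty.
- move=> a e.
  transitivity (\int[P]_w (symbol_density (Some (a, e)) (bU w) * weightP m n w)%:E)%E.
    by apply: eq_integral => w _; rewrite mulrC.
  by rewrite joint_moments; apply: eq_integral => w _; rewrite mulrC.
Qed.

Let indE2 (S : Type) (D : set S) x (z : R) : ((EFin \o \1_D) x * z%:E)%E = (\1_D x * z)%:E.
Proof. by []. Qed.

(** The indicator of the first coordinate joins the weight; for a fixed power of [after], the
    moments in [before] are then given by [joint_law_terminal], and finite exponential moments make
    them determine the law. *)
Lemma joint_law_before n (A C : set R) : measurable A -> measurable C ->
  (\int[P]_w (\1_A (bU w) * \1_C (before w) * after w ^+ n)%:E =
   \int[Q]_w (\1_A (half_B w) * \1_C (part1 w) * (c * L1 w * part2 w ^+ n))%:E)%E.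
Proof.
move=> mA mC; have mAi := mind mA; have mCi := mind mC.
have h := @moments_unique R _ _ P (fun w => \1_A (bU w) * weightP 0 n w) before
  _ mbefore _ before0 _ _ Q (fun w => \1_A (half_B w) * weightQ 0 n w) part1
  _ mpart1 _ part10 _ _ (EFin \o \1_C).
rewrite (_ : (\int[P]_w _ = \int[P]_w ((EFin \o \1_C) (before w) * (\1_A (bU w) * weightP 0 n w)%:E))%E); last first.
  by apply: eq_integral => w _; rewrite indE2 /weightP expr0 mul1r mulrCA mulrA.
rewrite h.
- by apply: eq_integral => w _; rewrite indE2 /weightQ expr0 mul1r mulrCA mulrA.
- by apply: measurable_funM => //; exact: (measurableT_comp mAi mbU).
- by move=> w; rewrite mulr_ge0//; case/andP: (indE A (bU w)).
- by apply: measurable_funM => //; exact: (measurableT_comp mAi mhalf).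
- by move=> w; rewrite mulr_ge0//; case/andP: (indE A (half_B w)).
- move=> a a0; apply: (@local_time_weight_lty _ _ c a n.+1) => //.
  + by apply: measurable_funM => //; exact: (measurableT_comp mAi mhalf).
  + move=> w; have /andP[i0 i1] := indE A (half_B w); rewrite mulr_ge0//=.
    by rewrite (le_trans _ (weightQ_le 0 n w))// ler_piMl.
  + by move=> w; rewrite part10 part1_le.
- move=> k.
  transitivity (\int[P]_w ((EFin \o \1_A) (bU w) * (weightP k n w)%:E))%E.
    by apply: eq_integral => w _; rewrite indE2 /weightP expr0 mul1r -mulrA (mulrC (before w ^+ k)).
  rewrite joint_law_terminal; [|exact/measurable_EFinP|by move=> x; rewrite lee_fin; case/andP: (indE A x)].
  apply: eq_integral => w _; rewrite indE2 /weightQ expr0 mul1r; congr (_%:E); ring.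
- exact/measurable_EFinP.
- by move=> x; rewrite lee_fin; case/andP: (indE C x).
Qed.

(** The argument of [joint_law_before] for the last coordinate, now with two indicators in the
    weight. *)
Lemma joint_law_rectangle (A C D : set R) : measurable A -> measurable C -> measurable D ->
  (\int[P]_w (\1_C (before w) * \1_D (after w) * \1_A (bU w))%:E =
   \int[Q]_w (\1_C (part1 w) * \1_D (part2 w) * (\1_A (half_B w) * (c * L1 w)))%:E)%E.
Proof.
move=> mA mC mD; have mAi := mind mA; have mCi := mind mC; have mDi := mind mD.
pose Z1 w : R := \1_A (bU w) * \1_C (before w).
pose Z2 w : R := \1_A (half_B w) * \1_C (part1 w) * (c * L1 w).
have mZ1 : measurable_fun setT Z1.
  by apply: measurable_funM; [exact: (measurableT_comp mAi mbU)|exact: (measurableT_comp mCi mbefore)].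
have mZ2 : measurable_fun setT Z2.
  apply: measurable_funM; last exact: measurable_funM.
  by apply: measurable_funM; [exact: (measurableT_comp mAi mhalf)|exact: (measurableT_comp mCi mpart1)].
have Z10 w : 0 <= Z1 w.
  by rewrite mulr_ge0.
have Z20 w : 0 <= Z2 w <= c * L1 w ^+ 1.
  have /andP[i0 i1] := indE A (half_B w); have /andP[j0 j1] := indE C (part1 w).
  by rewrite expr1 !mulr_ge0//= ler_piMl ?mulr_ge0// mulr_ile1.
have Z20' w : 0 <= Z2 w by case/andP: (Z20 w).
rewrite (_ : (\int[P]_w _ = \int[P]_w ((EFin \o \1_D) (after w) * (Z1 w)%:E))%E); last first.
  by apply: eq_integral => w _; rewrite indE2 /Z1; congr (_%:E); ring.
rewrite (@moments_unique R _ _ P Z1 after mZ1 mafter Z10 after0 _ _ Q Z2 part2 mZ2 mpart2 Z20' part20).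
- by apply: eq_integral => w _; rewrite indE2 /Z2; congr (_%:E); ring.
- move=> a a0; apply: (@local_time_weight_lty _ _ c a 1) => // w.
  by rewrite part20 part2_le.
- move=> k; rewrite joint_law_before//; apply: eq_integral => w _; rewrite /Z2; congr (_%:E); ring.
- exact/measurable_EFinP.
- by move=> x; rewrite lee_fin; case/andP: (indE D x).
Qed.

(** The triple is a pair whose second component is a pair, so the reduction to rectangles is made
    twice; in the inner one the indicator of the first coordinate belongs to the weight. *)
Lemma joint_law (Phi : R * (R * R) -> \bar R) :
  measurable_fun setT Phi -> (forall x, 0 <= Phi x)%E ->
  (\int[P]_w Phi (bU w, (before w, after w)) =
   \int[Q]_w (Phi (half_B w, (part1 w, part2 w)) * (c * L1 w)%:E))%E.
Proof.
move=> mPhi Phi0.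
have m1 : measurable_fun setT (cst 1 : T -> R) by [].
have mcL : measurable_fun setT (fun w => c * L1 w) by exact: measurable_funM.
have cL0 w : 0 <= c * L1 w by rewrite mulr_ge0.
have Poo A : measurable A -> (\int[P]_w (\1_A (bU w) : R)%:E < +oo)%E.
  move=> mA; apply: (@le_lt_trans _ _ (\int[P]_w 1%:E)%E).
    apply: ge0_le_integral => //.
    - by apply/measurable_EFinP; exact: (measurableT_comp (mind mA) mbU).
    - by move=> w _; rewrite lee_fin; case/andP: (indE A (bU w)).
  by rewrite probability_integral_cst ltry.
rewrite -(weighted_rectangles_unique (P1 := P) (Z1 := cst 1) (X1 := bU) (Y1 := fun w => (before w, after w)))//.
- by apply: eq_integral => w _; rewrite mule1.
- exact: measurable_fun_pair.
- exact: measurable_fun_pair.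
- suff: (\int[P]_w (cst 1%:E) w < +oo)%E by [].
  by rewrite probability_integral_cst ltry.
move=> A E mA mE.
have mZ1 : measurable_fun setT (fun w => \1_A (bU w) : R) by exact: (measurableT_comp (mind mA) mbU).
have mZ2 : measurable_fun setT (fun w => \1_A (half_B w) * (c * L1 w)).
  by apply: measurable_funM => //; exact: (measurableT_comp (mind mA) mhalf).
have mEi : measurable_fun setT (EFin \o \1_E : R * R -> \bar R).
  by apply/measurable_EFinP; exact: measurable_indic.
have Ei0 x : (0 <= (EFin \o \1_E : R * R -> \bar R) x)%E by rewrite lee_fin; case/andP: (indE E x).
have i0 w : 0 <= (\1_A (bU w) : R) by case/andP: (indE A (bU w)).
have j0 w : 0 <= \1_A (half_B w) * (c * L1 w).
  by rewrite mulr_ge0//; case/andP: (indE A (half_B w)).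
transitivity (\int[P]_w ((EFin \o \1_E) (before w, after w) * (\1_A (bU w))%:E))%E.
  by apply: eq_integral => w _; rewrite indE2 mulr1 mulrC.
rewrite (weighted_rectangles_unique (P2 := Q) (Z2 := fun w => \1_A (half_B w) * (c * L1 w)) (X2 := part1) (Y2 := part2))//.
- by apply: eq_integral => w _; rewrite indE2; congr (_%:E); ring.
- exact: Poo.
- by move=> C D mC mD; exact: joint_law_rectangle.
Qed.

End joint_law.

(* The functions f and g are only given on R x [0, +oo[ and [0, 1];
   f \_ A extends f by 0 outside of A (the point of R is 0).  *)
Theorem theorem3p2 (R : realType)
  (d : measure_display) (T : measurableType d) (P : probability T R)
  (b : R -> {RV P >-> R}) (lambda : R -> R -> {RV P >-> R})
  (U : {RV P >-> R})
  (hb : is_brownian_bridge b)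
  (hlambda : is_local_time `[0%R, 1%R] b lambda)
  (hU : is_uniform01 U)
  (hUb : indep_process U `[0%R, 1%R] b)
  (d' : measure_display) (T' : measurableType d') (Q : probability T' R)
  (B : R -> {RV Q >-> R}) (L : R -> R -> {RV Q >-> R})
  (Lambda : {RV Q >-> R})
  (hB : is_brownian_motion B)
  (hL : is_local_time `[0%R, +oo[ B L)
  (hLambda : is_uniform01 Lambda)
  (hLambdaBL : indep_var Q Lambda (fun w => (B 1%R w, L 1%R 0%R w)))
  (f : R * R -> R) (g : R -> R)
  (mf : measurable_fun ([set: R] `*` (`[0%R, +oo[ : set R)) f)
  (f0 : forall x l : R, (0 <= l)%R -> (0 <= f (x, l))%R)
  (mg : measurable_fun (`[0%R, 1%R] : set R) g)
  (g0 : forall v : R, (0 <= v <= 1)%R -> (0 <= g v)%R) :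
  let F := f \_ ([set: R] `*` (`[0%R, +oo[ : set R)) in
  let G := g \_ `[0%R, 1%R] in
  'E_P[fun w => (F (b (U w) w, lambda 1 0 w)
                 * G (lambda (U w) 0 w / lambda 1 0 w))%R]
  = (Num.sqrt (pi / 2))%:E
    * 'E_Q[fun w => (F (2^-1 * B 1 w, L 1 0 w) * L 1 0 w)%R]
    * 'E_Q[fun w => G (Lambda w)].
Proof.
move=> F G.
have mF : measurable_fun setT F.
  have mD : measurable ([set: R] `*` (`[0%R, +oo[%classic : set R)).
    by apply: measurableX => //; exact: measurable_itv.
  exact: (measurable_restrictT f mD).1 mf.
have mG : measurable_fun setT G by exact: (measurable_restrictT g (measurable_itv _)).1 mg.
have F0 x : (0 <= F x)%R.
  rewrite /F patchE; case: ifPn => // /set_mem[_ /=]; rewrite in_itv/= andbT => x0.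
  by case: x x0 => x l /= l0; exact: f0.
have G0 v : (0 <= G v)%R.
  by rewrite /G patchE; case: ifPn => // /set_mem/=; rewrite in_itv/= => v01; exact: g0.
(* The integrand is rewritten in the local times before and after [U], whose sum stands for
   [lambda 1 0]. *)
pose Phi (x : R * (R * R)) := (F (x.1, x.2.1 + x.2.2) * G (x.2.1 / (x.2.1 + x.2.2)))%R.
have m21 : measurable_fun setT (fun x : R * (R * R) => x.2.1).
  exact: (measurableT_comp measurable_fst measurable_snd).
have m22 : measurable_fun setT (fun x : R * (R * R) => x.2.2).
  exact: (measurableT_comp measurable_snd measurable_snd).
have mPhi : measurable_fun setT Phi.
  apply: measurable_funM.
    by apply: (measurableT_comp mF); apply: measurable_fun_pair => //; exact: measurable_funD.
  apply: (measurableT_comp mG); apply: measurable_funM => //.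
  by apply: (measurableT_comp (@measurable_invr R)); exact: measurable_funD.
have Phi0 x : (0 <= Phi x)%R by rewrite mulr_ge0.
have mbU := measurable_bridge_U hb hU.
have mlU := measurable_lambda_U hlambda hU.
have mbefore := measurable_local_time_before hlambda hU.
have mafter := measurable_local_time_after hlambda hU.
have mL1 := measurable_local_time_one L.
have L10 w : (0 <= local_time_one L w)%R by rewrite le_max lexx.
rewrite expectation.unlock.
transitivity (\int[P]_w (Phi (b (U w) w, (local_time_before lambda U w, local_time_after lambda U w)))%:E).
  (* Almost surely the truncations at [0] change nothing and the two parts add up to
     [lambda 1 0]. *)
  apply: ge0_ae_eq_integral => //.
  - apply/measurable_EFinP; apply: measurable_funM.
      by apply: (measurableT_comp mF); exact: measurable_fun_pair.
    by apply: (measurableT_comp mG); apply: measurable_funM => //; exact: (measurableT_comp (@measurable_invr R)).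
  - apply/measurable_EFinP; apply: (measurableT_comp mPhi).
    by apply: measurable_fun_pair => //; exact: measurable_fun_pair.
  - by move=> w _; rewrite lee_fin mulr_ge0.
  - by move=> w _; rewrite lee_fin.
  have := local_time_ge0_le (@subset_refl _ _) hlambda (bridge_continuous hb).
  apply: filterS => w h _; have u01 : (0 <= U w <= 1)%R by have := hU.1 w; rewrite in_itv.
  have /andP[l0 l1] := h _ u01.
  rewrite /Phi /= /local_time_before /local_time_after (max_r l0) max_r ?subr_ge0//.
  by rewrite addrC subrK.
rewrite (joint_law hb hlambda hU hUb hB hL hLambda hLambdaBL (Phi := fun x => (Phi x)%:E))//; last first.
  exact/measurable_EFinP.
pose k (x : R * R) := (F (2^-1 * x.1, Num.max 0 x.2) * Num.max 0 x.2)%R.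
have mmax : measurable_fun setT (fun x : R * R => Num.max 0%R x.2) by exact: measurable_maxr.
have mk : measurable_fun setT k.
  apply: measurable_funM => //; apply: (measurableT_comp mF); apply: measurable_fun_pair => //.
  exact: measurable_funM.
have k0 x : (0 <= k x)%R by rewrite mulr_ge0// le_max lexx.
have mBL : measurable_fun setT (fun w => (B 1%R w, L 1%R 0%R w)) by exact: measurable_fun_pair.
(* Where [L 1 0] is negative, [F] vanishes as an extension by [0], so both integrands are [0]
   there. *)
have -> : \int[Q]_w (F (2^-1 * B 1 w, L 1 0 w)%R * L 1 0 w)%:E = \int[Q]_w (k (B 1 w, L 1 0 w))%:E.
  apply: eq_integral => w _; rewrite /k /=; have [l0|l0] := leP 0%R (L 1%R 0%R w) => //.
  rewrite mulr0 /F patchE memNset ?mul0r// => -[_ /=].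
  by rewrite in_itv/= andbT leNgt l0.
rewrite -muleA [X in _ = _ * X]muleC.
rewrite -(indep_var_integralM _ mBL hLambdaBL (h := fun v => (G v)%:E) (k := fun x => (k x)%:E))//; last 2 first.
- exact/measurable_EFinP.
- exact/measurable_EFinP.
rewrite -ge0_integralZl//; last 2 first.
- apply: emeasurable_funM; apply/measurable_EFinP.
    exact: (measurableT_comp mG).
  exact: (measurableT_comp mk mBL).
- by move=> w _; rewrite mule_ge0 ?lee_fin.
apply: eq_integral => w _; rewrite -!EFinM; congr (_%:E).
rewrite /Phi /k /= -/(local_time_one L w) -mulrDl addrC subrK mul1r.
(* Where the local time vanishes the quotient need not be [Lambda], but the weight makes both sides
   [0]. *)
have [->|l0] := eqVneq (local_time_one L w) 0%R; first by rewrite !(mulr0, mul0r).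
by rewrite mulfK//; ring.
Qed.
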